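(* Let $k\in\mathbb{N}$, $i_1,\ldots,i_k\in\{0,1,\ldots,m\}$, and $r(x)\ge0$ on $[t,T]$. Suppose that every $\psi_l$ $(l=1,\ldots,k)$ is a continuous non-random function on $[t,T]$ and that $\{\Psi_j(x)\sqrt{r(x)}\}_{j=0}^{\infty}$ is a complete orthonormal system of functions in $L_2([t,T])$, each function $\Psi_j(x)\sqrt{r(x)}$ of which satisfies condition $(\star)$. Then for the iterated Ito stochastic integral $$\tilde J[\psi^{(k)}]_{T,t}=\int_t^T\psi_k(t_k)\sqrt{r(t_k)}\ldots\int_t^{t_2}\psi_1(t_1)\sqrt{r(t_1)}\,d{\bf w}_{t_1}^{(i_1)}\ldots d{\bf w}_{t_k}^{(i_k)}$$ we have $$\tilde J[\psi^{(k)}]_{T,t}=\mathop{\rm l.i.m.}_{p_1,\ldots,p_k\to\infty}\sum_{j_1=0}^{p_1}\ldots\sum_{j_k=0}^{p_k}\tilde C_{j_k\ldots j_1}\Biggl(\prod_{l=1}^k\tilde\zeta_{j_l}^{(i_l)}-\mathop{\rm l.i.m.}_{N\to\infty}\sum_{(l_1,\ldots,l_k)\in{\rm G}_k}\Psi_{j_1}(\tau_{l_1})\sqrt{r(\tau_{l_1})}\,\Delta{\bf w}_{\tau_{l_1}}^{(i_1)}\ldots\Psi_{j_k}(\tau_{l_k})\sqrt{r(\tau_{l_k})}\,\Delta{\bf w}_{\tau_{l_k}}^{(i_k)}\Biggr),$$ where $\Delta{\bf w}_{\tau_j}^{(i)}={\bf w}_{\tau_{j+1}}^{(i)}-{\bf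 w}_{\tau_j}^{(i)}$ $(i=0,1,\ldots,m)$, $$\tilde\zeta_j^{(i)}=\int_t^T\Psi_j(s)\sqrt{r(s)}\,d{\bf w}_s^{(i)}$$ are independent standard Gaussian random variables for different $i$ or $j$ (in the case $i\ne0$), and $$\tilde C_{j_k\ldots j_1}=\int_{[t,T]^k}K(t_1,\ldots,t_k)\prod_{l=1}^k\bigl(\Psi_{j_l}(t_l)r(t_l)\bigr)dt_1\ldots dt_k,$$ with $K(t_1,\ldots,t_k)=\psi_1(t_1)\ldots\psi_k(t_k)$ if $t_1<\ldots<t_k$ and $K(t_1,\ldots,t_k)=0$ otherwise (for $k\ge2$, $t_1,\ldots,t_k\in[t,T]$), and $K(t_1)=\psi_1(t_1)$ for $k=1$.
   Context: $(\Omega,{\rm F},{\sf P})$ is a complete probability space with a non-decreasing right-continuous family of $\sigma$-algebras $\{{\rm F}_s,s\in[0,T]\}$, $0\le t<T$; ${\bf f}_s$ is a standard $m$-dimensional Wiener process, ${\rm F}_s$-measurable for each $s\in[0,T]$, with independent components ${\bf f}_s^{(i)}$, $i=1,\ldots,m$. Put ${\bf w}_\tau^{(i)}={\bf f}_\tau^{(i)}$ for $i=1,\ldots,m$ and ${\bf w}_\tau^{(0)}=\tau$. Stochastic integrals are Ito integrals; l.i.m. is the limit in the mean-square sense. Standing assumption on the weight: $K(t_1,\ldots,t_k)\prod_{l=1}^k\sqrt{r(t_l)}\in L_2([t,T]^k)$ (and the integral $\tilde J[\psi^{(k)}]_{T,t}$ exists). Condition $(\star)$ for a function $f:[t,T]\to\mathbb{R}$: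 $f$ is continuous on $[t,T]$ except possibly at finitely many points of finite (jump) discontinuity, and $f$ is right-continuous on $[t,T]$. $\{\tau_j\}_{j=0}^N$ is a partition (depending on $N$) $t=\tau_0<\ldots<\tau_N=T$ with $\max_{0\le j\le N-1}(\tau_{j+1}-\tau_j)\to0$ as $N\to\infty$. ${\rm G}_k={\rm H}_k\setminus{\rm L}_k$, where ${\rm H}_k=\{(l_1,\ldots,l_k): l_1,\ldots,l_k=0,1,\ldots,N-1\}$ and ${\rm L}_k=\{(l_1,\ldots,l_k)\in{\rm H}_k: l_g\ne l_r \text{ for } g\ne r,\ g,r=1,\ldots,k\}$. *)

(* Defs.v *)
From HB Require Import structures.
From mathcomp Require Import all_boot all_order all_algebra.
From mathcomp Require Import all_classical all_reals all_analysis.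

Set Implicit Arguments.
Unset Strict Implicit.
Unset Printing Implicit Defensive.

Import Order.TTheory GRing.Theory Num.Theory.
Import numFieldNormedType.Exports.
Local Open Scope classical_set_scope.
Local Open Scope ring_scope.

(** * Square integrability and mean-square limits *)

Definition square_integrable (d : measure_display) (T : measurableType d)
    (R : realType) (mu : {measure set T -> \bar R}) (D : set T) (f : T -> R) :=
  measurable_fun D f /\ (\int[mu]_(x in D) ((f x) ^+ 2)%:E < +oo)%E.

(* The filter [F] is [\oo] for ordinary sequences of random variables and
   [multi_oo k] for families with several indices. *)
Definition ms_limit (d : measure_display) (Omega : measurableType d)
    (R : realType) (P : probability Omega R) (I : Type) (F : set_system I)
    (X : I -> Omega -> R) (Y : Omega -> R) :=
  [/\ forall i, measurable_fun [set: Omega] (X i),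
      measurable_fun [set: Omega] Y &
      (fun i => \int[P]_om ((X i om - Y om) ^+ 2)%:E)%E @ F --> 0%E].

(* [p_1, ..., p_k -> oo] jointly and independently of each other. *)
Definition multi_oo (k : nat) : set_system ('I_k -> nat) :=
  filter_from [set: nat] (fun M => [set p | forall l, (M <= p l)%N]).
Arguments multi_oo k _ : clear implicits.

(** * Lebesgue measure on [R^k] *)

Definition tuple_cons (R : realType) (k : nat)
    (z : k.-tuple (measurableTypeR R) * measurableTypeR R) :
  k.+1.-tuple (measurableTypeR R) := [tuple of z.2 :: z.1].

Lemma measurable_tuple_cons (R : realType) (k : nat) :
  measurable_fun setT (@tuple_cons R k).
Proof. exact: (measurable_cons measurable_snd measurable_fst). Qed.

Definition lebesgue_tuple_cons (R : realType) (k : nat)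
    (mu : {measure set (k.-tuple (measurableTypeR R)) -> \bar R}) :=
  pushforward (mu \x lebesgue_measure)%E (@tuple_cons R k).

HB.instance Definition _ (R : realType) (k : nat)
    (mu : {measure set (k.-tuple (measurableTypeR R)) -> \bar R}) :=
  Measure.copy (lebesgue_tuple_cons mu)
    (measure_function_pushforward__canonical__measure_function_Measure
      (mu \x lebesgue_measure)%E (@measurable_tuple_cons R k)).

Fixpoint lebesgue_tuple (R : realType) (k : nat) :
    {measure set (k.-tuple (measurableTypeR R)) -> \bar R} :=
  match k with
  | 0 => \d_ [tuple]
  | k'.+1 => lebesgue_tuple_cons (lebesgue_tuple R k')
  end.

Definition cube (R : realType) (t T : R) (k : nat) :
  set (k.-tuple (measurableTypeR R)) :=
  [set x | forall l, t <= tnth x l <= T].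
Arguments cube {R} t T k _.

(** * Function systems on [[t, T]] *)

Definition right_cont_jump (R : realType) (t T : R) (f : R -> R) :=
  [/\ exists D : seq R, forall x, x \in `[t, T] -> x \notin D ->
        f @ within `[t, T] (nbhs x) --> f x,
      forall x, t < x <= T -> cvg (f @ x^'-) &
      forall x, t <= x < T -> f @ x^'+ --> f x].

Definition orthonormal_system (R : realType) (t T : R) (phi : nat -> R -> R) :=
  (forall j, square_integrable lebesgue_measure `[t, T] (phi j)) /\
  (forall i j, \int[lebesgue_measure]_(x in `[t, T]) (phi i x * phi j x) =
     (i == j)%:R).

(* Completeness: the linear span is dense in [L_2([t, T])]. *)
Definition complete_system (R : realType) (t T : R) (phi : nat -> R -> R) :=
  forall g : R -> R, square_integrable lebesgue_measure `[t, T] g ->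
  forall e : R, 0 < e -> exists n (c : nat -> R),
    (\int[lebesgue_measure]_(x in `[t, T])
       ((g x - \sum_(j < n) c j * phi j x) ^+ 2)%:E < e%:E)%E.

(** * Filtrations, Gaussian variables, Wiener processes *)

Record is_filtration (d : measure_display) (Omega : measurableType d)
    (R : realType) (T : R) (F : R -> set_system Omega) : Prop := {
  filt_sigma : forall s : R, 0 <= s <= T -> sigma_algebra [set: Omega] (F s) ;
  filt_sub : forall s : R, 0 <= s <= T -> F s `<=` measurable ;
  filt_mono : forall s u : R, 0 <= s -> s <= u -> u <= T -> F s `<=` F u ;
  filt_right : forall s : R, 0 <= s < T ->
    \bigcap_(u in `]s, T]) F u `<=` F s }.

Definition measurable_for (Omega : Type) (R : realType) (G : set_system Omega)
    (X : Omega -> R) :=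
  forall B : set R, measurable B -> G (X @^-1` B).

Definition centered_gaussian (d : measure_display) (Omega : measurableType d)
    (R : realType) (P : probability Omega R) (sigma : R) (X : Omega -> R) :=
  measurable_fun [set: Omega] X /\
  forall B : set R, measurable B -> P (X @^-1` B) = normal_prob 0 sigma B.

Definition independent_family (d : measure_display) (Omega : measurableType d)
    (R : realType) (P : probability Omega R) (J : eqType)
    (X : J -> Omega -> R) :=
  forall (s : seq J) (B : J -> set R), uniq s ->
    (forall j, measurable (B j)) ->
    P (\bigcap_(j in [set` s]) (X j @^-1` B j)) =
    (\prod_(j <- s) P (X j @^-1` B j))%E.

(* [wiener_indep] says that the increments over [[u, s]] of the [m] components
   are independent of each other and, jointly, of [F u]. *)
Record is_wiener (d : measure_display) (Omega : measurableType d)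
    (R : realType) (P : probability Omega R) (T : R) (F : R -> set_system Omega)
    (m : nat) (f : 'I_m -> R -> Omega -> R) : Prop := {
  wiener_adapted : forall i (s : R), 0 <= s <= T -> measurable_for (F s) (f i s) ;
  wiener_start : forall i, {ae P, forall om, f i 0 om = 0} ;
  wiener_continuous : forall i,
    {ae P, forall om, {within `[0, T], continuous (fun s => f i s om)}} ;
  wiener_gauss : forall i (u s : R), 0 <= u -> u < s -> s <= T ->
    centered_gaussian P (Num.sqrt (s - u)) (fun om => f i s om - f i u om) ;
  wiener_indep : forall u s : R, 0 <= u -> u < s -> s <= T ->
    forall (A : set Omega) (B : 'I_m -> set R), F u A ->
    (forall i, measurable (B i)) ->
    let df := fun i om => f i s om - f i u om in
    P (A `&` \bigcap_i (df i @^-1` B i)) =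
    (P A * \prod_i P (df i @^-1` B i))%E }.

(* Index [ord0] is time, index [lift ord0 i] is the component [f i]. *)
Definition integrator (Omega : Type) (R : realType) (m : nat)
    (f : 'I_m -> R -> Omega -> R) (i : 'I_m.+1) (s : R) (om : Omega) : R :=
  if unlift ord0 i is Some i' then f i' s om else s.

(** * The Ito integral *)

Record step_process (Omega : Type) (R : realType) := StepProcess {
  step_size : nat ;
  step_grid : nat -> R ;
  step_coef : nat -> Omega -> R }.

Definition step_value (Omega : Type) (R : realType) (X : step_process Omega R)
    (s : R) (om : Omega) : R :=
  \sum_(j < step_size X)
    step_coef X j om * \1_(`[step_grid X j, step_grid X j.+1[) s.

Definition step_integral (Omega : Type) (R : realType)
    (X : step_process Omega R) (w : R -> Omega -> R) (om : Omega) : R :=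
  \sum_(j < step_size X)
    step_coef X j om * (w (step_grid X j.+1) om - w (step_grid X j) om).

Definition adapted_step (d : measure_display) (Omega : measurableType d)
    (R : realType) (P : probability Omega R) (F : R -> set_system Omega)
    (a b : R) (X : step_process Omega R) :=
  [/\ step_grid X 0 = a, step_grid X (step_size X) = b,
      forall j, (j < step_size X)%N -> step_grid X j < step_grid X j.+1 &
      forall j, (j < step_size X)%N ->
        measurable_for (F (step_grid X j)) (step_coef X j) /\
        square_integrable P [set: Omega] (step_coef X j)].

Definition ito_class (d : measure_display) (Omega : measurableType d)
    (R : realType) (P : probability Omega R) (F : R -> set_system Omega)
    (a b : R) (xi : R -> Omega -> R) :=
  square_integrable (lebesgue_measure \x P)%E (`[a, b] `*` [set: Omega])
    (fun z => xi z.1 z.2) /\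
  (forall s, a <= s <= b -> measurable_for (F s) (xi s)).

(* [I] is (a version of) the integral of [xi] over [[a, b]] with respect to
   [w]: the mean-square limit of the integrals of adapted step processes
   converging to [xi] in [L_2([a, b] x Omega)].  With [w s = s] this is the
   mean-square version of the Lebesgue integral in time. *)
Definition is_ito_integral (d : measure_display) (Omega : measurableType d)
    (R : realType) (P : probability Omega R) (F : R -> set_system Omega)
    (w : R -> Omega -> R) (a b : R) (xi : R -> Omega -> R) (I : Omega -> R) :=
  ito_class P F a b xi /\
  exists X : nat -> step_process Omega R,
    [/\ forall n, adapted_step P F a b (X n),
        (fun n => \int[(lebesgue_measure \x P)%E]_(z in
             `[a, b] `*` [set: Omega])
           ((step_value (X n) z.1 z.2 - xi z.1 z.2) ^+ 2)%:E)%E @ \oo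
         --> 0%E &
        ms_limit P \oo (fun n => step_integral (X n) w) I].

(* [g l] and [w l] are the weight and the integrator of the [l]-th integration,
   the innermost one being [l = 0]; [I l s] is the [l]-fold iterated integral
   with outermost upper limit [s]. *)
Definition is_iterated_ito (d : measure_display) (Omega : measurableType d)
    (R : realType) (P : probability Omega R) (F : R -> set_system Omega)
    (t T : R) (k : nat) (g : 'I_k -> R -> R) (w : 'I_k -> R -> Omega -> R)
    (J : Omega -> R) :=
  exists I : nat -> R -> Omega -> R,
    [/\ forall s om, I 0%N s om = 1,
        forall (l : 'I_k) s, t <= s <= T ->
          is_ito_integral P F (w l) t s (fun u om => g l u * I l u om)
            (I l.+1 s) &
        I k T = J].

(** * The kernel and its Fourier coefficients *)

(* For [k = 1] the sortedness test is vacuous and [K(t_1) = psi_1(t_1)]. *)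
Definition kernel_K (R : realType) (k : nat) (psi : 'I_k -> R -> R)
    (x : k.-tuple (measurableTypeR R)) : R :=
  if sorted (fun a b : R => a < b) x then \prod_(l < k) psi l (tnth x l) else 0.

Definition coef_C (R : realType) (t T : R) (k : nat) (psi : 'I_k -> R -> R)
    (r : R -> R) (Psi : nat -> R -> R) (j : 'I_k -> nat) : R :=
  \int[lebesgue_tuple R k]_(x in cube t T k)
    (kernel_K psi x * \prod_(l < k) (Psi (j l) (tnth x l) * r (tnth x l))).

(** * Partitions and the diagonal sums *)

(* [tau N] is a partition into [N] intervals; [tau 0] carries no constraint,
   since no partition of a nondegenerate interval has zero intervals. *)
Record is_partition_seq (R : realType) (t T : R) (tau : nat -> nat -> R) :
    Prop := {
  part_start : forall N, (0 < N)%N -> tau N 0%N = t ;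
  part_end : forall N, (0 < N)%N -> tau N N = T ;
  part_incr : forall N j, (j < N)%N -> tau N j < tau N j.+1 ;
  part_mesh : (fun N => \big[Num.max/0]_(j < N) (tau N j.+1 - tau N j)) @ \oo
    --> (0 : R) }.

(* A multi-index [l] belongs to [L_k] iff it is injective, hence to [G_k] iff
   it is not. *)
Definition diagonal_sum (Omega : Type) (R : realType) (k : nat)
    (tau : nat -> nat -> R) (phi : nat -> R -> R) (w : 'I_k -> R -> Omega -> R)
    (j : 'I_k -> nat) (N : nat) (om : Omega) : R :=
  \sum_(l : {ffun 'I_k -> 'I_N} | ~~ injectiveb l)
    \prod_(a < k) (phi (j a) (tau N (l a)) *
                   (w a (tau N (l a).+1) om - w a (tau N (l a)) om)).

(* Main.v *)
(** The iterated Ito integral over [t_1 < ... < t_k] extends, by the Ito isometry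
    (up to a constant), from step kernels to a bounded linear map [W] on the square
    integrable kernels supported on the simplex. Off the diagonals, the sum over
    multi-indices splits, according to the permutation [s] sorting the multi-index,
    into [k!] ordered sums, and each of them is [W], for the permuted integrators,
    of a sampled tensor product restricted to the simplex. As the full sum tends to
    [prod_l zeta_(j_l)], the bracket in the expansion tends to [sum_s W_s(...)].
    Since [K] is supported on the simplex, [J] minus the partial sum of the
    expansion is [sum_s W_s (1_simplex * ((K - S_p) o s^-1))], where [S_p] is the
    partial sum of the Fourier series of [K]. Its second moment is at most a constant
    times [|| K - S_p ||^2], which tends to 0 because the products of the [phi_j]
    form a complete orthonormal system on the cube.

    For the full sum, convergence in mean square of each factor does not suffice:
    the even moments of the factors are bounded, since they are Gaussian or constant. All the
    Gaussian facts are read off from the expectations [E cos(th + X)]: a bounded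
    [Z] with [E (Z cos(u V + th)) = E Z * E cos(u Y + th)] for all [u] and [th]
    satisfies [E (Z 1_B(V)) = E Z * P(Y in B)] for all Borel sets [B]. *)

Require Import Defs.
From HB Require Import structures.
From mathcomp Require Import all_boot all_order fingroup perm all_algebra.
From mathcomp Require Import all_classical all_reals all_analysis.
From mathcomp Require Import measurable_realfun ring lra.

Set Implicit Arguments.
Unset Strict Implicit.
Unset Printing Implicit Defensive.

Import Order.TTheory GRing.Theory Num.Theory.
Import numFieldNormedType.Exports.
Local Open Scope classical_set_scope.
Local Open Scope ring_scope.

(** * Mean-square convergence *)

(** The iterated Ito integral is given only through versions [I l s], one for each upper limit [s],
    with no path continuity. It is therefore identified with [W] of its kernel by induction on the
    number of integrations, the integrands being compared in mean square for almost every time only.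
    Single weights [psi_l sqrt r] may fail to be square integrable, as only the kernel is assumed to
    be; so they are truncated, made continuous and then sampled, and finiteness of the norm of the
    kernel is a hypothesis of the induction. Time and the Wiener components are treated alike,
    because Ito's isometry enters as an inequality with a constant, which time satisfies by
    Cauchy-Schwarz. Squared norms are used throughout: their triangle inequality costs a factor 2,
    whence the constants 4 and the error budgets [e / 4]. The Gaussian part goes through cosines
    because independence is given for Borel sets, whose indicators do not pass to mean-square
    limits, while Lipschitz functions do: indicators are turned into cosines, the limit is taken,
    and cosines are turned back into indicators. *)

Ltac clear_ereal := repeat match goal with
  | H : is_true (@Order.lt ereal_display _ _ _) |- _ => clear H
  | H : is_true (@Order.le ereal_display _ _ _) |- _ => clear H
  end.
Ltac elra := clear_ereal; lra.

Section ereal_limits.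
Context {R : realType} {I : Type}.

(** A value below a real [e] is finite, so finitely many infinite norms along the family do no harm
    to the convergence. *)
Lemma ge0_cvg0P (F : set_system I) (FF : Filter F) (u : I -> \bar R) :
  (forall i, 0 <= u i)%E ->
  (u @ F --> 0%E) <-> (forall e : R, 0 < e -> \forall i \near F, (u i < e%:E)%E).
Proof.
move=> u0; split=> [cu e e0|h].
  apply: (cu [set x | (x < e%:E)%E]).
  rewrite /nbhs/= /ereal_nbhs/=.
  have : nbhs (0 : R) [set r | r < e] by exact: lt_nbhsl.
  by apply: filterS => r /=; rewrite lte_fin.
move=> A; rewrite /nbhs/= /ereal_nbhs/= => -[e /= e0 eA].
have := h _ e0; apply: filterS => i uie /=.
have ui := u0 i.
have fin : u i \is a fin_num.
  by rewrite ge0_fin_numE// (lt_le_trans uie)// leey.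
rewrite -(fineK fin); apply: eA => /=.
rewrite sub0r normrN -lte_fin ger0_norm ?fine_ge0// fineK//.
Qed.

Lemma cvg0_le (F : set_system I) {FF : Filter F} (u v : I -> \bar R) :
  (forall i, 0 <= u i)%E -> (\forall i \near F, u i <= v i)%E ->
  v @ F --> 0%E -> u @ F --> 0%E.
Proof.
move=> u0 uv cv.
apply: (@squeeze_cvge _ _ _ _ (cst 0%E) _ v) => //; last exact: cvg_cst.
by apply: filterS uv => i ->; rewrite u0.
Qed.

Lemma cvg0Z (F : set_system I) {FF : Filter F} (c : R) (u : I -> \bar R) :
  u @ F --> 0%E -> (fun i => c%:E * u i)%E @ F --> 0%E.
Proof. by move=> cu; have := cvgeZl (y := c%:E) isT cu; rewrite mule0; exact. Qed.

Lemma cvg0D (F : set_system I) {FF : Filter F} (u v : I -> \bar R) :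
  u @ F --> 0%E -> v @ F --> 0%E -> (fun i => u i + v i)%E @ F --> 0%E.
Proof. by move=> cu cv; have := cvgeD (a := 0%E) (b := 0%E) isT cu cv; rewrite adde0; exact. Qed.

Lemma cvg0_sum (F : set_system I) {FF : Filter F} (J : Type) (r : seq J) (P : pred J)
    (u : J -> I -> \bar R) :
  (forall j, P j -> u j @ F --> 0%E) -> (fun i => \sum_(j <- r | P j) u j i)%E @ F --> 0%E.
Proof.
move=> cu; elim: r => [|j r IH].
  by under eq_fun do rewrite big_nil; exact: cvg_cst.
have [Pj|nPj] := boolP (P j); last by under eq_fun do rewrite big_cons (negbTE nPj).
by under eq_fun do rewrite big_cons Pj; exact: cvg0D (cu _ Pj) IH.
Qed.

End ereal_limits.

(** Lagrange's identity: the double sum of the squared differences is twice the gap between the two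
    sides. *)
Lemma sqr_sum_le (R : realType) (J : finType) (x : J -> R) :
  (\sum_j x j) ^+ 2 <= #|J|%:R * \sum_j (x j) ^+ 2.
Proof.
have h : 0 <= \sum_i \sum_j (x i - x j) ^+ 2.
  by apply: sumr_ge0 => i _; apply: sumr_ge0 => j _; exact: sqr_ge0.
have E : \sum_i \sum_j (x i - x j) ^+ 2 =
    (#|J|%:R * \sum_j (x j) ^+ 2) *+ 2 - (\sum_j x j) ^+ 2 *+ 2.
  under eq_bigr do under eq_bigr do rewrite sqrrB.
  under eq_bigr do rewrite big_split/= big_split/= sumr_const sumrN.
  rewrite big_split/= big_split/= sumr_const sumrN.
  under [X in _ - X + _]eq_bigr do rewrite sumrMnl -mulr_sumr.
  rewrite [X in _ - X + _]sumrMnl -mulr_suml -expr2 sumrMnl -mulr_natl.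
  by rewrite (_ : #|xpredT| = #|J|)//; ring.
rewrite E in h.
by rewrite subr_ge0 lerMn2r/= in h.
Qed.

(** The squared L2 norm as an extended real, so that it can be written down before square
    integrability is known. *)
Notation n2 mu D f := (\int[mu]_(x in D) ((f x) ^+ 2)%:E)%E.

Section square_norm.
Context d (T : measurableType d) (R : realType) (mu : {measure set T -> \bar R}).
Context (D : set T) (mD : measurable D).
Implicit Types f g h : T -> R.

Lemma n2_ge0 f : (0 <= n2 mu D f)%E.
Proof. by apply: integral_ge0 => x _; rewrite lee_fin sqr_ge0. Qed.

Lemma measurable_sqr_EFin f : measurable_fun D f ->
  measurable_fun D (fun x => (f x ^+ 2)%:E : \bar R).
Proof. by move=> mf; apply/measurable_EFinP; exact: measurable_funX. Qed.

Lemma n2_le f g : measurable_fun D f -> measurable_fun D g ->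
  (forall x, D x -> (f x) ^+ 2 <= (g x) ^+ 2) -> (n2 mu D f <= n2 mu D g)%E.
Proof.
move=> mf mg fg; apply: ge0_le_integral => //; try exact: measurable_sqr_EFin.
  by move=> x _; rewrite lee_fin sqr_ge0.
Qed.

Lemma n2Z (c : R) f : measurable_fun D f ->
  (n2 mu D (fun x => c * f x) = (c ^+ 2)%:E * n2 mu D f)%E.
Proof.
move=> mf; under eq_integral do rewrite exprMn EFinM.
rewrite ge0_integralZl_EFin ?sqr_ge0//; first by move=> x _; rewrite lee_fin sqr_ge0.
exact: measurable_sqr_EFin.
Qed.

Lemma n2N f : (n2 mu D (fun x => - f x) = n2 mu D f)%E.
Proof. by under eq_integral do rewrite sqrrN. Qed.

Lemma n2_sum (J : finType) (f : J -> T -> R) : (forall j, measurable_fun D (f j)) ->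
  (n2 mu D (fun x => \sum_j f j x) <= #|J|%:R%:E * \sum_j n2 mu D (f j))%E.
Proof.
move=> mf.
rewrite -ge0_integral_sum//; last 2 first.
- by move=> j; exact: measurable_sqr_EFin.
- by move=> j x _; rewrite lee_fin sqr_ge0.
rewrite -ge0_integralZl_EFin//; last 2 first.
- by move=> x _; apply: sume_ge0 => j _; rewrite lee_fin sqr_ge0.
- by apply: emeasurable_sum => j; exact: measurable_sqr_EFin.
apply: ge0_le_integral => //.
- by move=> x _; rewrite lee_fin sqr_ge0.
- by apply: measurable_sqr_EFin; exact: measurable_sum.
- apply: measurable_funeM.
  by apply: emeasurable_sum => j; exact: measurable_sqr_EFin.
- by move=> x _; rewrite sumEFin -EFinM lee_fin sqr_sum_le.
Qed.

Lemma n2D f g : measurable_fun D f -> measurable_fun D g ->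
  (n2 mu D (fun x => (f x + g x)%R) <= 2%:E * n2 mu D f + 2%:E * n2 mu D g)%E.
Proof.
move=> mf mg.
have mm (b : bool) : measurable_fun D (if b then f else g) by case: b.
have := n2_sum mm; rewrite big_bool/= card_bool.
under eq_integral do rewrite big_bool/=.
by rewrite ge0_muleDr ?n2_ge0.
Qed.

Lemma n2_triangle g f h : measurable_fun D f -> measurable_fun D g -> measurable_fun D h ->
  (n2 mu D (fun x => (f x - h x)%R) <=
   2%:E * n2 mu D (fun x => (f x - g x)%R) + 2%:E * n2 mu D (fun x => (g x - h x)%R))%E.
Proof.
move=> mf mg mh.
have := @n2D (f \- g) (g \- h) (measurable_funB mf mg) (measurable_funB mg mh).
by under eq_integral do rewrite /= addrA subrK.
Qed.

Lemma n2_sym f g :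
  (n2 mu D (fun x => (f x - g x)%R) = n2 mu D (fun x => (g x - f x)%R))%E.
Proof. by under eq_integral do rewrite -opprB sqrrN. Qed.

Lemma n2_lty_sub f g : measurable_fun D f -> measurable_fun D g ->
  (n2 mu D f < +oo -> n2 mu D (fun x => (f x - g x)%R) < +oo -> n2 mu D g < +oo)%E.
Proof.
move=> mf mg ff fg.
have := @n2_triangle f (cst 0) g (measurable_cst _ ) mf mg.
under [X in (X <= _)%E]eq_integral do rewrite /= sub0r sqrrN.
under [X in (_ <= _ * X + _)%E]eq_integral do rewrite /= sub0r sqrrN.
move=> /le_lt_trans; apply; rewrite lte_add_pinfty// lte_mul_pinfty//.
Qed.

Lemma n2_lty_add f g : measurable_fun D f -> measurable_fun D g ->
  (n2 mu D f < +oo -> n2 mu D g < +oo -> n2 mu D (fun x => (f x + g x)%R) < +oo)%E.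
Proof.
move=> mf mg ff fg; apply: (le_lt_trans (n2D mf mg)).
by rewrite lte_add_pinfty// lte_mul_pinfty.
Qed.

Lemma n2_integrableM f g : measurable_fun D f -> measurable_fun D g ->
  (n2 mu D f < +oo -> n2 mu D g < +oo -> mu.-integrable D (fun x => (f x * g x)%:E))%E.
Proof.
move=> mf mg ff fg; apply/integrableP; split.
  by apply/measurable_EFinP; exact: measurable_funM.
apply: (@le_lt_trans _ _ (n2 mu D f + n2 mu D g)%E); last exact: lte_add_pinfty.
rewrite -ge0_integralD//; last 4 first.
- by move=> x _; rewrite lee_fin sqr_ge0.
- exact: measurable_sqr_EFin.
- by move=> x _; rewrite lee_fin sqr_ge0.
- exact: measurable_sqr_EFin.
apply: ge0_le_integral => //.
- by apply/measurable_EFinP; apply: measurableT_comp => //; exact: measurable_funM.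
- by apply: emeasurable_funD; exact: measurable_sqr_EFin.
- move=> x _; rewrite /= -EFinD lee_fin normrM.
  rewrite -(real_normK (num_real (f x))) -(real_normK (num_real (g x))).
  have := sqr_ge0 (`|f x| - `|g x|); have := normr_ge0 (f x); have := normr_ge0 (g x).
  nra.
Qed.

Lemma n2_integrable_sqr f : measurable_fun D f -> (n2 mu D f < +oo)%E ->
  mu.-integrable D (fun x => ((f x) ^+ 2)%:E).
Proof. by move=> mf ff; under eq_fun do rewrite expr2; exact: n2_integrableM. Qed.

Lemma n2_eq0 f : measurable_fun D f -> n2 mu D f = 0%E ->
  {ae mu, forall x, D x -> f x = 0}.
Proof.
move=> mf h.
have h' : (\int[mu]_(x in D) `|((f x) ^+ 2)%:E| = 0)%E.
  by rewrite -h; apply: eq_integral => x _; rewrite gee0_abs// lee_fin sqr_ge0.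
have := ae_eq_integral_abs mu mD (measurable_sqr_EFin mf).
move=> [/(_ h') + _]; apply: filterS => x /[apply] /= -[/eqP].
by rewrite sqrf_eq0 => /eqP.
Qed.

End square_norm.

(** Young's inequality; the free weight [a] lets it play the part of Cauchy-Schwarz in the estimates
    below. *)
Lemma mulr_le_weighted_sqr (R : realFieldType) (a p q : R) : 0 < a ->
  p * q <= 2^-1 / a * p ^+ 2 + a / 2 * q ^+ 2.
Proof.
move=> a0; rewrite -subr_ge0.
have -> : 2^-1 / a * p ^+ 2 + a / 2 * q ^+ 2 - p * q = (p - a * q) ^+ 2 / (2 * a).
  by field; lra.
by rewrite divr_ge0 ?sqr_ge0// mulr_ge0// ltW.
Qed.

Lemma Rintegral_mul_cvg d (T : measurableType d) (R : realType)
    (mu : {measure set T -> \bar R}) (D : set T) (mD : measurable D)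
    (I : Type) (F : set_system I) (FF : Filter F) (f : I -> T -> R) (f0 g : T -> R) :
  (forall i, measurable_fun D (f i)) -> measurable_fun D f0 -> measurable_fun D g ->
  (n2 mu D f0 < +oo)%E -> (n2 mu D g < +oo)%E ->
  (fun i => n2 mu D (fun x => (f i x - f0 x)%R)) @ F --> 0%E ->
  (fun i => \int[mu]_(x in D) (f i x * g x)) @ F --> \int[mu]_(x in D) (f0 x * g x).
Proof.
move=> mf mf0 mg f0f gf cf.
have mB i : measurable_fun D (fun x => f i x - f0 x) by exact: measurable_funB.
have G0 : 0 <= fine (n2 mu D g) by rewrite fine_ge0// n2_ge0.
set G := fine (n2 mu D g) in G0.
have GE : n2 mu D g = G%:E by rewrite fineK// ge0_fin_numE// n2_ge0.
apply/cvgrPdist_le => /= e e0.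
(* With this weight the term in [g] is [e / 2 * (G / (G + 1))], and the other one is [e / 2] as soon
   as the squared distance is below [a * e]. Adding 1 keeps the denominator positive when [g]
   vanishes. *)
pose a : R := e / (G + 1).
have a0 : 0 < a by rewrite divr_gt0// ltr_wpDl.
have := (ge0_cvg0P FF (fun i => n2_ge0 mu D _)).1 cf (a * e) (mulr_gt0 a0 e0).
apply: filterS => i hi.
have fi : (n2 mu D (f i) < +oo)%E.
  by apply: (n2_lty_sub mD mf0 (mf i) f0f); rewrite n2_sym (lt_trans hi)// ltry.
have i1 : mu.-integrable D (EFin \o (fun x => f0 x * g x)) by exact: n2_integrableM.
have i2 : mu.-integrable D (EFin \o (fun x => f i x * g x)) by exact: n2_integrableM.
rewrite -RintegralB//.
have i3 : mu.-integrable D (EFin \o (fun x => f0 x * g x - f i x * g x)).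
  by have := integrableB mD i1 i2.
apply: (le_trans (le_normr_Rintegral mD i3)).
rewrite /Rintegral -lee_fin fineK; last first.
  apply: integrable_fin_num => //.
  exact: (integrable_norm i3).
apply: (@le_trans _ _ (\int[mu]_(x in D)
   ((2^-1 / a) * (f i x - f0 x) ^+ 2 + (a / 2) * (g x) ^+ 2)%:E)%E).
  apply: ge0_le_integral => //.
  - apply/measurable_EFinP; apply: measurableT_comp => //.
    by apply: measurable_funB; exact: measurable_funM.
  - apply/measurable_EFinP; apply: measurable_funD.
      by apply: measurable_funM => //; exact: measurable_funX.
    by apply: measurable_funM => //; exact: measurable_funX.
  - move=> x _; rewrite lee_fin -mulrBl normrM distrC.
    rewrite -(real_normK (num_real (f i x - f0 x))) -(real_normK (num_real (g x))).
    exact: mulr_le_weighted_sqr.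
have m1 : measurable_fun D (fun x => ((f i x - f0 x) ^+ 2)%:E) by exact: measurable_sqr_EFin.
have m2 : measurable_fun D (fun x => ((g x) ^+ 2)%:E) by exact: measurable_sqr_EFin.
have a1 : 0 <= 2^-1 / a by rewrite divr_ge0// ltW.
have a2 : 0 <= a / 2 by rewrite divr_ge0// ltW.
under eq_integral do rewrite EFinD !EFinM.
rewrite ge0_integralD//; last 4 first.
- by move=> x _; rewrite mule_ge0 ?lee_fin ?sqr_ge0.
- exact: measurable_funeM.
- by move=> x _; rewrite mule_ge0 ?lee_fin ?sqr_ge0.
- exact: measurable_funeM.
rewrite !ge0_integralZl_EFin//; last 2 first.
- by move=> x _; rewrite lee_fin sqr_ge0.
- by move=> x _; rewrite lee_fin sqr_ge0.
rewrite GE.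
apply: (@le_trans _ _ ((2^-1 / a)%:E * (a * e)%:E + (a / 2)%:E * G%:E)%E).
  by apply: leeD => //; apply: lee_pmul => //; [exact: n2_ge0|exact: ltW].
rewrite -!EFinM -EFinD lee_fin.
have -> : 2^-1 / a * (a * e) = e / 2 by field; elra.
have -> : a / 2 * G = e / 2 * (G / (G + 1)) by rewrite /a; field; elra.
have : G / (G + 1) <= 1 by rewrite ler_pdivrMr; elra.
clear_ereal; nra.
Qed.

Lemma limn_einf_le (R : realType) (u : nat -> \bar R) (c : \bar R) :
  (\forall n \near \oo, (u n <= c)%E) -> (limn_einf u <= c)%E.
Proof.
move=> uc; rewrite limn_einf_lim; apply: lime_le.
  by apply/cvg_ex; eexists; apply/ereal_nondecreasing_cvgn; exact: nondecreasing_einfs.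
apply: filterS uc => n; apply: le_trans; apply: ereal_inf_lbound; by exists n => //=.
Qed.

Lemma cvgn_geometric_increments (R : realType) (u : nat -> R) (C : R) :
  (forall k, `|u k.+1 - u k| <= C * 2^-1 ^+ k) -> cvgn u.
Proof.
move=> uC.
have su : cvgn (series (fun k => u k.+1 - u k)).
  apply: normed_cvg; apply: (series_le_cvg (v_ := geometric C 2^-1)).
  - by move=> n; exact: normr_ge0.
  - by move=> n; rewrite /geometric/= (le_trans _ (uC n)).
  - by move=> n; exact: uC.
  - by apply: is_cvg_geometric_series; rewrite ger0_norm ?invr_ge0// invf_lt1// ltr1n.
have -> : u = (fun n => u 0%N + series (fun k => u k.+1 - u k) n).
  apply/funext => n; rewrite /series/= telescope_sumr//; lra.
by apply: is_cvgD => //; exact: is_cvg_cst.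
Qed.

(** * Completeness of L2 *)

Section L2_complete.
Context d (T : measurableType d) (R : realType) (mu : {measure set T -> \bar R}).

(** Riesz-Fischer: a fast subsequence converges almost everywhere, and Fatou's lemma turns the
    Cauchy estimate into convergence of the whole sequence. *)
Lemma L2_complete (X : nat -> T -> R) : (forall n, measurable_fun setT (X n)) ->
  (forall e : R, 0 < e -> exists N, forall m n, (N <= m)%N -> (N <= n)%N ->
    (n2 mu setT (fun x => (X m x - X n x)%R) < e%:E)%E) ->
  exists Y : T -> R, measurable_fun setT Y /\
    (fun n => n2 mu setT (fun x => (X n x - Y x)%R)) @ \oo --> 0%E.
Proof.
move=> mX CX.
(* Squared increments below [8^-k] stay summable after multiplication by [4^k]; a finite weighted
   sum then bounds the increments themselves by a multiple of [2^-k]. *)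
have e8 k : 0 < 8^-1 ^+ k :> R by rewrite exprn_gt0.
pose N k := projT1 (cid (CX _ (e8 k))).
have NP k : forall m n, (N k <= m)%N -> (N k <= n)%N ->
    (n2 mu setT (fun x => (X m x - X n x)%R) < (8^-1 ^+ k)%:E)%E.
  by rewrite /N; case: cid.
(* The maximum makes [phi] nondecreasing, and adding [k] gives [k <= phi k], which the final
   estimate uses. *)
pose phi k := (\max_(i < k.+1) N i + k)%N.
have phiN k : (N k <= phi k)%N 
  by rewrite (leq_trans (@leq_bigmax _ (fun i : 'I_k.+1 => N i) ord_max))// leq_addr.
have phiS k : (phi k <= phi k.+1)%N 
  by rewrite /phi [X in (_ <= X + _)%N]big_ord_recr/= leq_add// leq_maxl.
have phi_ge k j : (k <= j)%N -> (phi k <= phi j)%N.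
  move=> /subnK <-; elim: (j - k)%N => // n IH.
  by rewrite addSn (leq_trans IH).
pose D k x := X (phi k.+1) x - X (phi k) x.
have mD k : measurable_fun setT (D k) by exact: measurable_funB.
have ms k : measurable_fun setT (fun x => (4 ^+ k * (D k x) ^+ 2)%:E : \bar R).
  by apply/measurable_EFinP; apply: measurable_funM => //; exact: measurable_funX.
have s0 k x : (0 <= (4 ^+ k * (D k x) ^+ 2)%:E)%E.
  by rewrite lee_fin mulr_ge0 ?sqr_ge0// exprn_ge0.
pose S x := (\sum_(k <oo) (4 ^+ k * (D k x) ^+ 2)%:E)%E.
have S0 x : (0 <= S x)%E by apply: nneseries_ge0 => k _ _; exact: s0.
have mS : measurable_fun setT S.
  by apply: ge0_emeasurable_sum => // k x _ _; exact: s0.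
have intS : (\int[mu]_x S x < +oo)%E.
  rewrite integral_nneseries//.
  apply: (@le_lt_trans _ _ (\sum_(k <oo) (geometric 1 2^-1 k)%:E)%E).
    apply: lee_nneseries => k _.
      by move=> _; apply: integral_ge0 => x _; exact: s0.
    under eq_integral do rewrite EFinM.
    rewrite ge0_integralZl_EFin//; last 2 first.
    - by move=> x _; rewrite lee_fin sqr_ge0.
    - exact: measurable_sqr_EFin.
    apply: (@le_trans _ _ ((4 ^+ k)%:E * (8^-1 ^+ k)%:E)%E).
      apply: lee_wpmul2l; first by rewrite lee_fin exprn_ge0.
      by apply: ltW; apply: NP => //; exact: leq_trans (phiN k) (phiS k).
    by rewrite -EFinM lee_fin /geometric/= mul1r -exprMn (_ : 4 / 8 = 2^-1)//; lra.
  have : cvgn (series (geometric (1 : R) 2^-1)).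
    by apply: is_cvg_geometric_series; rewrite ger0_norm ?invr_ge0// invf_lt1// ltr1n.
  move=> /cvg_ex[l cl].
  have : (fun n => (\sum_(0 <= k < n) (geometric (1 : R) 2^-1 k)%:E)%E) @ \oo --> l%:E.
    have -> : (fun n => (\sum_(0 <= k < n) (geometric (1 : R) 2^-1 k)%:E)%E) =
        EFin \o series (geometric (1 : R) 2^-1).
      by apply/funext => n; rewrite /= sumEFin.
    by apply: cvg_EFin; [exact: nearW|exact: cl].
  by move/cvg_lim => ->//; rewrite ltry.
pose A := [set x | (S x < +oo)%E].
have mA : measurable A.
  by have := emeasurable_fun_infty_o measurableT mS +oo%E; rewrite setTI.
have aeA : {ae mu, forall x, x \in A}.
  have iS : mu.-integrable setT S.
    apply/integrableP; split => //.
    by under eq_integral do rewrite gee0_abs//.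
  have := integrable_ae measurableT iS; apply: filterS => x /(_ I) Sx.
  by rewrite inE /A/= -ge0_fin_numE.
(* Cutting off to the set of convergence makes the sequence converge everywhere, so that its limit
   is measurable. *)
pose Z k x := X (phi k) x * \1_A x.
have mZ k : measurable_fun setT (Z k).
  by apply: measurable_funM => //; exact: measurable_indic.
have cZ x : cvgn (fun k => Z k x).
  rewrite /Z; have [xA|xA] := boolP (x \in A); last first.
    under eq_fun do rewrite indicE (negbTE xA) mulr0.
    exact: is_cvg_cst.
  under eq_fun do rewrite indicE xA mulr1.
  have fS : S x \is a fin_num by rewrite ge0_fin_numE//; move: xA; rewrite inE.
  apply: (@cvgn_geometric_increments _ _ (Num.sqrt (fine (S x)))) => k.
  have q0 : 0 <= 2^-1 ^+ k :> R by rewrite exprn_ge0.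
  have : ((4 ^+ k * (D k x) ^+ 2)%:E <= S x)%E.
    have := @nneseries_lim_ge R (fun k => (4 ^+ k * (D k x) ^+ 2)%:E) xpredT 0 k.+1.
    move=> /(_ (fun n _ _ => s0 n x)); rewrite big_nat_recr//=.
    apply: le_trans; rewrite leeDr// sume_ge0// => i _; exact: s0.
  rewrite -{1}(fineK fS) lee_fin => h.
  rewrite -(@ler_pXn2r _ 2)// ?nnegrE ?mulr_ge0 ?sqrtr_ge0//.
  rewrite exprMn sqr_sqrtr ?fine_ge0// real_normK ?num_real// -exprM mulnC exprM.
  have -> : 2^-1 ^+ 2 = 4^-1 :> R by lra.
  by rewrite exprVn ler_pdivlMr ?exprn_gt0// mulrC.
pose Y x := limn (fun k => Z k x).
have mY : measurable_fun setT Y.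
  by apply: (measurable_fun_cvg mZ) => x _; exact: cZ.
exists Y; split => //.
apply/ge0_cvg0P; first by move=> n; exact: n2_ge0.
move=> e e0.
have e20 : 0 < e / 2 by rewrite divr_gt0.
have [M MP] := CX _ e20.
exists M => // n /= Mn.
apply: (@le_lt_trans _ _ (e / 2)%:E); last by rewrite lte_fin; lra.
(* The integrand is rewritten as a lower limit along the subsequence, the form to which Fatou's
   lemma applies. *)
have -> : n2 mu setT (fun x => (X n x - Y x)%R) =
    (\int[mu]_x limn_einf (fun k => ((X n x - Z k x) ^+ 2)%:E))%E.
  apply: eq_integral => x _.
  have cx : (fun k => ((X n x - Z k x) ^+ 2)%:E) @ \oo --> ((X n x - Y x) ^+ 2)%:E.
    apply: cvg_EFin; first exact: nearW.
    rewrite expr2; under eq_fun do rewrite /= expr2.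
    by apply: cvgM; (apply: cvgB; [exact: cvg_cst|exact: cZ]).
  have := is_cvg_limn_einfE (cvgP _ cx) => ->.
  by rewrite (cvg_lim _ cx).
apply: (le_trans (fatou _ _ _ _)) => //.
- by move=> k; apply: measurable_sqr_EFin; exact: measurable_funB.
- by move=> k x _; rewrite lee_fin sqr_ge0.
apply: limn_einf_le; exists M => // k /= Mk.
have -> : n2 mu setT (fun x => (X n x - Z k x)%R) = n2 mu setT (fun x => (X n x - X (phi k) x)%R).
  apply: ge0_ae_eq_integral => //.
  - by apply: measurable_sqr_EFin; exact: measurable_funB.
  - by apply: measurable_sqr_EFin; exact: measurable_funB.
  - by move=> x _; rewrite lee_fin sqr_ge0.
  - by move=> x _; rewrite lee_fin sqr_ge0.
  - by apply: filterS aeA => x xA _; rewrite /Z indicE xA mulr1.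
by apply: ltW; apply: MP => //; rewrite (leq_trans Mk)// leq_addl.
Qed.

End L2_complete.

(** * Normal laws *)

Section density.
Local Open Scope ereal_scope.
Context d (T : measurableType d) (R : realType) (mu nu : {measure set T -> \bar R}).
Context (p : T -> R) (mp : measurable_fun setT p) (p0 : forall x, (0 <= p x)%R).
Hypothesis nuE : forall A, measurable A -> nu A = \int[mu]_(x in A) (p x)%:E.

Import HBNNSimple.

Let density_nnsfun (f : {nnsfun T >-> R}) :
  \int[nu]_x (f x)%:E = \int[mu]_x (f x * p x)%:E.
Proof.
under [LHS]eq_integral do rewrite fimfunE -fsumEFin//.
rewrite [LHS]ge0_integral_fsum//; last 2 first.
  - by move=> r; exact/measurable_EFinP/measurableT_comp.
  - by move=> n x _; rewrite EFinM nnfun_muleindic_ge0.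
under [RHS]eq_integral.
  move=> x xD; rewrite EFinM fimfunE -fsumEFin// ge0_mule_fsuml; last first.
    by move=> r; rewrite EFinM nnfun_muleindic_ge0.
  over.
rewrite [RHS]ge0_integral_fsum//; last 2 first.
  - move=> r; apply: emeasurable_funM; last exact/measurable_EFinP.
    by apply/measurable_EFinP; exact/measurableT_comp.
  - by move=> n x _; apply: mule_ge0; [rewrite EFinM nnfun_muleindic_ge0|rewrite lee_fin].
apply: eq_fsbigr => r _.
rewrite integralZl_indic_nnsfun// integral_indic// setIT nuE//.
have [r0|r0] := leP 0%R r.
  rewrite -ge0_integralZl_EFin//; last 2 first.
  - by move=> x _; rewrite lee_fin.
  - by apply/measurable_EFinP; exact: measurable_funTS.
  rewrite integral_mkcond; apply: eq_integral => x _.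
  rewrite patchE indicE; case: ifPn => // _; first by rewrite mulr1.
  by rewrite mulr0 mul0e.
rewrite preimage_nnfun0// integral_set0 mule0.
under eq_integral do rewrite indicE in_set0 mulr0 mul0e.
by rewrite integral0.
Qed.

(** From simple functions by monotone convergence on both sides. *)
Lemma ge0_integral_density (f : T -> \bar R) : measurable_fun setT f -> (forall x, 0 <= f x) ->
  \int[nu]_x f x = \int[mu]_x (f x * (p x)%:E).
Proof.
move=> mf f0.
pose g := nnsfun_approx measurableT mf.
transitivity (limn (fun n => \int[nu]_x (g n x)%:E)).
  rewrite -monotone_convergence//.
  - by apply: eq_integral => x _; apply/esym/cvg_lim => //; exact: cvg_nnsfun_approx.
  - by move=> n; exact/measurable_EFinP.
  - by move=> n x _; rewrite lee_fin.
  - by move=> x _ a b ab; rewrite lee_fin; exact/lefP/nd_nnsfun_approx.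
rewrite (_ : (fun n => _) = (fun n => \int[mu]_x ((g n x)%:E * (p x)%:E))); last first.
  by apply/funext => n; rewrite density_nnsfun; apply: eq_integral => x _; rewrite EFinM.
rewrite -monotone_convergence//.
- apply: eq_integral => x _; apply/cvg_lim => //.
  by apply: cvgeZr => //; exact: cvg_nnsfun_approx.
- by move=> n; apply: emeasurable_funM; apply/measurable_EFinP.
- by move=> n x _; rewrite mule_ge0// lee_fin.
- move=> x _ a b ab; rewrite lee_wpmul2r ?lee_fin//; exact/lefP/nd_nnsfun_approx.
Qed.

End density.

Section normal_integrals.
Context {R : realType}.
Local Notation N s := (@normal_prob R 0 s).
Local Notation leb := (@lebesgue_measure R).
Implicit Types (s : R) (h : R -> R).

Lemma measurable_normal_pdf_EFin s :
  measurable_fun setT (fun x : R => (normal_pdf 0 s x)%:E : \bar R).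
Proof. by apply/measurable_EFinP; exact: measurable_normal_pdf. Qed.

Lemma ge0_integral_normal s (f : R -> \bar R) : measurable_fun setT f -> (forall x, (0 <= f x)%E) ->
  (\int[N s]_x f x = \int[leb]_x (f x * (normal_pdf 0 s x)%:E))%E.
Proof.
move=> mf f0; apply: ge0_integral_density => //.
- exact: measurable_normal_pdf.
- by move=> x; exact: normal_pdf_ge0.
Qed.

Lemma normal_pdf_scale s x : s != 0 -> normal_pdf 0 `|s| (s * x) * `|s| = normal_pdf 0 1 x.
Proof.
move=> s0; rewrite !normal_pdfE ?oner_eq0 ?normr_eq0// /normal_fun /normal_peak !subr0.
rewrite expr1n real_normK ?num_real//.
have -> : - (s * x) ^+ 2 / (s ^+ 2 *+ 2) = - x ^+ 2 / (1 *+ 2).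
  by rewrite -(mulr_natr (s ^+ 2)); field.
have -> : s ^+ 2 * pi *+ 2 = s ^+ 2 * (1 * pi *+ 2) by rewrite mul1r mulrnAr.
rewrite sqrtrM ?sqr_ge0// sqrtr_sqr invfM.
move: (Num.sqrt _) (expR _) => q e.
by rewrite [LHS]mulrC !mulrA mulfV ?normr_eq0// mul1r.
Qed.

Lemma continuous_measurable_EFin h : continuous h ->
  measurable_fun setT (fun x => (h x)%:E : \bar R).
Proof. by move=> ch; apply/measurable_EFinP; exact: continuous_measurable_fun. Qed.

Lemma integral_normal_scale s h : 0 < s -> continuous h -> (forall x, 0 <= h x) ->
  (\int[N s]_x (h x)%:E = \int[N 1]_x (h (s * x)%R)%:E)%E.
Proof.
move=> s0 ch h0.
have chs : continuous (fun x => h (s * x)).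
  move=> x; apply: (@continuous_comp _ _ _ (fun x => s * x) h).
    by apply: cvgM; [exact: cvg_cst|exact: cvg_id].
  exact: ch.
have m1 := continuous_measurable_EFin ch; have m2 := continuous_measurable_EFin chs.
have p1 x : (0 <= (h x)%:E)%E by rewrite lee_fin.
rewrite (ge0_integral_normal _ m1 p1) (ge0_integral_normal _ m2 (fun x => p1 _)).
under eq_integral do rewrite -EFinM.
pose F (x : R^o) := s * x : R^o.
have dF x : derivable F x 1 by exact: derivableM.
have F'E : F^`()%classic = cst s.
  apply/funext => x; rewrite /F derive1E deriveM// derive_cst scaler0 addr0 derive_id.
  by rewrite /GRing.scale/= mulr1.
rewrite (@increasing_ge0_integration_by_substitutionT _ F); last 9 first.
- by move=> x y xy; rewrite /F ltr_pM2l.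
- by rewrite F'E => ?; exact: cvg_cst.
- by rewrite F'E; exact: is_cvg_cst.
- by rewrite F'E; exact: is_cvg_cst.
- exact: dF.
- by rewrite /F; under eq_fun do rewrite mulrC; apply/gt0_cvgMlNy => //; exact: cvg_id.
- by rewrite /F; under eq_fun do rewrite mulrC; apply/gt0_cvgMly => //; exact: cvg_id.
- by move=> x; apply: cvgM; [exact: ch|apply: continuous_normal_pdf; rewrite gt_eqF].
- by move=> x; rewrite mulr_ge0// normal_pdf_ge0.
apply: eq_integral => x _; rewrite -EFinM F'E /F/= -mulrA; congr (_ * _)%:E.
by rewrite -(@normal_pdf_scale s) ?gt_eqF// gtr0_norm.
Qed.

Lemma ge0_integral_lebesgue_opp (f : R -> \bar R) : measurable_fun setT f ->
  (forall x, (0 <= f x)%E) -> (\int[leb]_x f x = \int[leb]_x f (- x)%R)%E.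
Proof.
move=> mf f0.
have mo : measurable_fun setT (-%R : R -> measurableTypeR R) by exact: oppr_measurable.
have -> : (\int[leb]_x f (- x)%R =
    \int[leb]_(x in (-%R : _ -> measurableTypeR R) @^-1` setT) (f \o -%R) x)%E.
  by rewrite preimage_setT.
rewrite -ge0_integral_pushforward//=.
by apply: eq_measure_integral => A mA AS; exact/esym/lebesgue_measureN.
Qed.

Lemma integral_normal_opp s h : s != 0 -> continuous h -> (forall x, 0 <= h x) ->
  (\int[N s]_x (h x)%:E = \int[N s]_x (h (- x)%R)%:E)%E.
Proof.
move=> s0 ch h0.
have chs : continuous (fun x => h (- x)).
  move=> x; apply: (@continuous_comp _ _ _ (fun x => - x) h).
    by apply: cvgN; exact: cvg_id.
  exact: ch.
have pdfN x : normal_pdf 0 s (- x) = normal_pdf 0 s x.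
  by rewrite !normal_pdfE// /normal_fun !subr0 sqrrN.
have m1 := continuous_measurable_EFin ch; have m2 := continuous_measurable_EFin chs.
have p1 x : (0 <= (h x)%:E)%E by rewrite lee_fin.
rewrite (ge0_integral_normal _ m1 p1) (ge0_integral_normal _ m2 (fun x => p1 _)).
rewrite ge0_integral_lebesgue_opp.
- by apply: eq_integral => x _; rewrite pdfN.
- by apply: emeasurable_funM; [exact: m1|exact: measurable_normal_pdf_EFin].
- by move=> x; rewrite mule_ge0// lee_fin ?normal_pdf_ge0.
Qed.

(** Write [exp(-x^2/2)] as the square of [exp(-x^2/4)]. One factor absorbs the power, by
    [y^(n+1) <= (n+1)! exp y] at [y = x^2/4]; the other one is a multiple of the density of variance
    2. The constant [C] collects the two normalisations and [4^(n+1) (n+1)!]. *)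
Lemma normal_moment_lty n : (\int[N 1]_x (x ^+ n.*2)%:E < +oo)%E.
Proof.
have mp k : measurable_fun setT (fun x : R => (x ^+ k)%:E : \bar R).
  by apply/measurable_EFinP; exact: exprn_measurable.
rewrite (ge0_integral_normal _ (mp _)); last by move=> x; rewrite lee_fin -mul2n exprM exprn_ge0// sqr_ge0.
pose s : R := Num.sqrt 2.
have s0 : s != 0 by rewrite sqrtr_eq0 -ltNge.
case: n => [|n].
  under eq_integral do rewrite /= expr0 mul1e.
  by rewrite integral_normal_pdf ltry.
pose C := (normal_peak 1 / normal_peak s) * (4 ^+ n.+1 * n.+1`!%:R) : R.
have C0 : 0 <= C by rewrite mulr_ge0 ?divr_ge0 ?normal_peak_ge0// mulr_ge0.
apply: (@le_lt_trans _ _ (\int[leb]_x (C%:E * (normal_pdf 0 s x)%:E))%E).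
  apply: ge0_le_integral => //.
  - move=> x _; rewrite mule_ge0// lee_fin ?normal_pdf_ge0//.
    by rewrite -mul2n exprM exprn_ge0// sqr_ge0.
  - by apply: emeasurable_funM; [exact: mp|exact: measurable_normal_pdf_EFin].
  - by apply: measurable_funeM; exact: measurable_normal_pdf_EFin.
  - move=> x _; rewrite -!EFinM lee_fin !normal_pdfE ?oner_eq0// /normal_fun !subr0.
    have -> : - x ^+ 2 / (1 ^+ 2 *+ 2) = - x ^+ 2 / 4 + - x ^+ 2 / 4 :> R.
      by rewrite expr1n; field.
    have -> : - x ^+ 2 / (s ^+ 2 *+ 2) = - x ^+ 2 / 4 :> R.
      by rewrite sqr_sqrtr// -mulr_natr; field.
    rewrite expRD.
    have -> : C * (normal_peak s * expR (- x ^+ 2 / 4)) =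
        normal_peak 1 * (4 ^+ n.+1 * n.+1`!%:R * expR (- x ^+ 2 / 4)).
      by rewrite /C; field; rewrite gt_eqF// normal_peak_gt0.
    rewrite mulrCA ler_wpM2l ?normal_peak_ge0// mulrA ler_wpM2r ?expR_ge0//.
    rewrite mulNr expRN ler_pdivrMr ?expR_gt0//.
    have := @expR_ge1Dxn R (x ^+ 2 / 4) n (divr_ge0 (sqr_ge0 _) (ler0n _ 4)).
    rewrite exprMn exprVn -exprM mul2n => h.
    have h1 : x ^+ (n.+1).*2 / 4 ^+ n.+1 / n.+1`!%:R <= expR (x ^+ 2 / 4).
      by apply: le_trans h; rewrite lerDr.
    by rewrite mulrC -ler_pdivrMr ?mulr_gt0 ?exprn_gt0 ?ltr0n ?fact_gt0// invfM mulrA.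
rewrite ge0_integralZl_EFin//; last 2 first.
- by move=> x _; rewrite lee_fin normal_pdf_ge0.
- by exact: measurable_normal_pdf_EFin.
by rewrite integral_normal_pdf mule1 ltry.
Qed.

End normal_integrals.

(** * Integrators and adapted step families *)

Section independence.
Context d (Omega : measurableType d) (R : realType) (P : probability Omega R).

Definition indep2 (X V : Omega -> R) := forall A B : set R, measurable A -> measurable B ->
  P (X @^-1` A `&` V @^-1` B) = (P (X @^-1` A) * P (V @^-1` B))%E.

Section mfun.
Context (X V : {mfun Omega >-> R}) (XV : indep2 X V).

Let XV_pair := fun om => (X om, V om).
Let mXV : measurable_fun setT XV_pair.
Proof. by apply: measurable_fun_pair; exact: measurable_funPT. Qed.
Let pair_mixin := isMeasurableFun.Build _ _ _ _ _ mXV.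
Let pairXV : {mfun Omega >-> (R * R)%type} := HB.pack XV_pair pair_mixin.

(** Rectangles determine a measure on the plane, so independence makes the joint law the product of
    the two laws; expectations of products then follow from Tonelli and Fubini. *)
Lemma distribution_pair_indep (S : set (R * R)) : measurable S ->
  (distribution P X \x distribution P V)%E S = distribution P pairXV S.
Proof. by apply: product_measure_unique => A B mA mB; rewrite -[RHS]XV. Qed.

Lemma ge0_indep_mfun (g h : R -> \bar R) :
  measurable_fun setT g -> measurable_fun setT h ->
  (forall x, (0 <= g x)%E) -> (forall x, (0 <= h x)%E) ->
  (\int[P]_om (g (X om) * h (V om)) = \int[P]_om g (X om) * \int[P]_om h (V om))%E.
Proof.
move=> mg mh g0 h0.
pose F (z : R * R) := (g z.1 * h z.2)%E.
have mF : measurable_fun setT F.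
  by apply: emeasurable_funM; [exact: (measurableT_comp mg)|exact: (measurableT_comp mh)].
have F0 z : (0 <= F z)%E by rewrite mule_ge0.
rewrite -(ge0_integral_distribution pairXV mF F0).
transitivity (\int[(distribution P X \x distribution P V)%E]_z F z)%E.
  by apply: eq_measure_integral => S mS _; exact/esym/distribution_pair_indep.
rewrite fubini_tonelli1// /fubini_F/=.
rewrite -(ge0_integral_distribution X mg g0) -(ge0_integral_distribution V mh h0).
rewrite -ge0_integralZr//; last exact: integral_ge0.
by apply: eq_integral => x _; rewrite /F/= ge0_integralZl.
Qed.

Lemma indep_mfun : P.-integrable setT (EFin \o X) -> P.-integrable setT (EFin \o V) ->
  P.-integrable setT (fun om => (X om * V om)%:E) /\
  (\int[P]_om (X om * V om) = (\int[P]_om X om) * \int[P]_om V om).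
Proof.
move=> iX iV.
pose F (z : R * R) := (z.1 * z.2)%:E.
have mF : measurable_fun setT F.
  by apply/measurable_EFinP; exact: measurable_funM.
have mXVf : measurable_fun setT (fun om => (X om * V om)%:E : \bar R).
  by apply/measurable_EFinP; apply: measurable_funM; exact: measurable_funPT.
have mabs : measurable_fun setT (fun x : R => `|x|%:E : \bar R).
  by apply/measurable_EFinP; exact: normr_measurable.
have iXV : P.-integrable setT (fun om => (X om * V om)%:E).
  apply/integrableP; split => //.
  under eq_integral do rewrite /= normrM EFinM.
  rewrite (ge0_indep_mfun mabs mabs) => [|x|x]; try by rewrite lee_fin.
  move/integrableP : iX => [_ iX]; move/integrableP : iV => [_ iV].
  by rewrite lte_mul_pinfty// ?ge0_fin_numE//; exact: integral_ge0.
split => //.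
have iF : (distribution P X \x distribution P V)%E.-integrable setT F.
  apply/integrableP; split => //.
  rewrite (eq_measure_integral (distribution P pairXV)); last by move=> S mS _; exact: distribution_pair_indep.
  rewrite ge0_integral_distribution//; last exact: measurableT_comp.
  by case/integrableP : iXV.
rewrite /Rintegral -fineM; last 2 first.
- exact: integrable_fin_num.
- exact: integrable_fin_num.
congr fine.
transitivity (\int[(distribution P X \x distribution P V)%E]_z F z)%E.
  rewrite (eq_measure_integral (distribution P pairXV)); last by move=> S mS _; exact: distribution_pair_indep.
  by rewrite integral_distribution.
rewrite -integral12_prod_meas1// /fubini_F/=.
rewrite -(integral_distribution (X := X) (f := EFin))//.
rewrite -(integral_distribution (X := V) (f := EFin))//.
have iVd : (distribution P V).-integrable setT EFin.
  by apply: integrable_pushforward.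
have iXd : (distribution P X).-integrable setT EFin.
  by apply: integrable_pushforward.
rewrite -(fineK (integrable_fin_num measurableT iVd)) -integralZr//.
apply: eq_integral => x _; rewrite /F/= fineK ?integrable_fin_num//.
by rewrite -integralZl//; apply: eq_integral => y _; rewrite EFinM.
Qed.

End mfun.

Lemma ge0_indep_integralM (X V : Omega -> R) : measurable_fun setT X -> measurable_fun setT V ->
  indep2 X V -> forall g h : R -> \bar R,
  measurable_fun setT g -> measurable_fun setT h ->
  (forall x, (0 <= g x)%E) -> (forall x, (0 <= h x)%E) ->
  (\int[P]_om (g (X om) * h (V om)) = \int[P]_om g (X om) * \int[P]_om h (V om))%E.
Proof.
move=> mX mV XV g h mg mh g0 h0.
pose X' : {mfun Omega >-> R} := HB.pack X (isMeasurableFun.Build _ _ _ _ _ mX).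
pose V' : {mfun Omega >-> R} := HB.pack V (isMeasurableFun.Build _ _ _ _ _ mV).
exact: (@ge0_indep_mfun X' V' XV).
Qed.

Lemma indep_integralM (X V : Omega -> R) :
  indep2 X V -> P.-integrable setT (EFin \o X) -> P.-integrable setT (EFin \o V) ->
  P.-integrable setT (fun om => (X om * V om)%:E) /\
  (\int[P]_om (X om * V om) = (\int[P]_om X om) * \int[P]_om V om).
Proof.
move=> XV iX iV.
have mX : measurable_fun setT X by apply/measurable_EFinP; case/integrableP : iX.
have mV : measurable_fun setT V by apply/measurable_EFinP; case/integrableP : iV.
pose X' : {mfun Omega >-> R} := HB.pack X (isMeasurableFun.Build _ _ _ _ _ mX).
pose V' : {mfun Omega >-> R} := HB.pack V (isMeasurableFun.Build _ _ _ _ _ mV).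
exact: (@indep_mfun X' V' XV).
Qed.

End independence.

Section measurable_for.
Context (Omega : pointedType) (R : realType) (G : set_system Omega) (sG : sigma_algebra setT G).
Implicit Types X Y : Omega -> R.

(** Turns adaptedness, which is stated through preimages, into measurability for a generated
    sigma-algebra, so that the closure properties of measurable functions apply. *)
Lemma measurable_forP X :
  measurable_for G X <-> measurable_fun (setT : set (g_sigma_algebraType G)) X.
Proof.
split=> [h _ B mB|h B mB].
  by rewrite setTI; apply: sub_sigma_algebra; exact: h.
by have := h measurableT B mB; rewrite setTI /measurable/= sigma_algebra_id.
Qed.

Lemma measurable_for_cst (c : R) : measurable_for G (fun _ => c).
Proof. by apply/measurable_forP; exact: measurable_cst. Qed.

Lemma measurable_forD X Y : measurable_for G X -> measurable_for G Y ->
  measurable_for G (fun om => X om + Y om).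
Proof.
by move=> /measurable_forP mX /measurable_forP mY; apply/measurable_forP; exact: measurable_funD.
Qed.

Lemma measurable_forM X Y : measurable_for G X -> measurable_for G Y ->
  measurable_for G (fun om => X om * Y om).
Proof.
by move=> /measurable_forP mX /measurable_forP mY; apply/measurable_forP; exact: measurable_funM.
Qed.

Lemma measurable_forB X Y : measurable_for G X -> measurable_for G Y ->
  measurable_for G (fun om => X om - Y om).
Proof.
by move=> /measurable_forP mX /measurable_forP mY; apply/measurable_forP; exact: measurable_funB.
Qed.

Lemma measurable_for_sum (J : Type) (s : seq J) (Q : pred J) (X : J -> Omega -> R) :
  (forall j, Q j -> measurable_for G (X j)) ->
  measurable_for G (fun om => \sum_(j <- s | Q j) X j om).
Proof.
move=> mX; elim: s => [|j s IH].
  by under eq_fun do rewrite big_nil; exact: measurable_for_cst.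
have [Qj|nQj] := boolP (Q j).
  by under eq_fun do rewrite big_cons Qj; apply: measurable_forD IH; exact: mX.
by under eq_fun do rewrite big_cons (negbTE nQj).
Qed.

End measurable_for.

Lemma centered_gaussian_integral d (Omega : measurableType d) (R : realType)
    (P : probability Omega R) (s : R) (X : Omega -> R) : centered_gaussian P s X ->
  forall h : R -> \bar R, measurable_fun setT h ->
  (\int[P]_om h (X om) = \int[normal_prob 0 s]_x h x)%E.
Proof.
move=> [mX GX] h mh.
pose X' : {mfun Omega >-> measurableTypeR R} :=
  HB.pack X (isMeasurableFun.Build _ _ _ (measurableTypeR R) _ mX).
have ge0 (g : R -> \bar R) : measurable_fun setT g -> (forall x, (0 <= g x)%E) ->
    (\int[P]_om g (X om) = \int[normal_prob 0 s]_x g x)%E.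
  move=> mg g0; rewrite -(ge0_integral_distribution X' mg g0).
  by apply: eq_measure_integral => B mB _; exact: GX.
rewrite integralE [RHS]integralE; congr (_ - _)%E.
  transitivity (\int[P]_x h^\+ (X x))%E; first by apply: eq_integral => x _; rewrite !funeposE.
  by apply: ge0 => //; exact: measurable_funepos.
transitivity (\int[P]_x h^\- (X x))%E; first by apply: eq_integral => x _; rewrite !funenegE.
by apply: ge0 => //; exact: measurable_funeneg.
Qed.

(** The negative part of an odd function is the reflection of its positive part, and the law is
    symmetric. *)
Lemma normal_integral_odd (R : realType) (s : R) (h : R -> R) : s != 0 -> continuous h ->
  (forall x, h (- x) = - h x) -> (normal_prob 0 s).-integrable setT (EFin \o h) ->
  \int[normal_prob 0 s]_x (h x) = 0.
Proof.
move=> s0 ch oh ih.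
pose hp x := Num.max (h x) 0.
have chp : continuous hp by move=> x; apply: continuous_max; [exact: ch|exact: cvg_cst].
have hp0 x : 0 <= hp x by rewrite /hp le_max lexx orbT.
have := integral_normal_opp s0 chp hp0.
rewrite /Rintegral integralE => E.
have -> : (\int[normal_prob 0 s]_x ((EFin \o h)^\- x) =
           \int[normal_prob 0 s]_x ((EFin \o h)^\+ x))%E.
  transitivity (\int[normal_prob 0 s]_x (hp (- x)%R)%:E)%E.
    by apply: eq_integral => x _; rewrite /hp/= funenegE oh EFin_max.
  by rewrite -E; apply: eq_integral => x _; rewrite /hp/= funeposE EFin_max.
rewrite subee//; rewrite fin_numElt; apply/andP; split.
  by rewrite (lt_le_trans ltNy0)// integral_ge0.
exact: integral_funepos_lt_pinfty.
Qed.

(** * Ito's inequality for time and for the Wiener components *)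

Section integrators.
Context d (Omega : measurableType d) (R : realType) (P : probability Omega R) (t T : R).
Context (F : R -> set_system Omega) (m : nat) (f : 'I_m -> R -> Omega -> R).
Hypotheses (t0 : 0 <= t) (tT : t < T) (hF : is_filtration T F) (hf : is_wiener P T F f).
Local Notation E2 X := (n2 P setT X).

Lemma sigma_algebra_filt s : t <= s <= T -> sigma_algebra setT (F s).
Proof. by move=> /andP[ts sT]; apply: (filt_sigma hF); rewrite (le_trans t0)//. Qed.

Lemma measurable_for_fun s (X : Omega -> R) : t <= s <= T -> measurable_for (F s) X ->
  measurable_fun setT X.
Proof.
move=> /andP[ts sT] mX _ B mB; rewrite setTI; apply: (filt_sub hF (s := s)); last exact: mX.
by rewrite (le_trans t0)//.
Qed.

Lemma measurable_for_le s u (X : Omega -> R) : t <= s -> s <= u -> u <= T ->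
  measurable_for (F s) X -> measurable_for (F u) X.
Proof. by move=> ts su uT mX B mB; apply: (filt_mono hF _ su uT); [exact: le_trans ts|exact: mX]. Qed.

(** Ito's isometry weakened to an inequality, so that time qualifies as well. The second clause
    provides the finite second moments of iterated step integrals. *)
Definition ito_isometric (C : R) (W : R -> Omega -> R) :=
  [/\ forall s, t <= s <= T -> measurable_for (F s) (W s),
    forall a b eta, t <= a -> a < b -> b <= T -> measurable_for (F a) eta ->
      (E2 eta < +oo)%E -> (E2 (fun om => eta om * (W b om - W a om))%R < +oo)%E &
    forall n (sg : nat -> R) (eta : nat -> Omega -> R),
      (forall q, (q <= n)%N -> t <= sg q <= T) ->
      (forall q, (q < n)%N -> sg q < sg q.+1) ->
      (forall q, (q < n)%N -> measurable_for (F (sg q)) (eta q) /\ (E2 (eta q) < +oo)%E) ->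
      (E2 (fun om => \sum_(q < n) eta q om * (W (sg q.+1) om - W (sg q) om)) <=
       C%:E * \sum_(q < n) ((sg q.+1 - sg q)%:E * E2 (eta q)))%E].

Lemma integrator_time : integrator f ord0 = fun s _ => s.
Proof. by apply/funext => s; apply/funext => om; rewrite /integrator unlift_none. Qed.

Lemma integrator_wiener i : integrator f (lift ord0 i) = f i.
Proof. by apply/funext => s; apply/funext => om; rewrite /integrator liftK. Qed.

Lemma time_ito_isometric : ito_isometric (T - t) (integrator f ord0).
Proof.
rewrite integrator_time; split.
- by move=> s hs; apply: measurable_for_cst; exact: sigma_algebra_filt.
- move=> a b eta ta ab bT meta eta2.
  have := @n2Z _ _ _ P setT measurableT (b - a) eta.
  under eq_integral do rewrite mulrC.
  move=> ->; first by rewrite lte_mul_pinfty// lee_fin sqr_ge0.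
  by apply: (@measurable_for_fun a) => //; rewrite ta (le_trans (ltW ab)).
move=> n sg eta hsg sg_lt heta.
have meta q : (q < n)%N -> measurable_fun setT (eta q).
  by move=> qn; apply: (measurable_for_fun (hsg q (ltnW qn))); exact: (heta q qn).1.
have D0 (q : 'I_n) : 0 <= sg q.+1 - sg q by rewrite subr_ge0 ltW// sg_lt.
have mq (q : 'I_n) : measurable_fun setT (fun om => ((eta q om) ^+ 2)%:E : \bar R).
  by apply: measurable_sqr_EFin; exact: meta.
have -> : ((T - t)%:E * \sum_(q < n) ((sg q.+1 - sg q)%:E * E2 (eta q)) =
   \int[P]_om ((T - t) * \sum_(q < n) (sg q.+1 - sg q) * (eta q om) ^+ 2)%:E)%E.
  under eq_integral do rewrite EFinM -sumEFin.
  rewrite ge0_integralZl_EFin ?subr_ge0 ?(ltW tT)//; last 2 first.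
  - by move=> om _; apply: sume_ge0 => q _; rewrite lee_fin mulr_ge0// sqr_ge0.
  - apply: emeasurable_sum => q; under eq_fun do rewrite EFinM.
    exact: measurable_funeM.
  rewrite ge0_integral_sum//.
  - congr (_ * _)%E; apply: eq_bigr => q _; under [RHS]eq_integral do rewrite EFinM.
    by rewrite ge0_integralZl_EFin// => om _; rewrite lee_fin sqr_ge0.
  - by move=> q; under eq_fun do rewrite EFinM; exact: measurable_funeM.
  - by move=> q om _; rewrite lee_fin mulr_ge0// sqr_ge0.
have msum : measurable_fun setT (fun om => \sum_(q < n) eta q om * (sg q.+1 - sg q)).
  by apply: measurable_sum => q; apply: measurable_funM => //; exact: meta.
apply: ge0_le_integral => //.
- by move=> om _; rewrite lee_fin sqr_ge0.
- exact: measurable_sqr_EFin.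
- apply/measurable_EFinP; apply: measurable_funM => //; apply: measurable_sum => q.
  by apply: measurable_funM => //; apply: measurable_funX; exact: meta.
move=> om _; rewrite lee_fin.
(* Weighted Cauchy-Schwarz, again from a nonnegative double sum of squared differences. The weights
   are the lengths of the cells, whose sum telescopes to at most [T - t]. *)
have cs (x y : 'I_n -> R) : (forall q, 0 <= y q) ->
    (\sum_q x q * y q) ^+ 2 <= (\sum_q y q) * \sum_q y q * x q ^+ 2.
  move=> y0.
  have h : 0 <= \sum_p \sum_q (y p * y q) * (x p - x q) ^+ 2.
    by apply: sumr_ge0 => p _; apply: sumr_ge0 => q _; rewrite mulr_ge0 ?sqr_ge0// mulr_ge0.
  have E : \sum_p \sum_q (y p * y q) * (x p - x q) ^+ 2 =
      ((\sum_q y q) * (\sum_q y q * x q ^+ 2) - (\sum_q x q * y q) ^+ 2) * 2.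
    have E1 : (\sum_q y q) * (\sum_q y q * x q ^+ 2) = \sum_p \sum_q y p * (y q * x q ^+ 2).
      by rewrite mulr_suml; apply: eq_bigr => p _; rewrite mulr_sumr.
    have E2 : (\sum_q y q) * (\sum_q y q * x q ^+ 2) = \sum_p \sum_q y q * (y p * x p ^+ 2).
      by rewrite E1 exchange_big.
    have E3 : (\sum_q x q * y q) ^+ 2 = \sum_p \sum_q (x p * y p) * (x q * y q).
      by rewrite expr2 mulr_suml; apply: eq_bigr => p _; rewrite mulr_sumr.
    transitivity ((\sum_q y q) * (\sum_q y q * x q ^+ 2) +
       (\sum_q y q) * (\sum_q y q * x q ^+ 2) - (\sum_q x q * y q) ^+ 2 * 2); last by ring.
    rewrite {1}E1 E2 E3 mulr_suml -!big_split/= -sumrB; apply: eq_bigr => p _.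
    rewrite mulr_suml -!big_split/= -sumrB; apply: eq_bigr => q _; ring.
  by rewrite E pmulr_lge0// subr_ge0 in h.
apply: le_trans (cs _ _ D0) _.
apply: ler_wpM2r; first by apply: sumr_ge0 => q _; rewrite mulr_ge0// sqr_ge0.
have -> : \sum_(q < n) (sg q.+1 - sg q) = sg n - sg 0%N.
  by rewrite -(big_mkord xpredT (fun q => sg q.+1 - sg q)) telescope_sumr.
have := hsg n (leqnn n); have := hsg 0%N (leq0n n); lra.
Qed.

(** The other components are left free by giving them the whole line as Borel set. *)
Lemma wiener_indep2 i u s (U : Omega -> R) : t <= u -> u < s -> s <= T ->
  measurable_for (F u) U -> indep2 P U (fun om => f i s om - f i u om).
Proof.
move=> tu us sT mU A B mA mB.
have := wiener_indep hf (le_trans t0 tu) us sT (mU A mA) (B := fun j => if j == i then B else setT).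
move=> /(_ (fun j => _)) /=; have -> : (\bigcap_i0
    ((fun om => f i0 s om - f i0 u om) @^-1` (if i0 == i then B else setT))) =
    (fun om => f i s om - f i u om) @^-1` B.
  apply/seteqP; split=> om /=.
    by move=> /(_ i I); rewrite eqxx.
  by move=> h j _ /=; case: eqP => // ->.
move=> ->; last by move=> j; case: ifP.
congr (_ * _)%E; rewrite (bigD1 i)//= eqxx big1 ?mule1// => j ji.
by rewrite (negbTE ji) preimage_setT probability_setT.
Qed.

(** The variance of the standard normal law, kept as an abstract constant: it is the constant in the
    inequality for the Wiener components. *)
Definition normal_var : R := fine (\int[normal_prob 0 1]_x ((x : R) ^+ 2)%:E)%E.

Lemma sqr_continuousE : continuous (fun x : R => x ^+ 2).
Proof. exact: exprn_continuous. Qed.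

Lemma wiener_increment_n2 i u s : t <= u -> u < s -> s <= T ->
  E2 (fun om => f i s om - f i u om) = (normal_var * (s - u))%:E.
Proof.
move=> tu us sT.
have su0 : 0 < s - u by rewrite subr_gt0.
have := wiener_gauss hf i (le_trans t0 tu) us sT => G.
have mE : measurable_fun setT (fun x : R => (x ^+ 2)%:E : \bar R).
  by apply/measurable_EFinP; exact: exprn_measurable.
rewrite (centered_gaussian_integral G mE).
rewrite integral_normal_scale ?sqrtr_gt0//; last 2 first.
- exact: sqr_continuousE.
- by move=> x; exact: sqr_ge0.
under eq_integral do rewrite exprMn EFinM.
rewrite ge0_integralZl_EFin ?sqr_ge0//; last by move=> x _; rewrite lee_fin sqr_ge0.
rewrite sqr_sqrtr ?(ltW su0)// mulrC EFinM fineK//.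
have := @normal_moment_lty R 1; rewrite ge0_fin_numE//.
by apply: integral_ge0 => x _; rewrite lee_fin sqr_ge0.
Qed.

Lemma wiener_measurable i s : t <= s <= T -> measurable_fun setT (f i s).
Proof.
move=> /[dup] hs /andP[ts sT]; apply: (measurable_for_fun hs).
by apply: (wiener_adapted hf); rewrite (le_trans t0)//.
Qed.

Lemma prob_n2_integrable (X : Omega -> R) : measurable_fun setT X -> (E2 X < +oo)%E ->
  P.-integrable setT (EFin \o X).
Proof.
move=> mX X2.
have -> : EFin \o X = (fun x => (X x * cst 1 x)%:E) by apply/funext => x; rewrite /= mulr1.
apply: n2_integrableM => //; under eq_integral do rewrite /= expr1n.
exact: (integrable_lty measurableT (finite_measure_integrable_cst P 1 measurableT)).
Qed.

Lemma wiener_increment_mean i u s : t <= u -> u < s -> s <= T ->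
  P.-integrable setT (fun om => (f i s om - f i u om)%:E) /\
  \int[P]_om (f i s om - f i u om) = 0.
Proof.
move=> tu us sT.
have su0 : Num.sqrt (s - u) != 0 by rewrite gt_eqF// sqrtr_gt0 subr_gt0.
have G := wiener_gauss hf i (le_trans t0 tu) us sT.
have iD : P.-integrable setT (fun om => (f i s om - f i u om)%:E).
  apply: prob_n2_integrable; first exact: G.1.
  by rewrite wiener_increment_n2// ltry.
split => //; rewrite /Rintegral (centered_gaussian_integral G (h := EFin))//.
rewrite -[fine _]/(Rintegral _ _ _).
apply: (@normal_integral_odd _ _ id) => //; first by move=> x; exact: cvg_id.
apply/integrableP; split; first by apply/measurable_EFinP; exact: measurable_id.
have mabs : measurable_fun setT (fun x : R => `|x%:E|%E : \bar R).
  by apply: measurableT_comp.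
rewrite -(centered_gaussian_integral G mabs).
by case/integrableP : iD.
Qed.

Lemma wiener_ito_isometric i : ito_isometric normal_var (integrator f (lift ord0 i)).
Proof.
rewrite integrator_wiener.
have inc2 a b (eta : Omega -> R) : t <= a -> a < b -> b <= T -> measurable_for (F a) eta ->
      (E2 (fun om => eta om * (f i b om - f i a om))%R =
       (normal_var * (b - a))%:E * E2 eta)%E.
  move=> ta ab bT meta.
  have ta' : t <= a <= T by rewrite ta (le_trans (ltW ab)).
  have tb' : t <= b <= T by rewrite bT (le_trans ta)// ltW.
  have mE : measurable_fun setT (fun x : R => (x ^+ 2)%:E : \bar R).
    by apply/measurable_EFinP; exact: exprn_measurable.
  have := ge0_indep_integralM (measurable_for_fun ta' meta)
    (measurable_funB (wiener_measurable i tb') (wiener_measurable i ta'))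
    (wiener_indep2 i ta ab bT meta) mE mE.
  rewrite (wiener_increment_n2 i ta ab bT) muleC.
  move=> <-; try by move=> x; rewrite lee_fin sqr_ge0.
  by apply: eq_integral => om _; rewrite exprMn EFinM.
split.
- by move=> s /andP[ts sT]; apply: (wiener_adapted hf); rewrite (le_trans t0)//.
- by move=> a b eta ta ab bT meta eta2; rewrite inc2// lte_mul_pinfty// lee_fin
    mulr_ge0 ?fine_ge0 ?subr_ge0 ?(ltW ab)// integral_ge0// => x _; rewrite lee_fin sqr_ge0.
move=> n sg eta.
(* Adaptedness of the partial sum joins the induction, since it makes the next increment independent
   of everything that multiplies it. *)
suff H : (forall q, (q <= n)%N -> t <= sg q <= T) ->
    (forall q, (q < n)%N -> sg q < sg q.+1) ->
    (forall q, (q < n)%N -> measurable_for (F (sg q)) (eta q) /\ (E2 (eta q) < +oo)%E) ->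
    measurable_for (F (sg n)) (fun om => \sum_(q < n) eta q om * (f i (sg q.+1) om - f i (sg q) om)) /\
    (E2 (fun om => \sum_(q < n) eta q om * (f i (sg q.+1) om - f i (sg q) om)) =
       normal_var%:E * \sum_(q < n) ((sg q.+1 - sg q)%:E * E2 (eta q)))%E.
  by move=> h1 h2 h3; have [_ ->] := H h1 h2 h3.
elim: n => [|n IH] hsg sg_lt heta.
  split; first by under eq_fun do rewrite big_ord0;
    apply: measurable_for_cst; exact/sigma_algebra_filt/hsg.
  rewrite big_ord0 mule0; under eq_integral do rewrite big_ord0 expr0n/=.
  exact: integral0.
have [| | |mS ES] := IH.
- by move=> q qn; apply: hsg; rewrite (leq_trans qn).
- by move=> q qn; apply: sg_lt; rewrite (leq_trans qn).
- by move=> q qn; apply: heta; rewrite (leq_trans qn).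
have [metan etan2] := heta n (ltnSn n).
have hn := hsg n (leqnSn n); have hSn := hsg n.+1 (leqnn n.+1).
have /andP[tn nT] := hn; have /andP[tSn SnT] := hSn.
have nSn := sg_lt n (ltnSn n).
set S := (fun om => \sum_(q < n) eta q om * (f i (sg q.+1) om - f i (sg q) om)) in mS ES *.
have adapt s : t <= s <= T -> measurable_for (F s) (f i s).
  by move=> /andP[ts sT]; apply: (wiener_adapted hf); rewrite (le_trans t0)//.
split.
  under eq_fun do rewrite big_ord_recr/=.
  apply: measurable_forD; first exact: sigma_algebra_filt.
    exact: (measurable_for_le tn (ltW nSn) SnT).
  apply: measurable_forM; first exact: sigma_algebra_filt.
    exact: (measurable_for_le tn (ltW nSn) SnT).
  apply: measurable_forB; first exact: sigma_algebra_filt.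
    exact: adapt.
  by apply: (measurable_for_le tn (ltW nSn) SnT); exact: adapt.
have S2 : (E2 S < +oo)%E.
  rewrite ES lte_mul_pinfty// ?lee_fin ?fine_ge0//.
    by apply: integral_ge0 => x _; rewrite lee_fin sqr_ge0.
  apply: lte_sum_pinfty => q _; rewrite lte_mul_pinfty//.
    by rewrite lee_fin subr_ge0 ltW// sg_lt// (leq_trans (ltn_ord q)).
  by have [] := heta q (leq_trans (ltn_ord q) (leqnSn n)).
set D := fun om => f i (sg n.+1) om - f i (sg n) om.
have mD : measurable_fun setT D by apply: measurable_funB; exact: wiener_measurable.
have mS' := measurable_for_fun hn mS; have meta' := measurable_for_fun hn metan.
have mED : measurable_fun setT (fun om => eta n om * D om) by exact: measurable_funM.
have ED2 : (E2 (fun om => eta n om * D om)%R < +oo)%E.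
  rewrite inc2// lte_mul_pinfty// lee_fin mulr_ge0 ?fine_ge0 ?subr_ge0 ?(ltW nSn)//.
  by rewrite integral_ge0// => x _; rewrite lee_fin sqr_ge0.
have [iD D0] := wiener_increment_mean i tn nSn SnT.
have iSe : P.-integrable setT (fun om => (S om * eta n om)%:E).
  exact: n2_integrableM.
have mSe : measurable_for (F (sg n)) (fun om => S om * eta n om).
  by apply: measurable_forM => //; exact: sigma_algebra_filt.
have [iSeD SeD0] := indep_integralM (wiener_indep2 i tn nSn SnT mSe) iSe iD.
(* The cross term vanishes: the partial sum times the next coefficient is measurable for the past,
   and the increment is independent of the past and centred. *)
rewrite D0 mulr0 in SeD0.
have SeD0' : (\int[P]_om (S om * eta n om * D om)%:E = 0)%E.
  by rewrite -(fineK (integrable_fin_num measurableT iSeD)); congr EFin.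
rewrite [in RHS]big_ord_recr/= ge0_muleDr; last 2 first.
- apply: sume_ge0 => q _; rewrite mule_ge0 ?n2_ge0// lee_fin subr_ge0 ltW// sg_lt//.
  exact: leq_trans (ltn_ord q) (leqnSn n).
- by rewrite mule_ge0 ?n2_ge0// lee_fin subr_ge0 ltW.
rewrite -ES muleA -EFinM -inc2//.
transitivity (\int[P]_om (((S om) ^+ 2)%:E +
   ((eta n om * D om) ^+ 2 + 2 * (S om * eta n om * D om))%:E))%E.
  apply: eq_integral => om _; rewrite big_ord_recr/= -EFinD -/(S om) -/(D om); congr EFin; ring.
have i1 := n2_integrable_sqr measurableT mS' S2.
have i2 := n2_integrable_sqr measurableT mED ED2.
have i3 : P.-integrable setT (fun om => (2 * (S om * eta n om * D om))%:E).
  by under eq_fun do rewrite EFinM; exact: integrableZl.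
rewrite integralD//; last first.
  by under eq_fun do rewrite EFinD; exact: integrableD.
congr (_ + _)%E; under eq_integral do rewrite EFinD.
rewrite integralD//; under [X in (_ + X)%E]eq_integral do rewrite EFinM.
by rewrite integralZl// SeD0' mule0 adde0.
Qed.

End integrators.

Section sorted_telescope.
Context (R : realType) (s : seq R) (x0 : R) (ss : sorted <%O s).
Local Notation sg := (nth x0 s).
Local Notation n := (size s).-1.

Lemma sorted_grid_lt q : (q < n)%N -> sg q < sg q.+1.
Proof.
move=> qn; have sn : (q.+1 < size s)%N by move: qn; case: (size s).
by rewrite lt_sorted_ltn_nth// inE ltnW.
Qed.

Lemma sorted_grid_mem x : x \in s -> (index x s <= n)%N.
Proof. by rewrite -index_mem; case: (size s). Qed.

(** No point of the grid lies strictly inside a cell, so an interval with end points in the grid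
    contains a cell or misses it. *)
Lemma sorted_grid_cell x q u : x \in s -> (q < n)%N -> sg q <= u < sg q.+1 ->
  (x <= u) = (x <= sg q).
Proof.
move=> xs qn /andP[qu uq].
have sn : (q.+1 < size s)%N by move: qn; case: (size s).
apply/idP/idP => [xu|/le_trans]; last exact.
rewrite -(nth_index x0 xs) lt_sorted_leq_nth ?inE ?index_mem//; last exact: ltnW.
have := le_lt_trans xu uq.
by rewrite -{1}(nth_index x0 xs) lt_sorted_ltn_nth ?inE ?index_mem.
Qed.

Lemma sorted_grid_indic x y q u : x \in s -> y \in s -> (q < n)%N -> sg q <= u < sg q.+1 ->
  \1_(`[x, y[) u = \1_(`[x, y[) (sg q) :> R.
Proof.
move=> xs ys qn uq; rewrite !indicE; congr (_%:R); rewrite !mem_setE !in_itv/=.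
by rewrite (sorted_grid_cell xs qn uq) !ltNge (sorted_grid_cell ys qn uq).
Qed.

(** The indicator selects the consecutive cells from [x] to [y], whose increments telescope. *)
Lemma sorted_grid_telescope (G : R -> R) x y : x \in s -> y \in s -> x <= y ->
  \sum_(q < n) \1_(`[x, y[) (sg q) * (G (sg q.+1) - G (sg q)) = G y - G x.
Proof.
move=> xs ys xy.
have ix := sorted_grid_mem xs; have iy := sorted_grid_mem ys.
have ixy : (index x s <= index y s)%N.
  by rewrite -(lt_sorted_leq_nth x0 ss) ?inE ?index_mem// !nth_index.
rewrite -(big_mkord xpredT (fun q => \1_(`[x, y[) (sg q) * (G (sg q.+1) - G (sg q)))).
rewrite (@big_cat_nat _ _ _ (index x s))//= big1_seq ?add0r; last first.
  move=> q; rewrite mem_index_iota => /andP[_ /andP[_ qx]].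
  have qs : (q < size s)%N by rewrite (ltn_trans qx)// index_mem.
  rewrite indicE mem_setE in_itv/= -{1}(nth_index x0 xs).
  by rewrite lt_sorted_leq_nth ?inE ?index_mem// leqNgt qx/= mul0r.
rewrite (@big_cat_nat _ _ _ (index y s))//= [X in _ + X]big1_seq ?addr0; last first.
  move=> q; rewrite mem_index_iota => /andP[_ /andP[yq qn]].
  have qs : (q < size s)%N by rewrite (leq_trans qn)// leq_pred.
  rewrite indicE mem_setE in_itv/= -{1}(nth_index x0 ys).
  by rewrite lt_sorted_ltn_nth ?inE ?index_mem// ltnNge yq/= andbF mul0r.
have -> : G y - G x = G (sg (index y s)) - G (sg (index x s)) by rewrite !nth_index.
rewrite -(telescope_sumr (fun q => G (sg q)))//.
apply: eq_big_seq => q; rewrite mem_index_iota => /andP[xq qy].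
have qs : (q < size s)%N by rewrite (ltn_trans qy)// index_mem.
rewrite indicE mem_setE in_itv/= -{1}(nth_index x0 xs) -{1}(nth_index x0 ys).
by rewrite lt_sorted_leq_nth ?lt_sorted_ltn_nth ?inE ?index_mem// xq qy mul1r.
Qed.

End sorted_telescope.

Section product_n2.
Context d (Omega : measurableType d) (R : realType) (P : probability Omega R).

Lemma n2_product (a b : R) (X : R -> Omega -> R) :
  measurable_fun (`[a, b]%classic `*` [set: Omega]) (fun z : measurableTypeR R * Omega => X z.1 z.2) ->
  n2 (lebesgue_measure \x P)%E (`[a, b] `*` [set: Omega]) (fun z => X z.1 z.2) =
  (\int[lebesgue_measure]_(u in `[a, b]) n2 P setT (X u))%E.
Proof.
move=> mX.
have mD : measurable (`[a, b]%classic `*` [set: Omega] : set (measurableTypeR R * Omega)).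
  by apply: measurableX => //; exact: measurable_itv.
rewrite integral_mkcond fubini_tonelli1; last 2 first.
- apply/(measurable_restrictT _ mD)/measurable_EFinP; exact: measurable_funX.
- by move=> z; rewrite patchE; case: ifP => // _; rewrite lee_fin sqr_ge0.
rewrite [RHS]integral_mkcond; apply: eq_integral => u _.
rewrite /fubini_F patchE; have [uD|uD] := boolP (u \in `[a, b]%classic).
  apply: eq_integral => om _; rewrite patchE ifT// inE; split => //=.
  by rewrite inE in uD.
rewrite integral0_eq// => om _; rewrite patchE ifF//.
by apply: contraNF uD; rewrite !inE => -[].
Qed.

End product_n2.

(** * Adapted step families and uniqueness of the Ito integral *)

Section adapted_families.
Context d (Omega : measurableType d) (R : realType) (P : probability Omega R) (t T : R).
Context (F : R -> set_system Omega).
Hypotheses (t0 : 0 <= t) (tT : t < T) (hF : is_filtration T F).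
Local Notation E2 X := (n2 P setT X).
Local Notation leb := (@lebesgue_measure R).

(** A step process whose intervals may overlap, come in any order or be empty. Sums and differences
    are thus disjoint unions of index types, with no common refinement to build. *)
Definition adapted_family (I : finType) (a b : I -> R) (xi : I -> Omega -> R) :=
  forall i, [/\ t <= a i, a i <= b i, b i <= T, measurable_for (F (a i)) (xi i) &
    (E2 (xi i) < +oo)%E].

Definition family_value (I : finType) (a b : I -> R) (xi : I -> Omega -> R) u om :=
  \sum_i xi i om * \1_(`[a i, b i[) u.

Definition family_integral (W : R -> Omega -> R) (I : finType) (a b : I -> R)
    (xi : I -> Omega -> R) om :=
  \sum_i xi i om * (W (b i) om - W (a i) om).

Lemma adapted_family_measurable (I : finType) (a b : I -> R) (xi : I -> Omega -> R) i :
  adapted_family a b xi -> measurable_fun setT (xi i).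
Proof.
move=> /(_ i)[ta ab bT mxi _]; apply: (measurable_for_fun t0 hF _ mxi).
by rewrite ta (le_trans ab).
Qed.

Lemma measurable_family_value (I : finType) (a b : I -> R) (xi : I -> Omega -> R) :
  adapted_family a b xi ->
  measurable_fun setT (fun z : measurableTypeR R * Omega => family_value a b xi z.1 z.2).
Proof.
move=> axi; apply: measurable_sum => i; apply: measurable_funM.
  by apply: (measurableT_comp (f := xi i)) => //; exact: adapted_family_measurable axi.
by apply: (measurableT_comp (f := (\1_(`[a i, b i[) : R -> R))).
Qed.

Lemma measurable_family_value_n2 (I : finType) (a b : I -> R) (xi : I -> Omega -> R) :
  adapted_family a b xi ->
  measurable_fun setT (fun u : measurableTypeR R => E2 (family_value a b xi u)).
Proof.
move=> axi.
apply: (measurable_fun_fubini_tonelli_F (m2 := P)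
  (fun z : measurableTypeR R * Omega => ((family_value a b xi z.1 z.2) ^+ 2)%:E)).
  by apply: measurable_sqr_EFin; exact: measurable_family_value.
by move=> z; rewrite lee_fin sqr_ge0.
Qed.

(** All end points are merged into one sorted grid. The value of the family is constant on its
    cells, so the right side of the inequality for this grid is at most the integral over time. *)
Lemma family_bound C W (I : finType) (a b : I -> R) (xi : I -> Omega -> R) :
  0 <= C -> ito_isometric P t T F C W -> adapted_family a b xi ->
  (E2 (family_integral W a b xi) <=
   C%:E * \int[leb]_(u in `[t, T]) E2 (family_value a b xi u))%E.
Proof.
move=> C0 [mW W2 isoW] axi.
pose s0 := undup (codom a ++ codom b).
pose s := sort <=%O s0.
have ss : sorted <%O s by rewrite sort_lt_sorted undup_uniq.
have as_ i : a i \in s by rewrite mem_sort mem_undup mem_cat codom_f.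
have bs_ i : b i \in s by rewrite mem_sort mem_undup mem_cat codom_f orbT.
have s_in x : x \in s -> t <= x <= T.
  rewrite mem_sort mem_undup mem_cat => /orP[] /codomP[i ->];
    have [ta ab bT _ _] := axi i; first by rewrite ta (le_trans ab).
  by rewrite bT (le_trans ta).
(* The default [T] keeps [sg q] inside [[t, T]] also beyond the end of the list. *)
pose sg := nth T s; pose n := (size s).-1.
have sg_in q : t <= sg q <= T.
  have [qs|qs] := ltnP q (size s); first by apply: s_in; exact: mem_nth.
  by rewrite /sg nth_default// lexx ltW.
have sg_lt q : (q < n)%N -> sg q < sg q.+1 by exact: sorted_grid_lt.
have sF q := sigma_algebra_filt t0 hF (sg_in q).
pose eta q om := family_value a b xi (sg q) om.
have meta q : measurable_for (F (sg q)) (eta q) /\ (E2 (eta q) < +oo)%E.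
  split.
    apply: measurable_for_sum => [|i _]; first exact: sF.
    have [ta ab bT mxi _] := axi i.
    rewrite indicE mem_setE in_itv/=; have [aq|aq] := leP (a i) (sg q); last first.
      by under eq_fun do rewrite mulr0; apply: measurable_for_cst; exact: sF.
    apply: measurable_forM; first exact: sF.
      by apply: (measurable_for_le t0 hF ta aq) => //; case/andP: (sg_in q).
    by apply: measurable_for_cst; exact: sF.
  apply: le_lt_trans (n2_sum _ measurableT _) _.
    by move=> i; apply: measurable_funM => //; exact: adapted_family_measurable axi.
  rewrite lte_mul_pinfty ?lee_fin//; apply: lte_sum_pinfty => i _.
  under eq_integral do rewrite mulrC.
  rewrite n2Z//; last exact: adapted_family_measurable axi.
  by rewrite lte_mul_pinfty ?lee_fin ?sqr_ge0//; have [] := axi i.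
have -> : family_integral W a b xi =
    (fun om => \sum_(q < n) eta q om * (W (sg q.+1) om - W (sg q) om)).
  apply/funext => om; rewrite /eta /family_value.
  under [RHS]eq_bigr do rewrite mulr_suml.
  rewrite exchange_big/=; apply: eq_bigr => i _.
  have [ta ab bT mxi _] := axi i.
  rewrite -(sorted_grid_telescope T ss (fun x => W x om) (as_ i) (bs_ i) ab) mulr_sumr.
  by apply: eq_bigr => q _; rewrite mulrA.
apply: le_trans (isoW n sg eta (fun q _ => sg_in q) sg_lt (fun q _ => meta q)) _.
apply: lee_wpmul2l; first by rewrite lee_fin.
have cell_in (q : 'I_n) : `[sg q, sg q.+1[ `<=` `[t, T]%classic.
  move=> u /=; rewrite !in_itv/= => /andP[qu uq].
  have /andP[tq _] := sg_in q; have /andP[_ qT] := sg_in q.+1.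
  by rewrite (le_trans tq qu) (le_trans (ltW uq) qT).
have -> : (\sum_(q < n) ((sg q.+1 - sg q)%:E * E2 (eta q)) =
  \int[leb]_(u in `[t, T]) \sum_(q < n) ((\1_(`[sg q, sg q.+1[) u)%:E * E2 (eta q)))%E.
  rewrite ge0_integral_sum//; last 2 first.
  - move=> q; apply: emeasurable_funM => //.
    by apply/measurable_EFinP; apply: measurable_indic; exact: measurable_itv.
  - by move=> q u _; rewrite mule_ge0 ?n2_ge0.
  apply: eq_bigr => q _.
  rewrite ge0_integralZr ?n2_ge0//; last first.
    by apply/measurable_EFinP; apply: measurable_indic; exact: measurable_itv.
  rewrite integral_indic; [|exact: measurable_itv|exact: measurable_itv].
  rewrite setIidl; last exact: cell_in.
  by congr (_ * _)%E; rewrite -[RHS]/(leb _) lebesgue_measure_itv/= lte_fin sg_lt.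
apply: ge0_le_integral.
- exact: measurable_itv.
- by move=> u _; apply: sume_ge0 => q _; rewrite mule_ge0 ?n2_ge0.
- apply: emeasurable_sum => q; apply: emeasurable_funM => //.
  by apply/measurable_EFinP; apply: measurable_indic; exact: measurable_itv.
- by apply: measurable_funTS; exact: measurable_family_value_n2.
move=> u _.
(* At a given time at most one cell contributes, with the value of the family there; off all cells
   the left side is zero. *)
have [/existsP[/= q uq]|/existsPn nou] := boolP [exists q : 'I_n, sg q <= u < sg q.+1]; last first.
  rewrite big1 ?n2_ge0// => q _; rewrite indicE mem_setE in_itv/=.
  by rewrite (negbTE (nou q)) mul0e.
rewrite (bigD1 q)//= big1 ?adde0; last first.
  move=> p pq; rewrite indicE mem_setE in_itv/=.
  have [up|_] := boolP (sg p <= u < sg p.+1); last by rewrite mul0e.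
  exfalso; move/eqP: pq; apply; apply/val_inj/eqP; rewrite eqn_leq; apply/andP.
  have ps (j : 'I_n) : (j.+1 < size s)%N.
    by case: j => j /=; rewrite /n; case: (size s).
  move: up uq => /andP[pu up] /andP[qu uq]; split.
    have := le_lt_trans pu uq.
    by rewrite lt_sorted_ltn_nth ?inE// ?ps// ltnW// ps.
  have := le_lt_trans qu up.
  by rewrite lt_sorted_ltn_nth ?inE// ?ps// ltnW// ps.
rewrite indicE mem_setE in_itv/= uq mul1e.
rewrite /eta (_ : family_value a b xi u = family_value a b xi (sg q))//.
apply/funext => om; apply: eq_bigr => i _; congr (_ * _).
exact: (sorted_grid_indic (x0 := T) ss (as_ i) (bs_ i) (ltn_ord q) uq).
Qed.

Lemma adapted_family_sub (I J : finType) (a b : I -> R) (xi : I -> Omega -> R)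
    (a' b' : J -> R) (xi' : J -> Omega -> R) :
  adapted_family a b xi -> adapted_family a' b' xi' ->
  exists (K : finType) (a2 b2 : K -> R) (xi2 : K -> Omega -> R),
    [/\ adapted_family a2 b2 xi2,
      forall u om, family_value a2 b2 xi2 u om = family_value a b xi u om - family_value a' b' xi' u om &
      forall W om, family_integral W a2 b2 xi2 om =
        family_integral W a b xi om - family_integral W a' b' xi' om].
Proof.
move=> axi axi'.
exists (I + J)%type, (fun k => match k with inl i => a i | inr j => a' j end),
  (fun k => match k with inl i => b i | inr j => b' j end),
  (fun k => match k with inl i => xi i | inr j => fun om => - xi' j om end); split.
- move=> [i|j]; first exact: axi.
  have [ta ab bT mxi xi2] := axi' j; split => //; last by under eq_integral do rewrite sqrrN.
  have haT : t <= a' j <= T by rewrite ta (le_trans ab).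
  have sF := sigma_algebra_filt t0 hF haT.
  have -> : (fun om => - xi' j om) = (fun om => 0 - xi' j om).
    by apply/funext => om; rewrite sub0r.
  by apply: measurable_forB => //; exact: measurable_for_cst.
- move=> u om; rewrite /family_value big_sumType/=; congr (_ + _).
  by rewrite -sumrN; apply: eq_bigr => j _; rewrite mulNr.
- move=> W om; rewrite /family_integral big_sumType/=; congr (_ + _).
  by rewrite -sumrN; apply: eq_bigr => j _; rewrite mulNr.
Qed.

Lemma measurable_family_integral C W (I : finType) (a b : I -> R) (xi : I -> Omega -> R) :
  ito_isometric P t T F C W -> adapted_family a b xi ->
  measurable_fun setT (family_integral W a b xi).
Proof.
move=> [mW _ _] axi; apply: measurable_sum => i.
have [ta ab bT mxi _] := axi i.
have ha : t <= a i <= T by rewrite ta (le_trans ab).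
have hb : t <= b i <= T by rewrite bT (le_trans ta).
apply: measurable_funM; first exact: adapted_family_measurable axi.
by apply: measurable_funB; [apply: (measurable_for_fun t0 hF hb)|apply: (measurable_for_fun t0 hF ha)]; exact: mW.
Qed.

Lemma adapted_step_grid a b (X : step_process Omega R) q : adapted_step P F a b X ->
  (q < step_size X)%N -> a <= step_grid X q /\ step_grid X q.+1 <= b.
Proof.
move=> [X0 Xn Xlt Xcoef] qs.
have mono p r : (p <= r)%N -> (r <= step_size X)%N -> step_grid X p <= step_grid X r.
  elim: r => [|r IH]; first by rewrite leqn0 => /eqP ->.
  rewrite leq_eqVlt => /orP[/eqP ->//|]; rewrite ltnS => pr rs.
  by rewrite (le_trans (IH pr (ltnW rs)))// ltW// Xlt.
by rewrite -X0 -Xn; split; apply: mono => //; exact: ltnW.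
Qed.

Lemma adapted_step_family a b (X : step_process Omega R) : t <= a -> b <= T ->
  adapted_step P F a b X ->
  adapted_family (fun q : 'I_(step_size X) => step_grid X q) (fun q => step_grid X q.+1)
    (fun q => step_coef X q).
Proof.
move=> ta bT aX q; have [aq qb] := adapted_step_grid aX (ltn_ord q).
have [_ _ Xlt Xcoef] := aX.
have [mX [mX' X2]] := Xcoef q (ltn_ord q); split => //.
- exact: le_trans aq.
- exact/ltW/Xlt.
- exact: le_trans bT.
Qed.

Lemma measurable_cut_process (a b : R) (xi : R -> Omega -> R) :
  measurable_fun (`[a, b]%classic `*` [set: Omega]) (fun z : measurableTypeR R * Omega => xi z.1 z.2) ->
  measurable_fun setT (fun z : measurableTypeR R * Omega => \1_(`[a, b]) z.1 * xi z.1 z.2).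
Proof.
move=> mxi.
have mD : measurable (`[a, b]%classic `*` [set: Omega] : set (measurableTypeR R * Omega)).
  by apply: measurableX => //; exact: measurable_itv.
have /(measurable_restrictT _ mD) := mxi.
apply: eq_measurable_fun => -[u om] _; rewrite patchE indicE/=.
case: ifPn; first by rewrite inE => -[/= uab _]; rewrite mem_set// mul1r.
by move=> h; rewrite memNset ?mul0r// => uab; move: h; rewrite notin_setE; apply; split.
Qed.

Lemma measurable_process_fix (Y : R -> Omega -> R) u :
  measurable_fun setT (fun z : measurableTypeR R * Omega => Y z.1 z.2) -> measurable_fun setT (Y u).
Proof.
move=> mY; have mu_ : measurable_fun setT (fun om : Omega => (u, om) : measurableTypeR R * Omega).
  exact: measurable_fun_pair.
exact: (measurableT_comp mY mu_).
Qed.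

Lemma measurable_process_n2 (Y : R -> Omega -> R) :
  measurable_fun setT (fun z : measurableTypeR R * Omega => Y z.1 z.2) ->
  measurable_fun setT (fun u : measurableTypeR R => E2 (Y u)).
Proof.
move=> mY; apply: (measurable_fun_fubini_tonelli_F (m2 := P)
  (fun z : measurableTypeR R * Omega => ((Y z.1 z.2) ^+ 2)%:E)).
  exact: measurable_sqr_EFin.
by move=> z; rewrite lee_fin sqr_ge0.
Qed.

(** The definition provides one sequence of step processes. By [family_bound], applied to
    differences, every other sequence of adapted families that approximates the integrand has
    integrals with the same limit. The families live on [[t, T]], hence the cut-off of [xi] to
    [[a, b]]. *)
Lemma ito_limit C W a b xi Z (I : nat -> finType) (a_ b_ : forall n, I n -> R)
    (xi_ : forall n, I n -> Omega -> R) :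
  0 <= C -> ito_isometric P t T F C W -> t <= a -> b <= T ->
  is_ito_integral P F W a b xi Z ->
  (forall n, adapted_family (a_ n) (b_ n) (xi_ n)) ->
  (fun n => \int[leb]_(u in `[t, T])
    E2 (fun om => (family_value (a_ n) (b_ n) (xi_ n) u om - \1_(`[a, b]) u * xi u om)%R))%E @ \oo --> 0%E ->
  (fun n => E2 (fun om => (family_integral W (a_ n) (b_ n) (xi_ n) om - Z om)%R)) @ \oo --> 0%E.
Proof.
move=> C0 isoW ta bT [[[mxi xi2] axi] [X [aX cX [mI mZ cI]]]] afam cfam.
have aS n := adapted_step_family ta bT (aX n).
pose v n u om := family_value (a_ n) (b_ n) (xi_ n) u om.
pose sv n u om := family_value (fun q : 'I_(step_size (X n)) => step_grid (X n) q)
  (fun q => step_grid (X n) q.+1) (fun q => step_coef (X n) q) u om.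
pose x1 u om := \1_(`[a, b]) u * xi u om.
have mx1 : measurable_fun setT (fun z : measurableTypeR R * Omega => x1 z.1 z.2).
  exact: measurable_cut_process mxi.
have mv n : measurable_fun setT (fun z : measurableTypeR R * Omega => v n z.1 z.2).
  exact: measurable_family_value (afam n).
have msv n : measurable_fun setT (fun z : measurableTypeR R * Omega => sv n z.1 z.2).
  exact: measurable_family_value (aS n).
have fix_ := measurable_process_fix; have mn2 := measurable_process_n2.
have msub (Y Z' : R -> Omega -> R) :
    measurable_fun setT (fun z : measurableTypeR R * Omega => Y z.1 z.2) ->
    measurable_fun setT (fun z : measurableTypeR R * Omega => Z' z.1 z.2) ->
    measurable_fun setT (fun z : measurableTypeR R * Omega => Y z.1 z.2 - Z' z.1 z.2).
  exact: measurable_funB.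
(* The step processes of the definition vanish outside [[a, b]], so they approximate the cut-off
   process on the whole of [[t, T]]. *)
have csv : (fun n => \int[leb]_(u in `[t, T]) E2 (fun om => (x1 u om - sv n u om)%R))%E @ \oo --> 0%E.
  apply: cvg0_le cX.
  - by move=> n; apply: integral_ge0 => u _; exact: n2_ge0.
  - apply: nearW => n; rewrite (@n2_product _ _ _ _ a b (fun u om => step_value (X n) u om - xi u om)).
    rewrite integral_mkcond [leRHS]integral_mkcond le_eqVlt; apply/orP; left; apply/eqP.
    apply: eq_integral => u _; rewrite !patchE.
    have [uab|uab] := boolP (u \in `[a, b]%classic).
      move: (uab); rewrite inE/= in_itv/= => /andP[au ub].
      rewrite ifT; last by rewrite inE/= in_itv/= (le_trans ta au) (le_trans ub bT).
      by rewrite n2_sym; apply: eq_integral => om _; rewrite /x1 indicE uab mul1r.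
    case: ifPn => // _; apply: integral0_eq => om _.
    rewrite /x1 indicE (negbTE uab) mul0r sub0r sqrrN /sv /family_value big1 ?expr0n// => q _.
    have [aq qb] := adapted_step_grid (aX n) (ltn_ord q).
    rewrite indicE; case: (boolP (u \in _)); last by rewrite mulr0.
    rewrite inE/= in_itv/= => /andP[qu uq]; exfalso; move/negP: uab; apply.
    by rewrite inE/= in_itv/= (le_trans aq qu) (le_trans (ltW uq) qb).
  by apply: measurable_funB => //; apply: measurable_funTS; exact: msv.
have mfI n : measurable_fun setT (family_integral W (a_ n) (b_ n) (xi_ n)).
  exact: measurable_family_integral isoW (afam n).
pose Q n : \bar R := (\int[leb]_(u in `[t, T]) E2 (fun om => (v n u om - x1 u om)%R))%E.
pose Q' n : \bar R := (\int[leb]_(u in `[t, T]) E2 (fun om => (x1 u om - sv n u om)%R))%E.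
apply: (@cvg0_le _ _ _ _ _ (fun n => 2%:E * (C%:E * (2%:E * Q n + 2%:E * Q' n)) +
   2%:E * E2 (fun om => (step_integral (X n) W om - Z om)%R))%E).
- by move=> n; exact: n2_ge0.
- apply: nearW => n.
  apply: le_trans (n2_triangle _ measurableT (g := step_integral (X n) W) _ _ _) _ => //.
  rewrite leeD2r// lee_wpmul2l// ?lee_fin//.
  have [K [aK [bK [xK [fK vK iK]]]]] := adapted_family_sub (afam n) (aS n).
  under eq_integral => om _ do rewrite -[step_integral (X n) W om]/(family_integral W
    (fun q : 'I_(step_size (X n)) => step_grid (X n) q) (fun q => step_grid (X n) q.+1)
    (fun q => step_coef (X n) q) om) -iK.
  apply: le_trans (family_bound C0 isoW fK) _.
  rewrite lee_wpmul2l ?lee_fin//.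
  under eq_integral => u _ do under eq_integral => om _ do rewrite vK.
  rewrite -!ge0_integralZl_EFin//; last 4 first.
  - by move=> u _; exact: n2_ge0.
  - by apply: measurable_funTS; apply: (mn2 (fun u om => x1 u om - sv n u om)); exact: msub.
  - by move=> u _; exact: n2_ge0.
  - by apply: measurable_funTS; apply: (mn2 (fun u om => v n u om - x1 u om)); exact: msub.
  rewrite -ge0_integralD//; last 4 first.
  - by move=> u _; rewrite mule_ge0 ?n2_ge0.
  - by apply: measurable_funeM; apply: measurable_funTS; apply: (mn2 (fun u om => v n u om - x1 u om)); exact: msub.
  - by move=> u _; rewrite mule_ge0 ?n2_ge0.
  - by apply: measurable_funeM; apply: measurable_funTS; apply: (mn2 (fun u om => x1 u om - sv n u om)); exact: msub.
  apply: ge0_le_integral => //.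
  - by move=> u _; exact: n2_ge0.
  - by apply: measurable_funTS; apply: (mn2 (fun u om => v n u om - sv n u om)); exact: msub.
  - apply: emeasurable_funD; apply: measurable_funeM; apply: measurable_funTS.
      by apply: (mn2 (fun u om => v n u om - x1 u om)); exact: msub.
    by apply: (mn2 (fun u om => x1 u om - sv n u om)); exact: msub.
  - move=> u _; apply: n2_triangle => //.
    + exact: fix_ (mv n).
    + exact: fix_ mx1.
    + exact: fix_ (msv n).
- have cQ : Q @ \oo --> 0%E by exact: cfam.
  have cQ' : Q' @ \oo --> 0%E by exact: csv.
  exact: cvg0D (cvg0Z _ (cvg0Z _ (cvg0D (cvg0Z _ cQ) (cvg0Z _ cQ')))) (cvg0Z _ cI).
Qed.

End adapted_families.

(** * Lebesgue measure on tuples *)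

Section tuple_measure.
Context (R : realType).
Local Notation MR := (measurableTypeR R).
Local Notation leb := (@lebesgue_measure R).

Definition tuple_box k (A : 'I_k -> set R) : set (k.-tuple MR) :=
  [set x | forall l, A l (tnth x l)].

Lemma measurable_tuple_box k (A : 'I_k -> set R) :
  (forall l, measurable (A l)) -> measurable (tuple_box A).
Proof.
move=> mA; have -> : tuple_box A = \bigcap_(l in [set: 'I_k]) ((fun x => tnth x l) @^-1` A l).
  by apply/seteqP; split=> x h l; [move=> _; exact: h|exact: h].
apply: fin_bigcap_measurable => // l _.
by have := @measurable_tnth _ MR k l measurableT (A l) (mA l); rewrite setTI.
Qed.

Lemma tuple_box_lebesgue k (A : 'I_k -> set R) : (forall l, measurable (A l)) ->
  lebesgue_tuple R k (tuple_box A) = (\prod_(l < k) leb (A l))%E.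
Proof.
elim: k A => [|k IH] A mA.
  rewrite big_ord0 /= diracE mem_set//= => -[] //.
transitivity ((lebesgue_tuple R k \x leb)%E (@tuple_cons R k @^-1` tuple_box A)); first by [].
have -> : @tuple_cons R k @^-1` tuple_box A =
    tuple_box (fun l => A (lift ord0 l)) `*` A ord0.
  apply/seteqP; split=> -[x y]/=.
    move=> h; split; last by have := h ord0.
    by move=> l; have := h (lift ord0 l); rewrite /tuple_cons/= tnthS.
  move=> [h hy] l; have [->|[j ->]] : l = ord0 \/ exists j, l = lift ord0 j.
    by case: (unliftP ord0 l) => [j ->|->]; [right; exists j|left].
  + by [].
  + by rewrite /tuple_cons/= tnthS; exact: h.
rewrite product_measure1E; [|exact: measurable_tuple_box|exact: mA].
by rewrite IH// big_ord_recl muleC.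
Qed.

(** Boxes form a generating pi-system and bounded ones exhaust the space. This yields invariance
    under permutations of the coordinates and the product form with the last coordinate split
    off. *)
Lemma lebesgue_tuple_unique k (nu : {measure set (k.-tuple MR) -> \bar R}) :
  (forall A : 'I_k -> set R, (forall l, measurable (A l)) ->
    nu (tuple_box A) = (\prod_(l < k) leb (A l))%E) ->
  forall B, measurable B -> lebesgue_tuple R k B = nu B.
Proof.
move=> nuE B mB.
pose G := [set S | exists2 A : 'I_k -> set R, (forall l, measurable (A l)) & S = tuple_box A].
apply: (measure_unique G (fun n => tuple_box (fun _ => `[- n%:R, n%:R]%classic))) => //.
- apply/seteqP; split => S.
    apply: smallest_sub; first exact: smallest_sigma_algebra.
    rewrite -bigcup_seq => _ [l /= _ [Y mY <-]]; apply: sub_sigma_algebra.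
    exists (fun j => if j == l then Y else setT); first by move=> j; case: ifP.
    apply/seteqP; split => x /=.
      by move=> [_ Yx] j; case: eqP => [->|].
    by move=> h; split => //; have := h l; rewrite eqxx.
  apply: smallest_sub; first exact: sigma_algebra_measurable.
  by move=> _ [A mA ->]; exact: measurable_tuple_box.
- move=> _ _ [A mA ->] [A' mA' ->]; exists (fun l => A l `&` A' l).
    by move=> l; exact: measurableI.
  by apply/seteqP; split=> x; [move=> [h h'] l; split; [exact: h|exact: h']|move=> h; split=> l; case: (h l)].
- by move=> n; exists (fun _ => `[- n%:R, n%:R]%classic) => // l; exact: measurable_itv.
- apply/seteqP; split => // x _.
  have [n nP] : exists n : nat, forall l, `|tnth x l| <= n%:R.
    pose M := \sum_(l < k) `|tnth x l|.
    exists (Num.truncn M).+1 => l; apply: ltW.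
    apply: le_lt_trans (truncnS_gt M).
    by rewrite /M (bigD1 l)//= lerDl sumr_ge0.
  by exists n => // l /=; rewrite in_itv/= -ler_norml.
- by move=> _ [A mA ->]; rewrite tuple_box_lebesgue// nuE.
- move=> n; rewrite [X in (X < _)%E]tuple_box_lebesgue; last by move=> l; exact: measurable_itv.
  rewrite -ge0_fin_numE; last by apply: prode_ge0.
  apply: prode_fin_num => l _; rewrite lebesgue_measure_itv/=; by case: ifP.
Qed.

(** A name for [lebesgue_tuple] that carries the sigma-finite structure required by Tonelli's
    theorem. *)
Definition tuple_measure k : set (k.-tuple MR) -> \bar R := lebesgue_tuple R k.

HB.instance Definition _ k := Measure.copy (@tuple_measure k) (lebesgue_tuple R k).

Lemma tuple_measure_sigma_finite k : sigma_finite setT (@tuple_measure k).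
Proof.
exists (fun n => tuple_box (fun _ => `[- n%:R, n%:R]%classic)).
  apply/esym/seteqP; split => // x _.
  have [n nP] : exists n : nat, forall l, `|tnth x l| <= n%:R.
    pose M := \sum_(l < k) `|tnth x l|.
    exists (Num.truncn M).+1 => l; apply: ltW.
    apply: le_lt_trans (truncnS_gt M).
    by rewrite /M (bigD1 l)//= lerDl sumr_ge0.
  by exists n => // l /=; rewrite in_itv/= -ler_norml.
move=> n; split; first by apply: measurable_tuple_box => l; exact: measurable_itv.
rewrite /tuple_measure tuple_box_lebesgue; last by move=> l; exact: measurable_itv.
rewrite -ge0_fin_numE; last by apply: prode_ge0.
apply: prode_fin_num => l _; rewrite lebesgue_measure_itv/=; by case: ifP.
Qed.

HB.instance Definition _ k := Measure_isSigmaFinite.Build _ _ _ (@tuple_measure k)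
  (@tuple_measure_sigma_finite k).

Definition tuple_rcons k (z : MR * k.-tuple MR) : k.+1.-tuple MR := [tuple of rcons z.2 z.1].

Lemma tnth_rcons_widen k (u : R) (x : k.-tuple R) (i : 'I_k) :
  tnth [tuple of rcons x u] (widen_ord (leqnSn k) i) = tnth x i.
Proof.
by rewrite (tnth_nth u) (tnth_nth u)/= nth_rcons size_tuple ltn_ord.
Qed.

Lemma tnth_rcons_max k (u : R) (x : k.-tuple R) : tnth [tuple of rcons x u] ord_max = u.
Proof. by rewrite (tnth_nth u)/= nth_rcons size_tuple ltnn eqxx. Qed.

Lemma ord_max_or_widen k (l : 'I_k.+1) :
  l = ord_max \/ exists i : 'I_k, l = widen_ord (leqnSn k) i.
Proof.
have [lk|kl] := ltnP l k; last first.
  by left; apply/val_inj/eqP; rewrite eqn_leq/= kl andbT -ltnS.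
by right; exists (Ordinal lk); exact/val_inj.
Qed.

Lemma measurable_tuple_rcons k : measurable_fun setT (@tuple_rcons k).
Proof.
apply/measurable_fun_tnthP => l; have [->|[i ->]] := ord_max_or_widen l.
  rewrite (_ : _ \o _ = fst)//; apply/funext => -[u x].
  by rewrite /tuple_rcons/= tnth_rcons_max.
rewrite (_ : _ \o _ = (fun x => tnth x i) \o snd).
  exact: (measurableT_comp (@measurable_tnth _ MR k i)).
by apply/funext => -[u x]; rewrite /tuple_rcons/= tnth_rcons_widen.
Qed.

(** [lebesgue_tuple] adds new coordinates in front, whereas an iterated integral is peeled from its
    last and outermost variable; the two orders agree on boxes. *)
Lemma ge0_integral_tuple_rcons k (f : k.+1.-tuple MR -> \bar R) :
  measurable_fun setT f -> (forall x, (0 <= f x)%E) ->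
  (\int[lebesgue_tuple R k.+1]_x f x =
   \int[leb]_u \int[lebesgue_tuple R k]_x f [tuple of rcons x u])%E.
Proof.
move=> mf f0.
pose nu := measure_function_pushforward__canonical__measure_function_Measure
  (leb \x @tuple_measure k)%E (@measurable_tuple_rcons k).
rewrite (eq_measure_integral nu); last first.
  move=> B mB _; apply: lebesgue_tuple_unique => // A mA.
  transitivity ((leb \x @tuple_measure k)%E (@tuple_rcons k @^-1` tuple_box A)); first by [].
  have -> : @tuple_rcons k @^-1` tuple_box A =
      A ord_max `*` tuple_box (fun i => A (widen_ord (leqnSn k) i)).
    apply/seteqP; split => -[u x]/=.
      move=> h; split; first by have := h ord_max; rewrite /tuple_rcons/= tnth_rcons_max.
      by move=> i; have := h (widen_ord (leqnSn k) i); rewrite /tuple_rcons/= tnth_rcons_widen.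
    move=> [Au h] l; have [->|[i ->]] := ord_max_or_widen l.
      by rewrite /tuple_rcons/= tnth_rcons_max.
    by rewrite /tuple_rcons/= tnth_rcons_widen; exact: h.
  rewrite product_measure1E; [|exact: mA|exact: measurable_tuple_box].
  by rewrite /tuple_measure tuple_box_lebesgue// big_ord_recr/= muleC.
transitivity (\int[pushforward (leb \x @tuple_measure k)%E (@tuple_rcons k)]_x f x)%E; first by [].
rewrite (ge0_integral_pushforward (@measurable_tuple_rcons k))//.
rewrite preimage_setT.
exact: (fubini_tonelli1 (f \o @tuple_rcons k)
  (measurableT_comp mf (@measurable_tuple_rcons k)) (fun z => f0 _)).
Qed.

Definition tuple_perm k (s : {perm 'I_k}) (x : k.-tuple MR) : k.-tuple MR :=
  [tuple tnth x (s l) | l < k].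

Lemma measurable_tuple_perm k (s : {perm 'I_k}) : measurable_fun setT (tuple_perm s).
Proof.
apply/measurable_fun_tnthP => l.
rewrite (_ : _ \o _ = (fun x => tnth x (s l))); first exact: measurable_tnth.
by apply/funext => x /=; rewrite tnth_mktuple.
Qed.

Lemma ge0_integral_tuple_perm k (s : {perm 'I_k}) (f : k.-tuple MR -> \bar R) :
  measurable_fun setT f -> (forall x, (0 <= f x)%E) ->
  (\int[lebesgue_tuple R k]_x f (tuple_perm s x) = \int[lebesgue_tuple R k]_x f x)%E.
Proof.
move=> mf f0.
pose nu := measure_function_pushforward__canonical__measure_function_Measure
  (lebesgue_tuple R k) (@measurable_tuple_perm k s).
rewrite [RHS](eq_measure_integral nu); last first.
  move=> B mB _; apply: lebesgue_tuple_unique => // A mA.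
  transitivity (lebesgue_tuple R k (tuple_perm s @^-1` tuple_box A)); first by [].
  have -> : tuple_perm s @^-1` tuple_box A = tuple_box (fun l => A ((s^-1)%g l)).
    apply/seteqP; split => x /= h l.
      by have := h ((s^-1)%g l); rewrite tnth_mktuple permKV.
    by rewrite tnth_mktuple; have := h (s l); rewrite permK.
  rewrite tuple_box_lebesgue//.
  by rewrite [RHS](reindex_inj (@perm_inj _ (s^-1)%g)).
transitivity (\int[pushforward (lebesgue_tuple R k) (tuple_perm s)]_x f x)%E; last by [].
by rewrite (ge0_integral_pushforward (@measurable_tuple_perm k s))// preimage_setT.
Qed.

End tuple_measure.

Section tuple_product_integrals.
Context (R : realType).
Local Notation MR := (measurableTypeR R).
Local Notation leb := (@lebesgue_measure R).

Lemma integral_tuple_rcons k (f : k.+1.-tuple MR -> \bar R) : measurable_fun setT f ->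
  (\int[lebesgue_tuple R k.+1]_x f x =
   \int[leb \x @tuple_measure R k]_z f (tuple_rcons z))%E.
Proof.
move=> mf.
have ge0 (g : k.+1.-tuple MR -> \bar R) : measurable_fun setT g -> (forall x, (0 <= g x)%E) ->
    (\int[lebesgue_tuple R k.+1]_x g x = \int[leb \x @tuple_measure R k]_z g (tuple_rcons z))%E.
  move=> mg g0; rewrite ge0_integral_tuple_rcons//.
  exact/esym/(fubini_tonelli1 (g \o @tuple_rcons R k)
    (measurableT_comp mg (@measurable_tuple_rcons R k)) (fun z => g0 _)).
rewrite integralE [RHS]integralE; congr (_ - _)%E.
  rewrite ge0//; last exact: measurable_funepos.
  by apply: eq_integral => z _; rewrite !funeposE.
rewrite ge0//; last exact: measurable_funeneg.
by apply: eq_integral => z _; rewrite !funenegE.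
Qed.

Lemma tuple_prod_rcons k (g : 'I_k.+1 -> R -> R) (x : k.-tuple R) u :
  \prod_(l < k.+1) g l (tnth [tuple of rcons x u] l) =
  (\prod_(i < k) g (widen_ord (leqnSn k) i) (tnth x i)) * g ord_max u.
Proof.
rewrite big_ord_recr/= tnth_rcons_max; congr (_ * _).
by apply: eq_bigr => i _; rewrite tnth_rcons_widen.
Qed.

Lemma measurable_tuple_prod k (g : 'I_k -> R -> R) : (forall l, measurable_fun setT (g l)) ->
  measurable_fun setT (fun x : k.-tuple MR => \prod_(l < k) g l (tnth x l)).
Proof.
move=> mg; apply: measurable_prod => l _.
exact: (measurableT_comp (mg l) (@measurable_tnth _ MR k l)).
Qed.

(** Fubini asks for integrability of the product, so integrability and value are proved in one
    induction. In dimension 0 the measure is a unit mass and the product is 1. *)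
Lemma tuple_prod_integral k (g : 'I_k -> R -> R) :
  (forall l, leb.-integrable setT (EFin \o g l)) ->
  (lebesgue_tuple R k).-integrable setT (fun x => (\prod_(l < k) g l (tnth x l))%:E) /\
  \int[lebesgue_tuple R k]_x (\prod_(l < k) g l (tnth x l)) = \prod_(l < k) \int[leb]_u g l u.
Proof.
elim: k g => [|k IH] g ig.
  have m0 (h : 0.-tuple MR -> \bar R) : measurable_fun setT h.
    have -> : h = cst (h [tuple]) by apply/funext => x; rewrite [x]tuple0.
    exact: measurable_cst.
  split; last first.
    rewrite big_ord0; under eq_Rintegral do rewrite big_ord0.
    by rewrite /Rintegral/= integral_dirac// diracT mul1e.
  apply/integrableP; split => //; under eq_integral do rewrite big_ord0.
  by rewrite /= integral_dirac//= diracT mul1e ?abse1 ?normr1 ltry.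
have mg l : measurable_fun setT (g l) by apply/measurable_EFinP; case/integrableP : (ig l).
have [iG GE] := IH (fun i => g (widen_ord (leqnSn k) i)) (fun i => ig _).
set G := (fun x : k.-tuple MR => \prod_(i < k) _) in iG GE.
have mG : measurable_fun setT G by exact: (measurable_tuple_prod (fun i => mg (widen_ord (leqnSn k) i))).
have mf := measurable_tuple_prod mg.
have iP : (leb \x @tuple_measure R k)%E.-integrable setT
    (fun z => (G z.2 * g ord_max z.1)%:E).
  apply/integrable12ltyP.
    apply/measurable_EFinP; apply: measurable_funM.
      exact: (measurableT_comp mG).
    exact: (measurableT_comp (mg ord_max)).
  under eq_integral => u _.
    under eq_integral => x _ do rewrite /= normrM EFinM.
    rewrite ge0_integralZr//; last first.
      by apply/measurable_EFinP; apply: measurableT_comp.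
    over.
  rewrite /= ge0_integralZl//; last 2 first.
  - by apply/measurable_EFinP; apply: measurableT_comp => //; exact: mg.
  - exact: integral_ge0.
  have /integrableP[_ iG'] := iG; have /integrableP[_ ig'] := ig ord_max.
  by rewrite lte_mul_pinfty ?ge0_fin_numE//; exact: integral_ge0.
split.
  apply/integrableP; split; first exact/measurable_EFinP.
  rewrite integral_tuple_rcons; last first.
    by apply: measurableT_comp => //; exact/measurable_EFinP.
  under eq_integral => z _ do rewrite tuple_prod_rcons.
  by case/integrableP : iP.
rewrite /Rintegral integral_tuple_rcons; last exact/measurable_EFinP.
under eq_integral => z _ do rewrite tuple_prod_rcons.
rewrite -integral12_prod_meas1// /fubini_F/= big_ord_recr/= -GE.
rewrite /Rintegral -fineM; last 2 first.
- exact: integrable_fin_num iG.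
- exact: integrable_fin_num (ig ord_max).
congr fine.
rewrite -(fineK (integrable_fin_num measurableT iG)) -integralZl//; last exact: ig.
apply: eq_integral => u _.
rewrite (fineK (integrable_fin_num measurableT iG)) -integralZr//.
Qed.

Lemma measurable_cube (t T : R) k : measurable (cube t T k).
Proof.
have -> : cube t T k = tuple_box (fun _ => `[t, T]%classic).
  by apply/seteqP; split => x /= h l; have := h l; rewrite /= in_itv.
by apply: measurable_tuple_box => l; exact: measurable_itv.
Qed.

Lemma cube_prod_integral (t T : R) k (f : 'I_k -> R -> R) :
  (forall l, leb.-integrable `[t, T] (EFin \o f l)) ->
  (lebesgue_tuple R k).-integrable (cube t T k) (fun x => (\prod_(l < k) f l (tnth x l))%:E) /\
  \int[lebesgue_tuple R k]_(x in cube t T k) (\prod_(l < k) f l (tnth x l)) =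
  \prod_(l < k) \int[leb]_(u in `[t, T]) f l u.
Proof.
move=> intf.
pose g l := f l \_ `[t, T].
have ig l : leb.-integrable setT (EFin \o g l).
  have /integrable_mkcond -/(_ (measurable_itv _)) := intf l.
  by rewrite restrict_EFin.
have [iP PE] := tuple_prod_integral ig.
have gE : (fun x : k.-tuple MR => \prod_(l < k) g l (tnth x l)) =
    (fun x : k.-tuple MR => \prod_(l < k) f l (tnth x l)) \_ (cube t T k).
  apply/funext => x; rewrite patchE; case: ifPn => [/set_mem xc|/negP xc].
    apply: eq_bigr => l _; rewrite /g patchE ifT//.
    by apply/mem_set; rewrite /= in_itv/=; exact: xc.
  have [l hl] : exists l, ~ (t <= tnth x l <= T).
    by apply/existsNP => h; apply: xc; exact/mem_set.
  rewrite (bigD1 l)//= /g patchE ifF ?mul0r//.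
  by apply/negbTE/negP => /set_mem; rewrite /= in_itv/=.
split.
  apply/integrable_mkcond; first exact: measurable_cube.
  have -> : (fun x : k.-tuple MR => (\prod_(l < k) f l (tnth x l))%:E) \_ (cube t T k) =
      EFin \o ((fun x : k.-tuple MR => \prod_(l < k) f l (tnth x l)) \_ (cube t T k)).
    by rewrite -restrict_EFin.
  by rewrite -gE.
rewrite Rintegral_mkcond -gE PE; apply: eq_bigr => l _.
by rewrite [RHS]Rintegral_mkcond.
Qed.

End tuple_product_integrals.

(** * Multiple stochastic integrals on the simplex *)

Section cube_norm.
Context (R : realType) (t T : R).
Local Notation MR := (measurableTypeR R).
Local Notation leb := (@lebesgue_measure R).

(** Kernels take sequences of any length, so that a section [Phi (rcons x u)] needs no cast; only
    the values at length [k] count. *)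
Definition cube_n2 k (Phi : seq R -> R) : \bar R :=
  n2 (lebesgue_tuple R k) (cube t T k) (fun x : k.-tuple MR => Phi x).

Definition cube_meas k (Phi : seq R -> R) : Prop :=
  measurable_fun (cube t T k) (fun x : k.-tuple MR => Phi x).

Lemma cube_n2_ge0 k Phi : (0 <= cube_n2 k Phi)%E.
Proof. exact: n2_ge0. Qed.

Lemma cube_rcons k (x : k.-tuple R) u :
  cube t T k.+1 [tuple of rcons x u] <-> (t <= u <= T) /\ cube t T k x.
Proof.
split=> [h|[hu hx] l].
  split; first by have := h ord_max; rewrite tnth_rcons_max.
  by move=> i; have := h (widen_ord (leqnSn k) i); rewrite tnth_rcons_widen.
by have [->|[i ->]] := ord_max_or_widen l; rewrite ?tnth_rcons_max ?tnth_rcons_widen.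
Qed.

Let patched k (Phi : seq R -> R) (x : k.-tuple MR) : \bar R :=
  ((fun x : k.-tuple MR => ((Phi x) ^+ 2)%:E) \_ (cube t T k)) x.

Let mpatched k Phi : cube_meas k Phi -> measurable_fun setT (@patched k Phi).
Proof.
move=> mPhi; apply/(measurable_restrictT _ (@measurable_cube R t T k)).
exact: measurable_sqr_EFin.
Qed.

Let patched_ge0 k Phi x : (0 <= @patched k Phi x)%E.
Proof. by rewrite /patched patchE; case: ifP => // _; rewrite lee_fin sqr_ge0. Qed.

Let patched_rcons k Phi (x : k.-tuple R) u : t <= u <= T ->
  @patched k.+1 Phi [tuple of rcons x u] = @patched k (fun y => Phi (rcons y u)) x.
Proof.
move=> hu; rewrite /patched !patchE.
have [/set_mem xc|/negP xc] := boolP (x \in cube t T k).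
  by rewrite ifT//; apply/mem_set/cube_rcons.
by rewrite ifF//; apply/negbTE/negP => /set_mem/cube_rcons[_ ?]; apply: xc; exact/mem_set.
Qed.

Lemma cube_n2_rcons k Phi : cube_meas k.+1 Phi ->
  (cube_n2 k.+1 Phi = \int[leb]_(u in `[t, T]) cube_n2 k (fun x => Phi (rcons x u)))%E.
Proof.
move=> mPhi.
rewrite /cube_n2 [LHS]integral_mkcond -/(@patched k.+1 Phi).
rewrite (ge0_integral_tuple_rcons (mpatched mPhi))//.
rewrite [RHS]integral_mkcond; apply: eq_integral => u _.
rewrite patchE; case: ifPn => [/set_mem|/negP uD].
  rewrite /= in_itv/= => hu; rewrite [RHS]integral_mkcond.
  by apply: eq_integral => x _; rewrite patched_rcons.
rewrite integral0_eq// => x _; rewrite /patched patchE ifF//.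
apply/negbTE/negP => /set_mem/cube_rcons[hu _]; apply: uD.
by apply/mem_set; rewrite /= in_itv.
Qed.

Lemma cube_n2_rcons_measurable k Phi : cube_meas k.+1 Phi ->
  measurable_fun `[t, T] (fun u : MR => cube_n2 k (fun x => Phi (rcons x u))).
Proof.
move=> mPhi.
have mF : measurable_fun setT (fun u : MR =>
    \int[@tuple_measure R k]_x @patched k.+1 Phi (tuple_rcons (u, x)))%E.
  apply: (measurable_fun_fubini_tonelli_F (m2 := @tuple_measure R k)
    (fun z => @patched k.+1 Phi (tuple_rcons z))).
    exact: (measurableT_comp (mpatched mPhi) (@measurable_tuple_rcons R k)).
  by move=> z; exact: patched_ge0.
apply: (eq_measurable_fun (fun u : MR =>
    \int[@tuple_measure R k]_x @patched k.+1 Phi (tuple_rcons (u, x)))%E).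
  move=> u /set_mem; rewrite /= in_itv/= => hu.
  rewrite /cube_n2 [RHS]integral_mkcond.
  by apply: eq_integral => x _; rewrite patched_rcons.
exact: measurable_funTS.
Qed.

Lemma cube_measD k Phi Psi : cube_meas k Phi -> cube_meas k Psi ->
  cube_meas k (fun x => Phi x + Psi x).
Proof. exact: measurable_funD. Qed.

Lemma cube_measB k Phi Psi : cube_meas k Phi -> cube_meas k Psi ->
  cube_meas k (fun x => Phi x - Psi x).
Proof. exact: measurable_funB. Qed.

Lemma cube_measZ k (c : R) Phi : cube_meas k Phi -> cube_meas k (fun x => c * Phi x).
Proof. exact: measurable_funM. Qed.

Lemma cube_meas_sum k (J : finType) (Q : pred J) (Phi : J -> seq R -> R) :
  (forall j, cube_meas k (Phi j)) -> cube_meas k (fun x => \sum_(j | Q j) Phi j x).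
Proof.
move=> mPhi; under eq_fun do rewrite big_mkcond.
apply: measurable_sum => j; case: (Q j) => //; exact: mPhi.
Qed.

End cube_norm.

Section elementary.
Context d (Omega : measurableType d) (R : realType) (P : probability Omega R) (t T : R).
Context (F : R -> set_system Omega).
Hypotheses (t0 : 0 <= t) (tT : t < T) (hF : is_filtration T F).
Context (C : R) (C0 : 0 <= C).
Local Notation E2 X := (n2 P setT X).
Local Notation leb := (@lebesgue_measure R).
Local Notation MR := (measurableTypeR R).
Context (w : nat -> R -> Omega -> R) (isoW : forall k, ito_isometric P t T F C (w k)).

(* [elem k a Phi Y]: [Y] is the [k]-fold iterated integral of the elementary kernel [Phi],
   whose support is contained in [{x_0 < ... < x_(k-1) <= a}]. *)
Fixpoint elem (k : nat) (a : R) (Phi : seq R -> R) (Y : Omega -> R) : Prop :=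
  match k with
  | 0 => Y = fun _ => Phi [::]
  | k'.+1 => exists (I : finType) (al be : I -> R) (Phi_ : I -> seq R -> R) (Y_ : I -> Omega -> R),
      [/\ forall i, [/\ t <= al i, al i <= be i, be i <= a & elem k' (al i) (Phi_ i) (Y_ i)],
        forall x u, size x = k' -> Phi (rcons x u) = \sum_i Phi_ i x * \1_(`[al i, be i[) u &
        Y = fun om => \sum_i Y_ i om * (w k' (be i) om - w k' (al i) om)]
  end.

Lemma elem_mono k a b Phi Y : a <= b -> elem k a Phi Y -> elem k b Phi Y.
Proof.
case: k => [//|k] ab [I [al [be [Phi_ [Y_ [h1 h2 h3]]]]]].
exists I, al, be, Phi_, Y_; split => // i; have [? ? ia ?] := h1 i; split => //.
exact: le_trans ab.
Qed.

Lemma elem_ext k a Phi Psi Y : (forall x, size x = k -> Phi x = Psi x) ->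
  elem k a Phi Y -> elem k a Psi Y.
Proof.
case: k => [E ->/=|k E [I [al [be [Phi_ [Y_ [h1 h2 h3]]]]]]].
  by rewrite E.
exists I, al, be, Phi_, Y_; split => // x u xk; rewrite -E ?size_rcons ?xk//; exact: h2.
Qed.

Lemma elem0 k a : elem k a (fun _ => 0) (fun _ => 0).
Proof.
case: k => [//|k]; exists void, (fun _ => 0), (fun _ => 0), (fun _ _ => 0), (fun _ _ => 0).
split; first by case.
- by move=> x u _; rewrite big_pred0// => -[].
- by apply/funext => om; rewrite big_pred0// => -[].
Qed.

Lemma elemD k a Phi Y Phi' Y' : elem k a Phi Y -> elem k a Phi' Y' ->
  elem k a (fun x => Phi x + Phi' x) (fun om => Y om + Y' om).
Proof.
case: k => [/= -> -> //|k].
move=> [I [al [be [Phi_ [Y_ [h1 h2 ->]]]]]] [I' [al' [be' [Phi_' [Y_' [h1' h2' ->]]]]]].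
exists (I + I')%type, (fun k => match k with inl i => al i | inr j => al' j end),
  (fun k => match k with inl i => be i | inr j => be' j end),
  (fun k => match k with inl i => Phi_ i | inr j => Phi_' j end),
  (fun k => match k with inl i => Y_ i | inr j => Y_' j end); split.
- by move=> [i|j]; [exact: h1|exact: h1'].
- by move=> x u xk; rewrite big_sumType/= h2// h2'.
- by apply/funext => om; rewrite big_sumType.
Qed.

Lemma elemZ k a c Phi Y : elem k a Phi Y -> elem k a (fun x => c * Phi x) (fun om => c * Y om).
Proof.
elim: k a Phi Y => [a Phi Y /= -> //|k IH a Phi Y [I [al [be [Phi_ [Y_ [h1 h2 ->]]]]]]].
exists I, al, be, (fun i x => c * Phi_ i x), (fun i om => c * Y_ i om); split.
- by move=> i; have [? ? ? ?] := h1 i; split => //; exact: IH.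
- by move=> x u xk; rewrite h2// mulr_sumr; apply: eq_bigr => i _; rewrite mulrA.
- by apply/funext => om; rewrite mulr_sumr; apply: eq_bigr => i _; rewrite mulrA.
Qed.

Lemma elem_sum k a (J : finType) (Phi : J -> seq R -> R) (Y : J -> Omega -> R) :
  (forall j, elem k a (Phi j) (Y j)) ->
  elem k a (fun x => \sum_j Phi j x) (fun om => \sum_j Y j om).
Proof.
move=> h.
have -> : (fun x => \sum_j Phi j x) = \sum_j Phi j by apply/funext => x; rewrite fct_sumE.
have -> : (fun om => \sum_j Y j om) = \sum_j Y j by apply/funext => x; rewrite fct_sumE.
apply: (big_ind2 (elem k a)) => //; first exact: elem0.
by move=> ? ? ? ?; exact: elemD.
Qed.

Lemma elem_adapted k a Phi Y : t <= a <= T -> elem k a Phi Y ->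
  measurable_for (F a) Y /\ (E2 Y < +oo)%E.
Proof.
elim: k a Phi Y => [|k IH] a Phi Y haT.
  move=> ->; split; first exact: (measurable_for_cst (sigma_algebra_filt t0 hF haT)).
  exact: (integrable_lty measurableT (finite_measure_integrable_cst P _ measurableT)).
move=> [I [al [be [Phi_ [Y_ [h1 h2 ->]]]]]].
have sF := sigma_algebra_filt t0 hF haT.
have /andP[ta aT] := haT.
have Yi i : [/\ measurable_for (F a) (Y_ i), measurable_for (F a) (w k (al i)),
    measurable_for (F a) (w k (be i)) &
    (E2 (fun om => Y_ i om * (w k (be i) om - w k (al i) om))%R < +oo)%E].
  have [tal albe bea hel] := h1 i.
  have hal : t <= al i <= T by rewrite tal (le_trans albe)// (le_trans bea).
  have hbe : t <= be i <= T by rewrite (le_trans tal)// (le_trans bea).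
  have [mY Y2] := IH _ _ _ hal hel.
  have [mW W2 _] := isoW k.
  have ala := le_trans albe bea.
  split.
  - exact: (measurable_for_le t0 hF tal ala aT).
  - by apply: (measurable_for_le t0 hF tal ala aT); exact: mW.
  - by apply: (measurable_for_le t0 hF (le_trans tal albe) bea aT); exact: mW.
  move: albe; rewrite le_eqVlt => /orP[/eqP <-|albe]; last first.
    by apply: W2 => //; exact: le_trans aT.
  under eq_integral do rewrite subrr mulr0 expr0n/=.
  by rewrite integral0.
have mYi i : measurable_for (F a) (fun om => Y_ i om * (w k (be i) om - w k (al i) om)).
  by have [? ? ? _] := Yi i; apply: measurable_forM => //; exact: measurable_forB.
split; first by apply: measurable_for_sum => // i _; exact: mYi.
apply: (le_lt_trans (n2_sum _ measurableT _)).
  by move=> i; exact: (measurable_for_fun t0 hF haT (mYi i)).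
rewrite lte_mul_pinfty ?lee_fin//; apply: lte_sum_pinfty => i _.
by have [] := Yi i.
Qed.

(** Brings the outermost integration into the form required by [family_bound] and [ito_limit]: the
    value of the family at time [u] is the elementary integral of the section at [u]. *)
Lemma elem_family k a Phi Y : a <= T -> elem k.+1 a Phi Y ->
  exists (I : finType) (al be : I -> R) (Y_ : I -> Omega -> R),
    [/\ adapted_family P t T F al be Y_, Y = family_integral (w k) al be Y_ &
      forall u, elem k T (fun x => Phi (rcons x u)) (family_value al be Y_ u)].
Proof.
move=> aT [I [al [be [Phi_ [Y_ [h1 h2 ->]]]]]].
exists I, al, be, Y_; split => //.
- move=> i; have [tal albe bea hel] := h1 i.
  have hal : t <= al i <= T by rewrite tal (le_trans albe)// (le_trans bea).
  have [? ?] := elem_adapted hal hel; split => //; exact: le_trans aT.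
- move=> u; apply: (@elem_ext _ _ (fun x => \sum_i Phi_ i x * \1_(`[al i, be i[) u)).
    by move=> x xk; rewrite h2.
  apply: elem_sum => i; have [tal albe bea hel] := h1 i.
  rewrite (_ : (fun x => _) = (fun x => \1_(`[al i, be i[) u * Phi_ i x)); last first.
    by apply/funext => x; rewrite mulrC.
  rewrite (_ : (fun om => _) = (fun om => \1_(`[al i, be i[) u * Y_ i om)); last first.
    by apply/funext => x; rewrite mulrC.
  by apply: elemZ; apply: elem_mono hel; rewrite (le_trans albe)// (le_trans bea).
Qed.

Lemma elem_measurable k a Phi Y : elem k a Phi Y ->
  measurable_fun setT (fun x : k.-tuple MR => Phi x).
Proof.
elim: k a Phi Y => [|k IH] a Phi Y.
  move=> _; have -> : (fun x : 0.-tuple MR => Phi x) = cst (Phi [::]).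
    by apply/funext => x; rewrite tuple0.
  exact: measurable_cst.
move=> [I [al [be [Phi_ [Y_ [h1 h2 _]]]]]].
pose bl (x : k.+1.-tuple MR) : k.-tuple MR := [tuple tnth x (widen_ord (leqnSn k) i) | i < k].
have mbl : measurable_fun setT bl.
  apply/measurable_fun_tnthP => i.
  rewrite (_ : _ \o _ = (fun x => tnth x (widen_ord (leqnSn k) i))); first exact: measurable_tnth.
  by apply/funext => x /=; rewrite tnth_mktuple.
have xE (x : k.+1.-tuple MR) : tval x = rcons (bl x) (tnth x ord_max).
  suff E : x = [tuple of rcons (bl x) (tnth x ord_max)] by exact: (congr1 val E).
  apply: eq_from_tnth => l; have [->|[i ->]] := ord_max_or_widen l.
    by rewrite tnth_rcons_max.
  by rewrite tnth_rcons_widen tnth_mktuple.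
have -> : (fun x : k.+1.-tuple MR => Phi x) =
    (fun x => \sum_i Phi_ i (bl x) * \1_(`[al i, be i[) (tnth x ord_max)).
  by apply/funext => x; rewrite xE h2 ?size_tuple.
apply: measurable_sum => i; apply: measurable_funM.
  have [_ _ _ hel] := h1 i; exact: (measurableT_comp (IH _ _ _ hel) mbl).
apply: (measurableT_comp (f := (\1_(`[al i, be i[) : R -> R))) => //.
exact: (@measurable_tnth _ MR k.+1 ord_max).
Qed.

Lemma elem_cube_meas k a Phi Y : elem k a Phi Y -> cube_meas t T k Phi.
Proof. by move=> /elem_measurable h; exact: measurable_funTS. Qed.

(** Each integration costs one factor [C]; the sections are bounded by induction and Tonelli's
    theorem puts their norms together. *)
Lemma elem_bound k a Phi Y : a <= T -> elem k a Phi Y ->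
  (E2 Y <= (C ^+ k)%:E * cube_n2 t T k Phi)%E.
Proof.
elim: k a Phi Y => [|k IH] a Phi Y aT.
  move=> ->; rewrite expr0 mul1e /cube_n2.
  have -> : cube t T 0 = setT by apply/seteqP; split => // x _ [].
  rewrite /= integral_dirac//; last first.
    apply: measurable_sqr_EFin.
    have -> : (fun x : 0.-tuple MR => Phi x) = cst (Phi [::]).
      by apply/funext => x; rewrite tuple0.
    exact: measurable_cst.
  rewrite diracT mul1e integral_cst// -[leRHS]mule1 lee_wpmul2l ?lee_fin ?sqr_ge0//.
  by rewrite probability_le1.
move=> hel; have mPhi := elem_cube_meas hel.
have [I [al [be [Y_ [fY -> hsec]]]]] := elem_family aT hel.
apply: le_trans (family_bound t0 tT hF C0 (isoW k) fY) _.
rewrite exprS EFinM -muleA lee_wpmul2l ?lee_fin//.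
rewrite cube_n2_rcons// -ge0_integralZl_EFin ?exprn_ge0//; last 2 first.
- by move=> u _; exact: cube_n2_ge0.
- exact: cube_n2_rcons_measurable.
apply: ge0_le_integral.
- exact: measurable_itv.
- by move=> u _; exact: n2_ge0.
- by apply: measurable_funTS; exact: (measurable_family_value_n2 t0 hF fY).
- by apply: measurable_funeM; exact: cube_n2_rcons_measurable.
by move=> u _; apply: (IH T) => //; exact: hsec.
Qed.

End elementary.

(** * Continuous extension of the elementary integral *)

Section closure.
Context d (Omega : measurableType d) (R : realType) (P : probability Omega R) (t T : R).
Context (F : R -> set_system Omega).
Hypotheses (t0 : 0 <= t) (tT : t < T) (hF : is_filtration T F).
Context (C : R) (C0 : 0 <= C).
Local Notation E2 X := (n2 P setT X).
Local Notation leb := (@lebesgue_measure R).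
Local Notation MR := (measurableTypeR R).
Context (w : nat -> R -> Omega -> R) (isoW : forall k, ito_isometric P t T F C (w k)).
Local Notation elem := (elem t w).
Local Notation cn2 := (cube_n2 t T).

(* [isW k Phi Y]: [Y] is the iterated integral of the kernel [Phi 1_(x_0 < ... < x_(k-1))],
   as the value at [Phi] of the continuous extension of the elementary integral. *)
Definition isW k (Phi : seq R -> R) (Y : Omega -> R) :=
  [/\ cube_meas t T k Phi, measurable_fun setT Y &
    forall e : R, 0 < e -> exists Psi Z,
      [/\ elem k T Psi Z, (cn2 k (fun x => (Psi x - Phi x)%R) < e%:E)%E &
        (E2 (fun om => (Z om - Y om)%R) < e%:E)%E]].

Let TT : T <= T. Proof. exact: lexx. Qed.

Lemma elem_cube_measT k Phi Y : elem k T Phi Y -> cube_meas t T k Phi.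
Proof. exact: elem_cube_meas. Qed.

Lemma elem_measurable_rv k Phi Y : elem k T Phi Y -> measurable_fun setT Y.
Proof.
have hT : t <= T <= T by rewrite lexx ltW.
by move=> /(elem_adapted t0 hF isoW hT)[mY _]; exact: (measurable_for_fun t0 hF hT mY).
Qed.

Lemma isW_elem k Phi Y : elem k T Phi Y -> isW k Phi Y.
Proof.
move=> h; split; first exact: (elem_cube_measT h).
  exact: elem_measurable_rv h.
move=> e e0; exists Phi, Y; split => //.
  rewrite /cube_n2; under eq_integral do rewrite subrr expr0n/=.
  by rewrite integral0.
under eq_integral do rewrite subrr expr0n/=.
by rewrite integral0.
Qed.

(** The bound for elementary kernels passes to limits. The factor 4 comes from two squared triangle
    inequalities, one for the integrals and one for the kernels. *)
Lemma isW_bound k Phi Y : isW k Phi Y -> (E2 Y <= (4 * C ^+ k)%:E * cn2 k Phi)%E.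
Proof.
move=> [mPhi mY h].
have Ck : 0 <= C ^+ k by rewrite exprn_ge0.
apply/lee_addgt0Pr => e e0.
(* The total coefficient of the approximation errors, so that errors of size [e / q] add up to
   [e]. *)
pose q := 2 + 4 * C ^+ k.
have q0 : 0 < q by rewrite /q ltr_wpDr// mulr_ge0.
have [Psi [Z [hel h1 h2]]] := h (e / q) (divr_gt0 e0 q0).
have mPsi := elem_cube_measT hel; have mZ := elem_measurable_rv hel.
have b1 : (E2 Y <= 2%:E * E2 (fun om => (Z om - Y om)%R) + 2%:E * E2 Z)%E.
  have := @n2D _ _ _ P setT measurableT (fun om => - (Z om - Y om)) Z
    (measurableT_comp (@oppr_measurable R setT) (measurable_funB mZ mY)) mZ.
  rewrite n2N; under [X in (X <= _)%E]eq_integral do rewrite opprB subrK.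
  exact.
have b2 : (cn2 k Psi <= 2%:E * cn2 k (fun x => (Psi x - Phi x)%R) + 2%:E * cn2 k Phi)%E.
  have := @n2D _ _ _ (lebesgue_tuple R k) (cube t T k) (@measurable_cube R t T k)
    (fun x : k.-tuple MR => Psi x - Phi x) (fun x : k.-tuple MR => Phi x) (cube_measB mPsi mPhi) mPhi.
  by under [X in (X <= _)%E]eq_integral do rewrite subrK.
have b3 := elem_bound t0 tT hF C0 isoW TT hel.
apply: (le_trans b1).
apply: (@le_trans _ _ (2%:E * (e / q)%:E + 2%:E * ((C ^+ k)%:E * (2%:E * (e / q)%:E + 2%:E * cn2 k Phi)))%E).
  apply: leeD; first by rewrite lee_wpmul2l// ltW.
  rewrite lee_wpmul2l//; apply: (le_trans b3); rewrite lee_wpmul2l ?lee_fin//.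
  by apply: (le_trans b2); rewrite leeD2r// lee_wpmul2l// ltW.
rewrite ge0_muleDr; [|by rewrite lee_fin; rewrite mulr_ge0// divr_ge0// ltW|by rewrite mule_ge0// cube_n2_ge0].
rewrite ge0_muleDr; last 2 first.
- by rewrite mule_ge0 ?lee_fin// mulr_ge0// divr_ge0// ltW.
- by rewrite mule_ge0 ?lee_fin// mule_ge0// cube_n2_ge0.
rewrite addeA addeC; apply: leeD.
  by rewrite !muleA -!EFinM (_ : 2 * C ^+ k * 2 = 4 * C ^+ k)//; ring.
rewrite -!EFinM -EFinD lee_fin.
have aux (x : R) : 2 * x + 2 * (C ^+ k * (2 * x)) = q * x by rewrite /q; ring.
rewrite aux.
by rewrite mulrC divfK// gt_eqF.
Qed.

Lemma isWD k Phi Y Phi' Y' : isW k Phi Y -> isW k Phi' Y' ->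
  isW k (fun x => Phi x + Phi' x) (fun om => Y om + Y' om).
Proof.
move=> [mPhi mY h] [mPhi' mY' h']; split; [exact: cube_measD|exact: measurable_funD|].
move=> e e0; have e4 : 0 < e / 4 by rewrite divr_gt0.
have [Psi [Z [hel h1 h2]]] := h _ e4; have [Psi' [Z' [hel' h1' h2']]] := h' _ e4.
have eE : (e%:E = 2%:E * (e / 4)%:E + 2%:E * (e / 4)%:E)%E.
  by rewrite -!EFinM -EFinD; congr EFin; field.
exists (fun x => Psi x + Psi' x), (fun om => Z om + Z' om); split.
- exact: elemD.
- rewrite eE /cube_n2; under eq_integral do rewrite opprD addrACA.
  apply: (le_lt_trans (n2D _ (@measurable_cube R t T k) _ _)).
  + exact: (cube_measB (elem_cube_measT hel) mPhi).
  + exact: (cube_measB (elem_cube_measT hel') mPhi').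
  + by apply: lteD; rewrite lte_pmul2l// ?fin_num_abs.
- rewrite eE; under eq_integral do rewrite opprD addrACA.
  apply: (le_lt_trans (n2D _ measurableT _ _)).
  + exact: (measurable_funB (elem_measurable_rv hel) mY).
  + exact: (measurable_funB (elem_measurable_rv hel') mY').
  + by apply: lteD; rewrite lte_pmul2l.
Qed.

Lemma isWZ k c Phi Y : isW k Phi Y -> isW k (fun x => c * Phi x) (fun om => c * Y om).
Proof.
move=> [mPhi mY h]; split; [exact: cube_measZ|exact: measurable_funM|].
move=> e e0.
have q0 : 0 < c ^+ 2 + 1 by rewrite ltr_wpDl// sqr_ge0.
have eq0 : 0 < e / (c ^+ 2 + 1) by rewrite divr_gt0.
have [Psi [Z [hel h1 h2]]] := h _ eq0.
have lt_ (x : \bar R) : (0 <= x)%E -> (x < (e / (c ^+ 2 + 1))%:E)%E -> ((c ^+ 2)%:E * x < e%:E)%E.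
  move=> x0 xe; apply: (@le_lt_trans _ _ ((c ^+ 2)%:E * (e / (c ^+ 2 + 1))%:E)%E).
    by rewrite lee_wpmul2l ?lee_fin ?sqr_ge0// ltW.
  by rewrite -EFinM lte_fin mulrCA gtr_pMr// ltr_pdivrMr// mul1r ltrDl.
exists (fun x => c * Psi x), (fun om => c * Z om); split.
- exact: elemZ.
- rewrite /cube_n2; under eq_integral do rewrite -mulrBr.
  rewrite (n2Z _ (@measurable_cube R t T k)); first by apply: lt_ => //; exact: n2_ge0.
  exact: (cube_measB (elem_cube_measT hel) mPhi).
- under eq_integral do rewrite -mulrBr.
  rewrite (n2Z _ measurableT); first by apply: lt_ => //; exact: n2_ge0.
  exact: (measurable_funB (elem_measurable_rv hel) mY).
Qed.

Lemma isW0 k : isW k (fun _ => 0) (fun _ => 0).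
Proof. by apply: isW_elem; exact: elem0. Qed.

Lemma isW_sum k (J : finType) (Phi : J -> seq R -> R) (Y : J -> Omega -> R) :
  (forall j, isW k (Phi j) (Y j)) -> isW k (fun x => \sum_j Phi j x) (fun om => \sum_j Y j om).
Proof.
move=> h.
have -> : (fun x => \sum_j Phi j x) = \sum_j Phi j by apply/funext => x; rewrite fct_sumE.
have -> : (fun om => \sum_j Y j om) = \sum_j Y j by apply/funext => x; rewrite fct_sumE.
apply: (big_ind2 (isW k)) => //; first exact: isW0.
by move=> ? ? ? ?; exact: isWD.
Qed.

Lemma isWB k Phi Y Phi' Y' : isW k Phi Y -> isW k Phi' Y' ->
  isW k (fun x => Phi x - Phi' x) (fun om => Y om - Y' om).
Proof.
move=> h /(isWZ (-1)) h'; have := isWD h h'.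
under [X in isW k X _ -> _]eq_fun do rewrite mulN1r.
by under [X in isW k _ X -> _]eq_fun do rewrite mulN1r.
Qed.

Lemma isW_ext k Phi Psi Y : (forall x, size x = k -> Phi x = Psi x) -> isW k Phi Y -> isW k Psi Y.
Proof.
move=> E [mPhi mY h]; split => //.
  by apply: eq_measurable_fun mPhi => x _; rewrite E ?size_tuple.
move=> e e0; have [Phi' [Z [hel h1 h2]]] := h _ e0; exists Phi', Z; split => //.
by rewrite /cube_n2; under eq_integral do rewrite -E ?size_tuple//.
Qed.

(** By [elem_bound] the integrals of approximating elementary kernels form a Cauchy sequence, and L2
    is complete. *)
Lemma isW_exists k Phi : cube_meas t T k Phi ->
  (forall e : R, 0 < e -> exists Psi Z, elem k T Psi Z /\ (cn2 k (fun x => (Psi x - Phi x)%R) < e%:E)%E) ->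
  exists Y, isW k Phi Y.
Proof.
move=> mPhi h.
have en0 n : 0 < n.+1%:R^-1 :> R by rewrite invr_gt0.
pose Psi n := projT1 (cid (h _ (en0 n))).
have hPsi n : exists Z, elem k T (Psi n) Z /\ (cn2 k (fun x => (Psi n x - Phi x)%R) < n.+1%:R^-1%:E)%E.
  by rewrite /Psi; case: cid.
pose Z n := projT1 (cid (hPsi n)).
have ZP n : elem k T (Psi n) (Z n) /\ (cn2 k (fun x => (Psi n x - Phi x)%R) < n.+1%:R^-1%:E)%E.
  by rewrite /Z; case: cid.
have mZ n : measurable_fun setT (Z n) by exact: elem_measurable_rv (ZP n).1.
have mPsi n := elem_cube_measT (ZP n).1.
have small (e : R) : 0 < e -> exists N, forall n, (N <= n)%N -> n.+1%:R^-1 < e.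
  move=> e0; exists (Num.truncn e^-1) => n Nn.
  rewrite invf_plt ?posrE//; apply: lt_le_trans (truncnS_gt _) _.
  by rewrite ler_nat ltnS.
have Ck : 0 <= C ^+ k by rewrite exprn_ge0.
have [Y [mY cY]] : exists Y : Omega -> R, measurable_fun setT Y /\
    (fun n => E2 (fun x => (Z n x - Y x)%R)) @ \oo --> 0%E.
  apply: (L2_complete mZ) => e e0.
  have q0 : 0 < C ^+ k * 4 + 1 by rewrite ltr_wpDl// mulr_ge0.
  have [N NP] := small _ (divr_gt0 e0 q0).
  exists N => m n Nm Nn.
  have hd : elem k T (fun x => Psi m x - Psi n x) (fun om => Z m om - Z n om).
    have := elemD (ZP m).1 (elemZ (-1) (ZP n).1).
    under [X in elem k T X _ -> _]eq_fun do rewrite mulN1r.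
    by under [X in elem k T _ X -> _]eq_fun do rewrite mulN1r.
  apply: (le_lt_trans (elem_bound t0 tT hF C0 isoW TT hd)).
  apply: (@le_lt_trans _ _ ((C ^+ k)%:E * (2%:E * (e / (C ^+ k * 4 + 1))%:E + 2%:E * (e / (C ^+ k * 4 + 1))%:E))%E).
    rewrite lee_wpmul2l ?lee_fin//.
    apply: (le_trans (n2_triangle _ (@measurable_cube R t T k) (mPsi m) mPhi (mPsi n))).
    apply: leeD; rewrite lee_wpmul2l//; apply: ltW.
      by apply: (lt_trans (ZP m).2); rewrite lte_fin NP.
    by rewrite n2_sym; apply: (lt_trans (ZP n).2); rewrite lte_fin NP.
  have aux (x : R) : ((C ^+ k)%:E * (2%:E * x%:E + 2%:E * x%:E) = (C ^+ k * 4 * x)%:E)%E.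
    by rewrite -(EFinM 2) -EFinD -EFinM; congr EFin; ring.
  rewrite aux lte_fin mulrCA.
  by rewrite gtr_pMr// ltr_pdivrMr// mul1r ltrDl.
exists Y; split => // e e0.
have [N NP] := small _ e0.
have := (ge0_cvg0P _ (fun n => n2_ge0 P setT _)).1 cY e e0.
move=> [M _ MP]; exists (Psi (N + M)%N), (Z (N + M)%N); split.
- exact: (ZP _).1.
- by apply: (lt_trans (ZP _).2); rewrite lte_fin NP// leq_addr.
- by apply: MP; rewrite /= leq_addl.
Qed.

Lemma isW_cvg k Phi Y (I : Type) (G : set_system I) (FG : Filter G)
    (Psi : I -> seq R -> R) (Z : I -> Omega -> R) :
  isW k Phi Y -> (forall n, isW k (Psi n) (Z n)) ->
  (fun n => cn2 k (fun x => (Psi n x - Phi x)%R)) @ G --> 0%E ->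
  (fun n => E2 (fun om => (Z n om - Y om)%R)) @ G --> 0%E.
Proof.
move=> hY hZ cPsi.
apply: (@cvg0_le _ _ _ _ _ (fun n => (4 * C ^+ k)%:E * cn2 k (fun x => (Psi n x - Phi x)%R))%E).
- by move=> n; exact: n2_ge0.
- by apply: nearW => n; apply: isW_bound; exact: isWB.
- exact: cvg0Z.
Qed.

End closure.

Section simplex_kernel.
Context (R : realType).
Local Notation MR := (measurableTypeR R).
Implicit Types (g : nat -> R -> R) (x : seq R) (s u : R).

(** The upper limit [s] is treated as one more coordinate, so that sortedness also places the last
    variable below [s]. *)
Definition simplex_kernel g (s : R) (x : seq R) : R :=
  if sorted (fun a b : R => a < b) (rcons x s) then \prod_(a < size x) g a (nth 0 x a) else 0.

Lemma sorted_rcons2 (A : Type) (r : rel A) (x : seq A) (u s : A) : sorted r (rcons (rcons x u) s) = sorted r (rcons x u) && r u s.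
Proof. by case: x => [|y x] /=; rewrite ?andbT// rcons_path last_rcons. Qed.

(** The recursion of the iterated integral at the level of kernels: the integrand at time [u] is the
    weight times the inner integral with upper limit [u]. *)
Lemma simplex_kernel_rcons g s u x :
  simplex_kernel g s (rcons x u) = (u < s)%R%:R * g (size x) u * simplex_kernel g u x.
Proof.
rewrite /simplex_kernel sorted_rcons2.
case: (sorted _ (rcons x u)) => /=; last by rewrite mulr0.
case: (u < s); last by rewrite !mul0r.
rewrite mul1r size_rcons big_ord_recr/= nth_rcons ltnn eqxx mulrC; congr (_ * _).
by apply: eq_bigr => i _; rewrite nth_rcons ltn_ord.
Qed.

Lemma sorted_tupleP k (x : k.-tuple R) :
  sorted (fun a b : R => a < b) x <-> forall i j : 'I_k, (i < j)%N -> tnth x i < tnth x j.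
Proof.
split=> [sx i j ij|h].
  rewrite !(tnth_nth 0) (lt_sorted_ltn_nth 0)// inE size_tuple; exact: ltn_ord.
apply/(sortedP 0) => i; rewrite size_tuple => ik.
have := h (Ordinal (ltnW ik)) (Ordinal ik) (ltnSn i).
by rewrite !(tnth_nth 0).
Qed.

Lemma measurable_sorted k :
  measurable [set x : k.-tuple MR | sorted (fun a b : R => a < b) x].
Proof.
have -> : [set x : k.-tuple MR | sorted (fun a b : R => a < b) x] =
    \bigcap_(p in [set p : 'I_k * 'I_k | (p.1 < p.2)%N]) [set x | tnth x p.1 < tnth x p.2].
  apply/seteqP; split=> x /=.
    by move=> /sorted_tupleP h [i j] /= ij; exact: h.
  by move=> h; apply/sorted_tupleP => i j ij; exact: (h (i, j) ij).
apply: fin_bigcap_measurable; first exact: finite_finset.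
move=> [i j] _ /=.
have mB : measurable_fun setT (fun x : k.-tuple MR => tnth x j - tnth x i).
  by apply: measurable_funB; exact: measurable_tnth.
have := mB measurableT `]0, +oo[%classic (measurable_itv _); rewrite setTI.
rewrite (_ : _ @^-1` _ = [set x | tnth x i < tnth x j])//.
by apply/seteqP; split=> x /=; rewrite in_itv/= andbT subr_gt0.
Qed.

Lemma simplex_kernel_tuple g s k (x : k.-tuple R) :
  simplex_kernel g s x = (\prod_(l < k) g l (tnth x l)) *
    \1_[set y : k.-tuple MR | sorted (fun a b : R => a < b) (rcons y s)] x.
Proof.
rewrite /simplex_kernel indicE.
have -> : (x \in [set y : k.-tuple MR | sorted (fun a b : R => a < b) (rcons y s)]) =
    sorted (fun a b : R => a < b) (rcons x s) by apply/idP/idP => [/set_mem//|?]; exact/mem_set.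
case: ifP => _; last by rewrite mulr0.
rewrite mulr1 size_tuple; apply: eq_bigr => i _.
by rewrite (tnth_nth 0).
Qed.

Lemma measurable_sorted_rcons k s :
  measurable [set y : k.-tuple MR | sorted (fun a b : R => a < b) (rcons y s)].
Proof.
have mr : measurable_fun setT (fun x : k.-tuple MR => tuple_rcons ((s : MR), x)).
  by apply: (measurableT_comp (@measurable_tuple_rcons R k)); exact: measurable_fun_pair.
by have := mr measurableT _ (@measurable_sorted k.+1); rewrite setTI.
Qed.

Lemma measurable_simplex_kernel g s k : (forall l, measurable_fun setT (g l)) ->
  measurable_fun setT (fun x : k.-tuple MR => simplex_kernel g s x).
Proof.
move=> mg; under eq_fun do rewrite simplex_kernel_tuple.
apply: measurable_funM; first exact: (measurable_tuple_prod (fun l : 'I_k => mg l)).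
apply: measurable_indic; exact: measurable_sorted_rcons.
Qed.

End simplex_kernel.

(** * The iterated Ito integral as [W] of its kernel *)

Section iterated.
Context d (Omega : measurableType d) (R : realType) (P : probability Omega R) (t T : R).
Context (F : R -> set_system Omega).
Hypotheses (t0 : 0 <= t) (tT : t < T) (hF : is_filtration T F).
Context (C : R) (C0 : 0 <= C).
Local Notation E2 X := (n2 P setT X).
Local Notation leb := (@lebesgue_measure R).
Local Notation MR := (measurableTypeR R).
Context (w : nat -> R -> Omega -> R) (isoW : forall k, ito_isometric P t T F C (w k)).
Local Notation elem := (elem t w).
Local Notation cn2 := (cube_n2 t T).
Local Notation isW := (isW P t T w).
Context (g : nat -> R -> R) (mg : forall l, measurable_fun setT (g l)).
Local Notation Ker := (simplex_kernel g).

Lemma simplex_kernel_cube_meas l s : cube_meas t T l (Ker s).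
Proof. by apply: measurable_funTS; exact: measurable_simplex_kernel. Qed.

(** Elementary kernels approximating [Ker s] have sections that approximate the sections of [Ker s]
    in time average; the outer integral is then a limit of elementary integrals by [ito_limit]. By
    Tonelli only almost every section has finite norm, so finiteness is a hypothesis of the
    induction instead of a property of all upper limits. *)
Lemma iterated_isW (I_ : nat -> R -> Omega -> R) (K : nat) :
  (forall l s, (l <= K)%N -> t <= s <= T -> (cn2 l (Ker s) < +oo)%E ->
    forall e : R, 0 < e -> exists Psi Z, elem l T Psi Z /\
      (cn2 l (fun x => (Psi x - Ker s x)%R) < e%:E)%E) ->
  (forall s om, I_ 0%N s om = 1) ->
  (forall l s, (l < K)%N -> t <= s <= T ->
    is_ito_integral P F (w l) t s (fun u om => g l u * I_ l u om) (I_ l.+1 s)) ->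
  forall l s, (l <= K)%N -> t <= s <= T -> (cn2 l (Ker s) < +oo)%E -> isW l (Ker s) (I_ l s).
Proof.
move=> app I0 IS; elim=> [|l IH] s lK hs fin.
  apply: (isW_elem t0 tT hF isoW) => /=.
  by apply/funext => om; rewrite I0 /simplex_kernel/= big_ord0.
have /andP[ts sT] := hs.
have ito := IS l s lK hs.
have [[[mxi _] _] _] := ito.
have mKer : cube_meas t T l.+1 (Ker s) by exact: simplex_kernel_cube_meas.
have en0 n : 0 < n.+1%:R^-1 :> R by rewrite invr_gt0.
have appn n := app l.+1 s lK hs fin _ (en0 n).
pose Phi n := projT1 (cid (appn n)).
have hPhi n : exists Z, elem l.+1 T (Phi n) Z /\
    (cn2 l.+1 (fun x => (Phi n x - Ker s x)%R) < n.+1%:R^-1%:E)%E by rewrite /Phi; case: cid.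
pose Z n := projT1 (cid (hPhi n)).
have ZP n : elem l.+1 T (Phi n) (Z n) /\
    (cn2 l.+1 (fun x => (Phi n x - Ker s x)%R) < n.+1%:R^-1%:E)%E by rewrite /Z; case: cid.
have mPhi n : cube_meas t T l.+1 (Phi n) by exact: elem_cube_meas (ZP n).1.
have cPhi : (fun n => cn2 l.+1 (fun x => (Phi n x - Ker s x)%R)) @ \oo --> 0%E.
  apply: (@cvg0_le _ _ _ _ _ (fun n => (n.+1%:R^-1 : R)%:E)).
  - by move=> n; exact: cube_n2_ge0.
  - by apply: nearW => n; exact/ltW/(ZP n).2.
  - by apply: cvg_EFin; [exact: nearW|exact: cvg_harmonic].
have fam n := elem_family t0 hF isoW (lexx T) (ZP n).1.
pose J n := projT1 (cid (fam n)).
have fam1 n : exists (al be : J n -> R) (Y_ : J n -> Omega -> R),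
    [/\ adapted_family P t T F al be Y_, Z n = family_integral (w l) al be Y_ &
      forall u, elem l T (fun x => Phi n (rcons x u)) (family_value al be Y_ u)].
  by rewrite /J; case: cid.
pose al n := projT1 (cid (fam1 n)).
have fam2 n : exists (be : J n -> R) (Y_ : J n -> Omega -> R),
    [/\ adapted_family P t T F (al n) be Y_, Z n = family_integral (w l) (al n) be Y_ &
      forall u, elem l T (fun x => Phi n (rcons x u)) (family_value (al n) be Y_ u)].
  by rewrite /al; case: cid.
pose be n := projT1 (cid (fam2 n)).
have fam3 n : exists (Y_ : J n -> Omega -> R),
    [/\ adapted_family P t T F (al n) (be n) Y_, Z n = family_integral (w l) (al n) (be n) Y_ &
      forall u, elem l T (fun x => Phi n (rcons x u)) (family_value (al n) (be n) Y_ u)].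
  by rewrite /be; case: cid.
pose Y_ n := projT1 (cid (fam3 n)).
have famP n : [/\ adapted_family P t T F (al n) (be n) (Y_ n),
    Z n = family_integral (w l) (al n) (be n) (Y_ n) &
    forall u, elem l T (fun x => Phi n (rcons x u)) (family_value (al n) (be n) (Y_ n) u)].
  by rewrite /Y_; case: cid.
pose xi u om := g l u * I_ l u om.
pose x1 u om := \1_(`[t, s]) u * xi u om.
have mx1 : measurable_fun setT (fun z : MR * Omega => x1 z.1 z.2) by exact: measurable_cut_process mxi.
have fin_ae : {ae leb, forall u, `[t, T]%classic u -> (cn2 l (fun x => Ker s (rcons x u)) < +oo)%E}.
  have ih : leb.-integrable `[t, T] (fun u => cn2 l (fun x => Ker s (rcons x u))).
    apply/integrableP; split; first exact: cube_n2_rcons_measurable mKer.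
    under eq_integral do rewrite gee0_abs ?cube_n2_ge0//.
    by rewrite -cube_n2_rcons.
  have mtT : measurable (`[t, T]%classic : set MR) by exact: measurable_itv.
  have := integrable_ae mtT ih.
  by apply: filterS => u h /h; rewrite ge0_fin_numE// cube_n2_ge0.
(* At [u = s] the kernel, which is strict, and the cut-off to the closed interval may disagree; this
   is a null set. *)
have nes_ae : {ae leb, forall u : MR, u != s}.
  exists [set s]; split => //; first exact: lebesgue_measure_set1.
  by move=> u /=/negP; rewrite negbK => /eqP.
(* For almost every [u] the family and the cut-off integrand are [W] of the sections of [Phi n] and
   of [Ker s], which [isW_bound] compares. *)
have key n : {ae leb, forall u, `[t, T]%classic u ->
    (E2 (fun om => (family_value (al n) (be n) (Y_ n) u om - x1 u om)%R) <=
     (4 * C ^+ l)%:E * cn2 l (fun x => (Phi n (rcons x u) - Ker s (rcons x u))%R))%E}.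
  apply: (@filterS2 _ _ (ae_filter_ringOfSetsType leb) _ _ _ _ fin_ae nes_ae) => u finu us hu.
  have [_ _ /(_ u) helu] := famP n.
  have := hu; rewrite /= in_itv/= => hu'.
  have /andP[tu uT] := hu'.
  apply: (isW_bound t0 tT hF C0 isoW); apply: (isWB t0 tT hF isoW).
    exact: (isW_elem t0 tT hF isoW).
  have kE x : size x = l -> (u < s)%R%:R * g l u * Ker u x = Ker s (rcons x u).
    by move=> xl; rewrite simplex_kernel_rcons xl.
  apply: (isW_ext kE).
  have [us'|su] := ltP u s; last first.
    rewrite (_ : (fun x => _) = fun _ => 0); last by apply/funext => x; rewrite !mul0r.
    rewrite (_ : x1 u = fun _ => 0); first exact: (isW0 t0 tT hF isoW).
    apply/funext => om; rewrite /x1 indicE mem_setE in_itv/=.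
    have lt_su : s < u by rewrite lt_neqAle su andbT; apply: contra us => /eqP ->.
    by rewrite [u <= s]leNgt lt_su andbF mul0r.
  have -> : x1 u = fun om => g l u * I_ l u om.
    by apply/funext => om; rewrite /x1 indicE mem_setE in_itv/= tu (ltW us') mul1r.
  rewrite (_ : (fun x => _) = fun x => g l u * Ker u x); last by apply/funext => x; rewrite mul1r.
  (* Where the weight vanishes, the section says nothing about the norm of [Ker u], but both sides
     are zero. *)
  have [->|gu0] := eqVneq (g l u) 0.
    rewrite (_ : (fun x => _) = fun _ => 0); last by apply/funext => x; rewrite mul0r.
    rewrite (_ : (fun om => _) = fun _ => 0); last by apply/funext => x; rewrite mul0r.
    exact: (isW0 t0 tT hF isoW).
  apply: (isWZ t0 tT hF isoW); apply: IH; [exact: ltnW|by []|].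
  (* Dividing by the nonzero weight, finiteness passes from the section of [Ker s] to [Ker u], as
     the induction hypothesis requires. *)
  have kE2 : cn2 l (fun x => Ker s (rcons x u)) = (((g l u) ^+ 2)%:E * cn2 l (Ker u))%E.
    rewrite /cube_n2 -(n2Z _ (@measurable_cube R t T l)); last exact: simplex_kernel_cube_meas.
    by apply: eq_integral => x _; rewrite -(kE x) ?size_tuple// us' mul1r.
  have := finu hu; rewrite kE2 !ltey; apply: contra => /eqP ->.
  by rewrite gt0_muley// lte_fin exprn_even_gt0.
have cfam : (fun n => \int[leb]_(u in `[t, T])
    E2 (fun om => (family_value (al n) (be n) (Y_ n) u om - \1_(`[t, s]) u * xi u om)%R))%E @ \oo --> 0%E.
  apply: (@cvg0_le _ _ _ _ _ (fun n => (4 * C ^+ l)%:E * cn2 l.+1 (fun x => (Phi n x - Ker s x)%R))%E).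
  - by move=> n; apply: integral_ge0 => u _; exact: n2_ge0.
  - apply: nearW => n.
    have mB : cube_meas t T l.+1 (fun x => Phi n x - Ker s x) by exact: cube_measB.
    rewrite (cube_n2_rcons mB) -ge0_integralZl_EFin//; last 3 first.
    + by move=> u _; exact: cube_n2_ge0.
    + exact: (cube_n2_rcons_measurable mB).
    + by rewrite mulr_ge0// exprn_ge0.
    apply: ae_ge0_le_integral.
    + exact: measurable_itv.
    + by move=> u _; exact: n2_ge0.
    + apply: measurable_funTS; apply: (@measurable_process_n2 _ _ _ P
        (fun u om => family_value (al n) (be n) (Y_ n) u om - x1 u om)).
      apply: measurable_funB => //.
      by have [fY _ _] := famP n; exact: measurable_family_value t0 hF _ _ _ _ fY.
    + by move=> u _; rewrite mule_ge0 ?cube_n2_ge0// lee_fin mulr_ge0// exprn_ge0.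
    + by apply: measurable_funeM; exact: (cube_n2_rcons_measurable mB).
    + exact: key.
  - exact: cvg0Z.
(* The [Z n] are integrals of families converging to the integrand, so their limit is the given
   version of the integral. *)
have cZ : (fun n => E2 (fun om => (Z n om - I_ l.+1 s om)%R)) @ \oo --> 0%E.
  have := ito_limit t0 tT hF C0 (isoW l) (lexx t) sT ito (fun n => let: And3 h _ _ := famP n in h) cfam.
  by under eq_fun => n do (have [_ <- _] := famP n).
split => //; first by have [_ [X [_ _ [_ mI _]]]] := ito.
move=> e e0.
have [N1 _ h1] := (ge0_cvg0P _ (fun n => cube_n2_ge0 t T l.+1 _)).1 cPhi e e0.
have [N2 _ h2] := (ge0_cvg0P _ (fun n => n2_ge0 P setT _)).1 cZ e e0.
exists (Phi (N1 + N2)%N), (Z (N1 + N2)%N); split; first exact: (ZP _).1.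
  by apply: h1; rewrite /= leq_addr.
by apply: h2; rewrite /= leq_addl.
Qed.

End iterated.

(** * Sampling along partitions *)

Lemma n2_dominated_cvg d (T : measurableType d) (R : realType) (mu : {measure set T -> \bar R})
    (D : set T) (mD : measurable D) (f : nat -> T -> R) (f0 G : T -> R) :
  (forall n, measurable_fun D (f n)) -> measurable_fun D f0 ->
  mu.-integrable D (EFin \o G) ->
  (forall n x, D x -> (f n x - f0 x) ^+ 2 <= G x) ->
  {ae mu, forall x, D x -> f ^~ x @ \oo --> f0 x} ->
  (fun n => n2 mu D (fun x => (f n x - f0 x)%R)) @ \oo --> 0%E.
Proof.
move=> mf mf0 iG fG cf.
have mF n : measurable_fun D (fun x => ((f n x - f0 x) ^+ 2)%:E : \bar R).
  by apply: measurable_sqr_EFin; exact: measurable_funB.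
have cF : {ae mu, forall x, D x ->
    (fun n => ((f n x - f0 x) ^+ 2)%:E : \bar R) @ \oo --> 0%E}.
  move: cf; apply: filterS => x /[apply] cf.
  apply: cvg_EFin; first exact: nearW.
  have : (fun n => (f n x - f0 x) * (f n x - f0 x)) @ \oo --> (f0 x - f0 x) * (f0 x - f0 x).
    by apply: cvgM; apply: cvgB => //; exact: cvg_cst.
  by rewrite subrr mulr0; apply: cvg_trans; apply: near_eq_cvg; apply: nearW => n /=; rewrite expr2.
have bF : {ae mu, forall x n, D x -> (`|((f n x - f0 x) ^+ 2)%:E| <= (EFin \o G) x)%E}.
  by apply: aeW => x n Dx; rewrite /= lee_fin ger0_norm ?sqr_ge0// fG.
have [_ _] := dominated_convergence mD mF (measurable_cst 0%E) cF iG bF.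
by rewrite integral0.
Qed.

Lemma integrable_cst_itv (R : realType) (t T c : R) :
  (@lebesgue_measure R).-integrable `[t, T] (EFin \o cst c).
Proof.
have mtT : measurable (`[t, T]%classic : set (measurableTypeR R)) by exact: measurable_itv.
apply/integrableP; split; first by apply/measurable_EFinP; exact: measurable_cst.
have := integral_cst (@lebesgue_measure R) mtT `|c|%:E => /= ->.
rewrite lebesgue_measure_itv/=; case: ifP => _; last by rewrite mule0 ltry.
by rewrite -EFinB -EFinM ltry.
Qed.

Section partitions.
Context (R : realType) (t T : R) (tau : nat -> nat -> R).
Hypotheses (tT : t < T) (htau : is_partition_seq t T tau).
Local Notation MR := (measurableTypeR R).
Local Notation leb := (@lebesgue_measure R).

Lemma part_mono N p q : (p <= q)%N -> (q <= N)%N -> tau N p <= tau N q.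
Proof.
move=> pq; elim: q pq => [|q IH]; first by rewrite leqn0 => /eqP ->.
rewrite leq_eqVlt => /orP[/eqP -> //|pq qN].
apply: le_trans (IH pq (ltnW qN)) _; exact/ltW/(part_incr htau).
Qed.

Lemma part_in N q : (0 < N)%N -> (q <= N)%N -> t <= tau N q <= T.
Proof.
move=> N0 qN; apply/andP; split.
  by rewrite -(part_start htau N0); exact: part_mono.
by rewrite -(part_end htau N0); exact: part_mono.
Qed.

Definition mesh N := \big[Num.max/0]_(j < N) (tau N j.+1 - tau N j).

Lemma mesh_ge N q : (q < N)%N -> tau N q.+1 - tau N q <= mesh N.
Proof. by move=> qN; exact: (le_bigmax 0 (fun j : 'I_N => tau N j.+1 - tau N j) (Ordinal qN)). Qed.

(** The index of the cell containing [u]. It is [N] at [u = T], which lies in no half-open cell. *)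
Definition part_idx N u := find (fun q => u < tau N q.+1) (iota 0 N).

Lemma part_idx_le N u : (part_idx N u <= N)%N.
Proof. by rewrite -{2}(size_iota 0 N); exact: find_size. Qed.

Lemma part_idx_min N u q : (q < N)%N -> u < tau N q.+1 -> (part_idx N u <= q)%N.
Proof.
move=> qN uq; rewrite leqNgt; apply/negP => /(before_find 0%N).
by rewrite nth_iota// add0n uq.
Qed.

Lemma part_idx_lt N u : (part_idx N u < N)%N -> u < tau N (part_idx N u).+1.
Proof.
move=> h; have hs : has (fun q => u < tau N q.+1) (iota 0 N) by rewrite has_find size_iota.
by have := nth_find 0%N hs; rewrite nth_iota.
Qed.

Lemma part_idxP N u q : (q < N)%N -> t <= u -> (tau N q <= u < tau N q.+1) = (q == part_idx N u).
Proof.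
move=> qN tu; apply/idP/eqP => [/andP[qu uq]|qE].
  apply/eqP; rewrite eqn_leq andbC part_idx_min//= leqNgt; apply/negP => iq.
  have iN : (part_idx N u < N)%N by exact: ltn_trans qN.
  have := lt_le_trans (part_idx_lt iN) (part_mono iq (ltnW qN)).
  by rewrite ltNge qu.
have iN : (part_idx N u < N)%N by rewrite -qE.
rewrite {2}qE (part_idx_lt iN) andbT.
case: q qN qE => [|q] qN qE; first by rewrite (part_start htau).
have : (q < part_idx N u)%N by rewrite -qE.
move=> /(before_find 0%N); rewrite nth_iota ?add0n; last exact: ltnW.
by move=> /negbT; rewrite -leNgt.
Qed.

Lemma part_idx_mono N u v : u <= v -> (part_idx N u <= part_idx N v)%N.
Proof.
move=> uv; have [vN|] := ltnP (part_idx N v) N; last exact: leq_trans (part_idx_le _ _).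
by apply: part_idx_min => //; apply: le_lt_trans uv _; exact: part_idx_lt.
Qed.

Lemma part_idx_end N : part_idx N T = N.
Proof.
apply/eqP; rewrite eqn_leq part_idx_le leqNgt; apply/negP => h.
have N0 : (0 < N)%N by exact: leq_ltn_trans h.
have := part_idx_lt h; have /andP[_] := part_in N0 h.
by move=> /le_lt_trans h' /h'; rewrite ltxx.
Qed.

(** Points further apart than the mesh cannot share a cell. *)
Lemma part_idx_strict N u v : (0 < N)%N -> t <= u -> v <= T -> mesh N < v - u ->
  (part_idx N u < part_idx N v)%N.
Proof.
move=> N0 tu vT muv.
have m0 : 0 <= mesh N by exact: bigmax_ge_id.
have uv : u < v by rewrite -subr_gt0; exact: le_lt_trans muv.
have uN : (part_idx N u < N)%N.
  have uT := lt_le_trans uv vT.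
  have p0 : (N.-1 < N)%N by rewrite prednK.
  have : u < tau N N.-1.+1 by rewrite prednK// (part_end htau).
  by move=> /(part_idx_min p0)/leq_ltn_trans; exact.
rewrite ltnNge; apply/negP => vu.
have vN := leq_ltn_trans vu uN.
have h1 := lt_le_trans (part_idx_lt vN) (part_mono (vu : (_.+1 <= _.+1)%N) uN).
have h2 := mesh_ge uN.
have : tau N (part_idx N u) <= u < tau N (part_idx N u).+1 by rewrite part_idxP.
by move=> /andP[h3 _]; lra.
Qed.

Lemma mesh_cvg : mesh @ \oo --> (0 : R).
Proof. exact: part_mesh htau. Qed.

(** Lets the indicator of increasing cell indices converge pointwise to that of strictly increasing
    coordinates, also on the diagonals. *)
Lemma part_idx_cvg u v : t <= u <= T -> t <= v <= T ->
  \forall N \near \oo, (part_idx N u < part_idx N v)%N = (u < v).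
Proof.
move=> /andP[tu uT] /andP[tv vT]; have [uv|vu] := ltP u v; last first.
  by apply: nearW => N; apply/negbTE; rewrite -leqNgt part_idx_mono.
have d0 : 0 < v - u by rewrite subr_gt0.
have := mesh_cvg => /cvgr_lt /(_ _ d0) h.
near=> N; apply/idP; apply: part_idx_strict => //; first by near: N; exact: nbhs_infty_gt.
by near: N; exact: h.
Unshelve. all: by end_near. Qed.

Definition sample N (h : R -> R) u : R :=
  \sum_(q < N) h (tau N q) * \1_(`[tau N q, tau N q.+1[) u.

Lemma part_indicE N q u : (q < N)%N -> t <= u ->
  \1_(`[tau N q, tau N q.+1[) u = (q == part_idx N u)%:R :> R.
Proof. by move=> qN tu; rewrite indicE mem_setE in_itv/= part_idxP. Qed.

Lemma sampleE N h u : t <= u ->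
  sample N h u = if (part_idx N u < N)%N then h (tau N (part_idx N u)) else 0.
Proof.
move=> tu; rewrite /sample.
under eq_bigr => q _ do rewrite part_indicE//.
case: ltnP => [iN|Ni].
  rewrite (bigD1 (Ordinal iN))//= eqxx mulr1 big1 ?addr0// => q qi.
  by rewrite (_ : _ == _ = false) ?mulr0//; apply: contraNF qi => /eqP h1; apply/eqP/val_inj.
rewrite big1// => q _; rewrite (_ : _ == _ = false) ?mulr0//.
by apply/negbTE; rewrite neq_ltn (leq_trans (ltn_ord q) Ni).
Qed.

Lemma measurable_sample N h : measurable_fun setT (sample N h : MR -> R).
Proof.
apply: measurable_sum => q; apply: measurable_funM; first exact: measurable_cst.
exact: measurable_indic.
Qed.

(** Boundedness and continuity off finitely many points make the left-end-point samples converge in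
    L2, by dominated convergence. *)
Definition sampleable (h : R -> R) :=
  [/\ measurable_fun `[t, T] (h : MR -> R), exists M, forall x, t <= x <= T -> `|h x| <= M &
    exists D : seq R, forall x, x \in `[t, T] -> x \notin D -> h @ within `[t, T] (nbhs x) --> h x].

Lemma sampleable_n2_lty h : sampleable h -> (n2 leb `[t, T] h < +oo)%E.
Proof.
move=> [mh [M hM] _].
apply: (@le_lt_trans _ _ (n2 leb `[t, T] (cst M))).
  apply: n2_le => // x /=; rewrite in_itv/= => hx.
  by rewrite -[h x ^+ 2]real_normK ?num_real// ler_pXn2r ?nnegrE// ?hM// (le_trans _ (hM x hx)).
have /integrableP[_] := integrable_cst_itv t T (M ^+ 2).
by under eq_integral do rewrite /= ger0_norm ?sqr_ge0//.
Qed.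

Lemma sample_cvg (h : R -> R) x : t <= x < T ->
  ((h : R -> R) @ within `[t, T] (nbhs x) --> h x) -> (fun N => sample N h x) @ \oo --> h x.
Proof.
move=> /andP[tx xT] ch; apply/cvgrPdist_lt => /= e e0.
have /cvgrPdist_lt /(_ e e0) := ch.
rewrite near_withinE => /nbhs_ballP [dl /= dl0 hdl].
have := mesh_cvg => /cvgr_lt /(_ _ dl0) hm.
near=> N.
have N0 : (0 < N)%N by near: N; exact: nbhs_infty_gt.
have mN : mesh N < dl by near: N; exact: hm.
have iN : (part_idx N x < N)%N.
  have p0 : (N.-1 < N)%N by rewrite prednK.
  have : x < tau N N.-1.+1 by rewrite prednK// (part_end htau).
  by move=> /(part_idx_min p0)/leq_ltn_trans; exact.
rewrite sampleE// iN.
have /andP[h1 h2] : tau N (part_idx N x) <= x < tau N (part_idx N x).+1 by rewrite part_idxP.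
have h3 := mesh_ge iN.
apply: hdl; last by rewrite /= in_itv/= part_in// ltnW.
by rewrite /ball/= ger0_norm ?subr_ge0//; lra.
Unshelve. all: by end_near. Qed.

(** The shift to [N.+1] skips [tau 0], which is not constrained. The samples converge except at the
    points of [D] and at [T]. *)
Lemma sample_n2_cvg h : sampleable h ->
  (fun N => n2 leb `[t, T] (fun x => (sample N.+1 h x - h x)%R)) @ \oo --> 0%E.
Proof.
move=> [mh [M hM] [D hD]].
have M0 : 0 <= M by apply: le_trans (normr_ge0 (h t)) (hM t _); rewrite lexx ltW.
apply: (@n2_dominated_cvg _ _ _ leb `[t, T]%classic _ _ _ (cst ((M + M) ^+ 2))).
- exact: measurable_itv.
- by move=> N; apply: measurable_funTS; exact: measurable_sample.
- exact: mh.
- exact: integrable_cst_itv.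
- move=> N x /=; rewrite in_itv/= => /andP[tx xT].
  rewrite -real_normK ?num_real// ler_pXn2r ?nnegrE ?addr_ge0//.
  apply: le_trans (ler_normB _ _) _; apply: lerD; last by rewrite hM// tx.
  by rewrite sampleE//; case: ltnP => iN; rewrite ?normr0// hM// part_in// ltnW.
have cD : countable (T |` [set` D]).
  by apply: finite_set_countable; rewrite finite_setU; split; [exact: finite_set1|exact: finite_seq].
exists (T |` [set` D]); split.
- by apply: countable_measurable => // x; exact: measurable_set1.
- exact: countable_lebesgue_measure0.
move=> x /= /not_implyP[+ nc]; rewrite in_itv/= => /andP[tx xT].
apply: contrapT => /not_orP[xnT xD]; apply: nc.
have xltT : x < T by rewrite lt_neqAle xT andbT; apply/eqP.
have := @sample_cvg h x; rewrite tx xltT => /(_ isT (hD _ _ _)).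
rewrite in_itv/= tx xT => /(_ isT); have -> : x \notin D by apply/negP.
by move=> /(_ isT); rewrite -(cvg_shiftS (fun N => sample N h x)).
Qed.

End partitions.

(** The one-sided limits bound the function on each side of every point, and compactness of [[t, T]]
    makes the local bounds uniform. *)
Lemma right_cont_jump_bounded (R : realType) (t T : R) (h : R -> R) : right_cont_jump t T h ->
  exists M, forall x, t <= x <= T -> `|h x| <= M.
Proof.
move=> [_ hl hr].
have cpt := @segment_compact R t T.
move/compact_near_coveringP : cpt => /(_ R +oo (fun M x => t <= x <= T -> `|h x| <= M) _).
have key (x : R) : t <= x <= T -> exists B : R, \forall x' \near x, t <= x' <= T -> `|h x'| <= B.
  move=> /andP[tx xT].
  have [B1 h1] : exists B : R, \forall x' \near x, x' < x -> t <= x' <= T -> `|h x'| <= B.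
    move: tx; rewrite le_eqVlt => /orP[/eqP tE|tx].
      exists 0; near=> x' => x'x /andP[tx' _].
      by move: (le_lt_trans tx' x'x); rewrite tE ltxx.
    have /cvg_ex[l /= /cvgrPdist_lt /(_ 1 ltr01)] := hl x (introT andP (conj tx xT)).
    rewrite near_withinE => cl; exists (`|l| + 1); move: cl; apply: filterS => x' + x'x _.
    move=> /(_ x'x) h1; rewrite -[h x'](subKr l) (le_trans (ler_normB _ _))// lerD2l ltW//.
  have [B2 h2] : exists B : R, \forall x' \near x, x < x' -> t <= x' <= T -> `|h x'| <= B.
    move: xT; rewrite le_eqVlt => /orP[/eqP tE|xT].
      exists 0; near=> x' => x'x /andP[_ x'T].
      by move: (lt_le_trans x'x x'T); rewrite tE ltxx.
    have /cvgrPdist_lt /(_ 1 ltr01) := hr x (introT andP (conj tx xT)).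
    rewrite near_withinE => cl; exists (`|h x| + 1); move: cl; apply: filterS => x' + x'x _.
    move=> /(_ x'x) h2; rewrite -[h x'](subKr (h x)) (le_trans (ler_normB _ _))// lerD2l ltW//.
  exists (Num.max B1 (Num.max B2 `|h x|)); near=> x' => hx'.
  rewrite !le_max; have [x'x|xx'|->] := ltgtP x' x; last by rewrite lexx !orbT.
    by apply/orP; left; move: x'x hx'; near: x'.
  by apply/orP; right; apply/orP; left; move: xx' hx'; near: x'.
case => [x xD|M [_ hM]].
  move: xD; rewrite /= in_itv/= => xD; have [B hB] := key x xD.
  exists ([set x' | t <= x' <= T -> `|h x'| <= B], [set i | B <= i]).
    by split => //=; exact: nbhs_pinfty_ge (num_real _).
  by move=> [x' i] /= [h1 h2] hx'; exact: le_trans (h1 hx') h2.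
exists (M + 1) => x hx; have M1 : M < M + 1 by rewrite ltrDl.
have hx' : `[t, T]%classic x by rewrite /= in_itv.
exact: (hM _ M1 x hx' hx).
Unshelve. all: by end_near. Qed.

(** * Tensor products of functions of one variable *)

Section tensors.
Context (R : realType) (t T : R) (tT : t < T).
Local Notation MR := (measurableTypeR R).
Local Notation leb := (@lebesgue_measure R).
Local Notation cn2 := (cube_n2 t T).
Implicit Types (g f : nat -> R -> R).

Definition tens g (x : seq R) := \prod_(a < size x) g a (nth 0 x a).

Lemma tens_tuple g k (x : k.-tuple R) : tens g x = \prod_(l < k) g l (tnth x l).
Proof. by rewrite /tens size_tuple; apply: eq_bigr => i _; rewrite (tnth_nth 0). Qed.

Lemma simplex_kernelE g s x :
  simplex_kernel g s x = (sorted (fun a b : R => a < b) (rcons x s))%:R * tens g x.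
Proof. by rewrite /simplex_kernel; case: ifP => _; rewrite ?mul1r ?mul0r. Qed.

Definition L2on (h : R -> R) := measurable_fun `[t, T] (h : MR -> R) /\ (n2 leb `[t, T] h < +oo)%E.

Lemma measurable_cube_tnth k (l : 'I_k) (h : R -> R) : measurable_fun `[t, T] (h : MR -> R) ->
  measurable_fun (cube t T k) (fun x : k.-tuple MR => h (tnth x l)).
Proof.
move=> mh; change (measurable_fun (cube t T k) ((h : MR -> R) \o (fun x : k.-tuple MR => tnth x l))).
apply: (@measurable_comp _ _ _ _ _ _ (`[t, T]%classic : set MR)) => //.
- by move=> _ [x xc <-]; rewrite /= in_itv/=; exact: xc.
- apply: measurable_funTS; exact: measurable_tnth.
Qed.

Lemma tens_cube_meas k g : (forall l, (l < k)%N -> measurable_fun `[t, T] (g l : MR -> R)) ->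
  cube_meas t T k (tens g).
Proof.
move=> mg; rewrite /cube_meas; under eq_fun do rewrite tens_tuple.
by apply: measurable_prod => l _; apply: measurable_cube_tnth; exact: mg.
Qed.

Lemma tens_n2_sub k f g : (forall l, (l < k)%N -> L2on (f l)) -> (forall l, (l < k)%N -> L2on (g l)) ->
  cn2 k (fun x => tens f x - tens g x) =
  ((\prod_(l < k) \int[leb]_(u in `[t, T]) (f l u * f l u)) -
   2 * (\prod_(l < k) \int[leb]_(u in `[t, T]) (f l u * g l u)) +
   \prod_(l < k) \int[leb]_(u in `[t, T]) (g l u * g l u))%:E.
Proof.
move=> hf hg.
have mtT : measurable (`[t, T]%classic : set MR) by exact: measurable_itv.
have iM h1 h2 : L2on h1 -> L2on h2 -> leb.-integrable `[t, T] (EFin \o (fun u => h1 u * h2 u)).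
  by move=> [? ?] [? ?]; exact: n2_integrableM.
have [iff ffE] := cube_prod_integral (fun l : 'I_k => iM _ _ (hf l (ltn_ord l)) (hf l (ltn_ord l))).
have [ifg fgE] := cube_prod_integral (fun l : 'I_k => iM _ _ (hf l (ltn_ord l)) (hg l (ltn_ord l))).
have [igg ggE] := cube_prod_integral (fun l : 'I_k => iM _ _ (hg l (ltn_ord l)) (hg l (ltn_ord l))).
have mc := @measurable_cube R t T k.
have ifg2 : (lebesgue_tuple R k).-integrable (cube t T k)
    (EFin \o (fun x => 2 * \prod_(l < k) (f l (tnth x l) * g l (tnth x l)))).
  by apply: (eq_integrable mc (fun x => 2%:E * (\prod_(l < k) (f l (tnth x l) * g l (tnth x l)))%:E)%E) => //; exact: integrableZl.
have iB := integrableB mc iff ifg2.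
have iD := integrableD mc iB igg.
have fgE2 := RintegralZl 2 mc ifg.
rewrite -ffE -fgE -ggE /cube_n2 -fgE2 -(RintegralB mc iff ifg2) -(RintegralD mc iB igg).
rewrite /Rintegral fineK; last by have := integrable_fin_num mc iD; exact.
by apply: eq_integral => x _; congr EFin; rewrite !tens_tuple !big_split/=; ring.
Qed.

Lemma cvg_prod_ord (I : Type) (F : set_system I) (FF : Filter F) k (u : 'I_k -> I -> R) (a : 'I_k -> R) :
  (forall l, u l @ F --> a l) -> (fun i => \prod_(l < k) u l i) @ F --> \prod_(l < k) a l.
Proof.
elim: k u a => [|k IH] u a cu.
  by rewrite big_ord0; under eq_fun do rewrite big_ord0; exact: cvg_cst.
rewrite big_ord_recl; under eq_fun do rewrite big_ord_recl.
by apply: cvgM; [exact: cu|apply: IH => l; exact: cu].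
Qed.

(** The squared distance expands into three products of one-dimensional inner products, and each
    inner product converges. *)
Lemma tens_cvg (I : Type) (F : set_system I) (FF : Filter F) k (f : I -> nat -> R -> R) g :
  (forall i l, (l < k)%N -> L2on (f i l)) -> (forall l, (l < k)%N -> L2on (g l)) ->
  (forall l, (l < k)%N -> (fun i => n2 leb `[t, T] (fun u => (f i l u - g l u)%R)) @ F --> 0%E) ->
  (fun i => cn2 k (fun x => (tens (f i) x - tens g x)%R)) @ F --> 0%E.
Proof.
move=> hf hg cf.
have mtT : measurable (`[t, T]%classic : set MR) by exact: measurable_itv.
have nE i := tens_n2_sub (hf i) hg.
under eq_fun do rewrite nE.
apply: cvg_EFin; first exact: nearW.
pose G := \prod_(l < k) \int[leb]_(u in `[t, T]) (g l u * g l u).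
have cfg h (l : 'I_k) : L2on h -> (fun i => \int[leb]_(u in `[t, T]) (f i l u * h u)) @ F -->
    \int[leb]_(u in `[t, T]) (g l u * h u).
  move=> [mh h2]; apply: Rintegral_mul_cvg => //; [by move=> i; exact: (hf i l _).1|exact: (hg l _).1|exact: (hg l _).2|exact: cf].
have cff (l : 'I_k) : (fun i => \int[leb]_(u in `[t, T]) (f i l u * f i l u)) @ F -->
    \int[leb]_(u in `[t, T]) (g l u * g l u).
  have E i : \int[leb]_(u in `[t, T]) (f i l u * f i l u) =
      fine (n2 leb `[t, T] (fun u => (f i l u - g l u)%R)) +
      2 * \int[leb]_(u in `[t, T]) (f i l u * g l u) - \int[leb]_(u in `[t, T]) (g l u * g l u).
    have lk := ltn_ord l.
    have [mf f2] := hf i l lk; have [mg g2] := hg l lk.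
    have i1 := n2_integrableM mtT mf mf f2 f2.
    have i2 := n2_integrableM mtT mf mg f2 g2.
    have i3 := n2_integrableM mtT mg mg g2 g2.
    have i2' : leb.-integrable `[t, T] (EFin \o (fun u => 2 * (f i l u * g l u))).
      by apply: (eq_integrable mtT (fun u => 2%:E * (f i l u * g l u)%:E)%E) => //; exact: integrableZl.
    have -> : fine (n2 leb `[t, T] (fun u => (f i l u - g l u)%R)) =
        \int[leb]_(u in `[t, T]) (f i l u * f i l u - 2 * (f i l u * g l u) + g l u * g l u).
      by rewrite /Rintegral; congr fine; apply: eq_integral => u _; congr EFin; ring.
    have iB := integrableB mtT i1 i2'.
    rewrite RintegralD// RintegralB// RintegralZl//; ring.
  under eq_fun do rewrite E.
  set Q := \int[leb]_(u in _) _.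
  suff : (fun i => fine (n2 leb `[t, T] (fun u => (f i l u - g l u)%R)) +
      2 * \int[leb]_(u in `[t, T]) (f i l u * g l u) - Q) @ F --> 0 + 2 * Q - Q.
    by rewrite (_ : 0 + 2 * Q - Q = Q)//; ring.
  apply: cvgB; last exact: cvg_cst.
  apply: cvgD; first exact: (fine_cvg (cf l (ltn_ord l))).
  by apply: cvgM; [exact: cvg_cst|exact: cfg (hg l (ltn_ord l))].
have c1 : (fun i => \prod_(l < k) \int[leb]_(u in `[t, T]) (f i l u * f i l u)) @ F --> G.
  exact: cvg_prod_ord cff.
have c2 : (fun i => \prod_(l < k) \int[leb]_(u in `[t, T]) (f i l u * g l u)) @ F --> G.
  by apply: cvg_prod_ord => l; exact: cfg (hg l (ltn_ord l)).
rewrite (_ : 0 = G - 2 * G + G); last by ring.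
apply: cvgD; last exact: cvg_cst.
by apply: cvgB => //; apply: cvgM => //; exact: cvg_cst.
Qed.

End tensors.

(** * Ordered sums over a partition *)

Section ordered_sums.
Context (R : realType).
Local Notation MR := (measurableTypeR R).
Local Notation leb := (@lebesgue_measure R).
Implicit Types (th : nat -> nat -> R).

(** The sum over [q_0 < ... < q_(k-1) < n] of the product of the [th b q_b], written with its
    largest index outermost to match the recursion of [elem]. *)
Fixpoint osum k n th : R :=
  match k with
  | 0 => 1
  | k'.+1 => \sum_(q < n) th k' q * osum k' q th
  end.

Lemma osum_ext k n th th' : (forall b q, (b < k)%N -> (q < n)%N -> th b q = th' b q) ->
  osum k n th = osum k n th'.
Proof.
elim: k n => [//|k IH] n E /=; apply: eq_bigr => q _; rewrite E//.
by congr (_ * _); apply: IH => b p bk pq; apply: E; [exact: ltnW|exact: ltn_trans (ltn_ord q)].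
Qed.

Context (t T : R) (tau : nat -> nat -> R).
Hypotheses (tT : t < T) (htau : is_partition_seq t T tau).

Definition cell N (x : seq R) b q : R := \1_(`[tau N q, tau N q.+1[) (nth 0 x b).
Local Notation sample := (sample tau).

(** The indicator of a cell freezes the value of [h b] to its sample, which no longer depends on the
    index and leaves the sum. *)
Lemma osum_sample N (h : nat -> R -> R) x k n : (n <= N)%N -> (forall b, (b < k)%N -> t <= nth 0 x b) ->
  osum k n (fun b q => h b (tau N q) * cell N x b q) =
  (\prod_(b < k) sample N (h b) (nth 0 x b)) * osum k n (cell N x).
Proof.
elim: k n => [|k IH] n nN tx /=; first by rewrite big_ord0 mulr1.
rewrite big_ord_recr/= mulr_sumr; apply: eq_bigr => q _.
have qN : (q < N)%N by exact: leq_trans (ltn_ord q) nN.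
rewrite IH; [|exact: ltnW|by move=> b bk; apply: tx; exact: ltnW].
have -> : h k (tau N q) * cell N x k q = sample N (h k) (nth 0 x k) * cell N x k q.
  rewrite /cell (part_indicE htau)//; last exact: tx.
  rewrite (sampleE htau)//; last exact: tx.
  by case: eqP => [<-|_]; rewrite ?mulr0// qN.
by ring.
Qed.

(** Only the multi-index formed by the cells of the coordinates can contribute, and it does so when
    it is increasing and below [n]. *)
Lemma osum_cell N x k n : (n <= N)%N -> (forall b, (b < k)%N -> t <= nth 0 x b) -> size x = k ->
  osum k n (cell N x) = (sorted ltn (rcons (map (part_idx tau N) x) n))%:R.
Proof.
elim: k n x => [|k IH] n x nN tx; first by move=> /size0nil ->.
case/lastP: x tx => [//|x u] tx; rewrite size_rcons => -[xk] /=.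
have tu : t <= u by have := tx k (ltnSn k); rewrite nth_rcons xk ltnn eqxx.
rewrite map_rcons sorted_rcons2.
have cellE (q : 'I_n) : cell N (rcons x u) k q = ((q : nat) == part_idx tau N u)%:R.
  rewrite /cell nth_rcons xk ltnn eqxx (part_indicE htau)//.
  exact: leq_trans (ltn_ord q) nN.
under eq_bigr do rewrite cellE.
have osE (q : 'I_n) : osum k q (cell N (rcons x u)) =
    (sorted ltn (rcons (map (part_idx tau N) x) q))%:R.
  rewrite -(IH q x)//.
  - by apply: osum_ext => b p bk _; rewrite /cell nth_rcons xk bk.
  - by apply: ltnW; exact: leq_trans (ltn_ord q) nN.
  - by move=> b bk; have := tx b (ltnW bk); rewrite nth_rcons xk bk.
under eq_bigr do rewrite osE.
have [un|nu] := ltnP (part_idx tau N u) n.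
  rewrite [X in _ && X](_ : _ = (part_idx tau N u < n)%N)// un andbT (bigD1 (Ordinal un))//= eqxx mul1r big1 ?addr0// => q qu.
  by rewrite (_ : _ == _ = false) ?mul0r//; apply: contraNF qu => /eqP h1; apply/eqP/val_inj.
rewrite [X in _ && X](_ : _ = (part_idx tau N u < n)%N)// [X in _ && X]ltnNge nu andbF big1// => q _; rewrite (_ : _ == _ = false) ?mul0r//.
by apply/negbTE; rewrite neq_ltn (leq_trans (ltn_ord q) nu).
Qed.

Lemma osum_cell_cvg x : (forall b, (b < size x)%N -> t <= nth 0 x b <= T) ->
  \forall N \near \oo, osum (size x) N (cell N x) = (sorted (fun a b : R => a < b) (rcons x T))%:R.
Proof.
move=> hx; pose y := rcons x T.
have hy i : (i < size y)%N -> t <= nth 0 y i <= T.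
  rewrite size_rcons ltnS nth_rcons => ix; case: ltngtP ix => // [ix _|_ _]; first exact: hx.
  by rewrite lexx ltW.
have : \forall N \near \oo, forall i : 'I_(size y), (i.+1 < size y)%N ->
    (part_idx tau N (nth 0%R y i) < part_idx tau N (nth 0%R y i.+1))%N = (nth 0%R y i < nth 0%R y i.+1).
  apply: filter_forall => i; have [iy|iy] := ltnP i.+1 (size y); last first.
    by apply: nearW.
  have := part_idx_cvg htau (hy i (ltn_ord i)) (hy i.+1 iy).
  by apply: filterS => N h _.
apply: filterS => N hN.
rewrite osum_cell//; last by move=> b /hx/andP[].
congr (_%:R).
have -> : rcons (map (part_idx tau N) x) N = map (part_idx tau N) y.
  by rewrite /y map_rcons (part_idx_end htau).
rewrite sorted_map; congr nat_of_bool; apply/idP/idP => /(sortedP 0) h; apply/(sortedP 0) => i iy.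
  by rewrite -(hN (Ordinal (ltnW iy)) iy); exact: h.
by rewrite /relpre/= (hN (Ordinal (ltnW iy)) iy); exact: h.
Qed.

Context d (Omega : measurableType d) (w : nat -> R -> Omega -> R).

(** The largest index determines the outermost interval, whose left end point bounds the inner ones;
    this is the support condition of [elem]. *)
Lemma osum_elem N (c : nat -> R -> R) k n : (0 < N)%N -> (n <= N)%N ->
  elem t w k (tau N n) (fun x => osum k n (fun b q => c b (tau N q) * cell N x b q))
    (fun om => osum k n (fun b q => c b (tau N q) * (w b (tau N q.+1) om - w b (tau N q) om))).
Proof.
move=> N0; elim: k n => [//|k IH] n nN.
exists 'I_n, (fun q : 'I_n => tau N q), (fun q : 'I_n => tau N q.+1),
  (fun (q : 'I_n) x => c k (tau N q) * osum k q (fun b q => c b (tau N q) * cell N x b q)),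
  (fun (q : 'I_n) om => c k (tau N q) * osum k q (fun b q => c b (tau N q) * (w b (tau N q.+1) om - w b (tau N q) om))).
split.
- move=> q; have qN : (q < N)%N by exact: leq_trans (ltn_ord q) nN.
  split.
  + by have /andP[] := part_in htau N0 (ltnW qN).
  + exact/ltW/(part_incr htau).
  + exact: (part_mono htau).
  + by apply: elemZ; apply: IH; exact: ltnW.
- move=> x u xk /=; apply: eq_bigr => q _.
  rewrite (@osum_ext k q _ (fun b q => c b (tau N q) * cell N x b q)); last first.
    by move=> b p bk _; rewrite /cell nth_rcons xk bk.
  by rewrite /cell nth_rcons xk ltnn eqxx; ring.
- by apply/funext => om /=; apply: eq_bigr => q _; ring.
Qed.

End ordered_sums.

Lemma clip_dist (R : realDomainType) (M x y : R) : - M <= y <= M ->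
  `|Num.max (- M) (Num.min M x) - y| <= `|x - y|.
Proof.
move=> /andP[y1 y2]; have [h1|h1] := leP M x.
  rewrite max_r; last by rewrite (le_trans y1).
  rewrite !ger0_norm ?subr_ge0// ?(le_trans y2)//; lra.
have [h2|h2] := leP (- M) x; first by [].
rewrite distrC (distrC x) !ger0_norm ?subr_ge0 ?(le_trans (ltW h2))//; lra.
Qed.

(** * Approximation of simplex kernels by elementary ones *)

Section kernel_approximation.
Context (R : realType) (t T : R) (tau : nat -> nat -> R).
Hypotheses (tT : t < T) (htau : is_partition_seq t T tau).
Local Notation MR := (measurableTypeR R).
Local Notation leb := (@lebesgue_measure R).
Local Notation cn2 := (cube_n2 t T).
Local Notation L2on := (L2on t T).
Local Notation sample := (sample tau).
Local Notation cell := (cell tau).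
Implicit Types (g h : nat -> R -> R).

Lemma bounded_L2on (h : R -> R) M : measurable_fun `[t, T] (h : MR -> R) ->
  (forall x, t <= x <= T -> `|h x| <= M) -> L2on h.
Proof.
move=> mh hM; split => //.
apply: (@le_lt_trans _ _ (n2 leb `[t, T] (cst M))).
  apply: n2_le => // x /=; rewrite in_itv/= => hx.
  by rewrite -[h x ^+ 2]real_normK ?num_real// ler_pXn2r ?nnegrE// ?hM// (le_trans _ (hM x hx)).
have /integrableP[_] := integrable_cst_itv t T (M ^+ 2).
by under eq_integral do rewrite /= ger0_norm ?sqr_ge0//.
Qed.

Lemma tens_n2_lty k g : (forall l, (l < k)%N -> L2on (g l)) -> (cn2 k (tens g) < +oo)%E.
Proof.
move=> hg; have mtT : measurable (`[t, T]%classic : set MR) by exact: measurable_itv.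
have iM (l : 'I_k) : leb.-integrable `[t, T] (EFin \o (fun u => g l u * g l u)).
  by have [? ?] := hg l (ltn_ord l); exact: n2_integrableM.
have [/integrableP[_ +] _] := cube_prod_integral iM.
apply: le_lt_trans; rewrite /cube_n2 le_eqVlt; apply/orP; left; apply/eqP.
apply: eq_integral => x _; rewrite /= tens_tuple expr2 -big_split/= ger0_norm//.
by apply: prodr_ge0 => l _; rewrite -expr2 sqr_ge0.
Qed.

Lemma cube_n2_lt_triangle k Phi Chi Psi (e : R) :
  cube_meas t T k Phi -> cube_meas t T k Chi -> cube_meas t T k Psi ->
  (cn2 k (fun x => (Phi x - Chi x)%R) < (e / 4)%:E)%E ->
  (cn2 k (fun x => (Chi x - Psi x)%R) < (e / 4)%:E)%E ->
  (cn2 k (fun x => (Phi x - Psi x)%R) < e%:E)%E.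
Proof.
move=> m1 m2 m3 h1 h2; apply: (le_lt_trans (n2_triangle _ (@measurable_cube R t T k) m1 m2 m3)).
have -> : (e%:E = 2%:E * (e / 4)%:E + 2%:E * (e / 4)%:E)%E.
  by rewrite -!EFinM -EFinD; congr EFin; field.
by apply: lteD; rewrite lte_pmul2l.
Qed.

Lemma measurable_sorted_nat k (s : R) :
  measurable_fun setT (fun x : k.-tuple MR => (sorted (fun a b : R => a < b) (rcons x s))%:R : R).
Proof.
have : measurable_fun setT (\1_[set y : k.-tuple MR | sorted (fun a b : R => a < b) (rcons y s)] : k.-tuple MR -> R).
  by apply: measurable_indic; exact: measurable_sorted_rcons.
apply: eq_measurable_fun => x _; rewrite indicE; congr (_%:R); congr nat_of_bool.
by apply/idP/idP => [/set_mem//|?]; exact/mem_set.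
Qed.

Lemma measurable_osum_cell k N : (0 < N)%N -> cube_meas t T k (fun x => osum k N (cell N x)).
Proof.
move=> N0; apply: measurable_funTS.
have := elem_measurable (osum_elem htau (fun _ _ (_ : MR) => 0) (fun _ _ => 1) k N0 (leqnn N)).
apply: eq_measurable_fun => x _; apply: osum_ext => b q _ _; by rewrite mul1r.
Qed.

Lemma osum_kernel_cvg h k : (forall b, (b < k)%N -> sampleable t T (h b)) ->
  (fun N => cn2 k (fun x => (osum k N.+1 (fun b q => h b (tau N.+1 q) * cell N.+1 x b q) -
    simplex_kernel h T x)%R)) @ \oo --> 0%E.
Proof.
move=> hh.
have mc := @measurable_cube R t T k.
have hL b : (b < k)%N -> L2on (h b).
  by move=> bk; split; [have [] := hh b bk|exact: sampleable_n2_lty (hh b bk)].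
have sL N b : (b < k)%N -> L2on (sample N.+1 (h b)).
  move=> bk; have [_ [M hM] _] := hh b bk.
  have M0 : 0 <= M by apply: le_trans (normr_ge0 (h b t)) (hM t _); rewrite lexx ltW.
  apply: (@bounded_L2on _ M).
    by apply: measurable_funTS; exact: measurable_sample.
  move=> x /andP[tx xT]; rewrite (sampleE htau)//; case: ltnP => iN; rewrite ?normr0// hM//.
  by rewrite (part_in htau)// ltnW.
have mth : cube_meas t T k (tens h) by apply: tens_cube_meas => l /hL[].
have mts N : cube_meas t T k (tens (fun b => sample N.+1 (h b))).
  by apply: tens_cube_meas => l /(sL N)[].
have mos N : cube_meas t T k (fun x => osum k N.+1 (cell N.+1 x)) by exact: measurable_osum_cell.
have mso : cube_meas t T k (fun x => (sorted (fun a b : R => a < b) (rcons x T))%:R).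
  by apply: measurable_funTS; exact: measurable_sorted_nat.
have cx (x : k.-tuple MR) : cube t T k x -> forall b, (b < k)%N -> t <= nth 0 x b <= T.
  by move=> xc b bk; have := xc (Ordinal bk); rewrite (tnth_nth 0).
have oE N (x : k.-tuple MR) : cube t T k x ->
    osum k N.+1 (fun b q => h b (tau N.+1 q) * cell N.+1 x b q) =
    tens (fun b => sample N.+1 (h b)) x * osum k N.+1 (cell N.+1 x).
  move=> xc; rewrite (osum_sample htau)//; last by move=> b /(cx x xc)/andP[].
  by rewrite /tens size_tuple.
have chi01 N (x : k.-tuple MR) : cube t T k x -> exists b : bool, osum k N.+1 (cell N.+1 x) = b%:R.
  move=> xc; rewrite (osum_cell htau) ?size_tuple//; last by move=> b /(cx x xc)/andP[].
  by eexists.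
(* The error splits into [A], the sampling error of the tensor product, controlled by [tens_cvg],
   and [B], the error in the indicator of the simplex, controlled by dominated convergence with the
   square of the tensor product. *)
pose A N : seq R -> R := fun x => osum k N.+1 (cell N.+1 x) * (tens (fun b => sample N.+1 (h b)) x - tens h x).
pose B N : seq R -> R := fun x => osum k N.+1 (cell N.+1 x) * tens h x -
  (sorted (fun a b : R => a < b) (rcons x T))%:R * tens h x.
have mA N : cube_meas t T k (A N) by apply: measurable_funM; [exact: mos|exact: (cube_measB (mts N) mth)].
have mB N : cube_meas t T k (B N).
  by apply: measurable_funB; apply: measurable_funM; [exact: mos|exact: mth|exact: mso|exact: mth].
apply: (@cvg0_le _ _ _ _ _ (fun N => 2%:E * cn2 k (A N) + 2%:E * cn2 k (B N))%E).
- by move=> N; exact: cube_n2_ge0.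
- apply: nearW => N; apply: le_trans (n2D _ mc (mA N) (mB N)).
  rewrite /cube_n2 le_eqVlt; apply/orP; left; apply/eqP; apply: eq_integral => x /set_mem xc.
  rewrite oE// simplex_kernelE /A /B; congr EFin; ring.
apply: cvg0D; apply: cvg0Z.
  apply: (@cvg0_le _ _ _ _ _ (fun N => cn2 k (fun x => (tens (fun b => sample N.+1 (h b)) x - tens h x)%R))).
  - by move=> N; exact: cube_n2_ge0.
  - apply: nearW => N; apply: n2_le; [exact: mc|exact: mA|exact: (cube_measB (mts N) mth)|].
    move=> x xc; rewrite /A; have [[] ->] := chi01 N x xc; rewrite ?mul1r//.
    by rewrite mul0r expr0n/= sqr_ge0.
  - apply: tens_cvg => // b bk; exact: (sample_n2_cvg tT htau (hh b bk)).
apply: (@n2_dominated_cvg _ _ _ (lebesgue_tuple R k) _ mc (fun N x => osum k N.+1 (cell N.+1 x) * tens h x)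
   (fun x => (sorted (fun a b : R => a < b) (rcons x T))%:R * tens h x) (fun x => (tens h x) ^+ 2)).
- by move=> N; apply: measurable_funM; [exact: mos|exact: mth].
- by apply: measurable_funM; [exact: mso|exact: mth].
- exact: (n2_integrable_sqr mc mth (tens_n2_lty hL)).
- move=> N x xc; rewrite -mulrBl exprMn; have [b ->] := chi01 N x xc.
  by rewrite ler_piMl ?sqr_ge0//; case: b; case: sorted => /=; rewrite ?subrr ?subr0 ?sub0r ?sqrrN ?expr1n ?expr0n.
apply: aeW => x xc.
have := osum_cell_cvg tT htau (x := tval x); rewrite size_tuple => /(_ (cx x xc)) hN.
apply: cvg_near_cst.
have : \forall N \near \oo, osum k N.+1 (cell N.+1 x) = (sorted (fun a b : R => a < b) (rcons x T))%:R.
  by case: hN => N0 _ hN; exists N0 => // N /= NN; apply: hN; exact: leqW.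
by apply: filterS => N ->.
Qed.

(** Large values are set to zero and not clipped: at each point the truncated tensor product is then
    either the original one or zero. *)
Definition trunc (M : nat) (g : nat -> R -> R) l u := if `|g l u| <= M%:R then g l u else 0.

Lemma measurable_trunc M g l : measurable_fun setT (g l : MR -> R) ->
  measurable_fun setT (trunc M g l : MR -> R).
Proof.
move=> mg; apply: measurable_fun_ifT => //.
by apply: measurable_fun_ler => //; exact: measurableT_comp.
Qed.

Lemma trunc_bound M g l u : `|trunc M g l u| <= M%:R.
Proof. by rewrite /trunc; case: ifP => // _; rewrite normr0. Qed.

(** Square integrability is known for the kernel and not for each weight, so the dominating function
    is the square of the kernel itself. *)
Lemma trunc_kernel_cvg k g : (forall l, measurable_fun setT (g l : MR -> R)) ->
  (cn2 k (simplex_kernel g T) < +oo)%E ->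
  (fun M => cn2 k (fun x => (simplex_kernel (trunc M g) T x - simplex_kernel g T x)%R)) @ \oo --> 0%E.
Proof.
move=> mg fin.
have mc := @measurable_cube R t T k.
have mK : cube_meas t T k (simplex_kernel g T) by exact: simplex_kernel_cube_meas.
have mKt M : cube_meas t T k (simplex_kernel (trunc M g) T).
  by apply: simplex_kernel_cube_meas => l; exact: measurable_trunc.
apply: (@n2_dominated_cvg _ _ _ (lebesgue_tuple R k) _ mc (fun M x => simplex_kernel (trunc M g) T x)
  (fun x => simplex_kernel g T x) (fun x => (simplex_kernel g T x) ^+ 2)) => //.
- exact: (n2_integrable_sqr mc mK fin).
- move=> M x xc; rewrite !simplex_kernelE -mulrBr !exprMn ler_wpM2l ?sqr_ge0//.
  have [/forallP hM|/forallPn[l hl]] := boolP [forall l : 'I_k, `|g l (tnth x l)| <= M%:R].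
    rewrite (_ : tens (trunc M g) x = tens g x) ?subrr ?expr0n ?sqr_ge0//.
    by rewrite !tens_tuple; apply: eq_bigr => l _; rewrite /trunc hM.
  rewrite (_ : tens (trunc M g) x = 0) ?sub0r ?sqrrN//.
  by rewrite tens_tuple (bigD1 l)//= /trunc (negbTE hl) mul0r.
apply: aeW => x xc; apply: cvg_near_cst.
have : \forall M \near \oo, forall l : 'I_k, `|g l (tnth x l)| <= (M : nat)%:R.
  apply: filter_forall => l; near=> M.
  apply: ltW; apply: lt_le_trans (truncnS_gt _) _; rewrite ler_nat.
  by near: M; exact: nbhs_infty_ge.
apply: filterS => M hM; rewrite !simplex_kernelE; congr (_ * _).
by rewrite !tens_tuple; apply: eq_bigr => l _; rewrite /trunc hM.
Unshelve. all: by end_near. Qed.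

(** Continuous functions are dense in L1. Clipping them to [[-M, M]] does not increase the distance
    to [g], and for functions bounded by [M] the squared difference is at most [2 M] times the
    difference, so L1 convergence gives L2 convergence. *)
Lemma bounded_continuous_approx (g : R -> R) M : measurable_fun setT (g : MR -> R) ->
  (forall x, `|g x| <= M) -> exists c : nat -> R -> R, [/\ forall n, continuous (c n),
    forall n x, `|c n x| <= M & (fun n => n2 leb `[t, T] (fun u => (c n u - g u)%R)) @ \oo --> 0%E].
Proof.
move=> mg gM; have M0 : 0 <= M by apply: le_trans (gM 0).
have mtT : measurable (`[t, T]%classic : set MR) by exact: measurable_itv.
have ig : leb.-integrable `[t, T] (EFin \o g).
  apply: (@le_integrable _ _ _ leb _ mtT _ (EFin \o cst M)).
  - by apply/measurable_EFinP; exact: measurable_funTS.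
  - by move=> x _; rewrite /= lee_fin (ger0_norm M0).
  - exact: integrable_cst_itv.
have fin : (leb `[t, T]%classic < +oo)%E.
  by rewrite lebesgue_measure_itv/= lte_fin tT -EFinB ltry.
have [c [cc ic hc]] := approximation_continuous_integrable mtT fin ig.
pose c' n x := Num.max (- M) (Num.min M (c n x)).
have c'c n : continuous (c' n).
  move=> x; apply: (@continuous_max _ _ (fun _ => - M) (fun x => Num.min M (c n x))); first exact: cvg_cst.
  by apply: (@continuous_min _ _ (fun _ => M) (c n)); [exact: cvg_cst|exact: cc].
have c'M n x : `|c' n x| <= M.
  by rewrite ler_norml /c' le_max lexx/= ge_max ge_min lexx/= andbT; lra.
have c'g n x : `|c' n x - g x| <= `|c n x - g x|.
  by apply: clip_dist; have := gM x; rewrite ler_norml.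
exists c'; split => //.
have mc n : measurable_fun `[t, T] (c n : MR -> R) by apply: measurable_funTS; exact: continuous_measurable_fun.
have mc' n : measurable_fun `[t, T] (c' n : MR -> R) by apply: measurable_funTS; exact: continuous_measurable_fun.
have mg' : measurable_fun `[t, T] (g : MR -> R) by exact: measurable_funTS.
have mabs n : measurable_fun `[t, T] (fun z : MR => `|(g z - c n z)%:E|%E).
  rewrite (_ : (fun z => _) = EFin \o (fun z => `|g z - c n z|))//.
  by apply/measurable_EFinP; apply: measurableT_comp => //; exact: measurable_funB.
apply: (@cvg0_le _ _ _ _ _ (fun n => (2 * M)%:E * \int[leb]_(z in `[t, T]) `|(g z - c n z)%:E|)%E).
- by move=> n; exact: n2_ge0.
- apply: nearW => n; rewrite -ge0_integralZl_EFin ?mulr_ge0//; last exact: mabs.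
  apply: ge0_le_integral => //.
  + by move=> x _; rewrite lee_fin sqr_ge0.
  + by apply: measurable_sqr_EFin; apply: measurable_funB; [exact: mc'|exact: mg'].
  + by apply: measurable_funeM; exact: mabs.
  move=> x _; rewrite /= -EFinM lee_fin -real_normK ?num_real// expr2.
  apply: ler_pM => //; last by rewrite (distrC (g x)).
  apply: le_trans (ler_normB _ _) _.
  by have := c'M n x; have := gM x; lra.
- exact: cvg0Z.
Qed.

Lemma continuous_sampleable (c : R -> R) M : continuous c -> (forall x, `|c x| <= M) -> sampleable t T c.
Proof.
move=> cc cM; split.
- by apply: measurable_funTS; exact: continuous_measurable_fun.
- by exists M.
- exists [::] => x _ _; apply: cvg_trans (cc x); apply: cvg_app; exact: cvg_within.
Qed.

Lemma sorted_tens_le k g h : (forall l, (l < k)%N -> measurable_fun `[t, T] (g l : MR -> R)) ->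
  (forall l, (l < k)%N -> measurable_fun `[t, T] (h l : MR -> R)) ->
  (cn2 k (fun x => (simplex_kernel g T x - simplex_kernel h T x)%R) <=
   cn2 k (fun x => (tens g x - tens h x)%R))%E.
Proof.
move=> mg mh.
have mt : cube_meas t T k (fun x => tens g x - tens h x).
  by apply: cube_measB; exact: tens_cube_meas.
have mso : cube_meas t T k (fun x => (sorted (fun a b : R => a < b) (rcons x T))%:R).
  by apply: measurable_funTS; exact: measurable_sorted_nat.
apply: n2_le => //; first exact: measurable_cube.
  rewrite (_ : (fun x => _) = (fun x : k.-tuple MR => (sorted (fun a b : R => a < b) (rcons x T))%:R *
    (tens g x - tens h x))); first exact: measurable_funM.
  by apply/funext => x; rewrite !simplex_kernelE mulrBr.
move=> x _; rewrite !simplex_kernelE -mulrBr exprMn; case: sorted; rewrite ?expr1n ?mul1r//.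
by rewrite expr0n mul0r sqr_ge0.
Qed.

Context d (Omega : measurableType d) (w : nat -> R -> Omega -> R).

Lemma simplex_kernel_approx_top k g (e : R) : (forall l, measurable_fun setT (g l : MR -> R)) ->
  (cn2 k (simplex_kernel g T) < +oo)%E -> 0 < e ->
  exists Psi Z, elem t w k T Psi Z /\ (cn2 k (fun x => (Psi x - simplex_kernel g T x)%R) < e%:E)%E.
Proof.
move=> mg fin e0.
(* Truncation gets [e / 4]; the continuous approximation and the sampling get [e / 16] each, as two
   squared triangle inequalities are nested. *)
have e4 : 0 < e / 4 by rewrite divr_gt0.
have e16 : 0 < e / 4 / 4 by rewrite divr_gt0.
have mK : cube_meas t T k (simplex_kernel g T) by exact: simplex_kernel_cube_meas.
have [M _ /(_ M (leqnn M)) hM] := (ge0_cvg0P _ (fun n => cube_n2_ge0 t T k _)).1 (trunc_kernel_cvg mg fin) _ e4.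
have mtr l := measurable_trunc M (mg l).
have mKt : cube_meas t T k (simplex_kernel (trunc M g) T) by exact: simplex_kernel_cube_meas.
have ex_c l := bounded_continuous_approx (mtr l) (trunc_bound M g l).
pose c l := projT1 (cid (ex_c l)).
have cP l : [/\ forall n, continuous (c l n), forall n x, `|c l n x| <= M%:R &
    (fun n => n2 leb `[t, T] (fun u => (c l n u - trunc M g l u)%R)) @ \oo --> 0%E].
  by rewrite /c; case: cid.
have mc l n : measurable_fun setT (c l n : MR -> R).
  by have [cc _ _] := cP l; exact: continuous_measurable_fun.
have cT : (fun n => cn2 k (fun x => (tens (fun l => c l n) x - tens (trunc M g) x)%R)) @ \oo --> 0%E.
  apply: tens_cvg => //.
  - move=> n l _; apply: (@bounded_L2on _ M%:R); first by apply: measurable_funTS; exact: mc.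
    by move=> x _; have [_ cM _] := cP l.
  - move=> l _; apply: (@bounded_L2on _ M%:R); first by apply: measurable_funTS; exact: mtr.
    by move=> x _; exact: trunc_bound.
  - by move=> l _; have [_ _] := cP l.
have [n _ /(_ n (leqnn n)) hn] := (ge0_cvg0P _ (fun n => cube_n2_ge0 t T k _)).1 cT _ e16.
have hn' : (cn2 k (fun x => (simplex_kernel (fun l => c l n) T x - simplex_kernel (trunc M g) T x)%R) < (e / 4 / 4)%:E)%E.
  by apply: le_lt_trans hn; apply: sorted_tens_le => l _; apply: measurable_funTS; [exact: mc|exact: mtr].
have mKc : cube_meas t T k (simplex_kernel (fun l => c l n) T) by apply: simplex_kernel_cube_meas => l; exact: mc.
have cs := @osum_kernel_cvg (fun l => c l n) k (fun b _ => let: And3 cc cM _ := cP b in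
  continuous_sampleable (cc n) (cM n)).
have [N _ /(_ N (leqnn N)) hN] := (ge0_cvg0P _ (fun n => cube_n2_ge0 t T k _)).1 cs _ e16.
have hel := osum_elem htau w (fun l => c l n) k (ltn0Sn N) (leqnn N.+1).
rewrite (part_end htau)// in hel.
eexists; eexists; split; first exact: hel.
have mo := elem_cube_meas hel : cube_meas t T k _.
apply: (cube_n2_lt_triangle mo mKt mK) => //.
exact: (cube_n2_lt_triangle mo mKc mKt).
Qed.

(** Moves the upper limit into the weights, so that partitions of [[t, T]] serve every [s]. Only the
    last variable has to be tested, the others lie below it. *)
Lemma simplex_kernel_cut g s x : s <= T -> (0 < size x)%N ->
  simplex_kernel g s x = simplex_kernel (fun l u => (u < s)%R%:R * g l u) T x.
Proof.
case/lastP: x => [//|y u] sT _; rewrite !simplex_kernelE !sorted_rcons2.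
have [sy|] := boolP (sorted _ (rcons y u)); last by rewrite !mul0r.
have tensE c : tens c (rcons y u) = tens c y * c (size y) u.
  rewrite /tens size_rcons big_ord_recr/= nth_rcons ltnn eqxx; congr (_ * _).
  by apply: eq_bigr => a _; rewrite nth_rcons ltn_ord.
rewrite /= !tensE; have [us|] := boolP (u < s); last by rewrite !(mul0r, mulr0).
rewrite (lt_le_trans us sT) !mul1r; congr (_ * _); apply: eq_bigr => a _.
have ay : (a : nat) \in [pred n | (n < size (rcons y u))%N] by rewrite inE size_rcons ltnS ltnW.
have yy : size y \in [pred n | (n < size (rcons y u))%N] by rewrite inE size_rcons.
have := lt_sorted_ltn_nth 0 (sy : sorted <%R _) ay yy.
by rewrite ltn_ord !nth_rcons ltnn eqxx ltn_ord => /lt_trans -> //; rewrite mul1r.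
Qed.

Lemma simplex_kernel_approx k g s (e : R) : (forall l, measurable_fun setT (g l : MR -> R)) ->
  s <= T -> (cn2 k (simplex_kernel g s) < +oo)%E -> 0 < e ->
  exists Psi Z, elem t w k T Psi Z /\ (cn2 k (fun x => (Psi x - simplex_kernel g s x)%R) < e%:E)%E.
Proof.
case: k => [|k] mg sT fin e0.
  exists (simplex_kernel g s), (fun _ => simplex_kernel g s [::]); split => //.
  by rewrite /cube_n2; under eq_integral do rewrite subrr expr0n/=; rewrite integral0 lte_fin.
pose g' l u := (u < s)%R%:R * g l u.
have kE (x : k.+1.-tuple MR) : simplex_kernel g s x = simplex_kernel g' T x.
  by rewrite simplex_kernel_cut// size_tuple.
have mg' l : measurable_fun setT (g' l : MR -> R).
  apply: measurable_funM; last exact: mg.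
  have : measurable_fun setT (\1_(`]-oo, s[) : MR -> R) by exact: measurable_indic.
  by apply: eq_measurable_fun => u _; rewrite indicE mem_setE in_itv.
have [|Psi [Z [hel h]]] := @simplex_kernel_approx_top k.+1 g' e mg' _ e0.
  by move: fin; rewrite /cube_n2; under eq_integral do rewrite kE.
exists Psi, Z; split => //.
by rewrite /cube_n2; under eq_integral do rewrite kE; exact: h.
Qed.

End kernel_approximation.

(** * Off-diagonal sums *)

Section ordered_decomposition.
Context (R : realType).
Implicit Types (k N : nat).

(* A sum over injective multi-indices splits according to the permutation that
   sorts the multi-index. *)
Definition increasing k N (l : {ffun 'I_k -> 'I_N}) :=
  [forall a : 'I_k, forall b : 'I_k, (a < b)%N ==> (l a < l b)%N].

Lemma increasingP k N (l : {ffun 'I_k -> 'I_N}) :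
  reflect (forall a b : 'I_k, (a < b)%N -> (l a < l b)%N) (increasing l).
Proof. by apply: (iffP 'forall_forallP) => h a b; [apply/implyP|apply/implyP; exact: h]. Qed.

Let glue k N (p : 'I_N * {ffun 'I_k -> 'I_N}) : {ffun 'I_k.+1 -> 'I_N} :=
  [ffun a => if unlift ord_max a is Some a' then p.2 a' else p.1].

Let unglue k N (l : {ffun 'I_k.+1 -> 'I_N}) : 'I_N * {ffun 'I_k -> 'I_N} :=
  (l ord_max, [ffun a => l (lift ord_max a)]).

Let glueK k N : cancel (@glue k N) (@unglue k N).
Proof.
move=> [q l]; rewrite /unglue; congr pair; first by rewrite ffunE unlift_none.
by apply/ffunP => a; rewrite !ffunE liftK.
Qed.

Let unglueK k N : cancel (@unglue k N) (@glue k N).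
Proof.
move=> l; apply/ffunP => a; rewrite ffunE.
by case: unliftP => [b ->|->]; rewrite ?ffunE.
Qed.

Let glue_increasing k N n (l : {ffun 'I_k -> 'I_N}) (q : 'I_N) :
  increasing (glue (q, l)) && [forall a, (glue (q, l) a < n)%N] =
  (q < n)%N && (increasing l && [forall a, (l a < q)%N]).
Proof.
have gl a : glue (q, l) (lift ord_max a) = l a by rewrite ffunE liftK.
have gm : glue (q, l) ord_max = q by rewrite ffunE unlift_none.
have lm (a : 'I_k) : (lift ord_max a : nat) = a by rewrite lift_max.
apply/andP/andP => [[/increasingP h1 /forallP h2]|[qn /andP[/increasingP h1 /forallP h2]]].
  split; first by have := h2 ord_max; rewrite gm.
  apply/andP; split.
    by apply/increasingP => a b ab; have := h1 (lift ord_max a) (lift ord_max b); rewrite !lm !gl; exact.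
  apply/forallP => a; have := h1 (lift ord_max a) ord_max; rewrite lm gl gm; apply; exact: ltn_ord.
split.
  apply/increasingP => a b; case: (unliftP ord_max a) => [a' ->|->]; case: (unliftP ord_max b) => [b' ->|->].
  - by rewrite !lm !gl; exact: h1.
  - by rewrite gl gm => _; exact: h2.
  - by rewrite lm /= => /ltn_trans/(_ (ltn_ord b')); rewrite ltnn.
  - by rewrite ltnn.
apply/forallP => a; case: (unliftP ord_max a) => [a' ->|->]; last by rewrite gm.
by rewrite gl; exact: ltn_trans (h2 a') qn.
Qed.

(** In an increasing multi-index the last entry is the largest; splitting it off by [glue] gives the
    recursion of [osum]. *)
Lemma osum_increasing k N n (th : nat -> nat -> R) : (n <= N)%N ->
  \sum_(l : {ffun 'I_k -> 'I_N} | increasing l && [forall a, (l a < n)%N]) \prod_(a < k) th a (l a) =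
  osum k n th.
Proof.
elim: k n => [|k IH] n nN.
  rewrite (big_pred1 (ffun0 (card_ord 0) : {ffun 'I_0 -> 'I_N})) ?big_ord0// => l /=.
  have -> : l = ffun0 (card_ord 0) by apply/ffunP => -[].
  by rewrite eqxx; apply/andP; split; [apply/increasingP => -[]|apply/forallP => -[]].
rewrite (reindex (@glue k N)); last first.
  by apply: onW_bij; exists (@unglue k N); [exact: glueK|exact: unglueK].
transitivity (\sum_(p : 'I_N * {ffun 'I_k -> 'I_N} |
    (p.1 < n)%N && (increasing p.2 && [forall a, (p.2 a < p.1)%N]))
    th k p.1 * \prod_(a < k) th a (p.2 a)).
  apply: eq_big => [[q l]|[q l] _]; first exact: glue_increasing.
  rewrite big_ord_recr/= ffunE unlift_none mulrC; congr (_ * _); apply: eq_bigr => a _.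
  rewrite ffunE (_ : widen_ord _ _ = lift ord_max a) ?liftK//.
  by apply/val_inj; rewrite /= /bump leqNgt ltn_ord.
rewrite -(pair_big_dep (fun q : 'I_N => (q < n)%N) (fun q (l : {ffun 'I_k -> 'I_N}) => increasing l && [forall a, (l a < q)%N])
  (fun q l => th k q * \prod_(a < k) th a (l a)))/=.
rewrite (big_ord_widen N (fun q => th k q * osum k q th) nN).
by apply: eq_bigr => q qn; rewrite -big_distrr/= IH// ltnW.
Qed.

(** The number of smaller entries: for an injective multi-index this is the place of [a] after
    sorting. *)
Let rank k N (l : {ffun 'I_k -> 'I_N}) (a : 'I_k) := #|[set b | (l b < l a)%N]%SET|.

Let rank_lt k N (l : {ffun 'I_k -> 'I_N}) a : (rank l a < k)%N.
Proof.
have k0 : (0 < k)%N by exact: leq_ltn_trans (ltn_ord a).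
rewrite -[X in (_ < X)%N](prednK k0) ltnS -[k in k.-1]card_ord -(cardsC1 a).
rewrite /rank; apply: fintype.subset_leq_card; apply/fintype.subsetP => b; rewrite !inE; apply: contraTneq => ->.
by rewrite ltnn.
Qed.

Let rank_mono k N (l : {ffun 'I_k -> 'I_N}) a b : (rank l a < rank l b)%N = (l a < l b)%N.
Proof.
have le_ c d : (l c <= l d)%N -> (rank l c <= rank l d)%N.
  by move=> cd; rewrite /rank; apply: fintype.subset_leq_card; apply/fintype.subsetP => e; rewrite !inE => /leq_trans; exact.
have [ab|ba] := ltnP (l a) (l b); last by apply/negbTE; rewrite -leqNgt le_.
rewrite /rank; apply: proper_card; apply/fintype.properP; split.
  by apply/fintype.subsetP => e; rewrite !inE => /ltn_trans; exact.
by exists a; rewrite !inE// ltnn.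
Qed.

Let rank_sorted k N (l : {ffun 'I_k -> 'I_N}) (s : 'S_k) : increasing [ffun b => l (s b)] ->
  forall b, rank l (s b) = b.
Proof.
move=> /increasingP h b.
have hs (c d : 'I_k) : (c < d)%N = (l (s c) < l (s d))%N.
  apply/idP/idP => [cd|]; first by have := h c d cd; rewrite !ffunE.
  apply: contraTT; rewrite -!leqNgt leq_eqVlt => /orP[/eqP/val_inj -> //|dc].
  by apply: ltnW; have := h d c dc; rewrite !ffunE.
rewrite /rank (_ : [set c | _]%SET = (s @: [set c : 'I_k | (c < b)%N])%SET); last first.
  apply/setP => c; rewrite inE; apply/idP/imsetP => [cb|[d + ->]]; last by rewrite inE hs.
  by exists ((s^-1)%g c); rewrite ?permKV// inE hs permKV.
rewrite card_imset; last exact: perm_inj.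
rewrite -sum1dep_card -(big_ord_widen k (fun=> 1%N) (ltnW (ltn_ord b))).
by rewrite sum1_card card_ord.
Qed.

(** For an injective multi-index the ranks form a permutation, whose inverse is the only one that
    sorts it. With a repeated value no rearrangement is strictly increasing. *)
Lemma card_sorting_perm k N (l : {ffun 'I_k -> 'I_N}) :
  #|[set s : 'S_k | increasing [ffun b => l (s b)]]%SET| = injectiveb l.
Proof.
have [/injectiveP li|lni] := boolP (injectiveb l); last first.
  apply/eqP; rewrite cards_eq0; apply/eqP/setP => s; rewrite !inE; apply/negbTE.
  apply: contraNN lni => /increasingP h; apply/injectiveP => a b.
  rewrite -(permKV s a) -(permKV s b); set c := (s^-1)%g a; set e := (s^-1)%g b.
  have [ce|ec|/val_inj -> //] := ltngtP c e.
    by have := h c e ce; rewrite !ffunE => + E; rewrite E ltnn.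
  by have := h e c ec; rewrite !ffunE => + E; rewrite E ltnn.
pose rk a := Ordinal (rank_lt l a).
have rki : injective rk.
  move=> a b E; have {}E : rank l a = rank l b := congr1 val E.
  have := rank_mono l a b; have := rank_mono l b a; rewrite E ltnn => ba ab.
  by apply: li; apply: ord_inj; move: ab ba; case: ltngtP.
pose rho := perm rki.
rewrite (_ : [set s | _]%SET = [set (rho^-1)%g]%SET) ?cards1//; apply/setP => s; rewrite !inE.
apply/idP/eqP => [/rank_sorted h|->].
  apply/permP => b; apply: (@perm_inj _ rho); rewrite permKV permE.
  by apply/val_inj; rewrite /= h.
apply/increasingP => a b ab; rewrite !ffunE.
have E c : rank l ((rho^-1)%g c) = c.
  by have := permKV rho c; rewrite {1}permE => /(congr1 val).
by have := rank_mono l ((rho^-1)%g a) ((rho^-1)%g b); rewrite !E ab => <-.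
Qed.

(** Families on ['I_k] are continued by a default value, since integrators and weights are indexed
    by all natural numbers in the recursions on [k]. *)
Definition ord_ext (A : Type) k (a0 : A) (c : 'I_k -> A) (b : nat) : A := oapp c a0 (insub b).

Lemma ord_extE (A : Type) k (a0 : A) (c : 'I_k -> A) (i : 'I_k) : ord_ext a0 c i = c i.
Proof. by rewrite /ord_ext valK. Qed.

(** The injectivity test is replaced by the number of sorting permutations. After exchanging the
    sums, reindexing by a fixed permutation makes the multi-index increasing. *)
Lemma sum_injective_osum k N (th : 'I_k -> nat -> R) :
  \sum_(l : {ffun 'I_k -> 'I_N} | injectiveb l) \prod_(a < k) th a (l a) =
  \sum_(s : 'S_k) osum k N (fun b q => ord_ext 0 (fun i => th (s i) q) b).
Proof.
transitivity (\sum_(l : {ffun 'I_k -> 'I_N}) \sum_(s : 'S_k | increasing [ffun b => l (s b)])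
    \prod_(a < k) th a (l a)).
  rewrite big_mkcond/=; apply: eq_bigr => l _; rewrite sumr_const.
  have -> : #|[pred s : 'S_k | increasing [ffun b => l (s b)]]| = injectiveb l.
    by rewrite -card_sorting_perm; apply: eq_card => s; rewrite !inE.
  by case: injectiveb.
rewrite (exchange_big_dep xpredT)//=; apply: eq_bigr => s _.
rewrite -(osum_increasing _ _ (leqnn N)).
rewrite (reindex (fun l : {ffun 'I_k -> 'I_N} => [ffun a => l ((s^-1)%g a)])); last first.
  apply: onW_bij; exists (fun l : {ffun 'I_k -> 'I_N} => [ffun a => l (s a)]) => l;
  by apply/ffunP => a; rewrite !ffunE ?permK ?permKV.
apply: eq_big => [l|l _].
  have -> : [ffun b => [ffun a => l ((s^-1)%g a)] (s b)] = l.
    by apply/ffunP => b; rewrite !ffunE permK.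
  rewrite (_ : [forall a, _] = true) ?andbT//; apply/forallP => a; exact: ltn_ord.
rewrite (reindex_inj (@perm_inj _ s)); apply: eq_bigr => b _.
by rewrite ffunE permK ord_extE.
Qed.

End ordered_decomposition.

(** * Gaussian laws and moments *)

Section bounded_expectation.
Context d (Omega : measurableType d) (R : realType) (P : probability Omega R).
Implicit Types (X Y Z : Omega -> R).

Definition bounded_rv X := measurable_fun setT X /\ exists M, forall om, `|X om| <= M.

Lemma bounded_rv_integrable X : bounded_rv X -> P.-integrable setT (EFin \o X).
Proof.
move=> [mX [M hM]]; apply: (@le_integrable _ _ _ P _ measurableT _ (EFin \o cst M)).
- exact/measurable_EFinP.
- by move=> om _; rewrite /= lee_fin (le_trans (hM om)) ?ler_norm.
- exact: finite_measure_integrable_cst.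
Qed.

Lemma bounded_rv_cst c : bounded_rv (fun _ => c).
Proof. by split; [exact: measurable_cst|exists `|c|]. Qed.

Lemma bounded_rvD X Y : bounded_rv X -> bounded_rv Y -> bounded_rv (fun om => X om + Y om).
Proof.
move=> [mX [M hM]] [mY [K hK]]; split; first exact: measurable_funD.
by exists (M + K) => om; apply: le_trans (ler_normD _ _) _; apply: lerD.
Qed.

Lemma bounded_rvM X Y : bounded_rv X -> bounded_rv Y -> bounded_rv (fun om => X om * Y om).
Proof.
move=> [mX [M hM]] [mY [K hK]]; split; first exact: measurable_funM.
by exists (M * K) => om; rewrite normrM; apply: ler_pM.
Qed.

Lemma bounded_rv_prod (J : Type) (s : seq J) (X : J -> Omega -> R) : (forall j, bounded_rv (X j)) ->
  bounded_rv (fun om => \prod_(j <- s) X j om).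
Proof.
move=> h; elim: s => [|j s IH].
  by under eq_fun do rewrite big_nil; exact: bounded_rv_cst.
by under eq_fun do rewrite big_cons; exact: bounded_rvM.
Qed.

Lemma bounded_rv_cos X : measurable_fun setT X -> bounded_rv (fun om => cos (X om)).
Proof.
move=> mX; split; last by exists 1 => om; exact: cos_max.
by apply: measurableT_comp mX; apply: continuous_measurable_fun; exact: continuous_cos.
Qed.

Lemma bounded_rv_indic (B : set R) X : measurable B -> measurable_fun setT X ->
  bounded_rv (fun om => \1_B (X om)).
Proof.
move=> mB mX; split; last by exists 1 => om; rewrite indicE; case: (_ \in _); rewrite ?normr1 ?normr0.
exact: (measurableT_comp (measurable_indic mB)).
Qed.

Lemma bounded_expectationD X Y : bounded_rv X -> bounded_rv Y ->
  \int[P]_om (X om + Y om) = \int[P]_om X om + \int[P]_om Y om.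
Proof. by move=> bX bY; apply: RintegralD => //; exact: bounded_rv_integrable. Qed.

Lemma bounded_expectationZ c X : bounded_rv X -> \int[P]_om (c * X om) = c * \int[P]_om X om.
Proof. by move=> bX; apply: RintegralZl => //; exact: bounded_rv_integrable. Qed.

Lemma bounded_expectation_cvg (X : nat -> Omega -> R) Y M :
  (forall n, measurable_fun setT (X n)) -> (forall n om, `|X n om| <= M) ->
  (forall om, X ^~ om @ \oo --> Y om) ->
  (fun n => \int[P]_om X n om) @ \oo --> \int[P]_om Y om.
Proof.
move=> mX hM cX.
have mY : measurable_fun setT Y by apply: (measurable_fun_cvg mX) => om _; exact: cX.
have cE : {ae P, forall om, setT om -> (fun n => (X n om)%:E : \bar R) @ \oo --> (Y om)%:E}.
  by apply: aeW => om _; apply: cvg_EFin; [exact: nearW|exact: cX].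
have bE : {ae P, forall om n, setT om -> (`|(X n om)%:E| <= (EFin \o cst M) om)%E}.
  by apply: aeW => om n _; rewrite /= lee_fin.
have mE n : measurable_fun setT (fun om => (X n om)%:E : \bar R) by exact/measurable_EFinP.
have mYE : measurable_fun setT (fun om => (Y om)%:E : \bar R) by exact/measurable_EFinP.
have [iY _ h] := dominated_convergence measurableT mE mYE cE
  (finite_measure_integrable_cst P M measurableT) bE.
apply: (@fine_cvg _ _ _ _ _ (\int[P]_om Y om)%R).
by rewrite fineK//; exact: integrable_fin_num.
Qed.

Lemma probability_Rintegral_cst (c : R) : \int[P]_om c = c.
Proof.
by have := integral_cst P measurableT c%:E => /= E; rewrite /Rintegral E probability_setT mule1.
Qed.

Lemma expectation_indic (B : set R) X : measurable B -> measurable_fun setT X ->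
  \int[P]_om \1_B (X om) = fine (P (X @^-1` B)).
Proof.
move=> mB mX; rewrite /Rintegral; congr fine.
have mXB : measurable (X @^-1` B) by have := mX measurableT B mB; rewrite setTI.
rewrite (eq_integral (fun om => (\1_(X @^-1` B) om)%:E)) ?integral_indic ?setIT//.
Qed.

End bounded_expectation.

(** * Factorising expectations: from indicators to bounded functions *)

Section uncorrelated.
Import HBNNSimple.
Context d (Omega : measurableType d) (R : realType) (P : probability Omega R).
Context d' (Omega' : measurableType d') (Q : probability Omega' R).
Context (Z V : Omega -> R) (bZ : bounded_rv Z) (mV : measurable_fun setT V).
Context (Y : Omega' -> R) (mY : measurable_fun setT Y).

(** [Y] may live on another probability space, such as the line with a normal law. For indicators
    [h] the identity says that, under the signed measure with density [Z], [V] has the law of [Y]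
    times the total mass. *)
Definition uncorrelated (h : R -> R) := bounded_rv h /\
  \int[P]_om (Z om * h (V om)) = (\int[P]_om Z om) * \int[Q]_om h (Y om).

Let bcomp d1 (O : measurableType d1) (X : O -> R) h :
  measurable_fun setT X -> @bounded_rv _ (measurableTypeR R) R h -> bounded_rv (fun om => h (X om)).
Proof. by move=> mX [mh [M hM]]; split; [exact: measurableT_comp mX|exists M => om]. Qed.

Lemma uncorrelatedD g h : uncorrelated g -> uncorrelated h -> uncorrelated (fun x => g x + h x).
Proof.
move=> [bg Eg] [bh Eh]; split; first exact: bounded_rvD.
under eq_Rintegral do rewrite mulrDr.
rewrite (bounded_expectationD P)//; try by apply: bounded_rvM => //; exact: bcomp.
rewrite Eg Eh (bounded_expectationD Q); [|exact: bcomp|exact: bcomp].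
by rewrite mulrDr.
Qed.

Lemma uncorrelatedZ c h : uncorrelated h -> uncorrelated (fun x => c * h x).
Proof.
move=> [bh Eh]; split; first by apply: bounded_rvM => //; exact: bounded_rv_cst.
under eq_Rintegral do rewrite mulrCA.
rewrite (bounded_expectationZ P); last by apply: bounded_rvM => //; exact: bcomp.
by rewrite Eh (bounded_expectationZ Q); [rewrite mulrCA|exact: bcomp].
Qed.

Lemma uncorrelated0 : uncorrelated (fun _ => 0).
Proof.
split; first exact: bounded_rv_cst.
by under eq_Rintegral do rewrite mulr0; rewrite !Rintegral_cst// !mul0r mulr0.
Qed.

Lemma uncorrelated_sum (J : Type) (s : seq J) (h : J -> R -> R) : (forall j, uncorrelated (h j)) ->
  uncorrelated (fun x => \sum_(j <- s) h j x).
Proof.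
move=> hh; elim: s => [|j s IH].
  by under eq_fun do rewrite big_nil; exact: uncorrelated0.
by under eq_fun do rewrite big_cons; exact: uncorrelatedD.
Qed.

Lemma uncorrelated_cvg (h : nat -> R -> R) g M : (forall n, uncorrelated (h n)) ->
  (forall n x, `|h n x| <= M) -> (forall x, h ^~ x @ \oo --> g x) -> uncorrelated g.
Proof.
move=> hh hM ch; have [mZ [K hK]] := bZ.
have mh n : measurable_fun setT (h n : measurableTypeR R -> R) by have [[]] := hh n.
have mg : measurable_fun setT (g : measurableTypeR R -> R).
  by apply: (measurable_fun_cvg mh) => x _; exact: ch.
split.
  split => //; exists M => x.
  have cn : (fun n => `|h n x|) @ \oo --> `|g x| by apply: cvg_norm; exact: ch.
  by rewrite -(cvg_lim _ cn)//; apply: limr_le; [apply/cvg_ex; exists (`|g x|)|exact: nearW].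
have c1 : (fun n => \int[P]_om (Z om * h n (V om))) @ \oo --> \int[P]_om (Z om * g (V om)).
  apply: (@bounded_expectation_cvg _ _ _ P _ _ (K * M)).
  - by move=> n; apply: measurable_funM => //; exact: (measurableT_comp (mh n)).
  - by move=> n om; rewrite normrM; apply: ler_pM.
  - by move=> om; apply: cvgM; [exact: cvg_cst|exact: ch].
have c2 : (fun n => \int[P]_om (Z om * h n (V om))) @ \oo -->
    (\int[P]_om Z om) * \int[Q]_om g (Y om).
  rewrite (_ : (fun n => _) = fun n => (\int[P]_om Z om) * \int[Q]_om h n (Y om)); last first.
    by apply/funext => n; have [_ ->] := hh n.
  apply: cvgM; first exact: cvg_cst.
  apply: (@bounded_expectation_cvg _ _ _ Q _ _ M) => //.
  by move=> n; exact: (measurableT_comp (mh n)).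
exact: (cvg_unique _ c1 c2).
Qed.

(** Nonnegative bounded functions are bounded pointwise limits of simple ones; a bounded function
    becomes nonnegative by adding its bound. *)
Lemma uncorrelated_indic_bounded : (forall B : set R, measurable B -> uncorrelated (\1_B)) ->
  forall h, @bounded_rv _ (measurableTypeR R) R h -> uncorrelated h.
Proof.
move=> hB.
have ge0 h M : measurable_fun setT (h : measurableTypeR R -> R) -> (forall x, 0 <= h x <= M) -> uncorrelated h.
  move=> mh h0M.
  have mhE : measurable_fun setT (EFin \o h : measurableTypeR R -> \bar R) by exact/measurable_EFinP.
  pose g := nnsfun_approx measurableT mhE.
  have cg x : (fun n => g n x) @ \oo --> h x.
    have h0 y : setT y -> (0 <= (EFin \o h) y)%E by move=> _; rewrite /= lee_fin; have /andP[] := h0M y.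
    exact: (fine_cvg (cvg_nnsfun_approx measurableT mhE h0 (I : setT x))).
  apply: (@uncorrelated_cvg (fun n => g n) _ M).
  - move=> n.
    rewrite (_ : (g n : R -> R) = fun x => \sum_(r <- finmap.enum_fset (fset_set (range (g n)))) r * \1_(g n @^-1` [set r]) x).
      apply: uncorrelated_sum => r; apply: uncorrelatedZ; apply: hB.
      rewrite -[X in measurable X]setTI.
      exact: (measurable_funPT (g n) measurableT [set r] (measurable_set1 r)).
    by apply/funext => x; rewrite fimfunE fsbig_finite.
  - move=> n x; rewrite ger0_norm ?fun_ge0//; have /andP[_ hxM] := h0M x; apply: le_trans hxM.
    have gnd : nondecreasing_seq (fun k => g k x).
      by move=> a b ab; have /lefP := nd_nnsfun_approx measurableT mhE ab; exact.
    by rewrite -(cvg_lim _ (cg x))//; apply: nondecreasing_cvgn_le => //; apply/cvg_ex; exists (h x); exact: cg.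
  - exact: cg.
move=> h [mh [M hM]].
rewrite (_ : h = fun x => (h x + M) + (- M) * \1_setT x); last first.
  by apply/funext => x; rewrite indicT mulr1 addrK.
apply: uncorrelatedD; last by apply: uncorrelatedZ; exact: hB.
apply: (ge0 _ (M + M)); first exact: measurable_funD.
by move=> x; have := hM x; rewrite ler_norml => /andP[? ?]; apply/andP; split; lra.
Qed.

End uncorrelated.

(** * Trigonometric polynomials and indicators of rays *)

Section trigonometric_polynomials.
Context (R : realType).
Implicit Types (f g h : R -> R).

Definition trig_poly h := exists (J : finType) (c u th : J -> R),
  h = fun x => \sum_j c j * cos (u j * x + th j).

Lemma trig_poly_cos (c u th : R) : trig_poly (fun x => c * cos (u * x + th)).
Proof.
exists unit, (fun _ => c), (fun _ => u), (fun _ => th); apply/funext => x.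
by rewrite (big_pred1 tt)//; case.
Qed.

Lemma trig_poly_cst c : trig_poly (fun _ => c).
Proof.
have := trig_poly_cos c 0 0; congr trig_poly; apply/funext => x.
by rewrite mul0r addr0 cos0 mulr1.
Qed.

Lemma trig_polyD g h : trig_poly g -> trig_poly h -> trig_poly (fun x => g x + h x).
Proof.
move=> [J [c [u [th ->]]]] [J' [c' [u' [th' ->]]]].
exists (J + J')%type, (fun j => match j with inl j => c j | inr j => c' j end),
  (fun j => match j with inl j => u j | inr j => u' j end),
  (fun j => match j with inl j => th j | inr j => th' j end).
by apply/funext => x; rewrite big_sumType.
Qed.

Lemma cosM (x y : R) : cos x * cos y = 2^-1 * cos (x + y) + 2^-1 * cos (x - y).
Proof. by rewrite cosD cosB; field. Qed.

Lemma trig_polyM g h : trig_poly g -> trig_poly h -> trig_poly (fun x => g x * h x).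
Proof.
move=> [J [c [u [th ->]]]] [J' [c' [u' [th' ->]]]].
(* The values 1 and -1 of [e] give the two cosines of the product-to-sum formula. *)
suff : forall e : R, trig_poly (fun x => \sum_(p : J * J')
    (c p.1 * c' p.2 / 2) * cos ((u p.1 + e * u' p.2) * x + (th p.1 + e * th' p.2))).
  move=> H; have := trig_polyD (H 1) (H (-1)); congr trig_poly; apply/funext => x.
  rewrite -big_split/= big_distrlr/= pair_big/=; apply: eq_bigr => p _.
  rewrite [RHS]mulrACA cosM.
  rewrite (_ : u p.1 * x + th p.1 + _ = (u p.1 + 1 * u' p.2) * x + (th p.1 + 1 * th' p.2)); last by ring.
  rewrite (_ : u p.1 * x + th p.1 - _ = (u p.1 + -1 * u' p.2) * x + (th p.1 + -1 * th' p.2)); last by ring.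
  by rewrite mulrDr !mulrA.
by move=> e; exists (J * J')%type, (fun p => c p.1 * c' p.2 / 2), (fun p => u p.1 + e * u' p.2),
  (fun p => th p.1 + e * th' p.2).
Qed.

Lemma trig_polyX n h : trig_poly h -> trig_poly (fun x => h x ^+ n).
Proof.
move=> hh; elim: n => [|n IH]; first by under eq_fun do rewrite expr0; exact: trig_poly_cst.
by under eq_fun do rewrite exprS; exact: trig_polyM.
Qed.

(* Tends to the indicator of [y < 1/2] on [[0, 1]] while staying a polynomial in
   [y], hence a trigonometric polynomial when [y] is one (cf. the Brosowski-Deutsch
   proof of the Stone-Weierstrass theorem). *)
Definition step_approx n (y : R) := (1 - y ^+ n.*2) ^+ (n * 4 ^ n).

Lemma bernoulli_le (a : R) n : 0 <= a <= 1 -> 1 - n%:R * a <= (1 - a) ^+ n.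
Proof.
move=> /andP[a0 a1]; elim: n => [|n IH]; first by rewrite mul0r subr0 expr0.
have b0 : 0 <= 1 - a by rewrite subr_ge0.
rewrite exprS; apply: le_trans (ler_wpM2l b0 IH).
rewrite -subr_ge0 -[n.+1]addn1 natrD.
have -> : (1 - a) * (1 - n%:R * a) - (1 - (n%:R + 1%:R) * a) = n%:R * a ^+ 2 by ring.
by rewrite mulr_ge0// sqr_ge0.
Qed.

(** Bernoulli's inequality for [1 + a], together with [(1 - a) (1 + a) <= 1]. *)
Lemma bernoulli_inv (a : R) n : 0 <= a <= 1 -> (1 - a) ^+ n <= (1 + n%:R * a)^-1.
Proof.
move=> /andP[a0 a1].
have h : 1 + n%:R * a <= (1 + a) ^+ n.
  elim: n => [|n IH]; first by rewrite mul0r addr0 expr0.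
  have b0 : 0 <= 1 + a by rewrite addr_ge0.
  rewrite exprS; apply: le_trans (ler_wpM2l b0 IH).
  rewrite -subr_ge0 -[n.+1]addn1 natrD.
  have -> : (1 + a) * (1 + n%:R * a) - (1 + (n%:R + 1%:R) * a) = n%:R * a ^+ 2 by ring.
  by rewrite mulr_ge0// sqr_ge0.
have d0 : 0 < 1 + n%:R * a by rewrite ltr_pwDl// mulr_ge0.
rewrite -[leRHS]mul1r ler_pdivlMr//.
apply: le_trans (_ : (1 - a) ^+ n * (1 + a) ^+ n <= 1).
  by apply: ler_wpM2l => //; rewrite exprn_ge0// subr_ge0.
rewrite -exprMn (_ : (1 - a) * (1 + a) = 1 - a ^+ 2); last by ring.
have := sqr_ge0 a => ha; apply: exprn_ile1; last by lra.
by rewrite subr_ge0 exprn_ile1.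
Qed.

Lemma step_approx_bound n y : 0 <= y <= 1 -> 0 <= step_approx n y <= 1.
Proof.
move=> /andP[y0 y1].
have h1 : 0 <= y ^+ n.*2 by rewrite exprn_ge0.
have h2 : y ^+ n.*2 <= 1 by rewrite exprn_ile1.
by rewrite /step_approx exprn_ge0 ?exprn_ile1//; lra.
Qed.

(** The exponent [n * 4 ^ n] places the threshold at 1/2: [n (2 y)^(2n)] tends to 0 below it and is
    at least [n] from it on, so the two Bernoulli bounds decide the limit. *)
Lemma step_approxE n (y : R) : (n * 4 ^ n)%:R * y ^+ n.*2 = n%:R * (2 * y) ^+ n.*2.
Proof.
rewrite natrM natrX -mul2n !exprM -mulrA -exprMn; congr (_ * _ ^+ _).
by rewrite exprMn; congr (_ * _); ring.
Qed.

Lemma step_approx_cvg y : 0 <= y <= 1 -> (step_approx ^~ y) @ \oo --> ((y < 2^-1)%R%:R : R).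
Proof.
move=> /andP[y0 y1].
have hy n : 0 <= y ^+ n.*2 <= 1 by rewrite exprn_ge0// exprn_ile1.
have [yl|yg] := ltP y 2^-1.
  pose z := 2 * y.
  have z0 : 0 <= z by rewrite mulr_ge0.
  have z1 : z < 1 by rewrite /z; lra.
  pose dl := 1 - z.
  have dl0 : 0 < dl by rewrite subr_gt0.
  have nz n : n%:R * z ^+ n <= dl^-1.
    have := @bernoulli_inv dl n; rewrite /dl subKr.
    rewrite subr_ge0 (ltW z1)/= gerBl z0 => /(_ isT) h.
    apply: (@le_trans _ _ (n%:R * (1 + n%:R * dl)^-1)); first by rewrite ler_wpM2l.
    have d0 : 0 < 1 + n%:R * dl by rewrite ltr_pwDl// mulr_ge0// ltW.
    by rewrite ler_pdivrMr// mulrDr mulr1 (mulrCA dl^-1) mulVf ?gt_eqF// mulr1 lerDr invr_ge0 ltW.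
  apply: (@squeeze_cvgr _ _ _ _ (fun n => 1 - dl^-1 * z ^+ n) (fun _ => 1)).
  - apply: nearW => n; apply/andP; split; last by have /andP[] := step_approx_bound n (introT andP (conj y0 y1)).
    apply: le_trans (bernoulli_le _ (hy n)); rewrite step_approxE lerD2l lerN2.
    by rewrite -addnn exprD mulrA ler_wpM2r// exprn_ge0.
  - rewrite -[X in _ --> X]subr0 -(mulr0 dl^-1); apply: cvgB; first exact: cvg_cst.
    apply: cvgM; first exact: cvg_cst.
    by apply: cvg_expr; rewrite ger0_norm.
  - exact: cvg_cst.
apply: (@squeeze_cvgr _ _ _ _ (fun _ => 0) (fun n => (n.+1%:R)^-1)); [|exact: cvg_cst|exact: cvg_harmonic].
apply: nearW => n; apply/andP; split; first by have /andP[] := step_approx_bound n (introT andP (conj y0 y1)).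
apply: le_trans (bernoulli_inv _ (hy n)) _; rewrite step_approxE.
have h1 : 1 <= (2 * y) ^+ n.*2 by rewrite exprn_ege1//; lra.
rewrite lef_pV2 ?posrE ?ltr0Sn//; last by rewrite ltr_pwDl// mulr_ge0// exprn_ge0// mulr_ge0.
by rewrite -natr1 [leLHS]addrC lerD2l ler_peMr.
Qed.

End trigonometric_polynomials.

Section uncorrelated_trig.
Context d (Omega : measurableType d) (R : realType) (P : probability Omega R).
Context d' (Omega' : measurableType d') (Q : probability Omega' R).
Context (Z V : Omega -> R) (bZ : bounded_rv Z) (mV : measurable_fun setT V).
Context (Y : Omega' -> R) (mY : measurable_fun setT Y).
Local Notation uncor := (uncorrelated P Q Z V Y).
Hypothesis hcos : forall u th : R, \int[P]_om (Z om * cos (u * V om + th)) =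
  (\int[P]_om Z om) * \int[Q]_om cos (u * Y om + th).

Lemma uncorrelated_trig_poly h : trig_poly h -> uncor h.
Proof.
move=> [J [c [u [th ->]]]]; apply: (uncorrelated_sum bZ mV mY) => j.
apply: (uncorrelatedZ bZ mV mY); split; last exact: hcos.
by apply: bounded_rv_cos; apply: measurable_funD => //; apply: measurable_funM.
Qed.

(** For large [n], [x > a] if and only if [sin ((x - a) / (n + 1)) > 0]. Now
    [y n = 1/2 - sin(...)/2] is a trigonometric polynomial with values in [[0, 1]], and it is below
    1/2 exactly when the sine is positive; [step_approx] reads this off. *)
Lemma uncorrelated_ray (a : R) : uncor (\1_(`]a, +oo[)).
Proof.
pose y n (x : R) := 2^-1 * cos (n.+1%:R^-1 * x + (pi / 2 - n.+1%:R^-1 * a)) + 2^-1.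
have yE n x : y n x = 2^-1 - 2^-1 * sin (n.+1%:R^-1 * (x - a)).
  rewrite /y (_ : _ * x + _ = n.+1%:R^-1 * (x - a) + pi / 2); last by ring.
  by rewrite cosDpihalf mulrN addrC.
have y01 n x : 0 <= y n x <= 1.
  have := sin_le1 (n.+1%:R^-1 * (x - a)); have := sin_geN1 (n.+1%:R^-1 * (x - a)).
  by rewrite yE => ? ?; apply/andP; split; lra.
have sgn n : uncor (fun x => (0 < sin (n.+1%:R^-1 * (x - a)))%R%:R).
  apply: (@uncorrelated_cvg _ _ _ P _ _ Q _ _ bZ mV _ mY (fun k x => step_approx k (y n x)) _ 1).
  - move=> k; apply: uncorrelated_trig_poly; apply: trig_polyX.
    rewrite (_ : (fun x => _) = fun x => 1 + (-1) * (y n x) ^+ k.*2); last by apply/funext => x; ring.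
    apply: trig_polyD; first exact: trig_poly_cst.
    apply: trig_polyM; first exact: trig_poly_cst.
    apply: trig_polyX; apply: trig_polyD; [exact: trig_poly_cos|exact: trig_poly_cst].
  - by move=> k x; have /andP[s0 s1] := step_approx_bound k (y01 n x); rewrite ger0_norm.
  - move=> x; have := step_approx_cvg (y01 n x); rewrite yE.
    by rewrite (_ : (2^-1 - _ < 2^-1) = (0 < sin (n.+1%:R^-1 * (x - a))))//; apply/idP/idP; lra.
apply: (@uncorrelated_cvg _ _ _ P _ _ Q _ _ bZ mV _ mY
  (fun n x => (0 < sin (n.+1%:R^-1 * (x - a)))%R%:R) _ 1) => //.
- by move=> n x; case: (0 < _); rewrite ?normr1 ?normr0.
move=> x; apply: cvg_near_cst.
have sm (b : R) : 0 < b -> \forall n \near \oo, 0 < n.+1%:R^-1 * b < pi.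
  move=> b0; near=> n; apply/andP; split; first by rewrite mulr_gt0// invr_gt0.
  rewrite ltr_pdivrMl// mulrC -ltr_pdivrMl ?pi_gt0//.
  apply: lt_le_trans (truncnS_gt _) _; rewrite ler_nat ltnS.
  by near: n; exact: nbhs_infty_ge.
rewrite indicE mem_setE in_itv/= andbT.
have [xa|ax|->] := ltgtP x a.
- have := sm (a - x); rewrite subr_gt0 => /(_ xa); apply: filterS => n /andP[h1 h2].
  rewrite (_ : (0 < _) = false)//; apply/negbTE; rewrite -leNgt -opprB mulrN sinN oppr_le0.
  by apply: ltW; apply: sin_gt0_pi; rewrite h1.
- have := sm (x - a); rewrite subr_gt0 => /(_ ax); apply: filterS => n /andP[h1 h2].
  by rewrite sin_gt0_pi// h1.
- by apply: nearW => n; rewrite subrr mulr0 sin0 ltxx.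
Unshelve. all: by end_near. Qed.

(** Dynkin's theorem: the rays form a generating pi-system, and linearity and bounded limits make
    the admissible sets a lambda-system. *)
Lemma uncorrelated_indic (B : set R) : measurable B -> uncor (\1_B).
Proof.
pose H : set (set R) := [set A | uncor (\1_A)].
pose G : set (set R) := [set A | exists a, A = `]a, +oo[%classic].
suff : <<s [set: R], G >> `<=` H.
  move=> GH mB; apply: GH.
  by have := (mB : @measurable _ (measurableTypeR R) B); rewrite RGenOInfty.measurableE.
have HT : H setT.
  have := uncorrelated_trig_poly (trig_poly_cst 1).
  by congr uncorrelated; apply/funext => x; rewrite indicT.
apply: lambda_system_subset => //.
- move=> A A' [a ->] [a' ->]; exists (Num.max a a').
  by apply/seteqP; split => x /=; rewrite !in_itv/= !andbT gt_max; [move=> [-> ->]|move=> /andP[]].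
- split => //.
  + move=> A A' AB HA HB; rewrite /H/=.
    have := uncorrelatedD bZ mV mY HA (uncorrelatedZ bZ mV mY (-1) HB).
    congr uncorrelated; apply/funext => x; rewrite !indicE in_setD.
    have [xB|xB] := boolP (x \in A'); last by rewrite mulr0 addr0 andbT.
    have -> : x \in A by apply/mem_set/AB/set_mem.
    by rewrite mulr1 subrr.
  + move=> A ndA HA; rewrite /H/=.
    apply: (@uncorrelated_cvg _ _ _ P _ _ Q _ _ bZ mV _ mY (fun n => \1_(A n)) _ 1) => //.
      by move=> n x; rewrite indicE; case: (_ \in _); rewrite ?normr1 ?normr0.
    move=> x; apply: cvg_near_cst; rewrite indicE.
    have [/set_mem[n _ An]|/negP xA] := boolP (x \in \bigcup_n A n).
      near=> k; have nk : (n <= k)%N by near: k; exact: nbhs_infty_ge.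
      have /subsetPset AnAk := ndA _ _ nk.
      by rewrite indicE mem_set//; exact: AnAk.
    apply: nearW => n; rewrite indicE memNset// => An; apply: xA; apply/mem_set; by exists n.
- by move=> _ [a ->]; exact: uncorrelated_ray.
Unshelve. all: by end_near. Qed.

End uncorrelated_trig.

(** * Characteristic functions of the Wiener increments *)

Section gaussian_characteristic.
Context (R : realType).
Local Notation Q := (@normal_prob R 0 1).

(* The characteristic function of the standard normal law. Its closed form is
   never needed: the Wiener increments force [normal_cf (sqrt x) * normal_cf (sqrt y) =
   normal_cf (sqrt (x + y))]. *)
Definition normal_cf (u : R) := \int[Q]_x cos (u * x).

Let m_affine (c th : R) : measurable_fun setT (fun x : measurableTypeR R => c * x + th).
Proof. by apply: measurable_funD => //; apply: measurable_funM. Qed.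

Lemma psi0 : normal_cf 0 = 1.
Proof.
rewrite /normal_cf; under eq_Rintegral do rewrite mul0r cos0.
exact: probability_Rintegral_cst.
Qed.

Lemma psiN u : normal_cf (- u) = normal_cf u.
Proof. by rewrite /normal_cf; apply: eq_Rintegral => x _; rewrite mulNr cosN. Qed.

Lemma psi_norm u : normal_cf `|u| = normal_cf u.
Proof. by have [u0|u0] := leP 0 u; [rewrite ger0_norm|rewrite ltr0_norm// psiN]. Qed.

Lemma psi_cvg (u : nat -> R) v : u @ \oo --> v -> (fun n => normal_cf (u n)) @ \oo --> normal_cf v.
Proof.
move=> cu; apply: (@bounded_expectation_cvg _ _ _ Q _ _ 1).
- move=> n; have [mc _] := bounded_rv_cos (m_affine (u n) 0).
  by apply: eq_measurable_fun mc => x _; rewrite addr0.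
- by move=> n x; exact: cos_max.
- move=> x; have cc : cos y @[y --> v * x] --> cos (v * x) by exact: continuous_cos.
  by apply: cvg_comp cc; apply: cvgM => //; exact: cvg_cst.
Qed.

Lemma normal_sin u : \int[Q]_x sin (u * x) = 0.
Proof.
apply: normal_integral_odd.
- exact: oner_neq0.
- move=> x; apply: (@continuous_comp _ _ _ (fun x => u * x) sin); last exact: continuous_sin.
  by apply: cvgM; [exact: cvg_cst|exact: cvg_id].
- by move=> x; rewrite mulrN sinN.
have [mc bc] := bounded_rv_cos (m_affine u (- (pi / 2))).
apply: bounded_rv_integrable; split.
  by apply: eq_measurable_fun mc => x _; rewrite cosBpihalf.
by have [M hM] := bc; exists M => x; rewrite -cosBpihalf.
Qed.

Lemma normal_cos u th : \int[Q]_x cos (u * x + th) = cos th * normal_cf u.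
Proof.
have bc : bounded_rv (fun x : measurableTypeR R => cos (u * x)).
  by have := bounded_rv_cos (m_affine u 0); under eq_fun do rewrite addr0.
have bs : bounded_rv (fun x : measurableTypeR R => sin (u * x)).
  by have := bounded_rv_cos (m_affine u (- (pi / 2))); under eq_fun do rewrite cosBpihalf.
transitivity (\int[Q]_x (cos th * cos (u * x) + (- sin th) * sin (u * x))).
  by apply: eq_Rintegral => x _; rewrite cosD; ring.
rewrite (bounded_expectationD Q); last 2 first.
- by apply: bounded_rvM => //; exact: bounded_rv_cst.
- by apply: bounded_rvM => //; exact: bounded_rv_cst.
by rewrite !(bounded_expectationZ Q)// normal_sin mulr0 addr0.
Qed.

End gaussian_characteristic.

Section wiener_characteristic.
Context d (Omega : measurableType d) (R : realType) (P : probability Omega R) (t T : R).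
Context (F : R -> set_system Omega) (m : nat) (f : 'I_m -> R -> Omega -> R).
Hypotheses (t0 : 0 <= t) (tT : t < T) (hF : is_filtration T F) (hf : is_wiener P T F f).
Local Notation Q := (@normal_prob R 0 1).

Lemma centered_gaussian_cos s X (c th : R) : 0 < s -> centered_gaussian P s X ->
  \int[P]_om cos (c * X om + th) = cos th * normal_cf (c * s).
Proof.
move=> s0 G; have [mX _] := G.
have bX : bounded_rv (fun om => cos (c * X om + th)).
  by apply: bounded_rv_cos; apply: measurable_funD => //; apply: measurable_funM.
have bY : bounded_rv (fun x : measurableTypeR R => cos (c * (s * x) + th)).
  by apply: bounded_rv_cos; apply: measurable_funD => //; apply: measurable_funM => //; apply: measurable_funM.
(* Adding 1 makes the integrand nonnegative, as the change of variables requires; the constant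
   cancels afterwards. *)
have ch : continuous (fun x : R => 1 + cos (c * x + th)).
  move=> x; apply: cvgD; first exact: cvg_cst.
  apply: (@continuous_comp _ _ _ (fun x => c * x + th) cos); last exact: continuous_cos.
  by apply: cvgD; [apply: cvgM; [exact: cvg_cst|exact: cvg_id]|exact: cvg_cst].
have h0 (x : R) : 0 <= 1 + cos (c * x + th) by have := cos_geN1 (c * x + th); lra.
have E1 : \int[P]_om (1 + cos (c * X om + th)) = \int[Q]_x (1 + cos (c * (s * x) + th)).
  rewrite /Rintegral; congr fine.
  rewrite (centered_gaussian_integral G (h := fun x => (1 + cos (c * x + th))%:E)); last exact: continuous_measurable_EFin.
  exact: (integral_normal_scale s0 ch h0).
rewrite (bounded_expectationD P (@bounded_rv_cst _ _ _ 1) bX) in E1.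
rewrite (bounded_expectationD Q (@bounded_rv_cst _ _ _ 1) bY) in E1.
rewrite !probability_Rintegral_cst in E1.
have -> : \int[P]_om cos (c * X om + th) = \int[Q]_x cos (c * (s * x) + th) by lra.
by rewrite -normal_cos; apply: eq_Rintegral => x _; rewrite mulrA.
Qed.

Section one_step.
Context (u s : R) (tu : t <= u) (us : u < s) (sT : s <= T).
Let D a om := f a s om - f a u om.
Let sg := Num.sqrt (s - u).

Let sg0 : 0 < sg. Proof. by rewrite sqrtr_gt0 subr_gt0. Qed.

Let mD a : measurable_fun setT (D a).
Proof. by have [] := wiener_gauss hf a (le_trans t0 tu) us sT. Qed.

Let mpre a (B : set R) : measurable B -> measurable (D a @^-1` B).
Proof. by move=> mB; rewrite -[X in measurable X]setTI; exact: mD. Qed.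

Let mS (c : 'I_m -> R) (s2 : seq 'I_m) : measurable_fun setT (fun om => \sum_(a <- s2) c a * D a om).
Proof. by apply: measurable_sum => a; apply: measurable_funM. Qed.

Let D_cos a c th : \int[P]_om cos (c * D a om + th) = cos th * normal_cf (c * sg).
Proof. exact: centered_gaussian_cos sg0 (wiener_gauss hf a (le_trans t0 tu) us sT). Qed.

(** Replaces indicators by cosines, one component at a time. With no cosine this is the independence
    of the increments. In the step, the induction hypothesis with [a] among the indicators makes
    [D a] uncorrelated with the remaining factor, first for indicators and then for all bounded
    functions, cosines included. *)
Let mixed (A : set Omega) (c : 'I_m -> R) (s1 s2 : seq 'I_m) (B : 'I_m -> set R) th :
  F u A -> uniq (s1 ++ s2) -> (forall a, measurable (B a)) ->
  \int[P]_om (\1_A om * (\prod_(a <- s1) \1_(B a) (D a om)) * cos (th + \sum_(a <- s2) c a * D a om)) =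
  fine (P A) * (\prod_(a <- s1) fine (P (D a @^-1` B a))) * (cos th * \prod_(a <- s2) normal_cf (c a * sg)).
Proof.
move=> FA; have mA : measurable A.
  by apply: (filt_sub hF (s := u)) => //; rewrite (le_trans t0)//= ltW// (lt_le_trans us).
have bA : bounded_rv (fun om => \1_A om : R).
  by split; [exact: measurable_indic|exists 1 => om; rewrite indicE; case: (_ \in _); rewrite ?normr1 ?normr0].
have bB (B' : 'I_m -> set R) s' : (forall a, measurable (B' a)) -> bounded_rv (fun om => \prod_(a <- s') \1_(B' a) (D a om) : R).
  by move=> mB; apply: bounded_rv_prod => a; exact: (bounded_rv_indic (mB a) (mD a)).
have bZ (B' : 'I_m -> set R) s' s'' th' : (forall a, measurable (B' a)) ->
    bounded_rv (fun om => \1_A om * (\prod_(a <- s') \1_(B' a) (D a om)) * cos (th' + \sum_(a <- s'') c a * D a om)).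
  move=> mB; apply: bounded_rvM; first by apply: bounded_rvM => //; exact: bB.
  by apply: bounded_rv_cos; apply: measurable_funD.
elim: s2 s1 B th => [|a s2 IH] s1 B th us12 mB.
  under eq_Rintegral do rewrite big_nil addr0 mulrC.
  rewrite (bounded_expectationZ P); last by apply: bounded_rvM => //; exact: bB.
  rewrite big_nil mulr1 mulrC; congr (_ * _).
  pose B' a := if a \in s1 then B a else setT.
  have mB' a : measurable (B' a) by rewrite /B'; case: ifP.
  have W : P (A `&` \bigcap_a (D a @^-1` B' a)) = (P A * \prod_a P (D a @^-1` B' a))%E.
    exact: (wiener_indep hf (le_trans t0 tu) us sT FA mB').
  have us1 : uniq s1 by rewrite cats0 in us12.
  have prodE (g : 'I_m -> \bar R) : (forall a, a \notin s1 -> g a = 1%E) ->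
      (\prod_a g a = \prod_(a <- s1) g a)%E.
    move=> g1; rewrite (big_uniq _ us1)/= [LHS](bigID (fun a => a \in s1))/=.
    by rewrite [X in (_ * X)%E]big1 ?mule1.
  rewrite prodE in W; last by move=> a as1; rewrite /B' (negbTE as1) preimage_setT probability_setT.
  transitivity (fine (P (A `&` \bigcap_a (D a @^-1` B' a)))).
    have mBB : measurable (\bigcap_a (D a @^-1` B' a)).
      by apply: fin_bigcap_measurable => // a _; exact: mpre.
    have E0 : (\int[P]_om (\1_(A `&` \bigcap_a (D a @^-1` B' a)) om)%:E = P (A `&` \bigcap_a (D a @^-1` B' a)))%E.
      by rewrite integral_indic ?setIT//; exact: measurableI.
    rewrite -E0.
    rewrite /Rintegral; congr fine; apply: eq_integral => om _; congr EFin.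
    have [omA|omA] := boolP (om \in A); last first.
      by rewrite !indicE (negbTE omA) mul0r in_setI (negbTE omA).
    rewrite [\1_A om]indicE omA mul1r indicE in_setI omA/=.
    have [/allP h|/allPn[a as1 h]] := boolP (all (fun a => D a om \in B a) s1).
      rewrite big_seq big1 => [|a /h]; last by rewrite indicE => ->.
      rewrite mem_set// => a _; rewrite /B'; case: ifP => [/h/set_mem//|//].
    rewrite (big_rem a as1)/= indicE (negbTE h) mul0r memNset// => /(_ a I).
    by rewrite /B' as1 => /mem_set; apply/negP.
  rewrite W fineM//; last 2 first.
  - exact: fin_num_measure.
  - by apply: prode_fin_num => a _; apply: fin_num_measure; exact: mpre.
  congr (_ * _).
  rewrite (eq_big_seq (fun a => P (D a @^-1` B a))); last by move=> a as1; rewrite /B' as1.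
  elim: (s1) => [|a s3 IHs]; first by rewrite !big_nil.
  rewrite !big_cons fineM ?IHs//.
    by apply: fin_num_measure; exact: mpre.
  by apply: prode_fin_num => b _; apply: fin_num_measure; exact: mpre.
have us12' : uniq ((a :: s1) ++ s2) by rewrite -(perm_uniq (permEl (perm_catCA s1 [:: a] s2))).
have us12'' : uniq (s1 ++ s2).
  by move: us12'; rewrite /= => /andP[].
have as1 : a \notin s1 by move: us12'; rewrite /= mem_cat negb_or => /andP[/andP[]].
have E1 th' : \int[P]_om (\1_A om * (\prod_(a <- s1) \1_(B a) (D a om)) * cos (th' + \sum_(a <- s2) c a * D a om)) =
    fine (P A) * (\prod_(a <- s1) fine (P (D a @^-1` B a))) * (cos th' * \prod_(a <- s2) normal_cf (c a * sg)).
  exact: IH.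
pose Z th' om := \1_A om * (\prod_(a <- s1) \1_(B a) (D a om)) * cos (th' + \sum_(a <- s2) c a * D a om) : R.
have bZth th' : bounded_rv (Z th') by exact: bZ.
have unc th' (B0 : set R) : measurable B0 -> uncorrelated P P (Z th') (D a) (D a) (\1_B0).
  move=> mB0; split.
    by apply: (@bounded_rv_indic _ _ _ B0 id) => //.
  pose B1 b := if b == a then B0 else B b.
  have mB1 b : measurable (B1 b) by rewrite /B1; case: ifP.
  have B1E b : b \in s1 -> B1 b = B b.
    by move=> bs1; rewrite /B1; case: eqP => // ba; move: as1; rewrite -ba bs1.
  have := IH (a :: s1) B1 th' us12' mB1.
  have B1a : B1 a = B0 by rewrite /B1 eqxx.
  rewrite E1 expectation_indic//.
  rewrite big_cons B1a.
  rewrite (eq_big_seq (fun b => fine (P (D b @^-1` B b)))); last by move=> b bs1; rewrite B1E.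
  move=> E2; transitivity (fine (P A) * (fine (P (D a @^-1` B0)) * \prod_(b <- s1) fine (P (D b @^-1` B b))) *
      (cos th' * \prod_(b <- s2) normal_cf (c b * sg))); last by ring.
  rewrite -E2; apply: eq_Rintegral => om _; rewrite /Z big_cons B1a.
  rewrite [in RHS](eq_big_seq (fun b => \1_(B b) (D b om))); last by move=> b bs1; rewrite B1E.
  by ring.
have ucos th' th0 : \int[P]_om (Z th' om * cos (c a * D a om + th0)) =
    (\int[P]_om Z th' om) * (cos th0 * normal_cf (c a * sg)).
  have bh : @bounded_rv _ (measurableTypeR R) R (fun x => cos (c a * x + th0)).
    by apply: bounded_rv_cos; apply: measurable_funD => //; apply: measurable_funM.
  by have [_ ->] := uncorrelated_indic_bounded (bZth th') (mD a) (mD a) (unc th') bh; rewrite D_cos.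
(* The addition formula produces a sine; as a cosine shifted by [pi / 2] it falls under the same
   identities. *)
transitivity (\int[P]_om (Z th om * cos (c a * D a om + 0) +
    (-1) * (Z (th - pi / 2) om * cos (c a * D a om + - (pi / 2))))).
  apply: eq_Rintegral => om _; rewrite big_cons addrCA.
  rewrite (cosD (c a * D a om)) cosBpihalf addr0 /Z.
  rewrite (_ : th - pi / 2 + _ = (th + \sum_(a <- s2) c a * D a om) - pi / 2); last by ring.
  by rewrite cosBpihalf; ring.
have bc th0 : bounded_rv (fun om => cos (c a * D a om + th0)).
  by apply: bounded_rv_cos; apply: measurable_funD => //; apply: measurable_funM.
rewrite (bounded_expectationD P); last 2 first.
- by apply: bounded_rvM.
- by apply: bounded_rvM; [exact: bounded_rv_cst|exact: bounded_rvM].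
rewrite (bounded_expectationZ P); last exact: bounded_rvM.
rewrite !ucos cos0 cosN cos_pihalf mul0r !mulr0 addr0 mul1r E1 big_cons; ring.
Qed.

(** The events on which [Y] lies in a Borel set belong to [F u] and can serve as [A] in [mixed];
    hence the cosine of the new increments is uncorrelated with all bounded functions of the past
    variable [Y]. *)
Lemma one_step_cos (c : 'I_m -> R) th (Y : Omega -> R) : measurable_for (F u) Y ->
  \int[P]_om cos (th + (Y om + \sum_a c a * D a om)) =
  (\int[P]_om cos (th + Y om)) * \prod_a normal_cf (c a * sg).
Proof.
move=> mY.
have hu : t <= u <= T by rewrite tu ltW// (lt_le_trans us).
have mY' := measurable_for_fun t0 hF hu mY.
have sF := sigma_algebra_filt t0 hF hu.
have FT : F u setT by have := mY setT measurableT; rewrite preimage_setT.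
pose Z th' om := cos (th' + \sum_a c a * D a om).
have bZ th' : bounded_rv (Z th').
  by apply: bounded_rv_cos; apply: measurable_funD.
have mixA A th' : F u A -> \int[P]_om (\1_A om * Z th' om) =
    fine (P A) * (cos th' * \prod_a normal_cf (c a * sg)).
  move=> FA; have := @mixed A c [::] (index_enum _) (fun _ => setT) th' FA.
  rewrite cat0s index_enum_uniq => /(_ isT (fun _ => measurableT)).
  rewrite big_nil mulr1 => <-.
  by apply: eq_Rintegral => om _; rewrite big_nil mulr1.
have EZ th' : \int[P]_om Z th' om = cos th' * \prod_a normal_cf (c a * sg).
  have := mixA setT th' FT; rewrite probability_setT mul1r => <-.
  by apply: eq_Rintegral => om _; rewrite indicT mul1r.
have unc th' (B : set R) : measurable B -> uncorrelated P P (Z th') Y Y (\1_B).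
  move=> mB; split; first by apply: (@bounded_rv_indic _ _ _ B id) => //.
  rewrite EZ expectation_indic// mulrC -mixA; last exact: mY.
  by apply: eq_Rintegral => om _; rewrite mulrC.
have ucos th' th0 : \int[P]_om (Z th' om * cos (Y om + th0)) =
    (cos th' * \prod_a normal_cf (c a * sg)) * (\int[P]_om cos (Y om + th0)).
  have bh : @bounded_rv _ (measurableTypeR R) R (fun x => cos (x + th0)).
    by apply: bounded_rv_cos; exact: measurable_funD.
  by have [_ ->] := uncorrelated_indic_bounded (bZ th') mY' mY' (unc th') bh; rewrite EZ.
have bc th0 : bounded_rv (fun om => cos (Y om + th0)).
  by apply: bounded_rv_cos; exact: measurable_funD.
transitivity (\int[P]_om (Z 0 om * cos (Y om + th) +
    (-1) * (Z (0 - pi / 2) om * cos (Y om + (th - pi / 2))))).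
  apply: eq_Rintegral => om _; rewrite addrA (cosD (th + Y om)) /Z add0r.
  rewrite (_ : 0 - pi / 2 + _ = \sum_a c a * D a om - pi / 2); last by ring.
  rewrite (_ : Y om + (th - pi / 2) = (Y om + th) - pi / 2); last by ring.
  by rewrite !cosBpihalf [th + _]addrC; ring.
rewrite (bounded_expectationD P); last 2 first.
- by apply: bounded_rvM.
- by apply: bounded_rvM; [exact: bounded_rv_cst|exact: bounded_rvM].
rewrite (bounded_expectationZ P); last exact: bounded_rvM.
rewrite !ucos cos0 add0r cosN cos_pihalf mul0r mul0r mulr0 addr0 mul1r mulrC; congr (_ * _).
by apply: eq_Rintegral => om _; rewrite addrC.
Qed.

End one_step.
End wiener_characteristic.

Section wiener_grid.
Context d (Omega : measurableType d) (R : realType) (P : probability Omega R) (t T : R).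
Context (F : R -> set_system Omega) (m : nat) (f : 'I_m -> R -> Omega -> R).
Hypotheses (t0 : 0 <= t) (tT : t < T) (hF : is_filtration T F) (hf : is_wiener P T F f).

Lemma wiener_adapted_le a s u : t <= s -> s <= u -> u <= T -> measurable_for (F u) (f a s).
Proof.
move=> ts su uT; apply: (measurable_for_le t0 hF ts su uT); apply: (wiener_adapted hf).
by rewrite (le_trans t0 ts) (le_trans su uT).
Qed.

Lemma grid_cos N (sg : nat -> R) (c : 'I_m -> nat -> R) th :
  (forall q, (q <= N)%N -> t <= sg q <= T) -> (forall q, (q < N)%N -> sg q < sg q.+1) ->
  \int[P]_om cos (th + \sum_(q < N) \sum_a c a q * (f a (sg q.+1) om - f a (sg q) om)) =
  cos th * \prod_(q < N) \prod_a normal_cf (c a q * Num.sqrt (sg q.+1 - sg q)).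
Proof.
elim: N => [|N IH] sgT sg_lt.
  rewrite big_ord0 mulr1 -[RHS](probability_Rintegral_cst P).
  by apply: eq_Rintegral => om _; rewrite big_ord0 addr0.
have /andP[tN NT] := sgT N (leqnSn N); have /andP[tSN SNT] := sgT N.+1 (leqnn _).
have sg_le q : (q <= N)%N -> sg q <= sg N.
  elim: {-2}N (leqnn N) => [|p IHp] pN; first by rewrite leqn0 => /eqP ->.
  rewrite leq_eqVlt => /orP[/eqP -> //|qp]; apply: le_trans (IHp (ltnW pN) qp) _.
  by apply/ltW/sg_lt; exact: ltnW.
pose Y om := \sum_(q < N) \sum_a c a q * (f a (sg q.+1) om - f a (sg q) om).
have hN : t <= sg N <= T by rewrite tN.
have sF := sigma_algebra_filt t0 hF hN.
have mY : measurable_for (F (sg N)) Y.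
  apply: measurable_for_sum => // q _; apply: measurable_for_sum => // a _.
  apply: measurable_forM => //; first exact: measurable_for_cst.
  have qN := ltn_ord q.
  apply: measurable_forB => //; apply: wiener_adapted_le => //.
  - by have /andP[] := sgT q.+1 (leqW qN).
  - exact: sg_le.
  - by have /andP[] := sgT q (leqW (ltnW qN)).
  - by apply: sg_le; exact: ltnW.
have := one_step_cos t0 hF hf tN (sg_lt N (ltnSn N)) SNT (fun a => c a N) th mY.
rewrite /Y IH => [E|q qN|q qN]; [|by apply: sgT; exact: leqW|by apply: sg_lt; exact: leqW].
rewrite [in RHS]big_ord_recr/= mulrA -E.
by apply: eq_Rintegral => om _; rewrite big_ord_recr.
Qed.

(** Read off from the process: the increment of a component over [[t, T]] is the sum of two
    increments, the second independent of the first. *)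
Lemma psi_sqrtD (a0 : 'I_m) (x y : R) : 0 <= x -> 0 <= y ->
  normal_cf (Num.sqrt x) * normal_cf (Num.sqrt y) = normal_cf (Num.sqrt (x + y)).
Proof.
rewrite le_eqVlt => /orP[/eqP <- _|x0]; first by rewrite sqrtr0 psi0 mul1r add0r.
rewrite le_eqVlt => /orP[/eqP <-|y0]; first by rewrite sqrtr0 psi0 mulr1 addr0.
have xy0 : 0 < x + y by rewrite addr_gt0.
have L0 : 0 < T - t by rewrite subr_gt0.
(* The scale [k] and the point [mid] are chosen so that [k] times the increments over [[t, mid]] and
   [[mid, T]] have standard deviations [sqrt x] and [sqrt y]. *)
pose k := Num.sqrt ((x + y) / (T - t)).
pose mid := t + x / (x + y) * (T - t).
have mt : mid - t = x / (x + y) * (T - t) by rewrite /mid; ring.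
have Tm : T - mid = y / (x + y) * (T - t).
  by rewrite /mid; field; rewrite gt_eqF.
have m1 : t < mid by rewrite -subr_gt0 mt; apply: mulr_gt0 => //; exact: divr_gt0.
have m2 : mid < T by rewrite -subr_gt0 Tm; apply: mulr_gt0 => //; exact: divr_gt0.
have k0 : 0 <= (x + y) / (T - t) by apply: divr_ge0; exact: ltW.
have kx : k * Num.sqrt (mid - t) = Num.sqrt x.
  rewrite /k -sqrtrM// mt; congr Num.sqrt; field.
  by rewrite !gt_eqF.
have ky : k * Num.sqrt (T - mid) = Num.sqrt y.
  rewrite /k -sqrtrM// Tm; congr Num.sqrt; field.
  by rewrite !gt_eqF.
have kxy : k * Num.sqrt (T - t) = Num.sqrt (x + y).
  by rewrite /k -sqrtrM// divfK// gt_eqF.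
pose c a := if a == a0 then k else 0.
have prodE s : \prod_a normal_cf (c a * s) = normal_cf (k * s).
  rewrite (bigD1 a0)//= /c eqxx big1 ?mulr1// => a /negbTE ->.
  by rewrite mul0r psi0.
have sumE (g : 'I_m -> R) : \sum_a c a * g a = k * g a0.
  by rewrite (bigD1 a0)//= /c eqxx big1 ?addr0// => a /negbTE ->; rewrite mul0r.
have one u s (tu : t <= u) (us : u < s) (sT : s <= T) Y : measurable_for (F u) Y ->
    \int[P]_om cos (0 + (Y om + k * (f a0 s om - f a0 u om))) =
    (\int[P]_om cos (0 + Y om)) * normal_cf (k * Num.sqrt (s - u)).
  move=> mY; rewrite -prodE -(one_step_cos t0 hF hf tu us sT c 0 mY).
  by apply: eq_Rintegral => om _; rewrite sumE.
have c0 u s (tu : t <= u) (us : u < s) (sT : s <= T) :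
    \int[P]_om cos (k * (f a0 s om - f a0 u om)) = normal_cf (k * Num.sqrt (s - u)).
  have hu : t <= u <= T by rewrite tu ltW// (lt_le_trans us).
  have := one u s tu us sT (fun _ => 0) (measurable_for_cst (sigma_algebra_filt t0 hF hu) 0).
  rewrite addr0 cos0 probability_Rintegral_cst mul1r => <-.
  by apply: eq_Rintegral => om _; rewrite !add0r.
rewrite -kx -ky -kxy -(c0 t mid)// ?ltW// -(c0 t T)//.
have hm : t <= mid <= T by rewrite !ltW.
have mY : measurable_for (F mid) (fun om => k * (f a0 mid om - f a0 t om)).
  have sF := sigma_algebra_filt t0 hF hm.
  apply: measurable_forM => //; first exact: measurable_for_cst.
  by apply: measurable_forB => //; apply: wiener_adapted_le => //; exact: ltW.
have := one mid T (ltW m1) m2 (lexx T) _ mY.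
under [X in _ = X * _ -> _]eq_Rintegral do rewrite add0r.
by move=> <-; apply: eq_Rintegral => om _; congr cos; ring.
Qed.

Lemma psi_sqrt_sum (a0 : 'I_m) (J : Type) (s : seq J) (x : J -> R) : (forall j, 0 <= x j) ->
  \prod_(j <- s) normal_cf (Num.sqrt (x j)) = normal_cf (Num.sqrt (\sum_(j <- s) x j)).
Proof.
move=> x0; elim: s => [|j s IH]; first by rewrite !big_nil sqrtr0 psi0.
by rewrite !big_cons IH psi_sqrtD// sumr_ge0.
Qed.

Lemma psi_mul_sqrt (c x : R) : normal_cf (c * Num.sqrt x) = normal_cf (Num.sqrt (c ^+ 2 * x)).
Proof.
by rewrite sqrtrM ?sqr_ge0// sqrtr_sqr -[RHS]psi_norm normrM normr_id -normrM psi_norm.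
Qed.

Lemma grid_cos_sum (a0 : 'I_m) N (sg : nat -> R) (c : 'I_m -> nat -> R) th :
  (forall q, (q <= N)%N -> t <= sg q <= T) -> (forall q, (q < N)%N -> sg q < sg q.+1) ->
  \int[P]_om cos (th + \sum_(q < N) \sum_a c a q * (f a (sg q.+1) om - f a (sg q) om)) =
  cos th * normal_cf (Num.sqrt (\sum_(q < N) \sum_a (c a q) ^+ 2 * (sg q.+1 - sg q))).
Proof.
move=> sgT sg_lt; rewrite grid_cos//; congr (_ * _).
have D0 (q : 'I_N) : 0 <= sg q.+1 - sg q by rewrite subr_ge0 ltW// sg_lt.
rewrite -(psi_sqrt_sum a0); last by move=> q; apply: sumr_ge0 => a _; rewrite mulr_ge0// sqr_ge0.
apply: eq_bigr => q _; rewrite -(psi_sqrt_sum a0); last by move=> a; rewrite mulr_ge0// sqr_ge0.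
by apply: eq_bigr => a _; exact: psi_mul_sqrt.
Qed.

End wiener_grid.

Section cosine_limits.
Context d (Omega : measurableType d) (R : realType) (P : probability Omega R).

Lemma cos_lipschitz (x y : R) : `|cos x - cos y| <= `|x - y|.
Proof.
wlog xy : x y / x < y => [hw|].
  have [xy|yx|->] := ltgtP x y; last by rewrite !subrr.
    exact: hw.
  by rewrite distrC (distrC x); exact: hw.
have dc (z : R) : is_derive z 1 cos (- sin z) by exact: is_derive_cos.
have cc : {within `[x, y], continuous (@cos R)}.
  by apply: continuous_subspaceT; exact: continuous_cos.
have [z _ E] := MVT xy (fun z _ => dc z) cc.
rewrite distrC (distrC x) E normrM normrN ler_piMl//; exact: sin_max.
Qed.

(** The cosine is 1-Lipschitz, and [|X - Y| <= (X - Y)^2 / (2 e) + e / 2]; a second moment below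
    [e^2] thus gives [e]. *)
Lemma cos_ms_cvg (X : nat -> Omega -> R) (Y : Omega -> R) (th : R) : (forall n, measurable_fun setT (X n)) ->
  measurable_fun setT Y -> (fun n => n2 P setT (fun om => (X n om - Y om)%R)) @ \oo --> 0%E ->
  (fun n => \int[P]_om cos (th + X n om)) @ \oo --> \int[P]_om cos (th + Y om).
Proof.
move=> mX mY cX.
have bc (V : Omega -> R) : measurable_fun setT V -> bounded_rv (fun om => cos (th + V om)).
  by move=> mV; apply: bounded_rv_cos; exact: measurable_funD.
apply/cvgrPdist_le => /= e e0.
have e20 : 0 < e ^+ 2 by rewrite exprn_gt0.
have [N _ hN] := (ge0_cvg0P _ (fun n => n2_ge0 P setT _)).1 cX _ e20.
exists N => // n /= /hN {hN} hn.
have bD : bounded_rv (fun om => `|cos (th + Y om) - cos (th + X n om)|).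
  have [m1 [M1 h1]] := bc _ mY; have [m2 [M2 h2]] := bc _ (mX n).
  split; first by apply: measurableT_comp => //; exact: measurable_funB.
  exists (M1 + M2) => om; rewrite normr_id; apply: le_trans (ler_normB _ _) _.
  exact: lerD.
have iD := bounded_rv_integrable P bD.
rewrite -RintegralB//; [|exact: (bounded_rv_integrable P (bc _ mY))|exact: (bounded_rv_integrable P (bc _ (mX n)))].
apply: (@le_trans _ _ (\int[P]_om `|cos (th + Y om) - cos (th + X n om)|)).
  apply: le_normr_Rintegral => //.
  apply: (@bounded_rv_integrable _ _ _ P (fun om => cos (th + Y om) - cos (th + X n om))).
  have [m1 [M1 h1]] := bc _ mY; have [m2 [M2 h2]] := bc _ (mX n).
  split; first exact: measurable_funB.
  by exists (M1 + M2) => om; apply: le_trans (ler_normB _ _) _; exact: lerD.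
rewrite -lee_fin /Rintegral fineK; last exact: (integrable_fin_num measurableT iD).
have mq : measurable_fun setT (fun om => ((X n om - Y om) ^+ 2)%:E : \bar R).
  by apply: measurable_sqr_EFin; exact: measurable_funB.
have c0 : 0 <= 2^-1 / e by rewrite divr_ge0 ?invr_ge0// ltW.
apply: (@le_trans _ _ ((2^-1 / e)%:E * n2 P setT (fun om => (X n om - Y om)%R) + (e / 2)%:E)%E).
  rewrite -ge0_integralZl_EFin//; last by move=> om _; rewrite lee_fin sqr_ge0.
  have -> : ((e / 2)%:E = \int[P]_om (cst (e / 2)%:E om))%E.
    rewrite /=; have := integral_cst P measurableT (e / 2)%:E => /= E.
    by rewrite E probability_setT mule1.
  rewrite -ge0_integralD//; last 3 first.
  - by move=> om _; rewrite mule_ge0// lee_fin ?sqr_ge0.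
  - exact: measurable_funeM.
  - by move=> om _; rewrite lee_fin divr_ge0// ltW.
  apply: ge0_le_integral => //.
  - exact: (measurable_int P iD).
  - by apply: emeasurable_funD => //; exact: measurable_funeM.
  move=> om _; rewrite -EFinM -EFinD lee_fin.
  have := mulr_le_weighted_sqr `|X n om - Y om| 1 e0.
  rewrite mulr1 expr1n mulr1 real_normK ?num_real// => h; apply: le_trans h.
  apply: le_trans (cos_lipschitz _ _) _.
  by rewrite opprD addrACA subrr add0r distrC.
have -> : (e%:E = (2^-1 / e)%:E * (e ^+ 2)%:E + (e / 2)%:E)%E.
  by rewrite -EFinM -EFinD; congr EFin; field; rewrite gt_eqF.
by rewrite leeD2r// lee_wpmul2l// ltW.
Qed.

End cosine_limits.

(** * Integrals of non-random functions as limits of grid sums *)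

Section deterministic_integrands.
Context d (Omega : measurableType d) (R : realType) (P : probability Omega R) (t T : R).
Context (F : R -> set_system Omega).
Hypotheses (t0 : 0 <= t) (tT : t < T) (hF : is_filtration T F).
Context (tau : nat -> nat -> R) (htau : is_partition_seq t T tau).
Local Notation MR := (measurableTypeR R).
Local Notation leb := (@lebesgue_measure R).

Definition grid_sum (W : R -> Omega -> R) (h : R -> R) N om :=
  \sum_(q < N) h (tau N q) * (W (tau N q.+1) om - W (tau N q) om).

Lemma sampleableM g h : sampleable t T g -> sampleable t T h -> sampleable t T (fun x => g x * h x).
Proof.
move=> [mg [M hM] [D hD]] [mh [K hK] [E hE]]; split.
- exact: measurable_funM.
- by exists (M * K) => x hx; rewrite normrM; apply: ler_pM => //; [exact: hM|exact: hK].
- exists (D ++ E) => x hx; rewrite mem_cat negb_or => /andP[xD xE].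
  by apply: cvgM; [exact: hD|exact: hE].
Qed.

Lemma sampleable_L2on h : sampleable t T h -> L2on t T h.
Proof. by move=> hh; split; [have [] := hh|exact: sampleable_n2_lty hh]. Qed.

Lemma sample_L2on N h : sampleable t T h -> L2on t T (sample tau N.+1 h).
Proof.
move=> [_ [M hM] _].
have M0 : 0 <= M by apply: le_trans (normr_ge0 (h t)) (hM t _); rewrite lexx ltW.
apply: (bounded_L2on (M := M)).
  by apply: measurable_funTS; exact: measurable_sample.
move=> x /andP[tx xT]; rewrite (sampleE htau)//; case: ltnP => iN; rewrite ?normr0// hM//.
by rewrite (part_in htau)// ltnW.
Qed.

(** The left Riemann sum is the inner product of the sample with the constant 1, so convergence of
    the samples in L2 suffices. *)
Lemma riemann_cvg h : sampleable t T h ->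
  (fun N => \sum_(q < N.+1) h (tau N.+1 q) * (tau N.+1 q.+1 - tau N.+1 q)) @ \oo -->
  \int[leb]_(x in `[t, T]) h x.
Proof.
move=> hh.
have mtT : measurable (`[t, T]%classic : set MR) by exact: measurable_itv.
have L1 : L2on t T (fun _ => 1) by apply: (bounded_L2on (M := 1)) => //; rewrite ?normr1.
have [mh h2] := sampleable_L2on hh.
have H : (fun N => \int[leb]_(x in `[t, T]) (sample tau N.+1 h x * 1)) @ \oo -->
    \int[leb]_(x in `[t, T]) (h x * 1).
  apply: Rintegral_mul_cvg => //; [by move=> N; exact: (sample_L2on N hh).1|exact: L1.2|exact: sample_n2_cvg].
rewrite (_ : \int[leb]_(x in _) h x = \int[leb]_(x in `[t, T]) (h x * 1)); last first.
  by under [RHS]eq_Rintegral do rewrite mulr1.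
apply: cvg_trans H; apply: near_eq_cvg; apply: nearW => N /=.
under eq_Rintegral do rewrite mulr1.
have indE (q : 'I_N.+1) : (\int[leb]_(x in `[t, T]) (\1_(`[tau N.+1 q, tau N.+1 q.+1[) x)%:E =
    (tau N.+1 q.+1 - tau N.+1 q)%:E)%E.
  have qlt := part_incr htau (ltn_ord q).
  rewrite integral_indic//.
  rewrite (_ : _ `&` _ = `[tau N.+1 q, tau N.+1 q.+1[%classic); last first.
    apply: setIidl => x /=; rewrite !in_itv/= => /andP[qx xq].
    have /andP[tq _] := part_in htau (ltn0Sn N) (ltnW (ltn_ord q)).
    have /andP[_ qT] := part_in htau (ltn0Sn N) (ltn_ord q).
    by rewrite (le_trans tq qx) (ltW (lt_le_trans xq qT)).
  have := @lebesgue_measure_itv R (Interval (BLeft (tau N.+1 q)) (BLeft (tau N.+1 q.+1))).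
  by rewrite /= lte_fin qlt -EFinB; exact.
have iq (q : 'I_N.+1) : leb.-integrable `[t, T] (EFin \o (\1_(`[tau N.+1 q, tau N.+1 q.+1[) : MR -> R)).
  apply/integrableP; split.
    by apply/measurable_EFinP; apply: measurable_funTS; exact: measurable_indic.
  under eq_integral do rewrite /= ger0_norm ?indicE ?ler0n// -indicE.
  by rewrite indE ltry.
have iq' (q : 'I_N.+1) : leb.-integrable `[t, T] (fun x => (h (tau N.+1 q) * \1_(`[tau N.+1 q, tau N.+1 q.+1[) x)%:E).
  by have := integrableZl mtT (h (tau N.+1 q)) (iq q); apply: eq_integrable.
rewrite /Rintegral /sample; under eq_integral do rewrite -sumEFin.
rewrite integral_sum//.
rewrite (eq_bigr (fun q : 'I_N.+1 => (h (tau N.+1 q) * (tau N.+1 q.+1 - tau N.+1 q))%:E)).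
  by rewrite sumEFin.
move=> q _; rewrite EFinM -indE; under eq_integral do rewrite EFinM.
exact: (integralZl mtT (iq q)).
Qed.

Lemma grid_sum_measurable C W h N : ito_isometric P t T F C W ->
  measurable_fun setT (grid_sum W h N.+1).
Proof.
move=> [mW _ _]; apply: measurable_sum => q; apply: measurable_funM => //.
have hq := part_in htau (ltn0Sn N) (ltn_ord q).
have hq' := part_in htau (ltn0Sn N) (ltnW (ltn_ord q)).
by apply: measurable_funB; [apply: (measurable_for_fun t0 hF hq)|apply: (measurable_for_fun t0 hF hq')]; exact: mW.
Qed.

Lemma grid_sum_ito C W h Z : 0 <= C -> ito_isometric P t T F C W -> sampleable t T h ->
  is_ito_integral P F W t T (fun s _ => h s) Z ->
  (fun N => n2 P setT (fun om => (grid_sum W h N.+1 om - Z om)%R)) @ \oo --> 0%E.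
Proof.
move=> C0 isoW hh hZ.
have E2c (c : R) : n2 P setT (fun _ => c) = (c ^+ 2)%:E.
  have := integral_cst P measurableT (c ^+ 2)%:E => /= ->.
  by rewrite probability_setT mule1.
apply: (ito_limit t0 tT hF C0 isoW (lexx t) (lexx T) hZ (I := fun N => 'I_N.+1)
  (a_ := fun N (q : 'I_N.+1) => tau N.+1 q) (b_ := fun N (q : 'I_N.+1) => tau N.+1 q.+1)
  (xi_ := fun N (q : 'I_N.+1) _ => h (tau N.+1 q))).
- move=> N q; have /andP[tq qT'] := part_in htau (ltn0Sn N) (ltnW (ltn_ord q)).
  have /andP[_ qT] := part_in htau (ltn0Sn N) (ltn_ord q).
  split => //.
  + exact/ltW/(part_incr htau).
  + by apply: measurable_for_cst; apply: (sigma_algebra_filt t0 hF); rewrite tq.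
  + by rewrite E2c ltry.
apply: (@cvg0_le _ _ _ _ _ (fun N => n2 leb `[t, T] (fun x => (sample tau N.+1 h x - h x)%R))).
- by move=> N; apply: integral_ge0 => u _; exact: n2_ge0.
- apply: nearW => N; rewrite le_eqVlt; apply/orP; left; apply/eqP.
  apply: eq_integral => u ut; rewrite indicE ut mul1r.
  by rewrite -[RHS]E2c; apply: eq_integral.
exact: sample_n2_cvg.
Qed.

End deterministic_integrands.

Section mean_square_limits.
Context d (Omega : measurableType d) (R : realType) (P : probability Omega R).
Context (I : Type) (G : set_system I) (FG : Filter G).
Implicit Types (X : I -> Omega -> R) (Y : Omega -> R).

Lemma ms_limitD X Y X' Y' : ms_limit P G X Y -> ms_limit P G X' Y' ->
  ms_limit P G (fun i om => X i om + X' i om) (fun om => Y om + Y' om).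
Proof.
move=> [mX mY c] [mX' mY' c']; split; [by move=> i; exact: measurable_funD|exact: measurable_funD|].
apply: (@cvg0_le _ _ _ _ _ (fun i => 2%:E * n2 P setT (fun om => (X i om - Y om)%R) +
    2%:E * n2 P setT (fun om => (X' i om - Y' om)%R))%E).
- by move=> i; exact: n2_ge0.
- apply: nearW => i; under eq_integral do rewrite opprD addrACA.
  by apply: n2D => //; exact: measurable_funB.
- by apply: cvg0D; exact: cvg0Z.
Qed.

Lemma ms_limitZ c X Y : ms_limit P G X Y -> ms_limit P G (fun i om => c * X i om) (fun om => c * Y om).
Proof.
move=> [mX mY cX]; split; [by move=> i; exact: measurable_funM|exact: measurable_funM|].
under eq_fun do under eq_integral do rewrite -mulrBr.
under eq_fun => i.
  rewrite (n2Z _ measurableT); last exact: measurable_funB.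
  over.
exact: cvg0Z.
Qed.

Lemma ms_limit_cst Y : measurable_fun setT Y -> ms_limit P G (fun _ => Y) Y.
Proof.
move=> mY; split => //; under eq_fun do under eq_integral do rewrite subrr expr0n.
by rewrite integral0; exact: cvg_cst.
Qed.

Lemma ms_limit_sum (J : Type) (s : seq J) (Q : pred J) (X : J -> I -> Omega -> R) (Y : J -> Omega -> R) :
  (forall j, Q j -> ms_limit P G (X j) (Y j)) ->
  ms_limit P G (fun i om => \sum_(j <- s | Q j) X j i om) (fun om => \sum_(j <- s | Q j) Y j om).
Proof.
move=> h; elim: s => [|j s IH].
  under eq_fun do under eq_fun do rewrite big_nil.
  by under [X in ms_limit _ _ _ X]eq_fun do rewrite big_nil; exact: ms_limit_cst.
under eq_fun do under eq_fun do rewrite big_cons.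
under [X in ms_limit _ _ _ X]eq_fun do rewrite big_cons.
by have [Qj|//] := boolP (Q j); apply: ms_limitD => //; exact: h.
Qed.

Lemma ms_limitB X Y X' Y' : ms_limit P G X Y -> ms_limit P G X' Y' ->
  ms_limit P G (fun i om => X i om - X' i om) (fun om => Y om - Y' om).
Proof.
move=> h /(ms_limitZ (-1)) h'; have := ms_limitD h h'.
under eq_fun do under eq_fun do rewrite mulN1r.
by under [X in ms_limit _ _ _ X -> _]eq_fun do rewrite mulN1r.
Qed.

End mean_square_limits.

Lemma cvg_sum_seq (R : realType) (I : Type) (G : set_system I) (FG : Filter G) (J : Type) (s : seq J)
    (u : J -> I -> R) (a : J -> R) : (forall j, u j @ G --> a j) ->
  (fun i => \sum_(j <- s) u j i) @ G --> \sum_(j <- s) a j.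
Proof.
move=> cu; elim: s => [|j s IH].
  by rewrite big_nil; under eq_fun do rewrite big_nil; exact: cvg_cst.
by rewrite big_cons; under eq_fun do rewrite big_cons; apply: cvgD.
Qed.

(** * Law and independence of the Fourier integrals *)

Section zeta.
Context d (Omega : measurableType d) (R : realType) (P : probability Omega R) (t T : R).
Context (F : R -> set_system Omega) (m : nat) (f : 'I_m -> R -> Omega -> R).
Hypotheses (t0 : 0 <= t) (tT : t < T) (hF : is_filtration T F) (hf : is_wiener P T F f).
Context (tau : nat -> nat -> R) (htau : is_partition_seq t T tau).
Context (phi : nat -> R -> R) (hphi : forall j, sampleable t T (phi j)).
Local Notation leb := (@lebesgue_measure R).
Local Notation Q := (@normal_prob R 0 1).
Hypothesis ortho : forall i j, \int[leb]_(x in `[t, T]) (phi i x * phi j x) = (i == j)%:R.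
Context (zeta : 'I_m -> nat -> Omega -> R).
Hypothesis hz : forall a j, is_ito_integral P F (f a) t T (fun s _ => phi j s) (zeta a j).
Local Notation GS a j N := (grid_sum tau (f a) (phi j) N.+1).
Local Notation z p := (zeta p.1 p.2).

Let isoW a : ito_isometric P t T F (normal_var R) (f a).
Proof. by have := wiener_ito_isometric t0 hF hf a; rewrite integrator_wiener. Qed.

Let C0 : 0 <= normal_var R.
Proof. by apply: fine_ge0; apply: integral_ge0 => x _; rewrite lee_fin sqr_ge0. Qed.

Lemma zeta_ms a j : ms_limit P \oo (fun N => GS a j N) (zeta a j).
Proof.
split.
- by move=> N; exact: (grid_sum_measurable t0 hF htau _ _ (isoW a)).
- by have [_ [Y [_ _ []]]] := hz a j.
- exact: (grid_sum_ito t0 tT hF htau C0 (isoW a) (hphi j) (hz a j)).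
Qed.

Let mz a j : measurable_fun setT (zeta a j). Proof. by have [] := zeta_ms a j. Qed.

(** A linear combination of grid sums is a combination of increments over the cells. Its variance is
    a double sum over pairs with the same component, each term a Riemann sum of a product of two
    basis functions. *)
Let combination_cos (s : seq ('I_m * nat)) (u : 'I_m * nat -> R) th N (a0 : 'I_m) :
  \int[P]_om cos (th + \sum_(p <- s) u p * GS p.1 p.2 N om) =
  cos th * normal_cf (Num.sqrt (\sum_(p <- s) \sum_(p' <- s) (p.1 == p'.1)%:R * (u p * u p') *
    \sum_(q < N.+1) (phi p.2 (tau N.+1 q) * phi p'.2 (tau N.+1 q)) * (tau N.+1 q.+1 - tau N.+1 q))).
Proof.
pose c a q := \sum_(p <- s) (p.1 == a)%:R * (u p * phi p.2 (tau N.+1 q)).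
have E om : \sum_(p <- s) u p * GS p.1 p.2 N om =
    \sum_(q < N.+1) \sum_a c a q * (f a (tau N.+1 q.+1) om - f a (tau N.+1 q) om).
  transitivity (\sum_(p <- s) \sum_(q < N.+1) \sum_a
      (p.1 == a)%:R * (u p * phi p.2 (tau N.+1 q)) * (f a (tau N.+1 q.+1) om - f a (tau N.+1 q) om)).
    apply: eq_bigr => p _; rewrite mulr_sumr; apply: eq_bigr => q _.
    rewrite (bigD1 p.1)//= eqxx big1 ?addr0; first by rewrite mul1r mulrA.
    by move=> a /negbTE pa; rewrite eq_sym pa !mul0r.
  rewrite exchange_big/=; apply: eq_bigr => q _; rewrite exchange_big/=; apply: eq_bigr => a _.
  by rewrite /c mulr_suml.
under eq_Rintegral do rewrite E.
rewrite (grid_cos_sum t0 tT hF hf a0); last 2 first.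
- by move=> q qN; exact: (part_in htau).
- by move=> q qN; exact: (part_incr htau).
congr (_ * normal_cf (Num.sqrt _)).
transitivity (\sum_(q < N.+1) \sum_(p <- s) \sum_(p' <- s) (p.1 == p'.1)%:R * (u p * u p') *
    ((phi p.2 (tau N.+1 q) * phi p'.2 (tau N.+1 q)) * (tau N.+1 q.+1 - tau N.+1 q))).
  apply: eq_bigr => q _.
  transitivity (\sum_a \sum_(p <- s) \sum_(p' <- s) (p.1 == a)%:R * (p'.1 == a)%:R * (u p * u p') *
    ((phi p.2 (tau N.+1 q) * phi p'.2 (tau N.+1 q)) * (tau N.+1 q.+1 - tau N.+1 q))).
    apply: eq_bigr => a _; rewrite /c expr2 big_distrlr/= mulr_suml; apply: eq_bigr => p _.
    by rewrite mulr_suml; apply: eq_bigr => p' _; ring.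
  rewrite exchange_big/=; apply: eq_bigr => p _; rewrite exchange_big/=; apply: eq_bigr => p' _.
  rewrite (bigD1 p.1)//= eqxx mul1r big1 ?addr0 1?[p'.1 == _]eq_sym//.
  by move=> a /negbTE pa; rewrite [p.1 == a]eq_sym pa !mul0r.
rewrite exchange_big/=; apply: eq_bigr => p _; rewrite exchange_big/=; apply: eq_bigr => p' _.
by rewrite mulr_sumr.
Qed.

(** The Riemann sums tend to inner products; orthonormality leaves the sum of the squares of the
    [u p], over which the characteristic function factorises. *)
Lemma zeta_cos (s : seq ('I_m * nat)) (u : 'I_m * nat -> R) th : uniq s ->
  \int[P]_om cos (th + \sum_(p <- s) u p * z p om) = cos th * \prod_(p <- s) normal_cf (u p).
Proof.
case: s => [|p0 s0]; first by move=> _; under eq_Rintegral do rewrite big_nil addr0;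
  rewrite big_nil mulr1 probability_Rintegral_cst.
(* A nonempty list provides a component of the process, as the functional equation of [normal_cf]
   needs one. *)
move: (p0.1) => a0; move: (p0 :: s0) => {p0 s0} s us.
have [mX mZ cX] : ms_limit P \oo (fun N om => \sum_(p <- s) u p * GS p.1 p.2 N om)
    (fun om => \sum_(p <- s) u p * z p om).
  by apply: ms_limit_sum => p _; apply: ms_limitZ; exact: zeta_ms.
have c1 := cos_ms_cvg (th := th) mX mZ cX.
have c2 : (fun N => \int[P]_om cos (th + \sum_(p <- s) u p * GS p.1 p.2 N om)) @ \oo -->
    cos th * normal_cf (Num.sqrt (\sum_(p <- s) \sum_(p' <- s) (p.1 == p'.1)%:R * (u p * u p') *
      (p.2 == p'.2)%:R)).
  under eq_fun do rewrite (combination_cos _ _ _ _ a0).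
  apply: cvgM; first exact: cvg_cst.
  apply: psi_cvg; apply: (@cvg_comp _ _ _ _ Num.sqrt); last exact: sqrt_continuous.
  apply: cvg_sum_seq => p; apply: cvg_sum_seq => p'; apply: cvgM; first exact: cvg_cst.
  by have := riemann_cvg tT htau (sampleableM (hphi p.2) (hphi p'.2)); rewrite ortho; exact.
rewrite (cvg_unique _ c1 c2)//; congr (_ * _).
have -> : \sum_(p <- s) \sum_(p' <- s) (p.1 == p'.1)%:R * (u p * u p') * (p.2 == p'.2)%:R =
    \sum_(p <- s) (u p) ^+ 2.
  apply: eq_big_seq => p ps; rewrite (big_rem p ps)/= !eqxx mul1r mulr1 -expr2.
  rewrite big1_seq ?addr0// => p' /=; rewrite (mem_rem_uniq p us) !inE => /andP[/negbTE pp' _].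
  rewrite mulrAC -natrM mulnb; move: pp'; rewrite -pair_eqE/= /pair_eq eq_sym [p'.2 == _]eq_sym => ->.
  by rewrite mul0r.
rewrite -(psi_sqrt_sum t0 tT hF hf a0); last by move=> p; exact: sqr_ge0.
by apply: eq_bigr => p _; rewrite sqrtr_sqr psi_norm.
Qed.

(** The converse passage to [mixed]: cosines are replaced by indicators one variable at a time,
    through [uncorrelated_indic]. With no cosine left it gives both the laws and the
    independence. *)
Lemma zeta_mixed (s1 s2 : seq ('I_m * nat)) (B : 'I_m * nat -> set R) (u : 'I_m * nat -> R) th :
  uniq (s1 ++ s2) -> (forall p, measurable (B p)) ->
  \int[P]_om ((\prod_(p <- s1) \1_(B p) (z p om)) * cos (th + \sum_(p <- s2) u p * z p om)) =
  (\prod_(p <- s1) fine (Q (B p))) * (cos th * \prod_(p <- s2) normal_cf (u p)).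
Proof.
move=> + mB; elim: s1 s2 u th => [|p s1 IH] s2 u th us.
  by under eq_Rintegral do rewrite big_nil mul1r; rewrite big_nil mul1r zeta_cos.
have us' : uniq (s1 ++ p :: s2) by rewrite (perm_uniq (permEl (perm_catCA s1 [:: p] s2))).
have us12 : uniq (s1 ++ s2) by move: us; rewrite /= => /andP[].
have ps2 : p \notin s2 by move: us; rewrite /= mem_cat negb_or => /andP[/andP[]].
have bpi : bounded_rv (fun om => \prod_(p <- s1) \1_(B p) (z p om) : R).
  by apply: bounded_rv_prod => b; exact: (bounded_rv_indic (mB b) (mz b.1 b.2)).
have mS : measurable_fun setT (fun om => \sum_(p <- s2) u p * z p om).
  by apply: measurable_sum => b; apply: measurable_funM => //; exact: mz.
pose Z om := (\prod_(p <- s1) \1_(B p) (z p om)) * cos (th + \sum_(p <- s2) u p * z p om) : R.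
have bZ : bounded_rv Z by apply: bounded_rvM => //; apply: bounded_rv_cos; exact: measurable_funD.
have EZ := IH s2 u th us12.
have step v th' : \int[P]_om ((\prod_(p <- s1) \1_(B p) (z p om)) *
      cos (th' + (v * z p om + \sum_(p <- s2) u p * z p om))) =
    (\prod_(p <- s1) fine (Q (B p))) * (cos th' * (normal_cf v * \prod_(p <- s2) normal_cf (u p))).
  pose u' b := if b == p then v else u b.
  have u'E b : b \in s2 -> u' b = u b.
    by move=> bs; rewrite /u'; case: eqP => // bp; move: ps2; rewrite -bp bs.
  have u'p : u' p = v by rewrite /u' eqxx.
  have := IH (p :: s2) u' th' us'; rewrite big_cons u'p.
  rewrite (_ : \prod_(b <- s2) normal_cf (u' b) = \prod_(b <- s2) normal_cf (u b)); last by apply: eq_big_seq => b bs; rewrite u'E.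
  move=> <-; apply: eq_Rintegral => om _; congr (_ * cos (_ + _)).
  rewrite big_cons u'p; congr (_ + _).
  by apply: eq_big_seq => b bs; rewrite u'E.
(* The product of the two cosines becomes cosines with phases [th + th'] and [th - th'] and
   coefficients [v] and [- v] at [p]. The induction hypothesis for [p :: s2] evaluates both, and
   evenness of [normal_cf] recombines them. *)
have hcos v th' : \int[P]_om (Z om * cos (v * z p om + th')) =
    (\int[P]_om Z om) * \int[Q]_x cos (v * x + th').
  rewrite normal_cos EZ.
  transitivity (\int[P]_om (2^-1 * ((\prod_(p <- s1) \1_(B p) (z p om)) *
      cos ((th + th') + (v * z p om + \sum_(p <- s2) u p * z p om))) +
    2^-1 * ((\prod_(p <- s1) \1_(B p) (z p om)) *
      cos ((th - th') + ((- v) * z p om + \sum_(p <- s2) u p * z p om))))).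
    apply: eq_Rintegral => om _; rewrite /Z -mulrA cosM.
    rewrite (_ : th + _ + (v * z p om + th') = (th + th') + (v * z p om + \sum_(p <- s2) u p * z p om)); last by ring.
    rewrite (_ : th + _ - (v * z p om + th') = (th - th') + ((- v) * z p om + \sum_(p <- s2) u p * z p om)); last by ring.
    by ring.
  have b2 v' th0 : bounded_rv (fun om => (\prod_(p <- s1) \1_(B p) (z p om)) *
      cos (th0 + (v' * z p om + \sum_(p <- s2) u p * z p om)) : R).
    apply: bounded_rvM => //; apply: bounded_rv_cos; apply: measurable_funD => //.
    by apply: measurable_funD => //; apply: measurable_funM => //; exact: mz.
  rewrite (bounded_expectationD P); [|by apply: bounded_rvM => //; exact: bounded_rv_cst|by apply: bounded_rvM => //; exact: bounded_rv_cst].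
  rewrite !(bounded_expectationZ P)// !step psiN cosD cosB; by field.
have mid : measurable_fun setT (id : measurableTypeR R -> R) by exact: measurable_id.
have [_] := @uncorrelated_indic _ _ _ P _ _ Q Z (z p) bZ (mz p.1 p.2) id mid hcos (B p) (mB p).
rewrite EZ expectation_indic// => E.
rewrite big_cons -mulrA mulrC.
transitivity (\int[P]_om (Z om * \1_(B p) (z p om))); last first.
  by rewrite E; congr (_ * _).
by apply: eq_Rintegral => om _; rewrite big_cons /Z; ring.
Qed.

Lemma zeta_law (B : set R) a j : measurable B -> P (zeta a j @^-1` B) = Q B.
Proof.
move=> mB.
have := @zeta_mixed [:: (a, j)] [::] (fun _ => B) (fun _ => 0) 0 isT (fun _ => mB).
rewrite !big_nil !big_cons big_nil cos0 !mulr1.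
under eq_Rintegral do rewrite big_cons !big_nil addr0 cos0 !mulr1.
rewrite expectation_indic// => E.
rewrite -[LHS]fineK; last by apply: fin_num_measure; rewrite -[X in measurable X]setTI; exact: mz.
by rewrite E fineK// fin_num_measure.
Qed.

Lemma zeta_gaussian a j : centered_gaussian P 1 (zeta a j).
Proof. by split; [exact: mz|move=> B mB; exact: zeta_law]. Qed.

Lemma zeta_independent : independent_family P (fun p : 'I_m * nat => z p).
Proof.
move=> s B us mB.
have mpre p : measurable (z p @^-1` B p) by rewrite -[X in measurable X]setTI; exact: mz.
have := @zeta_mixed s [::] B (fun _ => 0) 0; rewrite cats0 => /(_ us mB).
rewrite !big_nil cos0 !mulr1.
under eq_Rintegral do rewrite big_nil addr0 cos0 mulr1.
move=> E.
have mcap : measurable (\bigcap_(p in [set` s]) (z p @^-1` B p)).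
  by apply: fin_bigcap_measurable => //; exact: finite_seq.
rewrite -[LHS]fineK; last exact: fin_num_measure.
transitivity ((\prod_(p <- s) fine (Q (B p)))%:E); last first.
  elim: (s) => [|p s' IHs]; first by rewrite !big_nil.
  have fQ : Q (B p) \is a fin_num by apply: fin_num_measure; exact: mB.
  rewrite !big_cons EFinM IHs (fineK fQ); congr (_ * _)%E.
  by apply/esym; exact: zeta_law.
congr EFin; rewrite -E /Rintegral; congr fine.
transitivity (\int[P]_om (\1_(\bigcap_(p in [set` s]) (z p @^-1` B p)) om)%:E)%E.
  by rewrite integral_indic ?setIT.
apply: eq_integral => om _; congr EFin; rewrite indicE.
have [/allP h|/allPn[p ps h]] := boolP (all (fun p => z p om \in B p) s).
  rewrite big_seq big1 => [|p /h]; last by rewrite indicE => ->.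
  by rewrite mem_set// => p /= ps; have /set_mem := h p ps.
rewrite (big_rem p ps)/= indicE (negbTE h) mul0r memNset// => /(_ p ps) /mem_set.
exact/negP.
Qed.

End zeta.

(** * Products of mean-square limits *)

Section bounded_moments.
Context d (Omega : measurableType d) (R : realType) (P : probability Omega R).
Implicit Types (X : nat -> Omega -> R) (Y : Omega -> R).

Definition moments_bounded (I : Type) (V : I -> Omega -> R) :=
  forall n, exists B : R, forall i, (\int[P]_om ((V i om) ^+ n.*2)%:E <= B%:E)%E.

(* Mean-square convergence alone is not stable under products; bounded moments
   make it so. *)
Definition ms_limit_moments X Y :=
  [/\ ms_limit P \oo X Y, moments_bounded X & moments_bounded (fun _ : unit => Y)].

Let mpow n (V : Omega -> R) : measurable_fun setT V -> measurable_fun setT (fun om => (V om ^+ n.*2)%:E : \bar R).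
Proof. by move=> mV; apply/measurable_EFinP; exact: measurable_funX. Qed.

Let pow_ge0 n (x : R) : 0 <= x ^+ n.*2.
Proof. by rewrite -mul2n exprM exprn_ge0// sqr_ge0. Qed.

Let powM_le n (x y : R) : (x * y) ^+ n.*2 <= x ^+ n.*2.*2 + y ^+ n.*2.*2.
Proof.
rewrite exprMn -!(muln2 n.*2) !exprM.
have := pow_ge0 n x; have := pow_ge0 n y; move: (x ^+ _) (y ^+ _) => a b b0 a0.
have := sqr_ge0 (a - b); have := mulr_ge0 a0 b0; nra.
Qed.

Let powB_le n (x y : R) : (x - y) ^+ n.*2 <= 4 ^+ n * (x ^+ n.*2 + y ^+ n.*2).
Proof.
have h : (x - y) ^+ 2 <= 4 * Num.max (x ^+ 2) (y ^+ 2).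
  have := sqr_ge0 (x + y); rewrite /Num.max; case: ifPn; rewrite -?leNgt => ?; nra.
rewrite -!mul2n !exprM.
have h1 : ((x - y) ^+ 2) ^+ n <= (4 * Num.max (x ^+ 2) (y ^+ 2)) ^+ n.
  by apply: lerXn2r => //; rewrite nnegrE ?sqr_ge0// mulr_ge0// le_max sqr_ge0.
apply: le_trans h1 _; rewrite exprMn ler_wpM2l ?exprn_ge0//.
by rewrite /Num.max; case: ifPn => _; rewrite ?lerDr ?lerDl exprn_ge0// sqr_ge0.
Qed.

Lemma moments_boundedM (I : Type) (V W : I -> Omega -> R) : (forall i, measurable_fun setT (V i)) ->
  (forall i, measurable_fun setT (W i)) -> moments_bounded V -> moments_bounded W ->
  moments_bounded (fun i om => V i om * W i om).
Proof.
move=> mV mW bV bW n; have [B1 h1] := bV n.*2; have [B2 h2] := bW n.*2; exists (B1 + B2) => i.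
apply: (@le_trans _ _ (\int[P]_om ((V i om ^+ n.*2.*2)%:E + (W i om ^+ n.*2.*2)%:E))%E).
  apply: ge0_le_integral => //.
  - by move=> om _; rewrite lee_fin.
  - by apply: mpow; exact: measurable_funM.
  - by apply: emeasurable_funD; exact: mpow.
  - by move=> om _; rewrite -EFinD lee_fin; exact: powM_le.
rewrite ge0_integralD//; [|by move=> om _; rewrite lee_fin|exact: mpow|by move=> om _; rewrite lee_fin|exact: mpow].
by rewrite EFinD; apply: leeD.
Qed.

Lemma moments_boundedB (I : Type) (V W : I -> Omega -> R) : (forall i, measurable_fun setT (V i)) ->
  (forall i, measurable_fun setT (W i)) -> moments_bounded V -> moments_bounded W ->
  moments_bounded (fun i om => V i om - W i om).
Proof.
move=> mV mW bV bW n; have [B1 h1] := bV n; have [B2 h2] := bW n; exists (4 ^+ n * (B1 + B2)) => i.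
have q0 : 0 <= 4 ^+ n :> R by rewrite exprn_ge0.
apply: (@le_trans _ _ (\int[P]_om ((4 ^+ n)%:E * ((V i om ^+ n.*2)%:E + (W i om ^+ n.*2)%:E)))%E).
  apply: ge0_le_integral => //.
  - by move=> om _; rewrite lee_fin.
  - by apply: mpow; exact: measurable_funB.
  - by apply: measurable_funeM; apply: emeasurable_funD; exact: mpow.
  - by move=> om _; rewrite -EFinD -EFinM lee_fin; exact: powB_le.
rewrite ge0_integralZl_EFin//; [|by move=> om _; rewrite -EFinD lee_fin addr_ge0|by apply: emeasurable_funD; exact: mpow].
rewrite EFinM lee_wpmul2l ?lee_fin//.
rewrite ge0_integralD//; [|by move=> om _; rewrite lee_fin|exact: mpow|by move=> om _; rewrite lee_fin|exact: mpow].
by rewrite EFinD; apply: leeD.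
Qed.

(** [(V D)^2] is the product of [D] and [V^2 D]. Young's inequality bounds it by a multiple of
    [D^2], which tends to 0, plus a small multiple of [(V^2 D)^2], whose expectation stays
    bounded. *)
Lemma ms_cvg_mul_moments (D V : nat -> Omega -> R) : (forall n, measurable_fun setT (D n)) ->
  (forall n, measurable_fun setT (V n)) -> moments_bounded D -> moments_bounded V ->
  (fun n => n2 P setT (D n)) @ \oo --> 0%E ->
  (fun n => n2 P setT (fun om => (V n om * D n om)%R)) @ \oo --> 0%E.
Proof.
move=> mD mV bD bV cD; apply/(ge0_cvg0P _ (fun n => n2_ge0 P setT _)) => e e0.
have mVV i : measurable_fun setT (fun om => V i om * V i om) by exact: measurable_funM.
have bVVD : moments_bounded (fun i om => (V i om * V i om) * D i om).
  by apply: moments_boundedM => //; exact: moments_boundedM.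
have [B hB] := bVVD 1%N.
have B0 : 0 <= B.
  rewrite -lee_fin; apply: le_trans (hB 0%N); apply: integral_ge0 => om _; exact: pow_ge0.
pose a := e / (B + 1).
have B1 : 0 < B + 1 by rewrite ltr_wpDl.
have a0 : 0 < a by rewrite divr_gt0.
have ea0 : 0 < a * e by rewrite mulr_gt0.
have [N _ hN] := (ge0_cvg0P _ (fun n => n2_ge0 P setT _)).1 cD _ ea0.
exists N => // n /= /hN {hN} hn.
have c0 : 0 <= 2^-1 / a by rewrite divr_ge0 ?invr_ge0// ltW.
have a20 : 0 <= a / 2 by rewrite divr_ge0// ltW.
have mVVD : measurable_fun setT (fun om => V n om * V n om * D n om) by exact: measurable_funM.
apply: (@le_lt_trans _ _ ((2^-1 / a)%:E * n2 P setT (D n) + (a / 2)%:E * n2 P setT (fun om => (V n om * V n om * D n om)%R))%E).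
  rewrite -!ge0_integralZl_EFin//; try (by move=> om _; rewrite lee_fin sqr_ge0);
    try exact: measurable_sqr_EFin.
  rewrite -ge0_integralD//.
  - apply: ge0_le_integral => //.
    + by move=> om _; rewrite lee_fin sqr_ge0.
    + by apply: measurable_sqr_EFin; exact: measurable_funM.
    + by apply: emeasurable_funD; apply: measurable_funeM; exact: measurable_sqr_EFin.
    move=> om _; rewrite -!EFinM -EFinD lee_fin.
    have := mulr_le_weighted_sqr (D n om) (V n om * V n om * D n om) a0.
    by apply: le_trans; rewrite exprMn !expr2 le_eqVlt; apply/orP; left; apply/eqP; ring.
  - by move=> om _; rewrite mule_ge0// lee_fin ?sqr_ge0.
  - by apply: measurable_funeM; exact: measurable_sqr_EFin.
  - by move=> om _; rewrite mule_ge0// lee_fin ?sqr_ge0.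
  - by apply: measurable_funeM; exact: measurable_sqr_EFin.
have -> : (e%:E = (2^-1 / a)%:E * (a * e)%:E + (e / 2)%:E)%E.
  by rewrite -EFinM -EFinD; congr EFin; field; rewrite gt_eqF.
have f3 : ((a / 2)%:E * n2 P setT (fun om => (V n om * V n om * D n om)%R))%E \is a fin_num.
  by apply: fin_numM => //; rewrite ge0_fin_numE ?n2_ge0//; apply: le_lt_trans (hB n) _; exact: ltry.
apply: (lte_leD f3).
  by rewrite lte_pmul2l// lte_fin divr_gt0// invr_gt0.
apply: (@le_trans _ _ ((a / 2)%:E * B%:E)%E).
  by rewrite lee_wpmul2l ?lee_fin//; exact: (hB n).
rewrite -EFinM lee_fin /a (_ : e / (B + 1) / 2 * B = e / 2 * (B / (B + 1))); last by ring.
by rewrite ler_piMr ?divr_ge0 ?(ltW e0)// ler_pdivrMr// mul1r lerDl.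
Qed.

Lemma ms_limit_momentsM X Y X' Y' : ms_limit_moments X Y -> ms_limit_moments X' Y' ->
  ms_limit_moments (fun n om => X n om * X' n om) (fun om => Y om * Y' om).
Proof.
move=> [[mX mY cX] bX bY] [[mX' mY' cX'] bX' bY'].
have cst_ (W : Omega -> R) : moments_bounded (fun _ : unit => W) -> moments_bounded (fun _ : nat => W).
  by move=> h n; have [B hB] := h n; exists B => _; exact: (hB tt).
split; last first.
- by apply: moments_boundedM.
- exact: moments_boundedM.
split; [by move=> n; exact: measurable_funM|exact: measurable_funM|].
have mB1 n : measurable_fun setT (fun om => X n om - Y om) by exact: measurable_funB.
have mB2 n : measurable_fun setT (fun om => X' n om - Y' om) by exact: measurable_funB.
apply: (@cvg0_le _ _ _ _ _ (fun n => 2%:E * n2 P setT (fun om => (X' n om * (X n om - Y om))%R) +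
    2%:E * n2 P setT (fun om => (Y om * (X' n om - Y' om))%R))%E).
- by move=> n; exact: n2_ge0.
- apply: nearW => n.
  (* The difference of the products is split so that each term has one factor tending to 0 and one
     with bounded moments. *)
  rewrite (eq_integral (fun om => ((X' n om * (X n om - Y om) + Y om * (X' n om - Y' om)) ^+ 2)%:E)).
    by apply: n2D => //; exact: measurable_funM.
  by move=> om _; congr EFin; congr (_ ^+ _); ring.
apply: cvg0D; apply: cvg0Z; apply: ms_cvg_mul_moments => //.
- by apply: moments_boundedB => //; exact: cst_.
- by apply: moments_boundedB => //; exact: cst_.
- exact: cst_.
Qed.

Lemma ms_limit_moments_cst c : ms_limit_moments (fun _ _ => c) (fun _ => c).
Proof.
have b (I : Type) : moments_bounded (fun (_ : I) (_ : Omega) => c).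
  move=> n; exists (c ^+ n.*2) => _.
  by have := integral_cst P measurableT (c ^+ n.*2)%:E => /= ->; rewrite probability_setT mule1.
by split => //; exact: ms_limit_cst.
Qed.

Lemma ms_limit_moments_prod (J : Type) (s : seq J) (X : J -> nat -> Omega -> R) (Y : J -> Omega -> R) :
  (forall j, ms_limit_moments (X j) (Y j)) ->
  ms_limit_moments (fun n om => \prod_(j <- s) X j n om) (fun om => \prod_(j <- s) Y j om).
Proof.
move=> h; elim: s => [|j s IH].
  under eq_fun do under eq_fun do rewrite big_nil.
  by under [X in ms_limit_moments _ X]eq_fun do rewrite big_nil; exact: ms_limit_moments_cst.
under eq_fun do under eq_fun do rewrite big_cons.
under [X in ms_limit_moments _ X]eq_fun do rewrite big_cons.
by apply: ms_limit_momentsM.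
Qed.

(** Taking [Z = 1] in [uncorrelated_indic] identifies the law of [V] with that of [s * x] under the
    standard normal law. This form includes the degenerate case [s = 0], which occurs when all
    sampled values vanish. *)
Lemma gaussian_moments (V : Omega -> R) (s : R) : measurable_fun setT V ->
  (forall u th : R, \int[P]_om cos (u * V om + th) = cos th * normal_cf (u * s)) ->
  forall n, (\int[P]_om ((V om) ^+ n.*2)%:E = (s ^+ n.*2)%:E * \int[@normal_prob R 0 1]_x ((x : R) ^+ n.*2)%:E)%E.
Proof.
move=> mV hV n.
pose Q := @normal_prob R 0 1.
pose Y (x : measurableTypeR R) : R := s * x.
have mY : measurable_fun setT Y by apply: measurable_funM => //; exact: measurable_id.
have hcos u th : \int[P]_om (cst 1 om * cos (u * V om + th)) =
    (\int[P]_om cst 1 om) * \int[Q]_x cos (u * Y x + th).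
  under eq_Rintegral do rewrite mul1r.
  rewrite (_ : \int[P]_om cst 1 om = 1) ?mul1r; last exact: (probability_Rintegral_cst P 1).
  rewrite hV -normal_cos.
  by apply: eq_Rintegral => x _; rewrite /Y mulrA.
have law B : measurable B -> P (V @^-1` B) = Q (Y @^-1` B).
  move=> mB; have [_] := uncorrelated_indic (@bounded_rv_cst _ _ _ 1) mV mY hcos mB.
  rewrite (_ : \int[P]_om cst 1 om = 1) ?mul1r; last exact: (probability_Rintegral_cst P 1).
  rewrite [RHS]expectation_indic//.
  under eq_Rintegral do rewrite mul1r.
  rewrite expectation_indic// => E.
  have m1 : measurable (V @^-1` B) by rewrite -[X in measurable X]setTI; exact: mV.
  have m2 : measurable (Y @^-1` B) by rewrite -[X in measurable X]setTI; exact: mY.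
  by rewrite -[LHS]fineK ?fin_num_measure// E fineK// fin_num_measure.
have mg : measurable_fun setT (fun x : measurableTypeR R => (x ^+ n.*2)%:E : \bar R).
  by apply/measurable_EFinP; exact: exprn_measurable.
pose V' : {mfun Omega >-> measurableTypeR R} :=
  HB.pack V (isMeasurableFun.Build _ _ _ (measurableTypeR R) _ mV).
pose Y' : {mfun measurableTypeR R >-> measurableTypeR R} :=
  HB.pack Y (isMeasurableFun.Build _ _ _ (measurableTypeR R) _ mY).
have g0 (x : measurableTypeR R) : (0 <= ((x : R) ^+ n.*2)%:E)%E by rewrite lee_fin; exact: pow_ge0.
transitivity (\int[Q]_x ((Y x) ^+ n.*2)%:E)%E.
  have := ge0_integral_distribution V' mg g0 (P := P); have := ge0_integral_distribution Y' mg g0 (P := Q).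
  move=> <- <-; apply: eq_measure_integral => B mB _; exact: law.
under eq_integral do rewrite /Y exprMn EFinM.
by rewrite ge0_integralZl_EFin.
Qed.

End bounded_moments.

Section ito_existence.
Context d (Omega : measurableType d) (R : realType) (P : probability Omega R) (t T : R).
Context (F : R -> set_system Omega).
Hypotheses (t0 : 0 <= t) (tT : t < T) (hF : is_filtration T F).
Context (tau : nat -> nat -> R) (htau : is_partition_seq t T tau).
Local Notation MR := (measurableTypeR R).
Local Notation leb := (@lebesgue_measure R).

Lemma n2_probability_cst (c : R) : n2 P setT (fun _ => c) = (c ^+ 2)%:E.
Proof.
have := integral_cst P measurableT (c ^+ 2)%:E => /= ->.
by rewrite probability_setT mule1.
Qed.

Lemma grid_family N h : adapted_family P t T F (fun q : 'I_N.+1 => tau N.+1 q)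
  (fun q => tau N.+1 q.+1) (fun q _ => h (tau N.+1 q)).
Proof.
move=> q; have /andP[tq qT'] := part_in htau (ltn0Sn N) (ltnW (ltn_ord q)).
have /andP[_ qT] := part_in htau (ltn0Sn N) (ltn_ord q).
split => //.
- exact/ltW/(part_incr htau).
- by apply: measurable_for_cst; apply: (sigma_algebra_filt t0 hF); rewrite tq.
- by rewrite n2_probability_cst ltry.
Qed.

Lemma grid_sum_sub_bound C W h M N : 0 <= C -> ito_isometric P t T F C W ->
  (n2 P setT (fun om => (grid_sum tau W h M.+1 om - grid_sum tau W h N.+1 om)%R) <=
   C%:E * n2 leb `[t, T] (fun x => (sample tau M.+1 h x - sample tau N.+1 h x)%R))%E.
Proof.
move=> C0 isoW.
have [K [a [b [xi [fK vK iK]]]]] := adapted_family_sub t0 hF (@grid_family M h) (@grid_family N h).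
have := family_bound t0 tT hF C0 isoW fK.
have -> : family_integral W a b xi = (fun om => grid_sum tau W h M.+1 om - grid_sum tau W h N.+1 om).
  by apply/funext => om; rewrite iK.
have E : (\int[leb]_(u in `[t, T]) n2 P setT (family_value a b xi u) =
    n2 leb `[t, T] (fun x => (sample tau M.+1 h x - sample tau N.+1 h x)%R))%E.
  apply: eq_integral => u _; rewrite -n2_probability_cst.
  by apply: eq_integral => om _; rewrite vK.
by rewrite E.
Qed.

(** The samples are Cauchy in L2, so the grid sums are Cauchy in mean square; their limit is an
    integral, the grids themselves being the step processes. *)
Lemma ito_exists C W h : 0 <= C -> ito_isometric P t T F C W -> sampleable t T h ->
  exists Z, is_ito_integral P F W t T (fun s _ => h s) Z.
Proof.
move=> C0 isoW hh; have [mh h2] := sampleable_L2on hh.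
have mtT : measurable (`[t, T]%classic : set MR) by exact: measurable_itv.
have mS N := (sample_L2on tT htau N hh).1.
have cS := sample_n2_cvg tT htau hh.
have [Z [mZ cZ]] : exists Z : Omega -> R, measurable_fun setT Z /\
    (fun n => n2 P setT (fun om => (grid_sum tau W h n.+1 om - Z om)%R)) @ \oo --> 0%E.
  apply: L2_complete; first by move=> n; exact: grid_sum_measurable isoW.
  move=> e e0.
  (* The squared triangle inequality yields twice 2 such errors; [C + 1] keeps the denominator
     positive and the final inequality strict. *)
  have e1 : 0 < e / (4 * (C + 1)) by rewrite divr_gt0// mulr_gt0// ltr_wpDl.
  have [N _ hN] := (ge0_cvg0P _ (fun n => n2_ge0 leb _ _)).1 cS _ e1.
  exists N => m n /hN hm /hN hn.
  apply: (le_lt_trans (grid_sum_sub_bound h m n C0 isoW)).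
  apply: (@le_lt_trans _ _ (C%:E * (2%:E * (e / (4 * (C + 1)))%:E + 2%:E * (e / (4 * (C + 1)))%:E))%E).
    rewrite lee_wpmul2l ?lee_fin//.
    apply: le_trans (n2_triangle _ mtT (mS m) mh (mS n)) _.
    by rewrite leeD// lee_wpmul2l// ltW// n2_sym.
  rewrite -[X in (X < _)%E]/((C * (2 * (e / (4 * (C + 1))) + 2 * (e / (4 * (C + 1)))))%:E) lte_fin.
  have -> : C * (2 * (e / (4 * (C + 1))) + 2 * (e / (4 * (C + 1)))) = e * (C / (C + 1)).
    by field; rewrite gt_eqF// ltr_wpDl.
  by rewrite gtr_pMr// ltr_pdivrMr ?mul1r ?ltrDl// ltr_wpDl.
exists Z; split.
  split; last first.
    by move=> s hs; apply: measurable_for_cst; exact: (sigma_algebra_filt t0 hF).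
  have m1 : measurable_fun (`[t, T]%classic `*` [set: Omega]) (fun z : MR * Omega => h z.1).
    have mD : measurable (`[t, T]%classic `*` [set: Omega] : set (MR * Omega)) by exact: measurableX.
    apply/(measurable_restrictT _ mD).
    have m2 : measurable_fun setT (fun z : MR * Omega => (h \_ `[t, T]) z.1).
      by apply: measurableT_comp => //; exact/(measurable_restrictT _ mtT).
    apply: eq_measurable_fun m2 => -[u om] _; rewrite !patchE/=.
    have [uD|uD] := boolP (u \in `[t, T]%classic).
      by rewrite ifT// inE; split => //=; rewrite inE in uD.
    by rewrite ifF//; apply: contraNF uD; rewrite !inE => -[].
  split => //; rewrite (n2_product _ (X := fun s _ => h s))//.
  by under eq_integral do rewrite n2_probability_cst.
exists (fun n => StepProcess n.+1 (tau n.+1) (fun q _ => h (tau n.+1 q))); split.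
- move=> n; split => /=; [exact: (part_start htau)|exact: (part_end htau)|exact: (part_incr htau)|].
  move=> q qn; have [_ _ _ /= mq q2] := @grid_family n h (Ordinal qn).
  by split => //; split => //; exact: measurable_cst.
- apply: cvg_trans cS; apply: near_eq_cvg; apply: nearW => n /=.
  rewrite (n2_product _ (X := fun s om => step_value (StepProcess n.+1 (tau n.+1) (fun q _ => h (tau n.+1 q))) s om - h s)).
    by apply: eq_integral => u _; exact: esym (n2_probability_cst _).
  have mD : measurable (`[t, T]%classic `*` [set: Omega] : set (MR * Omega)) by exact: measurableX.
  apply/(measurable_restrictT _ mD).
  have m2 : measurable_fun setT (fun z : MR * Omega => ((fun x => sample tau n.+1 h x - h x) \_ `[t, T]) z.1).
    apply: measurableT_comp => //; apply/(measurable_restrictT _ mtT).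
    by apply: measurable_funB; [exact: mS|exact: mh].
  apply: eq_measurable_fun m2 => -[u om] _; rewrite !patchE/=.
  have [uD|uD] := boolP (u \in `[t, T]%classic).
    by rewrite ifT// inE; split => //=; rewrite inE in uD.
  by rewrite ifF//; apply: contraNF uD; rewrite !inE => -[].
- split => //; first by move=> n; exact: grid_sum_measurable isoW.
Qed.

End ito_existence.

(** * Multiple Fourier series *)

Lemma sqr_add_ge (R : realDomainType) (x y : R) : x ^+ 2 + 2 * (x * y) <= (x + y) ^+ 2.
Proof. by rewrite sqrrD mulr_natl lerDl sqr_ge0. Qed.

Lemma multi_oo_filter k : Filter (multi_oo k).
Proof.
apply: filter_from_filter; first by exists 0%N.
move=> i j _ _; exists (maxn i j) => // p /= h; split => l /=; apply: leq_trans (h l).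
  exact: leq_maxl.
exact: leq_maxr.
Qed.

Section multiple_fourier.
Context (R : realType) (t T : R) (tT : t < T).
Context (phi : nat -> R -> R) (ophi : orthonormal_system t T phi) (cphi : complete_system t T phi).
Local Notation MR := (measurableTypeR R).
Local Notation leb := (@lebesgue_measure R).
Local Notation cn2 := (cube_n2 t T).

Let phiL2 j : L2on t T (phi j).
Proof. by have [/(_ j)[m2 i2] _] := ophi. Qed.

Definition tens_phi (J : nat -> nat) := tens (fun l => phi (J l)).

Let tens_phi_meas k J : cube_meas t T k (tens_phi J).
Proof. by apply: tens_cube_meas => l _; have [] := phiL2 (J l). Qed.

Let tens_phi_lty k J : (cn2 k (tens_phi J) < +oo)%E.
Proof. by apply: tens_n2_lty => // l _; exact: phiL2. Qed.

Definition fourier_dense k (Phi : seq R -> R) := cube_meas t T k Phi /\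
  forall e : R, 0 < e -> exists (E : finType) (b : E -> R) (J : E -> nat -> nat),
    (cn2 k (fun x => (Phi x - \sum_i b i * tens_phi (J i) x)%R) < e%:E)%E.

Let sum_meas k (E : finType) (b : E -> R) (J : E -> nat -> nat) :
  cube_meas t T k (fun x => \sum_i b i * tens_phi (J i) x).
Proof. by apply: measurable_sum => i; apply: measurable_funM => //; exact: tens_phi_meas. Qed.

Lemma fourier_dense_closed k Phi : cube_meas t T k Phi ->
  (forall e : R, 0 < e -> exists Psi, fourier_dense k Psi /\ (cn2 k (fun x => (Phi x - Psi x)%R) < e%:E)%E) ->
  fourier_dense k Phi.
Proof.
move=> mPhi h; split => // e e0; have e4 : 0 < e / 4 by rewrite divr_gt0.
have [Psi [[mPsi hPsi] h1]] := h _ e4; have [E [b [J h2]]] := hPsi _ e4.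
exists E, b, J; exact: (cube_n2_lt_triangle mPhi mPsi (sum_meas b J) h1 h2).
Qed.

Lemma fourier_denseD k Phi Psi : fourier_dense k Phi -> fourier_dense k Psi ->
  fourier_dense k (fun x => Phi x + Psi x).
Proof.
move=> [mPhi hPhi] [mPsi hPsi]; split; first exact: measurable_funD.
move=> e e0; have e4 : 0 < e / 4 by rewrite divr_gt0.
have [E [b [J h1]]] := hPhi _ e4; have [E' [b' [J' h2]]] := hPsi _ e4.
exists (E + E')%type, (fun i => match i with inl i => b i | inr i => b' i end),
  (fun i => match i with inl i => J i | inr i => J' i end).
have eE : (e%:E = 2%:E * (e / 4)%:E + 2%:E * (e / 4)%:E)%E.
  by rewrite -!EFinM -EFinD; congr EFin; field.
rewrite eE /cube_n2; under eq_integral do rewrite big_sumType/= opprD addrACA.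
apply: (le_lt_trans (n2D _ (@measurable_cube R t T k) _ _)).
- exact: (cube_measB mPhi (sum_meas b J)).
- exact: (cube_measB mPsi (sum_meas b' J')).
- by apply: lteD; rewrite lte_pmul2l.
Qed.

Lemma fourier_denseZ k c Phi : fourier_dense k Phi -> fourier_dense k (fun x => c * Phi x).
Proof.
move=> [mPhi hPhi]; split; first exact: measurable_funM.
move=> e e0.
have q0 : 0 < c ^+ 2 + 1 by rewrite ltr_wpDl// sqr_ge0.
have eq0 : 0 < e / (c ^+ 2 + 1) by rewrite divr_gt0.
have [E [b [J h]]] := hPhi _ eq0.
exists E, (fun i => c * b i), J.
rewrite /cube_n2; under eq_integral do under eq_bigr do rewrite -mulrA.
under eq_integral do rewrite -mulr_sumr -mulrBr.
rewrite (n2Z _ (@measurable_cube R t T k)); last exact: (cube_measB mPhi (sum_meas b J)).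
apply: (@le_lt_trans _ _ ((c ^+ 2)%:E * (e / (c ^+ 2 + 1))%:E)%E).
  by rewrite lee_wpmul2l ?lee_fin ?sqr_ge0// ltW.
by rewrite -EFinM lte_fin mulrCA gtr_pMr// ltr_pdivrMr// mul1r ltrDl.
Qed.

Lemma fourier_dense_ext k Phi Psi : (forall x, size x = k -> Phi x = Psi x) ->
  fourier_dense k Phi -> fourier_dense k Psi.
Proof.
move=> E [mPhi h]; split.
  by apply: eq_measurable_fun mPhi => x _; rewrite E ?size_tuple.
move=> e e0; have [I [b [J h1]]] := h _ e0; exists I, b, J.
by rewrite /cube_n2; under eq_integral do rewrite -E ?size_tuple//.
Qed.

(** Each factor is approximated by a finite combination of the [phi j], and the product of the sums
    is expanded. *)
Lemma fourier_dense_tens k (g : nat -> R -> R) : (forall l, (l < k)%N -> L2on t T (g l)) ->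
  fourier_dense k (tens g).
Proof.
move=> hg; split; first by apply: tens_cube_meas => l /hg[].
have hc l n : exists p : nat * (nat -> R), (l < k)%N ->
    (n2 leb `[t, T] (fun x => (\sum_(j < p.1) p.2 j * phi j x - g l x)%R) < n.+1%:R^-1%:E)%E.
  have [lk|lk] := boolP (l < k)%N; last by exists (0%N, fun _ => 0).
  have en0 : 0 < n.+1%:R^-1 :> R by rewrite invr_gt0.
  have [p [c h]] := cphi (hg l lk) en0.
  by exists (p, c) => _; rewrite n2_sym.
pose p l n := projT1 (cid (hc l n)).
have pP l n : (l < k)%N ->
    (n2 leb `[t, T] (fun x => (\sum_(j < (p l n).1) (p l n).2 j * phi j x - g l x)%R) < n.+1%:R^-1%:E)%E.
  by rewrite /p; case: cid.
pose f n l x := \sum_(j < (p l n).1) (p l n).2 j * phi j x.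
have fL2 n l : L2on t T (f n l).
  split; first by apply: measurable_sum => j; apply: measurable_funM => //; have [] := phiL2 j.
  apply: (le_lt_trans (n2_sum _ _ _)).
  - exact: measurable_itv.
  - by move=> j; apply: measurable_funM => //; have [] := phiL2 j.
  rewrite lte_mul_pinfty ?lee_fin//; apply: lte_sum_pinfty => j _.
  rewrite n2Z; last by have [] := phiL2 j.
    by rewrite lte_mul_pinfty ?lee_fin ?sqr_ge0//; have [] := phiL2 j.
  exact: measurable_itv.
have cf : (fun n => cn2 k (fun x => (tens (f n) x - tens g x)%R)) @ \oo --> 0%E.
  apply: tens_cvg => // l lk.
  apply: (@cvg0_le _ _ _ _ _ (fun n => (n.+1%:R^-1 : R)%:E)).
  - by move=> n; exact: n2_ge0.
  - by apply: nearW => n; exact/ltW/pP.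
  - by apply: cvg_EFin; [exact: nearW|exact: cvg_harmonic].
move=> e e0.
have [n _ /(_ n (leqnn n)) hn] := (ge0_cvg0P _ (fun n => cube_n2_ge0 t T k _)).1 cf _ e0.
(* A common range for all the sums, so that the expanded product runs over [{ffun 'I_k -> 'I_N}];
   beyond the own range of a factor the coefficients are zero. *)
pose N := (\max_(l < k) (p l n).1)%N.
exists {ffun 'I_k -> 'I_N}, (fun i : {ffun 'I_k -> 'I_N} => \prod_(l < k) ((i l < (p l n).1)%N%:R * (p l n).2 (i l))),
  (fun (i : {ffun 'I_k -> 'I_N}) b => ord_ext 0%N (fun l => nat_of_ord (i l)) b).
rewrite /cube_n2 n2_sym; rewrite /cube_n2 in hn; apply: le_lt_trans hn; rewrite le_eqVlt; apply/orP; left; apply/eqP.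
apply: eq_integral => x _; congr EFin; congr (_ ^+ 2); congr (_ - _).
rewrite tens_tuple /f.
transitivity (\prod_(l < k) \sum_(j < N) ((j < (p l n).1)%N%:R * (p l n).2 j) * phi j (tnth x l)).
  rewrite bigA_distr_bigA/=; apply: eq_bigr => i _.
  by rewrite /tens_phi tens_tuple -big_split/=; apply: eq_bigr => l _; rewrite ord_extE.
apply: eq_bigr => l _.
have lN : ((p l n).1 <= N)%N by exact: (leq_bigmax (F := fun l : 'I_k => (p l n).1)).
rewrite (big_ord_widen _ (fun j => (p l n).2 j * phi j (tnth x l)) lN) [RHS]big_mkcond/=.
by apply: eq_bigr => j _; case: ifP => _; rewrite ?mul1r ?mul0r.
Qed.

Lemma fourier_dense_sum k (E : finType) (Phi : E -> seq R -> R) : (forall i, fourier_dense k (Phi i)) ->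
  fourier_dense k (fun x => \sum_i Phi i x).
Proof.
move=> h; rewrite (_ : (fun x => _) = \sum_i Phi i); last by apply/funext => x; rewrite fct_sumE.
apply: (big_ind (fourier_dense k)) => [|? ? ? ?|i _]; [|exact: fourier_denseD|exact: h].
split; first exact: measurable_cst.
move=> e e0; exists void, (fun _ => 0), (fun _ _ => 0%N).
rewrite /cube_n2 integral0_eq ?lte_fin// => x _.
by rewrite big_pred0 ?subr0 ?expr0n// => -[].
Qed.

Lemma tens_rcons (g : nat -> R -> R) x u : tens g (rcons x u) = tens g x * g (size x) u.
Proof.
rewrite /tens size_rcons big_ord_recr/= nth_rcons ltnn eqxx; congr (_ * _).
by apply: eq_bigr => a _; rewrite nth_rcons ltn_ord.
Qed.

(** By induction on [k]: the indicator of the outermost interval becomes the last factor of each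
    tensor product. *)
Lemma elem_tens_sum d (Omega : measurableType d) (w : nat -> R -> Omega -> R) k a Phi Y :
  elem t w k a Phi Y -> exists (E : finType) (b : E -> R) (g : E -> nat -> R -> R),
    (forall i l, L2on t T (g i l)) /\ forall x, size x = k -> Phi x = \sum_i b i * tens (g i) x.
Proof.
have L1 (B : set R) : measurable B -> L2on t T (\1_B).
  move=> mB; apply: (bounded_L2on (M := 1)).
    by apply: measurable_funTS; exact: measurable_indic.
  by move=> x _; rewrite indicE; case: (_ \in _); rewrite ?normr1 ?normr0.
elim: k a Phi Y => [|k IH] a Phi Y.
  move=> _; exists unit, (fun _ => Phi [::]), (fun _ _ => \1_setT); split; first by move=> _ _; exact: L1.
  by move=> x /size0nil ->; rewrite (big_pred1 tt)// ?/tens ?big_ord0 ?mulr1//; case.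
move=> [I [al [be [Phi_ [Y_ [h1 h2 _]]]]]].
pose TS (Psi : seq R -> R) := exists (E : finType) (b : E -> R) (g : E -> nat -> R -> R),
    (forall i l, L2on t T (g i l)) /\ forall x, size x = k.+1 -> Psi x = \sum_i b i * tens (g i) x.
have TS0 : TS (fun _ => 0).
  exists void, (fun _ => 0), (fun _ _ => \1_setT); split; first by case.
  by move=> x _; rewrite big_pred0// => -[].
have TSD Psi Psi' : TS Psi -> TS Psi' -> TS (fun x => Psi x + Psi' x).
  move=> [E [b [g [hg hE]]]] [E' [b' [g' [hg' hE']]]].
  exists (E + E')%type, (fun i => match i with inl i => b i | inr i => b' i end),
    (fun i => match i with inl i => g i | inr i => g' i end); split; first by case.
  by move=> x xk; rewrite big_sumType/= hE// hE'.
have TSi i : exists Psi, TS Psi /\ forall x u, size x = k -> Psi (rcons x u) = Phi_ i x * \1_(`[al i, be i[) u.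
  have [_ _ _ /IH[E [b [g [hg hE]]]]] := h1 i.
  pose g' e l := if l == k then \1_(`[al i, be i[) else g e l : R -> R.
  exists (fun y => \sum_e b e * tens (g' e) y); split.
    by exists E, b, g'; split => // e l; rewrite /g'; case: eqP => // _; exact: L1.
  move=> x u xk; rewrite hE// mulr_suml; apply: eq_bigr => e _.
  rewrite tens_rcons -mulrA; congr (_ * _); rewrite /g' xk eqxx; congr (_ * _).
  by apply: eq_bigr => j _; rewrite ltn_eqF// -xk.
pose Psi i := projT1 (cid (TSi i)).
have PsiP i : TS (Psi i) /\ forall x u, size x = k -> Psi i (rcons x u) = Phi_ i x * \1_(`[al i, be i[) u.
  by rewrite /Psi; case: cid.
have [E [b [g [hg hE]]]] : TS (\sum_i Psi i).
  by apply: (big_ind TS) => [|? ? ? ?|i _]; [exact: TS0|exact: TSD|have [] := PsiP i].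
exists E, b, g; split => // y yk; rewrite -hE//.
case/lastP: y yk => [//|x u]; rewrite size_rcons => -[xk].
by rewrite h2// fct_sumE; apply: eq_bigr => i _; have [_ ->] := PsiP i.
Qed.

Lemma fourier_dense_elem d (Omega : measurableType d) (w : nat -> R -> Omega -> R) k a Phi Y :
  elem t w k a Phi Y -> fourier_dense k Phi.
Proof.
move=> /elem_tens_sum[E [b [g [hg hE]]]].
apply: (fourier_dense_ext (Phi := fun x => \sum_i b i * tens (g i) x)); first by move=> x /hE.
by apply: fourier_dense_sum => i; apply: fourier_denseZ; exact: fourier_dense_tens.
Qed.

Lemma fourier_dense_simplex (tau : nat -> nat -> R) (g : nat -> R -> R) k : is_partition_seq t T tau ->
  (forall l, measurable_fun setT (g l : MR -> R)) -> (cn2 k (simplex_kernel g T) < +oo)%E ->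
  fourier_dense k (simplex_kernel g T).
Proof.
move=> htau mg fin; apply: fourier_dense_closed; first exact: simplex_kernel_cube_meas.
move=> e e0.
(* Only the approximating kernel is of interest here, so the integrators are taken to be zero. *)
have [Psi [Z [hel h]]] := simplex_kernel_approx tT htau (fun _ _ (_ : MR) => 0) mg (lexx T) fin e0.
by exists Psi; split; [exact: fourier_dense_elem hel|rewrite /cube_n2 n2_sym].
Qed.

Section best_approximation.
Context (k : nat) (K : seq R -> R) (dK : fourier_dense k K) (K2 : (cn2 k K < +oo)%E).
Local Notation mu := (lebesgue_tuple R k).
Local Notation D := (cube t T k).
Let mD : measurable D := @measurable_cube R t T k.

Definition tens_idx (j : 'I_k -> nat) := tens_phi (ord_ext 0%N j).

Lemma tens_idx_tuple j (x : k.-tuple R) : tens_idx j x = \prod_(l < k) phi (j l) (tnth x l).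
Proof. by rewrite /tens_idx /tens_phi tens_tuple; apply: eq_bigr => l _; rewrite ord_extE. Qed.

Definition fourier_coef (j : 'I_k -> nat) : R := \int[mu]_(x in D) (K x * tens_idx j x).

Definition fourier_sum (p : 'I_k -> nat) (x : seq R) : R :=
  \sum_(j : {dffun forall l : 'I_k, 'I_(p l).+1}) fourier_coef (fun l => j l) * tens_idx (fun l => j l) x.

Lemma tens_idx_orthonormal (p : 'I_k -> nat) (i j : {dffun forall l : 'I_k, 'I_(p l).+1}) :
  \int[mu]_(x in D) (tens_idx (fun l => i l) x * tens_idx (fun l => j l) x) = (i == j)%:R.
Proof.
have mtT : measurable (`[t, T]%classic : set MR) by exact: measurable_itv.
have iM (l : 'I_k) : leb.-integrable `[t, T] (EFin \o (fun u => phi (i l) u * phi (j l) u)).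
  by have [? ?] := phiL2 (i l); have [? ?] := phiL2 (j l); exact: n2_integrableM.
have [_ E] := cube_prod_integral iM.
transitivity (\int[mu]_(x in D) \prod_(l < k) (phi (i l) (tnth x l) * phi (j l) (tnth x l))).
  by apply: eq_Rintegral => x _; rewrite !tens_idx_tuple big_split.
rewrite E; have [_ orth] := ophi.
under eq_bigr do rewrite orth.
have [->|ij] := eqVneq i j; first by rewrite big1// => l _; rewrite eqxx.
have [l hl] : exists l, i l != j l.
  by apply/existsP; apply: contraNT ij => /existsPn h; apply/eqP/ffunP => l; have := h l; rewrite negbK => /eqP.
by rewrite (bigD1 l)//= (_ : _ == _ = false) ?mul0r//; apply: negbTE.
Qed.

Let iM (f g : seq R -> R) : cube_meas t T k f -> cube_meas t T k g -> (cn2 k f < +oo)%E -> (cn2 k g < +oo)%E ->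
  mu.-integrable D (fun x => (f x * g x)%:E).
Proof. by move=> *; exact: n2_integrableM. Qed.

(** Best approximation: the remainder [Df] is orthogonal to every combination [V] of basis functions
    from the box, so [|| Df || <= || Df + V ||]. *)
Lemma fourier_best (p : 'I_k -> nat) (E : finType) (b : E -> R)
    (J : E -> {dffun forall l : 'I_k, 'I_(p l).+1}) :
  (cn2 k (fun x => (K x - fourier_sum p x)%R) <=
   cn2 k (fun x => (K x - \sum_e b e * tens_idx (fun l => J e l) x)%R))%E.
Proof.
have [mK _] := dK.
pose Tj (j : {dffun forall l : 'I_k, 'I_(p l).+1}) := tens_idx (fun l => j l).
have mT j : cube_meas t T k (Tj j) by exact: tens_phi_meas.
have T2 j : (cn2 k (Tj j) < +oo)%E by exact: tens_phi_lty.
pose C (j : {dffun forall l : 'I_k, 'I_(p l).+1}) := fourier_coef (fun l => j l).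
(* Distinct [e] may carry the same multi-index; their coefficients are collected. *)
pose a j := \sum_(e | J e == j) b e.
have AE x : \sum_e b e * tens_idx (fun l => J e l) x = \sum_j a j * Tj j x.
  rewrite (partition_big J xpredT)//=; apply: eq_bigr => j _.
  by rewrite /a mulr_suml; apply: eq_bigr => e /eqP ->.
have sum_lty (c : {dffun forall l : 'I_k, 'I_(p l).+1} -> R) :
    cube_meas t T k (fun x => \sum_j c j * Tj j x) /\ (cn2 k (fun x => (\sum_j c j * Tj j x)%R) < +oo)%E.
  have mcT j : cube_meas t T k (fun x => c j * Tj j x) by exact: cube_measZ.
  split; first exact: measurable_sum.
  apply: (le_lt_trans (n2_sum _ mD mcT)); rewrite lte_mul_pinfty ?lee_fin//.
  apply: lte_sum_pinfty => j _; rewrite (n2Z _ mD); last exact: mT.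
  by rewrite lte_mul_pinfty ?lee_fin ?sqr_ge0//; exact: T2.
have [mS S2] := sum_lty C; have [mV V2] := sum_lty (fun j => C j - a j).
pose Df x := K x - \sum_j C j * Tj j x.
have mDf : cube_meas t T k Df by exact: cube_measB.
have D2 : (cn2 k Df < +oo)%E.
  have := n2_lty_add mD mK (cube_measZ (-1) mS) K2.
  rewrite {1}/cube_n2 (n2Z _ mD); last exact: mS.
  rewrite sqrrN expr1n mul1e => /(_ S2).
  by rewrite /Df /cube_n2; under eq_integral do rewrite mulN1r.
have orthD j : \int[mu]_(x in D) (Df x * Tj j x) = 0.
  have i1 := iM mK (mT j) K2 (T2 j).
  have i2 := iM mS (mT j) S2 (T2 j).
  transitivity (\int[mu]_(x in D) (K x * Tj j x - (\sum_i C i * Tj i x) * Tj j x)).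
    by apply: eq_Rintegral => x _; rewrite /Df mulrBl.
  rewrite (RintegralB mD i1 i2) -[X in X - _]/(C j).
  suff -> : \int[mu]_(x in D) ((\sum_i C i * Tj i x) * Tj j x) = C j by rewrite subrr.
  have iij i : mu.-integrable D (fun x => (C i * (Tj i x * Tj j x))%:E).
    by have := integrableZl mD (C i) (iM (mT i) (mT j) (T2 i) (T2 j)); apply: eq_integrable.
  transitivity (fine (\int[mu]_(x in D) (\sum_i (C i * (Tj i x * Tj j x))%:E)))%E.
    rewrite /Rintegral; congr fine; apply: eq_integral => x _.
    by rewrite sumEFin mulr_suml; congr EFin; apply: eq_bigr => i _; rewrite mulrA.
  rewrite integral_sum//.
  rewrite (eq_bigr (fun i => (C i * (i == j)%:R)%:E)).
    rewrite sumEFin/= (bigD1 j)//= eqxx mulr1 big1 ?addr0// => i /negbTE ->.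
    by rewrite mulr0.
  move=> i _; rewrite -tens_idx_orthonormal -(RintegralZl (C i) mD (iM (mT i) (mT j) (T2 i) (T2 j))).
  by rewrite /Rintegral fineK//; exact: integrable_fin_num.
pose V x := \sum_j (C j - a j) * Tj j x.
have orthV : \int[mu]_(x in D) (Df x * V x) = 0.
  have ij j : mu.-integrable D (fun x => ((C j - a j) * (Df x * Tj j x))%:E).
    by have := integrableZl mD (C j - a j) (iM mDf (mT j) D2 (T2 j)); apply: eq_integrable.
  transitivity (fine (\int[mu]_(x in D) (\sum_j ((C j - a j) * (Df x * Tj j x))%:E)))%E.
    rewrite /Rintegral; congr fine; apply: eq_integral => x _.
    by rewrite sumEFin mulr_sumr; congr EFin; apply: eq_bigr => j _; rewrite mulrCA.
  rewrite integral_sum//.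
  rewrite (eq_bigr (fun j => 0%E)); first by rewrite big1.
  move=> j _; have EZ := RintegralZl (C j - a j) mD (iM mDf (mT j) D2 (T2 j)).
  rewrite orthD mulr0 in EZ.
  by rewrite -[LHS]fineK ?(integrable_fin_num mD (ij j))//; congr EFin.
have iD := n2_integrable_sqr mD mDf D2.
have iDV := iM mDf mV D2 V2.
have iDV2 : mu.-integrable D (fun x => (2 * (Df x * V x))%:E).
  by have := integrableZl mD 2 iDV; apply: eq_integrable.
(* The cross term integrates to zero and is inserted for free, after which the two integrands
   compare pointwise. *)
have E1 : (cn2 k Df = \int[mu]_(x in D) ((Df x) ^+ 2 + 2 * (Df x * V x))%:E)%E.
  under [RHS]eq_integral do rewrite EFinD.
  rewrite integralD//.
  have EZ := RintegralZl 2 mD iDV; rewrite orthV mulr0 in EZ.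
  have E0 : (\int[mu]_(x in D) (2 * (Df x * V x))%:E = 0)%E.
    by rewrite -[LHS]fineK ?(integrable_fin_num mD iDV2)//; congr EFin.
  by rewrite E0 adde0.
rewrite -[leLHS]/(cn2 k Df) E1.
have mKA : cube_meas t T k (fun x => K x - \sum_e b e * tens_idx (fun l => J e l) x).
  have [m1 _] := sum_lty a; have := cube_measB mK m1.
  by apply: eq_measurable_fun => x _; rewrite /= AE.
apply: le_integral => //.
- by under eq_fun do rewrite EFinD; exact: integrableD.
- apply: (n2_integrable_sqr mD mKA).
  have := n2_lty_add mD mDf mV D2 V2.
  congr (_ < _)%E; apply: eq_integral => x _; rewrite AE /Df /V; congr EFin; congr (_ ^+ _).
  rewrite -addrA; congr (_ + _).
  rewrite -[in RHS]sumrN -sumrN -big_split/=; apply: eq_bigr => j _; ring.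
move=> x _; rewrite lee_fin AE.
have -> : K x - \sum_j a j * Tj j x = Df x + V x.
  rewrite /Df /V -addrA; congr (_ + _).
  rewrite -[in LHS]sumrN -sumrN -big_split/=; apply: eq_bigr => j _; ring.
exact: sqr_add_ge.
Qed.

(** By best approximation, every box containing the multi-indices of one good combination does at
    least as well; this gives the joint limit in all [p l]. *)
Lemma fourier_sum_cvg : (fun p => cn2 k (fun x => (K x - fourier_sum p x)%R)) @ multi_oo k --> 0%E.
Proof.
apply/(ge0_cvg0P (multi_oo_filter k) (fun p => cube_n2_ge0 t T k _)) => e e0.
have [_ /(_ e e0)[E [b [J hJ]]]] := dK.
pose M := (\max_(i : E) \max_(l < k) J i l)%N.
exists M => // p /= hp.
pose J' i : {dffun forall l : 'I_k, 'I_(p l).+1} := [ffun l : 'I_k => inord (J i l) : 'I_(p l).+1].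
have J'E i l : J' i l = J i l :> nat.
  rewrite ffunE inordK// ltnS; apply: leq_trans (hp l).
  apply: leq_trans (leq_bigmax i).
  exact: (leq_bigmax (F := fun l : 'I_k => J i l) l).
apply: le_lt_trans (fourier_best b J') _.
apply: le_lt_trans hJ; rewrite le_eqVlt; apply/orP; left; apply/eqP.
apply: eq_integral => x _; congr EFin; congr (_ ^+ _); congr (_ - _); apply: eq_bigr => i _.
rewrite tens_idx_tuple /tens_phi tens_tuple; congr (_ * _); apply: eq_bigr => l _.
by rewrite J'E.
Qed.

End best_approximation.

End multiple_fourier.

(** * Limits of the diagonal sums *)

Lemma ms_limit_unique d (Omega : measurableType d) (R : realType) (P : probability Omega R)
    (X : nat -> Omega -> R) (Y Y' : Omega -> R) :
  ms_limit P \oo X Y -> ms_limit P \oo X Y' -> {ae P, forall om, Y om = Y' om}.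
Proof.
move=> [mX mY cX] [_ mY' cX'].
have c0 : (fun _ : nat => n2 P setT (fun om => (Y om - Y' om)%R)) @ \oo --> 0%E.
  apply: (@cvg0_le _ _ _ _ _ (fun n => 2%:E * n2 P setT (fun om => (X n om - Y om)%R) +
      2%:E * n2 P setT (fun om => (X n om - Y' om)%R))%E).
  - by move=> n; exact: n2_ge0.
  - by apply: nearW => n; rewrite [in X in (_ <= X + _)%E]n2_sym; exact: n2_triangle.
  - by apply: cvg0D; exact: cvg0Z.
have E0 : n2 P setT (fun om => (Y om - Y' om)%R) = 0%E.
  by apply: (cvg_unique _ _ c0) => //; exact: cvg_cst.
have := n2_eq0 measurableT (measurable_funB mY mY') E0.
by apply: filterS => om /(_ I)/eqP; rewrite subr_eq0 => /eqP.
Qed.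

Section integrators.
Context d (Omega : measurableType d) (R : realType) (P : probability Omega R) (t T : R).
Context (F : R -> set_system Omega) (m : nat) (f : 'I_m -> R -> Omega -> R).
Hypotheses (t0 : 0 <= t) (tT : t < T) (hF : is_filtration T F) (hf : is_wiener P T F f).
Context (tau : nat -> nat -> R) (htau : is_partition_seq t T tau).

Definition integrator_cst := Num.max (normal_var R) (T - t).

Lemma integrator_cst_ge0 : 0 <= integrator_cst.
Proof. by rewrite le_max subr_ge0 (ltW tT) orbT. Qed.

Lemma ito_isometric_le (C C' : R) (W : R -> Omega -> R) : C <= C' -> ito_isometric P t T F C W ->
  ito_isometric P t T F C' W.
Proof.
move=> CC' [h1 h2 h3]; split => // n sg eta hs hl he.
apply: le_trans (h3 n sg eta hs hl he) _; rewrite lee_wpmul2r ?lee_fin//.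
apply: sume_ge0 => q _; rewrite mule_ge0 ?n2_ge0// lee_fin subr_ge0 ltW//; exact: hl.
Qed.

Lemma integrator_isometric a : ito_isometric P t T F integrator_cst (integrator f a).
Proof.
case: (unliftP ord0 a) => [b ->|->].
  by apply: ito_isometric_le (wiener_ito_isometric t0 hF hf b); rewrite le_max lexx.
by apply: ito_isometric_le (time_ito_isometric P f t0 tT hF); rewrite le_max lexx orbT.
Qed.

Lemma integrator_grid_ms a h Z : sampleable t T h ->
  is_ito_integral P F (integrator f a) t T (fun s _ => h s) Z ->
  ms_limit P \oo (fun N => grid_sum tau (integrator f a) h N.+1) Z.
Proof.
move=> hh hZ; split.
- by move=> N; exact: (grid_sum_measurable t0 hF htau _ _ (integrator_isometric a)).
- by have [_ [Y [_ _ []]]] := hZ.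
- exact: (grid_sum_ito t0 tT hF htau integrator_cst_ge0 (integrator_isometric a) hh hZ).
Qed.

(** A grid sum is Gaussian with variance proportional to the Riemann sum of [h^2], which is at most
    [M^2 (T - t)] for every partition. *)
Lemma wiener_grid_moments a h : sampleable t T h ->
  moments_bounded P (fun N => grid_sum tau (f a) h N.+1).
Proof.
move=> hh n; have [_ [M hM] _] := hh.
have M0 : 0 <= M by apply: le_trans (normr_ge0 (h t)) (hM t _); rewrite lexx ltW.
pose mn := (\int[@normal_prob R 0 1]_x ((x : R) ^+ n.*2)%:E)%E.
have mn0 : (0 <= mn)%E.
  by apply: integral_ge0 => x _; rewrite lee_fin -mul2n exprM exprn_ge0// sqr_ge0.
have mnf : mn \is a fin_num by rewrite ge0_fin_numE//; exact: normal_moment_lty.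
exists ((M ^+ 2 * (T - t)) ^+ n * fine mn) => N.
pose S := \sum_(q < N.+1) (h (tau N.+1 q)) ^+ 2 * (tau N.+1 q.+1 - tau N.+1 q).
have D0 (q : 'I_N.+1) : 0 <= tau N.+1 q.+1 - tau N.+1 q by rewrite subr_ge0 ltW// (part_incr htau).
have S0 : 0 <= S by apply: sumr_ge0 => q _; rewrite mulr_ge0// sqr_ge0.
have SM : S <= M ^+ 2 * (T - t).
  rewrite -{1}(part_end htau (ltn0Sn N)) -{1}(part_start htau (ltn0Sn N)).
  rewrite -(telescope_sumr (fun q => tau N.+1 q))// big_mkord mulr_sumr.
  apply: ler_sum => q _; rewrite ler_wpM2r//.
  rewrite -[X in X <= _]real_normK ?num_real// ler_pXn2r ?nnegrE// hM//.
  exact: (part_in htau (ltn0Sn N) (ltnW (ltn_ord q))).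
have mG : measurable_fun setT (grid_sum tau (f a) h N.+1).
  have := integrator_isometric (lift ord0 a); rewrite integrator_wiener => isoW.
  exact: (grid_sum_measurable t0 hF htau _ _ isoW).
have hcos u th : \int[P]_om cos (u * grid_sum tau (f a) h N.+1 om + th) = cos th * normal_cf (u * Num.sqrt S).
  rewrite psi_mul_sqrt.
  have E := grid_cos_sum t0 tT hF hf a (N := N.+1) (sg := tau N.+1)
    (fun b q => (b == a)%:R * (u * h (tau N.+1 q))) th
    (fun q qN => part_in htau (ltn0Sn N) qN) (fun q qN => part_incr htau qN).
  transitivity (cos th * normal_cf (Num.sqrt (\sum_(q < N.+1) \sum_b ((b == a)%:R * (u * h (tau N.+1 q))) ^+ 2 *
      (tau N.+1 q.+1 - tau N.+1 q)))).
    rewrite -E; apply: eq_Rintegral => om _; rewrite addrC; congr (cos (_ + _)).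
    rewrite /grid_sum mulr_sumr; apply: eq_bigr => q _.
    rewrite (bigD1 a)//= eqxx mul1r mulrA big1 ?addr0// => b /negbTE ->.
    by rewrite !mul0r.
  congr (_ * normal_cf (Num.sqrt _)); rewrite /S mulr_sumr; apply: eq_bigr => q _.
  rewrite (bigD1 a)//= eqxx mul1r big1 ?addr0; first by rewrite exprMn mulrA.
  by move=> b /negbTE ->; rewrite mul0r expr0n mul0r.
rewrite (gaussian_moments mG hcos) -/mn EFinM fineK// lee_wpmul2r// lee_fin.
rewrite -mul2n exprM sqr_sqrtr//; apply: lerXn2r => //; rewrite nnegrE//.
by rewrite mulr_ge0 ?sqr_ge0// subr_ge0 ltW.
Qed.

(** Integration in time is deterministic: the grid sums are real numbers converging to the Lebesgue
    integral, and uniqueness of mean-square limits makes [Z] almost surely equal to it. *)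
Lemma time_grid_moments h Z : sampleable t T h ->
  is_ito_integral P F (integrator f ord0) t T (fun s _ => h s) Z ->
  ms_limit_moments P (fun N => grid_sum tau (integrator f ord0) h N.+1) Z.
Proof.
move=> hh hZ; have msG := integrator_grid_ms hh hZ.
pose G N := \sum_(q < N.+1) h (tau N.+1 q) * (tau N.+1 q.+1 - tau N.+1 q).
have GE N om : grid_sum tau (integrator f ord0) h N.+1 om = G N.
  by rewrite /grid_sum integrator_time.
have cG := riemann_cvg tT htau hh; set c := \int[lebesgue_measure]_(x in _) h x in cG.
have Ec (x : R) n : (\int[P]_om (x ^+ n.*2)%:E = (x ^+ n.*2)%:E)%E.
  by have := integral_cst P measurableT (x ^+ n.*2)%:E => /= ->; rewrite probability_setT mule1.
have msc : ms_limit P \oo (fun N => grid_sum tau (integrator f ord0) h N.+1) (fun _ => c).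
  split => //; first by have [] := msG.
  have E N : (\int[P]_om ((grid_sum tau (integrator f ord0) h N.+1 om - c) ^+ 2)%:E = ((G N - c) ^+ 2)%:E)%E.
    by under eq_integral do rewrite GE; exact: (Ec _ 1%N).
  under eq_fun do rewrite E.
  apply: cvg_EFin; first exact: nearW.
  rewrite -[X in _ --> X](expr0n R 2) -(subrr c).
  by apply: (@cvg_comp _ _ _ (fun N => G N - c) (fun x => x ^+ 2) _ (nbhs (c - c)));
    [apply: cvgB => //; exact: cvg_cst|exact: exprn_continuous].
have aeZ := ms_limit_unique msG msc.
split => //.
- move=> n; have : bounded_fun G by apply: cvg_seq_bounded; apply/cvg_ex; exists c.
  move=> [M0 [_ /(_ (M0 + 1) (ltr_pwDr ltr01 (lexx _)))]].
  move: (M0 + 1) => M hM'; have hM N : `|G N| <= M by exact: hM'.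
  have M_ge0 : 0 <= M by exact: le_trans (normr_ge0 _) (hM 0%N).
  exists (M ^+ n.*2) => N.
  under eq_integral do rewrite GE; rewrite Ec lee_fin.
  rewrite -mul2n !exprM; apply: lerXn2r; rewrite ?nnegrE ?sqr_ge0//.
  by rewrite -[X in X <= _]real_normK ?num_real// ler_pXn2r ?nnegrE.
- move=> n; exists (c ^+ n.*2) => _; rewrite -(Ec c n) le_eqVlt; apply/orP; left; apply/eqP.
  apply: ae_eq_integral => //.
  + by apply/measurable_EFinP; apply: measurable_funX; have [] := msG.
  + by apply: filterS aeZ => om -> _.
Qed.

Context (phi : nat -> R -> R) (hphi : forall j, sampleable t T (phi j)).
Hypothesis ortho : forall i j, \int[lebesgue_measure]_(x in `[t, T]) (phi i x * phi j x) = (i == j)%:R.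
Context (zeta : 'I_m.+1 -> nat -> Omega -> R).
Hypothesis hz : forall a j, is_ito_integral P F (integrator f a) t T (fun s _ => phi j s) (zeta a j).

Lemma wiener_zeta a j : is_ito_integral P F (f a) t T (fun s _ => phi j s) (zeta (lift ord0 a) j).
Proof. by have := hz (lift ord0 a) j; rewrite integrator_wiener. Qed.

Lemma integrator_grid_moments a j :
  ms_limit_moments P (fun N => grid_sum tau (integrator f a) (phi j) N.+1) (zeta a j).
Proof.
case: (unliftP ord0 a) => [b ->|->]; last exact: time_grid_moments.
split; first exact: integrator_grid_ms.
  by rewrite integrator_wiener; exact: wiener_grid_moments.
move=> n; exists (fine (\int[@normal_prob R 0 1]_x ((x : R) ^+ n.*2)%:E)%E) => _.
have mz : measurable_fun setT (zeta (lift ord0 b) j).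
  by have [] := integrator_grid_ms (hphi j) (hz (lift ord0 b) j).
have hcos u th : \int[P]_om cos (u * zeta (lift ord0 b) j om + th) = cos th * normal_cf (u * 1).
  have := @zeta_cos _ _ _ P t T F m f t0 tT hF hf tau htau phi hphi ortho _ wiener_zeta
    [:: (b, j)] (fun _ => u) th isT.
  rewrite big_cons big_nil !mulr1 => <-; apply: eq_Rintegral => om _.
  by rewrite big_cons big_nil/= addr0 addrC.
rewrite (gaussian_moments mz hcos) expr1n mul1e fineK//.
rewrite ge0_fin_numE; first exact: normal_moment_lty.
by apply: integral_ge0 => x _; rewrite lee_fin -mul2n exprM exprn_ge0// sqr_ge0.
Qed.

End integrators.

Section ordered_sum_limit.
Context d (Omega : measurableType d) (R : realType) (P : probability Omega R) (t T : R).
Context (F : R -> set_system Omega).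
Hypotheses (t0 : 0 <= t) (tT : t < T) (hF : is_filtration T F).
Context (tau : nat -> nat -> R) (htau : is_partition_seq t T tau).
Context (C : R) (C0 : 0 <= C).
Context (w : nat -> R -> Omega -> R) (isoW : forall b, ito_isometric P t T F C (w b)).

(** Ordered sums are elementary integrals of sampled kernels, which converge to the kernel on the
    simplex. *)
Lemma osum_ms_limit (h : nat -> R -> R) k : (forall b, (b < k)%N -> sampleable t T (h b)) ->
  exists Y, isW P t T w k (simplex_kernel h T) Y /\
    ms_limit P \oo (fun N om => osum k N.+1 (fun b q => h b (tau N.+1 q) *
      (w b (tau N.+1 q.+1) om - w b (tau N.+1 q) om))) Y.
Proof.
move=> hh.
have el N := osum_elem htau w h k (ltn0Sn N) (leqnn N.+1).
have cK := osum_kernel_cvg tT htau hh.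
have mK : cube_meas t T k (simplex_kernel h T).
  have mt : cube_meas t T k (tens h) by apply: tens_cube_meas => l /hh[].
  have ms : cube_meas t T k (fun x => (sorted (fun a b : R => a < b) (rcons x T))%:R).
    by apply: measurable_funTS; exact: measurable_sorted_nat.
  by have := measurable_funM ms mt; apply: eq_measurable_fun => x _; rewrite simplex_kernelE.
have [Y hY] : exists Y, isW P t T w k (simplex_kernel h T) Y.
  apply: (isW_exists t0 tT hF C0 isoW mK) => e e0.
  have [N _ /(_ N (leqnn N)) hN] := (ge0_cvg0P _ (fun n => cube_n2_ge0 t T k _)).1 cK _ e0.
  by have := el N; rewrite (part_end htau)// => elN; do 2!eexists; split; [exact: elN|exact: hN].
exists Y; split => //.
have isN N : isW P t T w k (fun x => osum k N.+1 (fun b q => h b (tau N.+1 q) * cell tau N.+1 x b q))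
    (fun om => osum k N.+1 (fun b q => h b (tau N.+1 q) * (w b (tau N.+1 q.+1) om - w b (tau N.+1 q) om))).
  by apply: (isW_elem t0 tT hF isoW); have := el N; rewrite (part_end htau).
split; [by move=> N; have [] := isN N|by have [] := hY|].
exact: (isW_cvg t0 tT hF C0 isoW _ hY isN cK).
Qed.

End ordered_sum_limit.

Lemma ms_limit_shift d (Omega : measurableType d) (R : realType) (P : probability Omega R)
    (X : nat -> Omega -> R) (Y : Omega -> R) : (forall n, measurable_fun setT (X n)) ->
  ms_limit P \oo (fun n => X n.+1) Y -> ms_limit P \oo X Y.
Proof. by move=> mX [_ mY cX]; split => //; rewrite -cvg_shiftS. Qed.

Section diagonal_limit.
Context d (Omega : measurableType d) (R : realType) (P : probability Omega R) (t T : R).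
Context (F : R -> set_system Omega) (m : nat) (f : 'I_m -> R -> Omega -> R).
Hypotheses (t0 : 0 <= t) (tT : t < T) (hF : is_filtration T F) (hf : is_wiener P T F f).
Context (tau : nat -> nat -> R) (htau : is_partition_seq t T tau).
Context (phi : nat -> R -> R) (hphi : forall j, sampleable t T (phi j)).
Hypothesis ortho : forall i j, \int[lebesgue_measure]_(x in `[t, T]) (phi i x * phi j x) = (i == j)%:R.
Context (zeta : 'I_m.+1 -> nat -> Omega -> R).
Hypothesis hz : forall a j, is_ito_integral P F (integrator f a) t T (fun s _ => phi j s) (zeta a j).
Context (k : nat) (i : 'I_k -> 'I_m.+1).

(** When [s] sorts a multi-index, the [b]-th smallest time belongs to the position [s b] and carries
    the integrator of that position. *)
Definition perm_integrator (s : 'S_k) : nat -> R -> Omega -> R :=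
  ord_ext (integrator f ord0) (fun l => integrator f (i (s l))).

Lemma perm_integrator_isometric s b :
  ito_isometric P t T F (integrator_cst t T) (perm_integrator s b).
Proof.
by rewrite /perm_integrator /ord_ext; case: (insub b) => [l|]; exact: integrator_isometric.
Qed.

Definition perm_phi (s : 'S_k) (j : 'I_k -> nat) : nat -> R -> R :=
  ord_ext (fun=> 0) (fun l => phi (j (s l))).

Lemma diagonal_sumE (j : 'I_k -> nat) N om :
  diagonal_sum tau phi (fun l => integrator f (i l)) j N om =
  \prod_(l < k) grid_sum tau (integrator f (i l)) (phi (j l)) N om -
  \sum_(s : 'S_k) osum k N (fun b q => perm_phi s j b (tau N q) *
    (perm_integrator s b (tau N q.+1) om - perm_integrator s b (tau N q) om)).
Proof.
pose th (a : 'I_k) q := phi (j a) (tau N q) * (integrator f (i a) (tau N q.+1) om - integrator f (i a) (tau N q) om).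
have -> : \prod_(l < k) grid_sum tau (integrator f (i l)) (phi (j l)) N om =
    \sum_(l : {ffun 'I_k -> 'I_N}) \prod_(a < k) th a (l a).
  by rewrite bigA_distr_bigA.
have -> : \sum_(s : 'S_k) osum k N (fun b q => perm_phi s j b (tau N q) *
      (perm_integrator s b (tau N q.+1) om - perm_integrator s b (tau N q) om)) =
    \sum_(l : {ffun 'I_k -> 'I_N} | injectiveb l) \prod_(a < k) th a (l a).
  rewrite sum_injective_osum; apply: eq_bigr => s _; apply: osum_ext => b q bk _.
  by rewrite -[b]/(val (Ordinal bk)) /perm_phi /perm_integrator !ord_extE.
by rewrite (bigID (fun l : {ffun 'I_k -> 'I_N} => injectiveb l))/= addrC addrK.
Qed.

Lemma perm_integral_exists (s : 'S_k) (j : 'I_k -> nat) :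
  exists Y, isW P t T (perm_integrator s) k (simplex_kernel (perm_phi s j) T) Y /\
    ms_limit P \oo (fun N om => osum k N.+1 (fun b q => perm_phi s j b (tau N.+1 q) *
      (perm_integrator s b (tau N.+1 q.+1) om - perm_integrator s b (tau N.+1 q) om))) Y.
Proof.
apply: (osum_ms_limit t0 tT hF htau (integrator_cst_ge0 tT) (perm_integrator_isometric s)) => b bk.
by rewrite -[b]/(val (Ordinal bk)) /perm_phi ord_extE; exact: hphi.
Qed.

Lemma diagonal_limit : (0 < k)%N ->
  exists Y : 'S_k -> ('I_k -> nat) -> Omega -> R,
    (forall s j, isW P t T (perm_integrator s) k (simplex_kernel (perm_phi s j) T) (Y s j)) /\
    forall j, ms_limit P \oo (diagonal_sum tau phi (fun l => integrator f (i l)) j)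
      (fun om => \prod_(l < k) zeta (i l) (j l) om - \sum_(s : 'S_k) Y s j om).
Proof.
move=> k0.
pose Y s j := projT1 (cid (perm_integral_exists s j)).
have YP s j : isW P t T (perm_integrator s) k (simplex_kernel (perm_phi s j) T) (Y s j) /\
    ms_limit P \oo (fun N om => osum k N.+1 (fun b q => perm_phi s j b (tau N.+1 q) *
      (perm_integrator s b (tau N.+1 q.+1) om - perm_integrator s b (tau N.+1 q) om))) (Y s j).
  by rewrite /Y; case: cid.
exists Y; split => [s j|j]; first by have [] := YP s j.
have h : ms_limit P \oo (fun N => diagonal_sum tau phi (fun l => integrator f (i l)) j N.+1)
    (fun om => \prod_(l < k) zeta (i l) (j l) om - \sum_(s : 'S_k) Y s j om).
  have E N := funext (diagonal_sumE j N).
  under eq_fun do rewrite E.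
  apply: ms_limitB; last by apply: ms_limit_sum => s _; have [] := YP s j.
  by have [] := ms_limit_moments_prod (index_enum _) (fun l : 'I_k =>
    integrator_grid_moments t0 tT hF hf htau hphi ortho hz (i l) (j l)).
(* The limit was taken along [N.+1]. At [N = 0] there is no multi-index, since [k] is positive, and
   the sum is zero. *)
apply: ms_limit_shift => // -[|N]; last by have [] := h.
rewrite (_ : diagonal_sum _ _ _ _ _ = fun _ => 0)//; apply/funext => om.
by rewrite /diagonal_sum big1// => l _; have [] := l (Ordinal k0).
Qed.

End diagonal_limit.

(** * The expansion *)

Section zero_norm.
Context (R : realType) (t T : R) (tT : t < T).
Local Notation MR := (measurableTypeR R).
Local Notation leb := (@lebesgue_measure R).
Local Notation cn2 := (cube_n2 t T).

Definition sorted_tens (g : nat -> R -> R) (x : seq R) : R :=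
  (sorted (fun a b : R => a < b) x)%:R * tens g x.

Lemma sorted_tens_cube_meas k g : (forall l, measurable_fun setT (g l : MR -> R)) ->
  cube_meas t T k (sorted_tens g).
Proof.
move=> mg; apply: measurable_funM; last by apply: tens_cube_meas => l _; apply: measurable_funTS; exact: mg.
apply: measurable_funTS.
have : measurable_fun setT (\1_[set y : k.-tuple MR | sorted (fun a b : R => a < b) y] : k.-tuple MR -> R).
  by apply: measurable_indic; exact: measurable_sorted.
apply: eq_measurable_fun => x _; rewrite indicE; congr (_%:R); congr nat_of_bool.
by apply/idP/idP => [/set_mem//|?]; exact/mem_set.
Qed.

(* The two kernels differ only where the last coordinate is [T]. *)
Lemma simplex_kernel_top k g : (forall l, measurable_fun setT (g l : MR -> R)) ->
  cn2 k (fun x => sorted_tens g x - simplex_kernel g T x) = 0%E.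
Proof.
move=> mg.
have mD : cube_meas t T k (fun x => sorted_tens g x - simplex_kernel g T x).
  by apply: cube_measB; [exact: sorted_tens_cube_meas|exact: simplex_kernel_cube_meas].
case: k mD => [|k] mD.
  rewrite /cube_n2 integral0_eq// => x _.
  by rewrite tuple0/= simplex_kernelE /sorted_tens/= subrr expr0n.
rewrite (cube_n2_rcons mD).
rewrite (ae_eq_integral (cst 0%E)) ?integral_cst ?mul0e//.
- exact: cube_n2_rcons_measurable mD.
have : {ae leb, forall u : MR, u != T}.
  exists [set T]; split => //; first exact: lebesgue_measure_set1.
  by move=> u /=/negP; rewrite negbK => /eqP.
apply: filterS => u uT /=; rewrite in_itv/= => /andP[_ uT'].
have ltuT : u < T by rewrite lt_neqAle uT.
rewrite /cube_n2 integral0_eq// => x _.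
by rewrite simplex_kernelE /sorted_tens sorted_rcons2 ltuT andbT subrr expr0n.
Qed.

Lemma simplex_kernel_top_integral k g (h : seq R -> R) : (forall l, measurable_fun setT (g l : MR -> R)) ->
  cube_meas t T k h ->
  \int[lebesgue_tuple R k]_(x in cube t T k) (sorted_tens g x * h x) =
  \int[lebesgue_tuple R k]_(x in cube t T k) (simplex_kernel g T x * h x).
Proof.
move=> mg mh.
have mc := @measurable_cube R t T k.
have m1 := sorted_tens_cube_meas (k := k) mg.
have m2 : cube_meas t T k (simplex_kernel g T) by exact: simplex_kernel_cube_meas.
rewrite /Rintegral; congr fine; apply: ae_eq_integral => //.
- by apply/measurable_EFinP; exact: measurable_funM.
- by apply/measurable_EFinP; exact: measurable_funM.
have := n2_eq0 mc (measurable_funB m1 m2) (simplex_kernel_top k mg).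
by apply: filterS => x h0 /h0/eqP; rewrite subr_eq0 => /eqP ->.
Qed.

End zero_norm.

Section permuted_kernels.
Context (R : realType) (t T : R).
Local Notation MR := (measurableTypeR R).
Local Notation cn2 := (cube_n2 t T).
Context (k : nat).

Definition seq_perm (s : 'S_k) (x : seq R) : seq R := [seq nth 0 x (s l) | l <- enum 'I_k].

Lemma seq_perm_tuple s (x : k.-tuple R) : seq_perm s x = tuple_perm s x :> seq R.
Proof. by apply: eq_map => l; rewrite (tnth_nth 0). Qed.

Lemma cube_tuple_perm (s : 'S_k) (x : k.-tuple MR) : cube t T k (tuple_perm s x) <-> cube t T k x.
Proof.
split=> h l; last by rewrite tnth_mktuple; exact: h.
by have := h ((s^-1)%g l); rewrite tnth_mktuple permKV.
Qed.

Lemma cube_meas_perm (s : 'S_k) Phi : cube_meas t T k Phi -> cube_meas t T k (fun x => Phi (seq_perm s x)).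
Proof.
move=> mPhi.
have mp : measurable_fun (cube t T k) (fun x : k.-tuple MR => tuple_perm s x).
  by apply: measurable_funTS; exact: measurable_tuple_perm.
have mc : measurable_fun (cube t T k) ((fun x : k.-tuple MR => Phi x) \o (fun x : k.-tuple MR => tuple_perm s x)).
  apply: (measurable_comp _ _ mPhi mp); first exact: measurable_cube.
  by move=> _ [x xc <-]; exact/cube_tuple_perm.
by apply: eq_measurable_fun mc => x _; rewrite /= seq_perm_tuple.
Qed.

Lemma cube_n2_perm (s : 'S_k) Phi : cube_meas t T k Phi -> cn2 k (fun x => Phi (seq_perm s x)) = cn2 k Phi.
Proof.
move=> mPhi.
rewrite /cube_n2 integral_mkcond [RHS]integral_mkcond.
rewrite -[RHS](ge0_integral_tuple_perm s); last 2 first.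
- apply/(measurable_restrictT _ (@measurable_cube R t T k)); exact: measurable_sqr_EFin.
- by move=> x; rewrite patchE; case: ifP => // _; rewrite lee_fin sqr_ge0.
apply: eq_integral => x _; rewrite !patchE seq_perm_tuple.
congr (if _ then _ else _).
by apply/idP/idP => /set_mem h; apply/mem_set; exact/cube_tuple_perm.
Qed.

(** Such a permutation is increasing, hence the identity: [a <= s a] by induction from below and
    [s a <= a] by induction from above. *)
Lemma sorted_perm_id (s : 'S_k) (x : k.-tuple R) : sorted (fun a b : R => a < b) x ->
  sorted (fun a b : R => a < b) (seq_perm s x) -> s = 1%g.
Proof.
move=> sx; rewrite seq_perm_tuple => sy.
have mono (a b : 'I_k) : (a < b)%N -> (s a < s b)%N.
  move=> ab; have := (sorted_tupleP _).1 sy a b ab; rewrite !tnth_mktuple => lt_ab.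
  have [//|sba] := ltnP (s a) (s b).
  move: sba; rewrite leq_eqVlt => /orP[/eqP/val_inj E|ba].
    by move: lt_ab; rewrite E ltxx.
  by have := (sorted_tupleP _).1 sx _ _ ba; rewrite ltNge (ltW lt_ab).
have ge_ (n : nat) (a : 'I_k) : a = n :> nat -> (a <= s a)%N.
  elim: n a => [|n IH] a an; first by rewrite an.
  have nk : (n < k)%N by rewrite -ltnS -an ltnW// ltnS.
  have := IH (Ordinal nk) erefl => /leq_ltn_trans; rewrite an; apply.
  by apply: mono; rewrite an.
apply/permP => a; rewrite perm1; apply/val_inj/eqP; rewrite /= eqn_leq (ge_ a)// andbT.
have le_ (n : nat) (b : 'I_k) : (k - b.+1)%N = n -> (s b <= b)%N.
  elim: n b => [|n IH] b bn.
    have /eqP : (k - b.+1 == 0)%N by rewrite bn.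
    by move=> /eqP; rewrite subn_eq0 => kb; rewrite -ltnS (leq_trans (ltn_ord _)).
  have b1k : (b.+1 < k)%N by rewrite -subn_gt0 bn.
  have h : (s (Ordinal b1k) <= b.+1)%N by apply: IH; rewrite /= subnS bn.
  by rewrite -ltnS; exact: leq_trans (mono b (Ordinal b1k) (ltnSn _)) h.
exact: (le_ _ a erefl).
Qed.

End permuted_kernels.

Lemma is_ito_integral_ext d (Omega : measurableType d) (R : realType) (P : probability Omega R)
    (F : R -> set_system Omega) (W : R -> Omega -> R) (a b : R) (xi xi' : R -> Omega -> R) (Z : Omega -> R) :
  (forall s om, a <= s <= b -> xi s om = xi' s om) ->
  is_ito_integral P F W a b xi Z -> is_ito_integral P F W a b xi' Z.
Proof.
move=> E [[[mxi xi2] axi] [X [aX cX msX]]].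
have E' (z : R * Omega) : (`[a, b]%classic `*` [set: Omega]) z -> xi z.1 z.2 = xi' z.1 z.2.
  by move=> [/= + _]; rewrite in_itv/= => /E.
split.
  split; last first.
    move=> s sab B mB; have := axi s sab B mB.
    by rewrite (_ : xi s = xi' s)//; apply/funext => om; exact: E.
  split; first by apply: eq_measurable_fun mxi => z /set_mem; exact: E'.
  have EI : (\int[lebesgue_measure \x P]_(z in `[a, b] `*` [set: Omega]) ((xi' z.1 z.2) ^+ 2)%:E =
      \int[lebesgue_measure \x P]_(z in `[a, b] `*` [set: Omega]) ((xi z.1 z.2) ^+ 2)%:E)%E.
    by apply: eq_integral => z /set_mem /E' ->.
  by rewrite EI.
exists X; split => //.
apply: cvg_trans cX; apply: near_eq_cvg; apply: nearW => n /=.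
by apply: eq_integral => z /set_mem /E' ->.
Qed.

Section iterated_integral.
Context (d : measure_display) (Omega : measurableType d) (R : realType) (P : probability Omega R).
Context (t T : R) (F : R -> set_system Omega) (m : nat) (f : 'I_m -> R -> Omega -> R).
Hypotheses (t0 : 0 <= t) (tT : t < T) (hF : is_filtration T F) (hf : is_wiener P T F f).
Context (tau : nat -> nat -> R) (htau : is_partition_seq t T tau).
Context (k : nat) (i : 'I_k -> 'I_m.+1) (psi : 'I_k -> R -> R) (r : R -> R) (Psi : nat -> R -> R).
Hypotheses (mr : measurable_fun `[t, T] (r : measurableTypeR R -> R)) (r0 : forall x, t <= x <= T -> 0 <= r x).
Hypothesis cpsi : forall l, {within `[t, T], continuous (psi l)}.
Hypothesis K2 : square_integrable (lebesgue_tuple R k) (cube t T k)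
  (fun x => kernel_K psi x * \prod_(l < k) Num.sqrt (r (tnth x l))).
Local Notation MR := (measurableTypeR R).
Local Notation cn2 := (cube_n2 t T).
Local Notation phi := (fun j x => Psi j x * Num.sqrt (r x)).
Hypotheses (ophi : orthonormal_system t T phi) (cphi : complete_system t T phi).

(** Extended by zero outside [[t, T]], where nothing is known of [psi] and [r], to obtain functions
    measurable on the whole line. *)
Definition weight : nat -> R -> R :=
  ord_ext (fun=> 0) (fun l => (fun x => psi l x * Num.sqrt (r x)) \_ `[t, T]).

Lemma weightE (l : 'I_k) x : t <= x <= T -> weight l x = psi l x * Num.sqrt (r x).
Proof. by move=> hx; rewrite /weight ord_extE patchE ifT// inE/= in_itv. Qed.

Lemma measurable_weight l : measurable_fun setT (weight l : MR -> R).
Proof.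
rewrite /weight /ord_ext; case: (insub l) => [a|]/=; last exact: measurable_cst.
have mtT : measurable (`[t, T]%classic : set MR) by exact: measurable_itv.
apply/(measurable_restrictT _ mtT); apply: measurable_funM.
  exact: (subspace_continuous_measurable_fun mtT (@cpsi a)).
by apply: (measurableT_comp (f := @Num.sqrt R)) => //; apply: continuous_measurable_fun; exact: sqrt_continuous.
Qed.

Lemma kernel_weight (x : k.-tuple MR) : cube t T k x ->
  kernel_K psi x * \prod_(l < k) Num.sqrt (r (tnth x l)) = sorted_tens weight x.
Proof.
move=> xc; rewrite /kernel_K /sorted_tens; case: ifP => _; rewrite ?mul0r// mul1r.
rewrite -big_split/= tens_tuple; apply: eq_bigr => l _.
by rewrite weightE//; exact: xc.
Qed.

Lemma weight_kernel_lty : (cn2 k (simplex_kernel weight T) < +oo)%E.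
Proof.
have [_ K2'] := K2; apply: le_lt_trans K2'.
have mW := measurable_weight.
apply: (@le_trans _ _ (cn2 k (sorted_tens weight))).
  apply: n2_le; first exact: measurable_cube.
  - exact: simplex_kernel_cube_meas.
  - exact: sorted_tens_cube_meas.
  move=> x _; rewrite simplex_kernelE /sorted_tens !exprMn ler_wpM2r ?sqr_ge0//.
  have sub : sorted (fun a b : R => a < b) (rcons x T) -> sorted (fun a b : R => a < b) x.
    by case: (tval x) => [//|y s] /=; rewrite rcons_path => /andP[].
  by case: (sorted _ (rcons x T)) sub => [->//|_]; rewrite expr0n/= sqr_ge0.
rewrite le_eqVlt; apply/orP; left; apply/eqP; apply: eq_integral => x /set_mem xc.
by rewrite kernel_weight.
Qed.

Lemma coef_C_weight j : coef_C t T psi r Psi j = fourier_coef t T phi (simplex_kernel weight T) j.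
Proof.
have [phiL2 _] := ophi.
rewrite /fourier_coef -simplex_kernel_top_integral; last 2 first.
- exact: measurable_weight.
- apply: tens_cube_meas => l lk; rewrite -[l]/(val (Ordinal lk)) ord_extE.
  by have [] := phiL2 (j (Ordinal lk)).
apply: eq_Rintegral => x /set_mem xc.
rewrite -kernel_weight// tens_idx_tuple -mulrA; congr (_ * _).
rewrite -big_split/=; apply: eq_bigr => l _.
(* The factor [r] in the coefficient is split: one square root completes the weight, the other the
   basis function. *)
have := sqr_sqrtr (r0 (xc l)); rewrite expr2 => {1}<-; ring.
Qed.

Lemma iterated_weight_isW J : is_iterated_ito P F t T (fun l x => psi l x * Num.sqrt (r x))
    (fun l => integrator f (i l)) J ->
  isW P t T (perm_integrator f i 1%g) k (simplex_kernel weight T) J.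
Proof.
move=> [I_ [I0 IS <-]].
apply: (iterated_isW t0 tT hF (integrator_cst_ge0 tT) (perm_integrator_isometric t0 tT hF hf i 1%g)
  measurable_weight (K := k)) => //.
- move=> l s lk /andP[_ sT] fin e e0.
  exact: (simplex_kernel_approx tT htau _ measurable_weight sT fin e0).
- move=> l s lk hs; have := IS (Ordinal lk) s hs.
  rewrite -[in X in _ -> X](_ : val (Ordinal lk) = l)// /perm_integrator ord_extE perm1.
  apply: is_ito_integral_ext => u om /andP[tu us].
  by rewrite weightE// tu (le_trans us)//; case/andP: hs.
- by rewrite lexx ltW.
- exact: weight_kernel_lty.
Qed.

(** Lets the partial sums for all [s] be seen as one function [fourier_sum] composed with [s^-1] and
    restricted to the simplex. *)
Lemma perm_kernelE (s : 'S_k) (j : 'I_k -> nat) (x : k.-tuple R) :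
  simplex_kernel (perm_phi phi s j) T x =
  (sorted (fun a b : R => a < b) (rcons x T))%:R * tens_idx phi j (seq_perm s^-1 x).
Proof.
rewrite simplex_kernelE tens_tuple seq_perm_tuple tens_idx_tuple; congr (_ * _).
rewrite (reindex_inj (@perm_inj _ (s^-1)%g)); apply: eq_bigr => l _.
by rewrite /perm_phi ord_extE tnth_mktuple permKV.
Qed.

(** A point of the simplex stays in the simplex after a permutation of its coordinates only if the
    permutation is trivial. *)
Lemma weight_kernel_perm (s : 'S_k) (x : k.-tuple R) :
  (sorted (fun a b : R => a < b) (rcons x T))%:R * simplex_kernel weight T (seq_perm s^-1 x) =
  (s == 1%g)%:R * simplex_kernel weight T x.
Proof.
have sub (y : seq R) : sorted (fun a b : R => a < b) (rcons y T) -> sorted (fun a b : R => a < b) y.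
  by case: y => [//|y z] /=; rewrite rcons_path => /andP[].
have [->|s1] := eqVneq s 1%g.
  rewrite mul1r (_ : seq_perm _ _ = x); last first.
    rewrite seq_perm_tuple; congr tval; apply: eq_from_tnth => l.
    by rewrite tnth_mktuple invg1 perm1.
  by rewrite simplex_kernelE; case: sorted; rewrite ?mul1r ?mul0r.
rewrite mul0r; have [/sub sx|_] := boolP (sorted _ (rcons x T)); last by rewrite mul0r.
rewrite simplex_kernelE; have [/sub sy|_] := boolP (sorted _ (rcons (seq_perm _ _) T)).
  have := sorted_perm_id sx sy => /(congr1 (fun u => u^-1)%g); rewrite invgK invg1 => E.
  by rewrite E eqxx in s1.
by rewrite mul0r mulr0.
Qed.

(* With [D := K - fourier_sum p], the error is the sum over the permutations [s]
   of the iterated integrals of [D o s^-1] on the simplex: for [s != 1], [K o s^-1]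
   vanishes there. *)
Lemma fourier_expansion J (Y : 'S_k -> ('I_k -> nat) -> Omega -> R) :
  is_iterated_ito P F t T (fun l x => psi l x * Num.sqrt (r x)) (fun l => integrator f (i l)) J ->
  (forall s j, isW P t T (perm_integrator f i s) k (simplex_kernel (perm_phi phi s j) T) (Y s j)) ->
  ms_limit P (multi_oo k) (fun (p : 'I_k -> nat) om =>
    \sum_(j : {dffun forall l : 'I_k, 'I_(p l).+1})
      coef_C t T psi r Psi (fun l => j l) * \sum_(s : 'S_k) Y s (fun l => j l) om) J.
Proof.
move=> /iterated_weight_isW hJ hY.
have FF := multi_oo_filter k.
have isoW := perm_integrator_isometric t0 tT hF hf i.
have C0 := integrator_cst_ge0 tT.
pose Ker := simplex_kernel weight T.
pose X (s : 'S_k) (p : 'I_k -> nat) om :=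
  \sum_(j : {dffun forall l : 'I_k, 'I_(p l).+1}) fourier_coef t T phi Ker (fun l => j l) * Y s (fun l => j l) om.
pose D (p : 'I_k -> nat) x := Ker x - fourier_sum t T phi Ker p x.
pose U (s : 'S_k) p om := (s == 1%g)%:R * J om - X s p om.
have mKer : cube_meas t T k Ker by apply: simplex_kernel_cube_meas; exact: measurable_weight.
have mD p : cube_meas t T k (D p).
  apply: cube_measB => //; apply: cube_meas_sum => j; apply: cube_measZ.
  apply: tens_cube_meas => l lk; rewrite -[l]/(val (Ordinal lk)) ord_extE.
  by have [/(_ (j (Ordinal lk)))[]] := ophi.
have hX s p := isW_sum t0 tT hF (isoW s) (fun j : {dffun forall l : 'I_k, 'I_(p l).+1} =>
  isWZ t0 tT hF (isoW s) (fourier_coef t T phi Ker (fun l => j l)) (hY s (fun l => j l))).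
have hJ1 (s : 'S_k) : isW P t T (perm_integrator f i s) k (fun x => (s == 1%g)%:R * Ker x)
    (fun om => (s == 1%g)%:R * J om).
  have [->|s1] := eqVneq s 1%g; first exact: (isWZ t0 tT hF (isoW 1%g)).
  rewrite (_ : (fun x => _) = fun _ => 0); last by apply/funext => x; rewrite mul0r.
  rewrite (_ : (fun om => _) = fun _ => 0); last by apply/funext => x; rewrite mul0r.
  exact: (isW0 t0 tT hF (isoW s)).
have hU s p : isW P t T (perm_integrator f i s) k
    (fun x => (sorted (fun a b : R => a < b) (rcons x T))%:R * D p (seq_perm s^-1 x)) (U s p).
  have := isWB t0 tT hF (isoW s) (hJ1 s) (hX s p); apply: isW_ext => x xk.
  have [x' {x xk}->] : exists x' : k.-tuple R, x = x' by exists (tcast xk (in_tuple x)); rewrite val_tcast.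
  rewrite -weight_kernel_perm /D mulrBr; congr (_ - _).
  rewrite mulr_sumr; apply: eq_bigr => j _; rewrite perm_kernelE; ring.
have mJ : measurable_fun setT J by have [] := hJ.
have mY s j : measurable_fun setT (Y s j) by have [] := hY s j.
split => //.
  move=> p; apply: measurable_sum => j; apply: measurable_funM => //.
  exact: measurable_sum.
have ms : measurable_fun (cube t T k) (fun x : k.-tuple MR => (sorted (fun a b : R => a < b) (rcons x T))%:R : R).
  by apply: measurable_funTS; exact: measurable_sorted_nat.
(* The number of permutations comes from squaring their sum, and [4 C^k] from [isW_bound]. Dropping
   the indicator of the simplex and undoing the permutation leaves the norm of [D p] in every
   term. *)
apply: (@cvg0_le _ _ _ _ _ (fun p => (#|'S_k|%:R)%:E * \sum_(s : 'S_k)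
    ((4 * integrator_cst t T ^+ k)%:E * cn2 k (D p)))%E).
- by move=> p; exact: n2_ge0.
- apply: nearW => p.
  rewrite (eq_integral (fun om => ((\sum_(s : 'S_k) U s p om) ^+ 2)%:E)); last first.
    move=> om _; congr EFin; rewrite -sqrrN opprB; congr (_ ^+ _).
    rewrite /U big_split/= sumrN; congr (_ - _).
      by rewrite (bigD1 1%g)//= eqxx mul1r big1 ?addr0// => s /negbTE ->; rewrite mul0r.
    rewrite /X exchange_big/=; apply: eq_bigr => j _.
    by rewrite coef_C_weight mulr_sumr.
  apply: le_trans (n2_sum _ measurableT _) _; first by move=> s; have [] := hU s p.
  rewrite lee_wpmul2l ?lee_fin//; apply: lee_sum => s _.
  apply: le_trans (isW_bound t0 tT hF C0 (isoW s) (hU s p)) _.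
  rewrite lee_wpmul2l ?lee_fin ?mulr_ge0 ?exprn_ge0//.
  rewrite -(cube_n2_perm s^-1 (mD p)); apply: n2_le; first exact: measurable_cube.
  + by apply: measurable_funM => //; exact: cube_meas_perm.
  + exact: cube_meas_perm.
  move=> x _; rewrite exprMn; case: sorted; rewrite ?expr1n ?mul1r//.
  by rewrite expr0n mul0r sqr_ge0.
apply: cvg0Z; apply: cvg0_sum => s _; apply: cvg0Z.
apply: fourier_sum_cvg => //; last exact: weight_kernel_lty.
exact: (fourier_dense_simplex tT ophi cphi htau measurable_weight weight_kernel_lty).
Qed.

End iterated_integral.

Lemma right_cont_jump_sampleable (R : realType) (t T : R) (h : R -> R) :
  square_integrable lebesgue_measure `[t, T] h -> right_cont_jump t T h -> sampleable t T h.
Proof.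
move=> [mh _] hh; split => //; first exact: right_cont_jump_bounded.
by have [] := hh.
Qed.

Theorem theorem5 (R : realType) (d : measure_display) (Omega : measurableType d)
  (P : probability Omega R) (t T : R) (F : R -> set_system Omega)
  (m : nat) (f : 'I_m -> R -> Omega -> R)
  (k : nat) (i : 'I_k -> 'I_m.+1) (psi : 'I_k -> R -> R) (r : R -> R)
  (Psi : nat -> R -> R) (tau : nat -> nat -> R) (J : Omega -> R) :
  let phi := fun (j : nat) (x : R) => Psi j x * Num.sqrt (r x) in
  let w := integrator f in
  measure_is_complete P ->
  0 <= t -> t < T ->
  is_filtration T F ->
  is_wiener P T F f ->
  (0 < k)%N ->
  measurable_fun `[t, T] r ->
  (forall x, t <= x <= T -> 0 <= r x) ->
  (forall l, {within `[t, T], continuous (psi l)}) ->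
  square_integrable (lebesgue_tuple R k) (cube t T k)
    (fun x => kernel_K psi x * \prod_(l < k) Num.sqrt (r (tnth x l))) ->
  orthonormal_system t T phi ->
  complete_system t T phi ->
  (forall j, right_cont_jump t T (phi j)) ->
  is_partition_seq t T tau ->
  is_iterated_ito P F t T (fun l x => psi l x * Num.sqrt (r x))
    (fun l => w (i l)) J ->
  (forall (a : 'I_m.+1) (j : nat), exists z : Omega -> R,
     is_ito_integral P F (w a) t T (fun s _ => phi j s) z) /\
  (forall zeta : 'I_m.+1 -> nat -> Omega -> R,
     (forall a j,
        is_ito_integral P F (w a) t T (fun s _ => phi j s) (zeta a j)) ->
     [/\ forall (a : 'I_m) (j : nat),
           centered_gaussian P 1 (zeta (lift ord0 a) j),
         independent_family P
           (fun aj : 'I_m * nat => zeta (lift ord0 aj.1) aj.2) &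
         exists S : ('I_k -> nat) -> Omega -> R,
           (forall j : 'I_k -> nat,
              ms_limit P \oo
                (diagonal_sum tau phi (fun l => w (i l)) j) (S j)) /\
           ms_limit P (multi_oo k)
             (fun (p : 'I_k -> nat) (om : Omega) =>
                \sum_(j : {dffun forall l : 'I_k, 'I_(p l).+1})
                  coef_C t T psi r Psi (fun l => j l) *
                  (\prod_(l < k) zeta (i l) (j l) om -
                   S (fun l => j l) om))
             J]).
Proof.
move=> phi w _ t0 tT hF hf k0 mr r0 cpsi K2 ophi cphi jphi htau hJ.
have hphi j : sampleable t T (phi j).
  by apply: right_cont_jump_sampleable => //; have [] := ophi.
have [_ ortho] := ophi.
split=> [a j|zeta hz].
  exact: (ito_exists t0 tT hF htau (integrator_cst_ge0 tT) (integrator_isometric t0 tT hF hf a) (hphi j)).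
have wz := wiener_zeta hz.
split; [exact: (zeta_gaussian t0 tT hF hf htau hphi ortho wz)|exact: (zeta_independent t0 tT hF hf htau hphi ortho wz)|].
have [Y [hY hS]] := diagonal_limit t0 tT hF hf htau hphi ortho hz i k0.
eexists; split; first exact: hS.
(* The products of the [zeta] cancel, and the bracket becomes the sum over the permutations of the
   simplex integrals. *)
under eq_fun do under eq_fun do under eq_bigr do rewrite subKr.
exact: (fourier_expansion t0 tT hF hf htau mr r0 cpsi K2 ophi cphi hJ hY).
Qed.
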